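(* There exist constants $c>0$ and $X_0$ such that for all $X\ge X_0$, \[\max_{X/2<x\leq 5X^{3/2}(\log X)^2}\left|\frac{\Delta(x^2)}{\sqrt x}\right| \ \ge\ c\,(\log X)^{1/4}\,(\log_2 X)^{\frac34(2^{4/3}-1)}\,(\log_3 X)^{-3/8}.\]
   Context: $d(n)$ is the number of positive divisors of $n$, $\gamma$ is Euler's constant, and $\Delta(x)$ is defined for real $x\geq 1$ by \[\sum_{n\leq x} d(n)= x\log x + (2\gamma-1)x+\Delta(x).\] Here $\log_2 X=\log\log X$ and $\log_3 X=\log\log\log X$. The maximum is over real $x$ and is understood as a supremum. *)

(* Defs.v *)
From HB Require Import structures.
From mathcomp Require Import all_boot all_order all_algebra.
From mathcomp Require Import all_classical all_reals all_analysis.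

Set Implicit Arguments.
Unset Strict Implicit.
Unset Printing Implicit Defensive.

Import Order.TTheory GRing.Theory Num.Theory.
Import numFieldNormedType.Exports.

Local Open Scope classical_set_scope.
Local Open Scope ring_scope.

Definition numdiv (n : nat) : nat := size (divisors n).

(* [series harmonic n] is 1 + 1/2 + ... + 1/n. *)
Definition euler_gamma (R : realType) : R :=
  limn (fun n : nat => series harmonic n - ln n%:R : R).

(* For x >= 0, [Num.truncn x] is the integer part of x, so the sum ranges over
   the integers 1 <= n <= x; Delta is only meaningful for x >= 1. *)
Definition Delta (R : realType) (x : R) : R :=
  \sum_(1 <= n < (Num.truncn x).+1) (numdiv n)%:R
  - (x * ln x + (2 * euler_gamma R - 1) * x).

(* Main.v *)
(* Write e(t) = exp(2 pi i t) and S(t) = sum_{h >= 1} h^3 e(ht), for Im t > 0, and for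
z = x + i eta let G(z) be the integral over theta of S(z e^{-theta}) S(z e^{theta}).

By Lipschitz's formula S(t) is a constant times sum_{a in Z} (t - a)^{-4}.  Multiplying
out G and absorbing a into theta leaves an integral over alpha near x of kernels
sum_n d(n) (alpha z - n)^{-4}, up to powers of alpha.  Partial summation bounds these by
the values Delta(n), n of order x^2.  Hence if |Delta(n)| <= B n^{1/4} in the range at
hand, then G(x + i eta) is O(eta^{-7} (B + 1) x^{-1/2}) for integers x > X.

Expanding instead both factors S gives frequencies h e^{-theta} + k e^{theta}, which have a
quadratic minimum 2 sqrt(hk) in theta.  So Re G(x + i eta) is a sum of cosines of x with
positive weights, concentrated at the frequencies 2 sqrt n with multiplicity d(n).

Following Soundararajan, average Re G(j + i eta) with a Fejer kernel of length J against
the resonator prod_{n in M} (1 + cos(4 pi j sqrt n)).  All Fourier coefficients being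
nonnegative, only the frequencies near 2 sqrt n with n in M are kept, which bounds
the average below by sum_{n in M} d(n).  Comparison with the upper bound gives
B >> N^{-3/4} sum_{n in M} d(n).  Here M consists of about eps log X integers of size
N = log X (log_2 X)^beta (log_3 X)^{1/2}, each with about 2^{4/3} log log N prime
factors, where beta = 1 - lam + lam log lam with lam = 2^{4/3}; the choice of beta is what
makes so many such integers available near N.

The integral over theta is replaced throughout by a sum over a fine geometric grid, and S by a
partial sum, so that only finite sums occur. *)

Require Import Defs.
From HB Require Import structures.
From mathcomp Require Import all_boot all_order all_algebra.
From mathcomp Require Import all_classical all_reals all_analysis.
From mathcomp Require Import complex ring lra zify.

Set Implicit Arguments.
Unset Strict Implicit.
Unset Printing Implicit Defensive.

Import Order.TTheory GRing.Theory Num.Theory.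
Import numFieldNormedType.Exports.

Local Open Scope classical_set_scope.
Local Open Scope ring_scope.

(** * Mertens' estimates and primes in short multiplicative intervals *)

Section Mertens.
Variable R : realType.
Implicit Types (n p k : nat) (x : R).

(** The exponents come from an optimisation. Put L = log X, l = log L, m = log l. There are about N
    l^(-beta) m^(-1/2) integers near N with lam m prime factors, so about L of them are available
    once N = L l^beta m^(1/2), and each has at least about l^(lam log 2) divisors. Then N^(-3/4) sum
    d(n) is about L^(1/4) l^(lam log 2 - 3 beta / 4) m^(-3/8); lam = 2^(4/3) maximises the exponent
    of l, which becomes 3/4 (2^(4/3) - 1).

    The size of M is held to eps log X because the resonator can reach 2^|M| for j up to X, where
    only bounds independent of Delta are available; that loss has to stay a small power of X. The
    length J is not prescribed: it is a power of 2 up to X^(3/2) selected by a maximum property.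

    The height is eta = N^(-1/2), at which the damping exp(-4 pi eta sqrt n) is of constant order on
    M. The lower bound then carries N^(11/4), the upper bound eta^(-7) = N^(7/2), whence the factor
    N^(-3/4). *)

Lemma ln_prod (I : Type) (r : seq I) (P : pred I) (F : I -> R) :
  (forall i, P i -> 0 < F i) ->
  ln (\prod_(i <- r | P i) F i) = \sum_(i <- r | P i) ln (F i).
Proof.
move=> F0; elim: r => [|a r IH]; first by rewrite !big_nil ln1.
rewrite !big_cons; case: ifP => // Pa.
by rewrite lnM ?IH // posrE ?F0 // prodr_gt0.
Qed.

Lemma ln_natr_logn n (B : nat) : (0 < n)%N -> (n < B)%N ->
  ln n%:R = \sum_(0 <= p < B | prime p) (logn p n)%:R * ln p%:R :> R.
Proof.
move=> n0 nB; rewrite -{1}(partnT n0) /partn natr_prod.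
rewrite [LHS]ln_prod; last first.
  move=> p _; rewrite ltr0n expn_gt0; case: p => //=.
rewrite [RHS](big_cat_nat _ (n := n.+1)) //= [X in _ = _ + X]big1_seq ?addr0; last first.
  move=> p; rewrite mem_index_iota => /andP[_ /andP[np _]].
  by rewrite lognE [(p %| n)%N]gtnNdvd // !andbF mul0r.
rewrite (bigID prime) /= [X in _ + X]big1 ?addr0; last first.
  by move=> p /negbTE pp; rewrite lognE pp expn0 ln1.
apply: eq_bigr => p pp.
by rewrite natrX lnXn ?ltr0n ?prime_gt0 // mulr_natl.
Qed.

Lemma ln_fact n :
  ln n`!%:R = \sum_(0 <= p < n.+1 | prime p) (logn p n`!)%:R * ln p%:R :> R.
Proof.
have h m : (m <= n)%N ->
    ln m`!%:R = \sum_(0 <= p < n.+1 | prime p) (logn p m`!)%:R * ln p%:R :> R.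
  elim: m => [|m IH] mn.
    by rewrite fact0 ln1 big1 // => p _; rewrite logn1 mul0r.
  rewrite factS natrM lnM ?posrE ?ltr0n ?fact_gt0 // IH 1?ltnW //.
  rewrite (@ln_natr_logn m.+1 n.+1) // -big_split /=.
  by apply: eq_bigr => p _; rewrite lognM ?fact_gt0 // natrD mulrDl.
exact: h.
Qed.

Lemma ln_fact_ge n : (0 < n)%N -> n%:R * ln n%:R - n%:R <= ln n`!%:R :> R.
Proof.
elim: n => // -[|n] IH _; first by rewrite (_ : 1`! = 1)%N // ln1 mulr0 sub0r lerN10.
have := IH isT; rewrite (factS n.+1) natrM lnM ?posrE ?ltr0n ?fact_gt0 //.
set a := ln n.+1%:R; set b := ln n.+2%:R; set c := ln _.
have : b - a <= n.+1%:R^-1.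
  rewrite /a /b -ln_div ?posrE ?ltr0n // -[n.+2]addn1 natrD mulrDl divff ?pnatr_eq0 //.
  by rewrite mul1r; apply: le_ln1Dx; rewrite (lt_le_trans (ltrN10 _)) // invr_ge0 ler0n.
rewrite -[n.+2]addn1 natrD; set m : R := n.+1%:R.
have m0 : 0 < m by rewrite ltr0n.
move=> h; have : m * (b - a) <= 1.
  by rewrite -[leRHS](divff (lt0r_neq0 m0)) ler_pM2l.
nra.
Qed.

Lemma ln_fact_le n : ln n`!%:R <= n%:R * ln n%:R :> R.
Proof.
elim: n => [|n IH]; first by rewrite fact0 ln1 mul0r.
rewrite factS natrM lnM ?posrE ?ltr0n ?fact_gt0 //.
have : ln n%:R <= ln n.+1%:R :> R.
  case: n {IH} => [|n]; first by rewrite ln0 // ln1.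
  by rewrite ler_ln ?posrE ?ltr0n // ler_nat.
have n0 : 0 <= n%:R :> R by rewrite ler0n.
move: IH; set a := ln n.+1%:R; rewrite -natr1 => IH h; nra.
Qed.

Definition psum_ln n : R := \sum_(0 <= p < n.+1 | prime p) ln p%:R / p%:R.
Definition theta n : R := \sum_(0 <= p < n.+1 | prime p) ln p%:R.

Lemma ln_prime_gt0 p : prime p -> 0 < ln p%:R :> R.
Proof. by move=> /prime_gt1 p1; rewrite ln_gt0 // ltr1n. Qed.

Lemma logn_bin_prime n p : prime p -> (n < p <= n.*2)%N ->
  (0 < logn p 'C(n.*2, n))%N.
Proof.
move=> pp /andP[np p2]; rewrite logn_gt0 mem_primes pp bin_gt0 -addnn leq_addl /=.
have pN k : (k < p)%N -> ~~ (p %| k`!)%N.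
  elim: k => [|k IH] kp; first by rewrite fact0 gtnNdvd ?prime_gt1.
  by rewrite factS Euclid_dvdM // negb_or IH 1?ltnW // gtnNdvd.
have : (p %| (n + n)`!)%N by rewrite dvdn_fact // prime_gt0 //= addnn.
have := @bin_fact (n + n) n (leq_addl _ _); rewrite addKn => <-.
by rewrite !Euclid_dvdM // (negbTE (pN _ np)) !orbF.
Qed.

Lemma bin_le_exp n k : ('C(n, k) <= 2 ^ n)%N.
Proof.
have [kn|nk] := leqP k n; last by rewrite bin_small.
rewrite -[2%N]/(1 + 1)%N expnDn (bigD1 (inord k)) //= inordK ?ltnS //.
by rewrite !exp1n !muln1 leq_addr.
Qed.

(** Chebyshev's argument: every prime in (n, 2n] divides the central binomial coefficient, which is
    at most 2^(2n). *)
Lemma theta_double n : theta n.*2 <= theta n + n.*2%:R * ln 2.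
Proof.
rewrite /theta (big_cat_nat _ (n := n.+1)) //=; last by rewrite ltnS -addnn leq_addl.
rewrite lerD2l.
have C0 : (0 < 'C(n.*2, n))%N by rewrite bin_gt0 -addnn leq_addl.
have : ln 'C(n.*2, n)%:R <= n.*2%:R * ln 2 :> R.
  by rewrite mulr_natl -lnXn // ler_ln ?posrE ?exprn_gt0 ?ltr0n // -natrX ler_nat bin_le_exp.
apply: le_trans.
rewrite (@ln_natr_logn _ ('C(n.*2, n) + n.*2).+1) ?ltnS ?leq_addr //.
rewrite [leRHS](big_cat_nat _ (n := n.+1)) //=; last by rewrite ltnS -addnn addnA leq_addl.
rewrite [X in _ <= _ + X](big_cat_nat _ (n := n.*2.+1)) //=; last 2 first.
- by rewrite ltnS -addnn leq_addl.
- by rewrite ltnS leq_addl.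
have pos a b : 0 <= \sum_(a <= p < b | prime p) (logn p 'C(n.*2, n))%:R * ln p%:R :> R.
  by apply: sumr_ge0 => p pp; rewrite mulr_ge0 ?ler0n // ltW // ln_prime_gt0.
rewrite -[leLHS]add0r lerD // -[leLHS]addr0 lerD //.
rewrite big_seq_cond [leRHS]big_seq_cond; apply: ler_sum => p.
rewrite mem_index_iota => /andP[/andP[np pn] pp].
rewrite -[leLHS]mul1r ler_pM2r ?ln_prime_gt0 // ler1n.
by apply: logn_bin_prime; rewrite // np -ltnS.
Qed.

Lemma ln2_le1 : ln 2 <= 1 :> R.
Proof. by have := @le_ln1Dx R 1; rewrite -[1 + 1]/(2 : R); apply; lra. Qed.

Lemma theta_le n : theta n <= 4 * n%:R.
Proof.
have mono a b : (a <= b)%N -> theta a <= theta b.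
  move=> ab; rewrite /theta [leRHS](big_cat_nat _ (n := a.+1)) //= lerDl.
  by apply: sumr_ge0 => p pp; rewrite ltW // ln_prime_gt0.
elim/ltn_ind: n => n IH.
have [->|n0] := posnP n.
  by rewrite /theta big_mkcond big_nat1 mulr0.
have [->|n1] := eqVneq n 1%N.
  by rewrite /theta big_mkcond big_nat_recl // big_nat1 /= addr0 mulr1; lra.
(* With m = n/2 rounded up, 3m <= 2n for n >= 2, so the doubling bound gives theta(2m) <= 4m + 2m ln
   2 <= 6m <= 4n. *)
pose m := uphalf n.
have mn : (m < n)%N by rewrite /m; lia.
have n2 : (n <= m.*2)%N by rewrite /m; lia.
have m3 : (3 * m <= n.*2)%N by rewrite /m; lia.
apply: le_trans (mono _ _ n2) _; apply: le_trans (theta_double m) _.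
have := IH _ mn; have := ln2_le1.
have : 3 * m%:R <= 2 * n%:R :> R.
  by rewrite -!natrM ler_nat mul2n.
rewrite -muln2 natrM; have : 0 <= m%:R :> R by rewrite ler0n.
set a : R := m%:R; set b := ln 2; nra.
Qed.

(** In Legendre's formula for ln n! only the first powers are kept. Rounding n/p down costs at most
    ln p per prime, hence [theta n] <= 4n in total; the rest is ln n! <= n ln n. *)
Lemma mertens_upper n : (0 < n)%N -> psum_ln n <= ln n%:R + 4.
Proof.
move=> n0; have nR : 0 < n%:R :> R by rewrite ltr0n.
rewrite -(ler_pM2l nR) mulrDr.
apply: le_trans (_ : ln n`!%:R + theta n <= _); last first.
  by apply: lerD; [exact: ln_fact_le | rewrite mulrC theta_le].
rewrite ln_fact /theta -big_split /= /psum_ln mulr_sumr.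
apply: ler_sum => p pp; have p0 := prime_gt0 pp.
have pR : 0 < p%:R :> R by rewrite ltr0n.
rewrite mulrCA mulrC -[X in _ <= _ + X]mul1r -mulrDl.
rewrite ler_pM2r ?ln_prime_gt0 // ler_pdivrMr // natr1 -natrM ler_nat.
have : (n %/ p <= logn p n`!)%N.
  by rewrite logn_fact // big_ltn // expn1 leq_addr.
move=> h; apply: leq_trans (_ : (n %/ p).+1 * p <= _)%N; last first.
  by rewrite leq_mul2r ltnS h orbT.
by rewrite mulSn addnC {1}(divn_eq n p) leq_add2l ltnW // ltn_pmod.
Qed.

Lemma logn_fact_le n p : prime p -> (logn p n`! * p.-1 <= n)%N.
Proof.
move=> pp; rewrite logn_fact // mulnC.
suff h m : (p.-1 * (\sum_(1 <= k < m.+1) n %/ p ^ k) + n %/ p ^ m <= n)%N.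
  by apply: leq_trans (h n); rewrite leq_addr.
elim: m => [|m IH]; first by rewrite big_nil muln0 expn0 divn1.
rewrite big_nat_recr //= mulnDr -addnA -mulSnr (ltn_predK (prime_gt1 pp)).
apply: leq_trans IH; rewrite leq_add2l expnSr divnMA mulnC.
exact: leq_divM.
Qed.

(** The right-hand side is modelled on the antiderivative -(ln t + 1)/t of ln t / t^2, with slack so
    that the induction closes. What is used later is the bound 2. *)
Lemma sum_ln_div_sqr n : (0 < n)%N ->
  \sum_(0 <= p < n.+1 | prime p) ln p%:R / (p%:R * p.-1%:R) <=
  2 - (ln n%:R + 2) / n%:R :> R.
Proof.
elim: n => // n IH _; have [->|n0] := posnP n.
  by rewrite big_mkcond big_nat_recl // big_nat1 /= ln1; lra.
have {}IH := IH n0; rewrite big_mkcond big_nat_recr //= -big_mkcond /=.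
have nR : 0 < n%:R :> R by rewrite ltr0n.
have mR : 0 < n.+1%:R :> R by rewrite ltr0n.
apply: le_trans (_ : _ <= (2 - (ln n%:R + 2) / n%:R) + ln n.+1%:R / (n.+1%:R * n%:R)) _.
  apply: lerD => //; case: ifP => // _.
  by rewrite divr_ge0 ?ln_ge0 ?ler1n // mulr_ge0 ?ler0n.
have hl : ln n.+1%:R - ln n%:R <= n%:R^-1 :> R.
  rewrite -ln_div ?posrE // -natr1 mulrDl divff ?lt0r_neq0 // mul1r.
  by apply: le_ln1Dx; rewrite (lt_le_trans (ltrN10 _)) // invr_ge0 ler0n.
have h1 : n.+1%:R * (ln n.+1%:R - ln n%:R) <= 2 :> R.
  apply: le_trans (_ : n.+1%:R * n%:R^-1 <= _); first by rewrite ler_pM2l.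
  by rewrite ler_pdivrMr // -natr1; have : 1 <= n%:R :> R; [rewrite ler1n|lra].
rewrite -subr_ge0.
set a : R := ln n%:R; set b : R := ln n.+1%:R; rewrite -/a -/b in hl h1.
suff -> : 2 - (b + 2) / n.+1%:R - (2 - (a + 2) / n%:R + b / (n.+1%:R * n%:R)) =
  (2 - n.+1%:R * (b - a)) / (n%:R * n.+1%:R) :> R.
  by rewrite divr_ge0 ?subr_ge0 // mulr_ge0 ?ler0n.
move: nR mR; rewrite -natr1; set m : R := n%:R => m0 m1.
field; apply/andP; split; apply: lt0r_neq0; lra.
Qed.

Lemma mertens_lower n : (0 < n)%N -> ln n%:R - 3 <= psum_ln n.
Proof.
move=> n0; have nR : 0 < n%:R :> R by rewrite ltr0n.
rewrite -(ler_pM2l nR).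
have h1 := ln_fact_ge n0; have h2 := sum_ln_div_sqr n0.
suff h3 : ln n`!%:R <= n%:R * (psum_ln n +
   \sum_(0 <= p < n.+1 | prime p) ln p%:R / (p%:R * p.-1%:R)) :> R.
  have : 0 <= (ln n%:R + 2) / n%:R :> R.
    by rewrite divr_ge0 ?ler0n // addr_ge0 // ln_ge0 // ler1n.
  by nra.
rewrite ln_fact /psum_ln -big_split /= mulr_sumr; apply: ler_sum => p pp.
have p1 : 0 < p.-1%:R :> R by rewrite ltr0n; have := prime_gt1 pp; lia.
have pE : p%:R = p.-1%:R + 1 :> R by rewrite natr1 prednK // prime_gt0.
have -> : ln p%:R / p%:R + ln p%:R / (p%:R * p.-1%:R) = ln p%:R / p.-1%:R :> R.
  rewrite pE; field; apply/andP; split; apply: lt0r_neq0; lra.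
rewrite mulrCA mulrC ler_pM2l ?ln_prime_gt0 // ler_pdivlMr // -natrM ler_nat.
exact: logn_fact_le.
Qed.

Definition psum_inv n : R := \sum_(0 <= p < n.+1 | prime p) p%:R^-1.

(** Partial summation in disguise: the [G] of the proof is nondecreasing. Its increment is (A +
    5)(1/a - 1/b) - (ln b - ln a) with A >= a - 3, and the 5 covers both this 3 and the second-order
    error in ln b - ln a <= (b - a)/a. *)
Lemma psum_inv_lower : exists C : R, forall n, (2 <= n)%N ->
  ln (ln n%:R) - C <= psum_inv n.
Proof.
pose G n := psum_inv n - psum_ln n / ln n%:R - ln (ln n%:R) - 5 / ln n%:R.
have lnp n : (2 <= n)%N -> 0 < ln n%:R :> R by move=> n2; rewrite ln_gt0 // ltr1n.
exists (- G 2%N) => n n2; have nR := lnp _ n2.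
suff : G 2%N <= G n.
  rewrite /G => h; rewrite opprK -lerBrDl.
  apply: le_trans h _; rewrite -subr_ge0 opprB.
  have : 0 <= psum_ln n.
    by apply: sumr_ge0 => p pp; rewrite divr_ge0 ?ler0n // ltW // ln_prime_gt0.
  move=> h; have h' : 0 <= psum_ln n / ln n%:R by rewrite divr_ge0 // ltW.
  have h'' : 0 <= 5 / ln n%:R :> R by rewrite divr_ge0 // ltW.
  lra.
elim: n n2 nR => // n IH; rewrite leq_eqVlt => /orP[/eqP <- //|]; rewrite ltnS => n2 _.
apply: le_trans (IH n2 (lnp _ n2)) _.
have a0 := lnp _ n2; have b0 := lnp _ (leqW n2).
have hA := mertens_lower (ltnW n2).
have E1 : psum_inv n.+1 = psum_inv n + (if prime n.+1 then n.+1%:R^-1 else 0).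
  by rewrite /psum_inv big_mkcond big_nat_recr //= -big_mkcond.
rewrite /G E1; set q : R := if prime _ then n.+1%:R^-1 else 0.
have -> : psum_ln n.+1 = psum_ln n + q * ln n.+1%:R.
  rewrite /psum_ln big_mkcond big_nat_recr //= -big_mkcond /q.
  by case: ifP => _; rewrite ?mul0r // mulrC.
have hl : ln n.+1%:R - ln n%:R <= 1 :> R.
  rewrite -ln_div ?posrE ?ltr0n // ?(ltnW n2) // -natr1 mulrDl divff ?pnatr_eq0 ?mul1r; last by lia.
  apply: le_trans (le_ln1Dx _) _; first by rewrite (lt_le_trans (ltrN10 _)) // invr_ge0 ler0n.
  by rewrite invf_le1 ?ler1n ?ltr0n // ltnW.
have ab : ln n%:R <= ln n.+1%:R :> R by rewrite ler_ln ?posrE ?ltr0n ?ler_nat // ltnW.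
set a := ln n%:R in hl ab a0 hA *; set b := ln n.+1%:R in hl ab b0 *.
set A := psum_ln n in hA *.
have lab : ln b - ln a <= (b - a) / a.
  rewrite -ln_div ?posrE //; have -> : b / a = 1 + (b - a) / a by field; rewrite lt0r_neq0.
  by apply: le_ln1Dx; rewrite (lt_le_trans (ltrN10 _)) // divr_ge0 ?subr_ge0 // ltW.
have ia : 0 < a^-1 by rewrite invr_gt0.
have ib : 0 < b^-1 by rewrite invr_gt0.
have eab : a^-1 - b^-1 = (b - a) / (a * b) by field; rewrite !lt0r_neq0.
have e2 : (b - a) / a - (b - a) / b = (b - a) ^+ 2 / (a * b) by field; rewrite !lt0r_neq0.
have pos : 0 <= (a * b)^-1 by rewrite invr_ge0 mulr_ge0 // ltW.
have k1 : (b - a) ^+ 2 / (a * b) <= (b - a) / (a * b).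
  by apply: ler_wpM2r => //; nra.
have k2 : (a - 3) * ((b - a) / (a * b)) <= A * ((b - a) / (a * b)).
  by apply: ler_wpM2r => //; rewrite mulr_ge0 // subr_ge0.
have k3 : a * ((b - a) / (a * b)) = (b - a) / b by field; rewrite !lt0r_neq0.
have k4 : 0 <= (b - a) / (a * b) by rewrite mulr_ge0 // subr_ge0.
have k5 : q * b / b = q by rewrite mulfK // lt0r_neq0.
rewrite [(A + _) / b]mulrDl k5 -subr_ge0.
have -> : psum_inv n + q - (A / b + q) - ln b - 5 / b - (psum_inv n - A / a - ln a - 5 / a)
  = A * (a^-1 - b^-1) + 5 * (a^-1 - b^-1) - (ln b - ln a) by ring.
rewrite eab; nra.
Qed.

(** The sum of ln p / p over z < p <= e^9 z is at least 9, minus 1 for the integer part, minus the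
    errors 3 and 4 of the two Mertens bounds, that is at least 1. Each of its terms is at most ln(C0
    z) / z. *)
Lemma prime_count_lower : exists C0 : R, 1 < C0 /\ forall z : R, 2 <= z ->
  z / ln (C0 * z) <=
  (size [seq p <- index_iota 0 (Num.truncn (C0 * z)).+1 | prime p & z < p%:R])%:R.
Proof.
exists (expR 9); split; first by rewrite expR_gt1.
move=> z z2; have z0 : 0 < z by lra.
have C1 : 1 < expR 9 :> R by rewrite expR_gt1.
set b := Num.truncn _; set a := Num.truncn z.
have bz : b%:R <= expR 9 * z < b.+1%:R.
  by apply: truncn_itv; rewrite mulr_ge0 ?expR_ge0 // ltW.
have az : a%:R <= z < a.+1%:R by apply: truncn_itv; rewrite ltW.
have a0 : (0 < a)%N by case: (a) az => // /andP[_]; lra.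
have ab : (a <= b)%N.
  rewrite -ltnS -(ltr_nat R); case/andP: bz => _; apply: le_lt_trans.
  by case/andP: az => h _; apply: le_trans h _; nra.
have b0 : (0 < b)%N by apply: leq_trans ab.
have lnCz : 0 < ln (expR 9 * z) by rewrite ln_gt0 //; nra.
have hb : ln (expR 9 * z) - 1 <= ln b%:R :> R.
  have : expR 9 * z <= expR 1 * b%:R.
    case/andP: bz => _ /ltW h; apply: le_trans h _.
    apply: le_trans (_ : 2 * b%:R <= _).
      by rewrite -natrM ler_nat; lia.
    by rewrite ler_wpM2r ?ler0n //; have := expR_ge1Dx (1 : R); lra.
  move=> h; rewrite lerBlDr addrC; have <- : ln (expR 1 * b%:R) = 1 + ln b%:R :> R.
    by rewrite lnM ?posrE ?expR_gt0 ?ltr0n // expRK.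
  by rewrite ler_ln // posrE mulr_gt0 ?expR_gt0 ?ltr0n.
have ha : ln a%:R <= ln z by rewrite ler_ln ?posrE ?ltr0n //; case/andP: az.
have lz : ln (expR 9 * z) = 9 + ln z by rewrite lnM ?posrE ?expR_gt0 // expRK.
have h1 := mertens_lower b0; have h2 := mertens_upper a0.
have h : 1 <= \sum_(a.+1 <= p < b.+1 | prime p) ln p%:R / p%:R :> R.
  have : psum_ln b = psum_ln a + \sum_(a.+1 <= p < b.+1 | prime p) ln p%:R / p%:R :> R.
    by rewrite /psum_ln (big_cat_nat _ (n := a.+1)) //.
  lra.
rewrite ler_pdivrMr // -[leLHS]mulr1.
apply: le_trans (ler_wpM2l (ltW z0) h) _.
rewrite -sum1_size natr_sum mulr_suml big_filter.
rewrite [leRHS](big_cat_nat _ (n := a.+1)) //=.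
rewrite [X in _ <= X + _]big1_seq ?add0r; last first.
  move=> p /andP[/andP[_ zp]]; rewrite mem_index_iota => /andP[_]; rewrite ltnS => pa.
  by have := lt_le_trans zp (_ : p%:R <= a%:R); rewrite ler_nat => /(_ pa); case/andP: az; lra.
rewrite mulr_sumr [leLHS]big_nat_cond [leRHS]big_nat_cond.
rewrite [leLHS](eq_bigl (fun p => (a < p < b.+1)%N && (prime p && (z < p%:R)))); last first.
  move=> p /=; case: (boolP (a < p < b.+1)%N) => //= /andP[ap _].
  suff -> : z < p%:R by rewrite andbT.
  by case/andP: az => _ /lt_le_trans; apply; rewrite ler_nat.
apply: ler_sum => p /andP[/andP[ap pb] /andP[pp zp]].
rewrite mul1r mulrCA -[leRHS]mulr1; apply: ler_pM.
- by rewrite ltW // ln_prime_gt0.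
- by rewrite divr_ge0 // ltW.
- rewrite ler_ln ?posrE ?ltr0n ?prime_gt0 ?mulr_gt0 ?expR_gt0 //.
  by case/andP: bz => h3 _; apply: le_trans h3; rewrite ler_nat -ltnS.
- by rewrite ler_pdivrMr ?ltr0n ?prime_gt0 // mul1r ltW.
Qed.

End Mertens.

(** * Integers with many divisors *)

Section Prods.

(** The recursion decides whether the head enters the product. [esym] below follows the same
    recursion, so that [esymE] converts multiplicative sums over this list into symmetric
    functions. *)
Fixpoint prods (k : nat) (s : seq nat) : seq nat :=
  match k, s with
  | 0, _ => [:: 1%N]
  | k'.+1, [::] => [::]
  | k'.+1, p :: s' => prods k s' ++ [seq (p * m)%N | m <- prods k' s']
  end.

Lemma prods_gt0 k s m : all prime s -> m \in prods k s -> (0 < m)%N.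
Proof.
elim: s k m => [|p s IH] [|k] m //=; rewrite ?inE.
- by move=> _ /eqP->.
- by move=> _ /eqP->.
case/andP=> pp sp; rewrite mem_cat => /orP[/IH->//|/mapP[m' /IH h ->]].
by rewrite muln_gt0 prime_gt0 // h.
Qed.

Lemma prods_prime k s m q : all prime s -> m \in prods k s -> prime q ->
  (q %| m)%N -> q \in s.
Proof.
elim: s k m => [|p s IH] [|k] m //=; rewrite ?inE.
- by move=> _ /eqP-> qp; rewrite gtnNdvd // prime_gt1.
- by move=> _ /eqP-> qp; rewrite gtnNdvd // prime_gt1.
case/andP=> pp sp; rewrite mem_cat => /orP[h qp qm|/mapP[m' h ->] qp].
  by rewrite (IH _ _ sp h qp qm) orbT.
rewrite Euclid_dvdM // dvdn_prime2 // => /orP[->//|qm].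
by rewrite (IH _ _ sp h qp qm) orbT.
Qed.

Lemma prods_uniq k s : all prime s -> uniq s -> uniq (prods k s).
Proof.
elim: s k => [|p s IH] [|k] //= /andP[pp sp] /andP[ps us].
rewrite cat_uniq IH // map_inj_in_uniq ?IH // ?andbT /=; last first.
  move=> a b _ _ /eqP; rewrite eqn_pmul2l ?prime_gt0 //; exact: eqP.
apply/hasPn => _ /mapP[m hm ->] /=; apply: contra ps => h.
by apply: (prods_prime sp h pp); rewrite dvdn_mulr.
Qed.

(** The divisors of m and their multiples by p are disjoint families of divisors of pm. *)
Lemma numdiv_prime_mul p m : prime p -> (0 < m)%N -> ~~ (p %| m)%N ->
  (2 * numdiv m <= numdiv (p * m))%N.
Proof.
move=> pp m0 pm; rewrite /numdiv mul2n -addnn.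
rewrite -[X in (_ + X <= _)%N](size_map (muln p)) -size_cat; apply: uniq_leq_size.
  rewrite cat_uniq divisors_uniq map_inj_uniq ?divisors_uniq ?andbT /=; last first.
    by move=> a b /eqP; rewrite eqn_pmul2l ?prime_gt0 // => /eqP.
  apply/hasPn => _ /mapP[d _ ->] /=; apply: contra pm.
  by rewrite -dvdn_divisors //; apply: dvdn_trans; rewrite dvdn_mulr.
have pm0 : (0 < p * m)%N by rewrite muln_gt0 prime_gt0.
move=> d; rewrite mem_cat -(dvdn_divisors _ m0) -(dvdn_divisors _ pm0) => /orP[h|].
  by rewrite dvdn_mull.
by case/mapP=> e; rewrite -dvdn_divisors // => h ->; rewrite dvdn_pmul2l // prime_gt0.
Qed.

Lemma prods_numdiv k s m : all prime s -> uniq s -> m \in prods k s ->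
  (2 ^ k <= numdiv m)%N.
Proof.
elim: s k m => [|p s IH] [|k] m //=; rewrite ?inE.
- by move=> _ _ /eqP->.
- by move=> _ _ /eqP->.
case/andP=> pp sp /andP[ps us]; rewrite mem_cat => /orP[h|/mapP[m' h ->]].
  exact: IH h.
rewrite expnS; apply: leq_trans (numdiv_prime_mul pp (prods_gt0 sp h) _).
  by rewrite leq_mul2l /= IH.
by apply: contra ps; apply: (prods_prime sp h pp).
Qed.

Lemma numdiv_mul_le p m : (0 < p * m)%N -> (numdiv m <= numdiv (p * m))%N.
Proof.
move=> h; apply: uniq_leq_size; first exact: divisors_uniq.
move: (h); rewrite muln_gt0 => /andP[p0 m0] d.
by rewrite -!dvdn_divisors // => dm; rewrite dvdn_mull.
Qed.

End Prods.

(** * Elementary symmetric functions compared with powers of the first one *)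

Section Esym.
Variable R : realFieldType.
Variable w : nat -> R.

Fixpoint esym (k : nat) (s : seq nat) : R :=
  match k, s with
  | 0, _ => 1
  | k'.+1, [::] => 0
  | k'.+1, p :: s' => esym k s' + w p * esym k' s'
  end.

Lemma esym0 s : esym 0 s = 1. Proof. by case: s. Qed.

Lemma esymE k s : (forall p m, w (p * m)%N = w p * w m) -> w 1%N = 1 ->
  \sum_(m <- prods k s) w m = esym k s.
Proof.
move=> wM w1; elim: s k => [|p s IH] [|k] /=; rewrite ?big_seq1 ?big_nil //.
rewrite big_cat /= IH big_map; congr (_ + _).
by rewrite -IH mulr_sumr; apply: eq_bigr => m _.
Qed.

Hypothesis w0 : forall p, 0 <= w p.

Lemma esym_ge0 k s : 0 <= esym k s.
Proof.
by elim: s k => [|p s IH] [|k] //=; rewrite ?ler01 // addr_ge0 // mulr_ge0.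
Qed.

Lemma esym_le_mul k s : k.+1%:R * esym k.+1 s <= (\sum_(p <- s) w p) * esym k s.
Proof.
elim: s k => [|p s IH] k /=; first by rewrite big_nil mulr0 mul0r.
rewrite big_cons; set S := \sum_(_ <- _) _ in IH *.
case: k => [|k] /=.
  by have := IH 0%N; rewrite !esym0; have := w0 p; nra.
have h1 := IH k.+1; have h2 := IH k.
have e0 := esym_ge0 k s; have p0 := w0 p.
have h3 : w p * (k.+1%:R * esym k.+1 s) <= w p * (S * esym k s) by rewrite ler_wpM2l.
rewrite -[k.+2%:R]natr1.
move: h1 h3; rewrite -[k.+2%:R]natr1; set a : R := k.+1%:R.
set x := esym k.+2 s; set y := esym k.+1 s; set z := esym k s in e0 *.
move=> h1 h3; have : 0 <= w p * w p * z by rewrite !mulr_ge0.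
nra.
Qed.

(** The product of the first and the (k+1)-st symmetric functions counts every product of k+2
    distinct entries k+2 times; the remaining terms contain a square w(p)^2 and are at most the sum
    of squares times [esym k s]. *)
Lemma esym_ge_mul k s : (\sum_(p <- s) w p) * esym k.+1 s -
  (\sum_(p <- s) w p ^+ 2) * esym k s <= k.+2%:R * esym k.+2 s.
Proof.
elim: s k => [|p s IH] k /=; first by rewrite !big_nil mulr0 !mul0r subr0.
rewrite !big_cons; set S := \sum_(_ <- _) w _ in IH *.
set P := \sum_(_ <- _) _ ^+ 2 in IH *.
case: k => [|k] /=.
  have := IH 0%N; have hle := esym_le_mul 0 s; rewrite !esym0.
  have hS : esym 1 s = S.
    rewrite /S; elim: (s) => [|q t iht]; rewrite ?big_nil //= big_cons iht esym0; ring.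
  rewrite hS; have := w0 p; rewrite !expr2; set x := esym 2 s; move=> *; nra.
have h1 := IH k.+1; have h2 := IH k.
have p0 := w0 p; have e0 := esym_ge0 k s.
move: h1 h2; rewrite -[k.+3%:R]natr1; set a : R := k.+2%:R.
set x := esym k.+3 s; set y := esym k.+2 s; set z := esym k.+1 s; set t := esym k s in e0 *.
move=> h1 h2.
have h3 : w p * (S * z - P * t) <= w p * (a * y) by rewrite ler_wpM2l.
have : 0 <= w p ^+ 3 * t by rewrite mulr_ge0 // exprn_ge0.
rewrite !expr2 !exprS expr0; nra.
Qed.

Lemma esym_le k s : k`!%:R * esym k s <= (\sum_(p <- s) w p) ^+ k.
Proof.
have S0 : 0 <= \sum_(p <- s) w p by apply: sumr_ge0.
elim: k => [|k IH]; first by rewrite esym0 fact0 mulr1 expr0.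
rewrite factS natrM mulrAC exprS.
have f0 : 0 <= k`!%:R :> R by rewrite ler0n.
apply: le_trans (_ : (\sum_(p <- s) w p) * esym k s * k`!%:R <= _).
  by rewrite ler_wpM2r // esym_le_mul.
by rewrite -mulrA ler_wpM2l // mulrC.
Qed.

(** Expanding the power of the sum with n = k+2 factors, the terms with a repeated index are
    controlled by a union bound over the pairs of factors, whose number is at most n^2 / 2. *)
Lemma esym_ge k s : (\sum_(p <- s) w p) ^+ k.+2 -
  (\sum_(p <- s) w p ^+ 2) * (\sum_(p <- s) w p) ^+ k * (k.+2 ^ 2)%:R / 2 <=
  k.+2`!%:R * esym k.+2 s.
Proof.
set S := \sum_(p <- s) w p; set P := \sum_(p <- s) w p ^+ 2.
have S0 : 0 <= S by apply: sumr_ge0.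
have P0 : 0 <= P by apply: sumr_ge0 => p _; rewrite sqr_ge0.
have hS : esym 1 s = S.
  rewrite /S; elim: (s) => [|q t iht]; rewrite ?big_nil //= big_cons iht esym0; ring.
have main n : n.+1%:R * S * (n.+1`!%:R * esym n.+1 s / n.+1%:R)
     - n.+1%:R * P * (n`!%:R * esym n s) <= n.+2`!%:R * esym n.+2 s.
  have f0 : 0 <= n.+1`!%:R :> R by rewrite ler0n.
  have := ler_wpM2l f0 (esym_ge_mul n s); rewrite -/S -/P.
  have -> : n.+2`!%:R * esym n.+2 s = n.+1`!%:R * (n.+2%:R * esym n.+2 s).
    by rewrite [n.+2`!]factS natrM; ring.
  apply: le_trans; rewrite {1}factS natrM; have : n.+1%:R != 0 :> R by rewrite pnatr_eq0.
  set a : R := n.+1%:R; set f : R := n`!%:R; set x := esym _ s; set y := esym _ s => a0.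
  rewrite le_eqVlt; apply/orP; left; apply/eqP; clearbody a f x y; field; exact: a0.
elim: k => [|k IH].
  have := main 0%N; rewrite hS esym0 fact0 (_ : 1`! = 1)%N // !mul1r !mulr1 divr1.
  by move=> h; apply: le_trans h; rewrite natrX expr2; lra.
have := main k.+1; apply: le_trans.
have hle := esym_le k.+1 s; rewrite -/S in hle.
set E2 := _%:R * esym k.+2 s in IH *; set E1 := _%:R * esym k.+1 s in hle *.
have h1 : S * (S ^+ k.+2 - P * S ^+ k * (k.+2 ^ 2)%:R / 2) <= S * E2 by rewrite ler_wpM2l.
have h2 : P * E1 <= P * S ^+ k.+1 by rewrite ler_wpM2l.
have -> : k.+2%:R * S * (E2 / k.+2%:R) = S * E2 :> R by rewrite [_ * S]mulrC -mulrA [X in S * X]mulrC divfK ?pnatr_eq0.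
have h3 : k.+2%:R * (P * E1) <= k.+2%:R * (P * S ^+ k.+1) by rewrite ler_wpM2l // ler0n.
have h4 : 0 <= P * S ^+ k.+1 by rewrite mulr_ge0 // exprn_ge0.
move: h1 h2 h3; rewrite !natrX -[k.+3%:R]natr1; set a : R := k.+2%:R.
rewrite [S ^+ k.+3]exprS; rewrite [S ^+ k.+1]exprS in h4 *; set u := S ^+ k.+2; set v := S ^+ k in h4 *.
nra.
Qed.

End Esym.

(** * Reciprocal sums over products of k primes *)

Section GoodProducts.
Variable R : realType.

Lemma sum_inv_sqr a b : (0 < a)%N ->
  \sum_(a.+1 <= m < b.+1) (m%:R ^- 2) <= a%:R^-1 :> R.
Proof.
move=> a0; have [ba|ab] := leqP b a.
  by rewrite big_geq // invr_ge0 ler0n.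
suff h : \sum_(a.+1 <= m < b.+1) (m%:R ^- 2) <= a%:R^-1 - b%:R^-1 :> R.
  by apply: le_trans h _; rewrite gerBl invr_ge0 ler0n.
elim: b ab => // b IH; rewrite ltnS leq_eqVlt => /orP[/eqP <-|ab].
  rewrite big_nat1; have aR : 0 < a%:R :> R by rewrite ltr0n.
  rewrite -natr1 -subr_ge0; set x : R := a%:R.
  have -> : x^-1 - (x + 1)^-1 - (x + 1) ^- 2 = (x * (x + 1) ^+ 2)^-1.
    field; apply/andP; split; apply: lt0r_neq0; rewrite -/x in aR; lra.
  by rewrite invr_ge0 mulr_ge0 ?ler0n // sqr_ge0.
have bR : 0 < b%:R :> R by rewrite ltr0n (leq_ltn_trans _ ab).
rewrite big_nat_recr /=; last by rewrite ltnS ltnW.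
have := IH ab; rewrite -natr1; set x : R := b%:R; rewrite -/x in bR.
suff : (x + 1) ^- 2 <= x^-1 - (x + 1)^-1 by move=> *; lra.
rewrite -subr_ge0.
have -> : x^-1 - (x + 1)^-1 - (x + 1) ^- 2 = (x * (x + 1) ^+ 2)^-1.
  field; apply/andP; split; apply: lt0r_neq0; lra.
by rewrite invr_ge0 mulr_ge0 ?sqr_ge0 // ltW.
Qed.

Lemma expR_le1D3x (t : R) : 0 <= t <= 1 -> expR t <= 1 + 3 * t.
Proof.
move=> /andP[t0 t1].
have h : 1 - t / 2 <= expR (- (t / 2)) by have := expR_ge1Dx (- (t / 2)).
have p : 0 < 1 - t / 2 by lra.
have e : expR t = (expR (- (t / 2))) ^- 2.
  by rewrite -expRM_natl -expRN; congr expR; rewrite -mulr_natl; field.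
rewrite e; apply: le_trans (_ : (1 - t / 2) ^- 2 <= _).
  by rewrite lef_pV2 ?posrE ?exprn_gt0 ?expR_gt0 // ler_pXn2r ?nnegrE ?expR_ge0 // ltW.
rewrite -[leLHS]mul1r ler_pdivrMr ?exprn_gt0 // -subr_ge0.
have -> : (1 + 3 * t) * (1 - t / 2) ^+ 2 - 1 = t * (1 - t) * (2 - 3 / 4 * t).
  by field.
by rewrite !mulr_ge0 //; lra.
Qed.

Lemma expR_ge_1Bx (t : R) : 0 <= t <= 2^-1 -> expR (- (2 * t)) <= 1 - t.
Proof.
move=> /andP[t0 t1]; rewrite expRN invf_ple ?posrE ?expR_gt0 //; last by lra.
apply: le_trans (expR_ge1Dx (2 * t)).
rewrite -[leLHS]mul1r ler_pdivrMr; last by lra.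
nra.
Qed.

(* [s] consists of the products of [k] distinct primes up to [N ^ (1/124)]; Rankin's trick with
   exponent [124 / ln N] shows that the products exceeding [sqrt N] are negligible. *)
Lemma prod_sum_lower : exists c1 E : R, 0 < c1 /\ forall (N : R) (k : nat),
  0 < N -> E <= ln (ln N) -> (2 <= k)%N -> k%:R <= 13 / 5 * ln (ln N) ->
  exists s : seq nat,
    [/\ uniq s,
        forall m, m \in s -> [/\ (0 < m)%N, m%:R ^+ 2 <= N, (2 ^ k <= numdiv m)%N &
          forall p, prime p -> (p %| m)%N -> p%:R ^+ 2 <= N] &
        c1 * (ln (ln N) ^+ k / k`!%:R) <= \sum_(m <- s) m%:R^-1].
Proof.
have [C hC] := psum_inv_lower R.
(* [D] collects what the prime sum loses: the constant of Mertens' theorem, the primes up to 16, and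
   the factor 248, twice 124 so as to allow for rounding N^(1/124) to an integer. *)
pose D : R := `|C| + psum_inv R 16 + ln 248.
have psum16 : 0 <= psum_inv R 16 by apply: sumr_ge0 => p _; rewrite invr_ge0 ler0n.
have ln248 : 0 <= ln 248 :> R by rewrite ln_ge0 // ler1n.
have D0 : 0 <= D by rewrite /D !addr_ge0.
exists (expR (- (26 / 5 * D)) / 4), (248 + 3 * D); split.
  by rewrite divr_gt0 ?expR_gt0.
move=> N k N0 hE k2 hk.
set l := ln (ln N) in hE hk *.
have l0 : 0 < l by lra.
have p248 : (0 : R) < 248 by rewrite ltr0n.
have L0 : 0 < ln N by rewrite ltNge; apply/negP => /ln0; rewrite -/l; lra.
have Lexp : ln N = expR l by rewrite /l lnK // posrE.
have L248 : 248 <= ln N by rewrite Lexp; have := expR_ge1Dx l; lra.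
have N1 : 1 < N.
  by rewrite ltNge; apply/negP => /ln_le0; lra.
pose y := expR (ln N / 124).
pose Y := Num.truncn y.
have y0 : 0 < y by rewrite expR_gt0.
have yE : ln y = ln N / 124 by rewrite expRK.
have Yy : Y%:R <= y < Y.+1%:R by apply: truncn_itv; rewrite ltW.
have y249 : 3 <= y by rewrite /y; have := expR_ge1Dx (ln N / 124); clear -L248; lra.
have Y2 : (2 <= Y)%N.
  by rewrite -ltnS -(ltr_nat R); case/andP: Yy => _ h; apply: le_lt_trans h; clear -y249; lra.
have lnY : ln N / 248 <= ln Y%:R.
  have h : y <= expR 1 * Y%:R.
    case/andP: Yy => _ /ltW h; apply: le_trans h _.
    apply: le_trans (_ : 2 * Y%:R <= _).
      by rewrite -natrM ler_nat mul2n -addnn -addn1 leq_add2l ltnW.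
    by rewrite ler_wpM2r ?ler0n //; have := expR_ge1Dx (1 : R); clear; lra.
  have : ln y <= 1 + ln Y%:R.
    rewrite -[X in X + _]expRK -lnM ?posrE ?expR_gt0 ?ltr0n ?(ltnW Y2) //.
    by rewrite ler_ln // posrE mulr_gt0 ?expR_gt0 ?ltr0n ?(ltnW Y2).
  by rewrite yE; clear -L248; lra.
(* Dropping the primes up to 16 brings the sum of 1/p^2 below 1/16; as k <= 4 S, the loss in
   [esym_ge] is then at most half of S^k. *)
pose P := [seq p <- index_iota 17 Y.+1 | prime p].
have Pp : all prime P by apply: filter_all.
have Pu : uniq P by rewrite filter_uniq // iota_uniq.
have PY p : p \in P -> (16 < p <= Y)%N.
  by rewrite mem_filter mem_index_iota ltnS => /andP[_].
pose w p : R := p%:R^-1.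
pose kap := 124 / ln N.
pose w' p : R := p%:R^-1 * p%:R `^ kap.
have w0 p : 0 <= w p by rewrite /w invr_ge0 ler0n.
have w'0 p : 0 <= w' p by rewrite /w' mulr_ge0 ?powR_ge0 // invr_ge0 ler0n.
pose S := \sum_(p <- P) w p.
have kap0 : 0 <= kap by rewrite /kap divr_ge0 // ltW.
have kap1 : kap <= 1 by rewrite /kap ler_pdivrMr // mul1r; clear -L248; lra.
have lnYN : ln Y%:R <= ln N / 124.
  by rewrite -yE ler_ln ?posrE ?ltr0n ?(ltnW Y2) //; case/andP: Yy.
have Sge : l - D <= S.
  have hs : psum_inv R Y <= psum_inv R 16 + S.
    rewrite /S /P big_filter /psum_inv.
    have [Y16|Y17] := leqP 17 Y.+1; first by rewrite (big_cat_nat _ (n := 17)).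
    rewrite [X in _ <= _ + X]big_geq 1?ltnW // addr0.
    rewrite [leRHS](big_cat_nat _ (n := Y.+1)) //= 1?ltnW // lerDl.
    by apply: sumr_ge0 => p _; rewrite invr_ge0 ler0n.
  have h := hC _ Y2; have hCa := ler_norm C.
  have : l - ln 248 <= ln (ln Y%:R).
    have lp : 0 < ln N / 248 by exact: divr_gt0.
    have lY : 0 < ln Y%:R :> R by exact: (lt_le_trans lp lnY).
    by rewrite /l -ln_div ?posrE // ler_ln ?posrE.
  by rewrite /D; clear -h hCa hs; lra.
have S2 : \sum_(p <- P) w p ^+ 2 <= 1 / 16.
  rewrite /P big_filter div1r; apply: le_trans (@sum_inv_sqr 16 Y isT).
  rewrite big_mkcond; apply: ler_sum => p _; case: ifP => _; rewrite /w ?exprVn //.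
have S' : \sum_(p <- P) w' p <= S + 15.
  suff : \sum_(p <- P) w' p <= S + \sum_(p <- P) 3 * kap * (ln p%:R / p%:R).
    rewrite -mulr_sumr => h; apply: le_trans h _; rewrite lerD2l.
    have : \sum_(p <- P) ln p%:R / p%:R <= psum_ln R Y.
      rewrite /P big_filter /psum_ln.
      have pos a b : 0 <= \sum_(a <= p < b | prime p) ln p%:R / p%:R :> R.
        apply: sumr_ge0 => p pp; rewrite divr_ge0 ?ler0n // ln_ge0 // ler1n.
        exact: prime_gt0.
      have [Y16|Y17] := leqP 17 Y.+1; last by rewrite big_geq ?pos // ltnW.
      by rewrite [leRHS](big_cat_nat _ (n := 17)) //= lerDr pos.
    have := mertens_upper R (ltnW Y2) => h1 h2.
    have h3 : \sum_(p <- P) ln p%:R / p%:R <= ln N / 124 + 4 by clear -h1 h2 lnYN; lra.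
    have k3 : 0 <= 3 * kap by rewrite mulr_ge0.
    apply: le_trans (ler_wpM2l k3 h3) _.
    have -> : 3 * kap * (ln N / 124 + 4) = 3 + 12 * kap.
      by rewrite /kap; field; rewrite lt0r_neq0.
    by clear -kap1; lra.
  rewrite /S -big_split /= big_seq [leRHS]big_seq; apply: ler_sum => p pP.
  have /andP[p16 pY] := PY _ pP.
  have pR : 0 < p%:R :> R by rewrite ltr0n (leq_ltn_trans _ p16).
  have t01 : 0 <= kap * ln p%:R <= 1.
    rewrite mulr_ge0 // ?ln_ge0 ?ler1n ?(leq_ltn_trans _ p16) //=.
    apply: le_trans (_ : kap * (ln N / 124) <= _).
      apply: ler_wpM2l => //; apply: le_trans lnYN.
      by rewrite ler_ln ?posrE ?ltr0n ?(ltnW Y2) ?ler_nat // (leq_ltn_trans _ p16).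
    by rewrite /kap le_eqVlt; apply/orP; left; apply/eqP; field; rewrite lt0r_neq0.
  rewrite /w' /w /powR (gt_eqF pR).
  apply: le_trans (ler_wpM2l _ (expR_le1D3x t01)) _; first by rewrite invr_ge0 ltW.
  rewrite le_eqVlt; apply/orP; left; apply/eqP; field; exact: lt0r_neq0.
have Sl : 13 / 20 * l <= S by clear -Sge hE l0; lra.
have S0 : 0 < S by apply: lt_le_trans Sl; rewrite mulr_gt0 //; lra.
have kS : k%:R <= 4 * S by clear -hk Sl; lra.
have f0 : 0 < k`!%:R :> R by rewrite ltr0n fact_gt0.
have main : S ^+ k / 2 <= k`!%:R * esym w k P.
  case: k k2 hk kS f0 => // -[|k] // _ hk kS f0.
  apply: le_trans (esym_ge w0 k P); rewrite -/S.
  have Sk : 0 <= S ^+ k by rewrite exprn_ge0 // ltW.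
  suff : (\sum_(p <- P) w p ^+ 2) * S ^+ k * (k.+2 ^ 2)%:R / 2 <= S ^+ k.+2 / 2.
    by move=> h; clear -h; lra.
  have -> : S ^+ k.+2 = S ^+ k * S ^+ 2 by rewrite -addn2 exprD.
  rewrite ler_pM2r ?invr_gt0 //.
  apply: le_trans (_ : 1 / 16 * S ^+ k * (16 * S ^+ 2) <= _); last first.
    by rewrite le_eqVlt; apply/orP; left; apply/eqP; field.
  have h16 : (k.+2 ^ 2)%:R <= 16 * S ^+ 2 :> R.
    have -> : 16 * S ^+ 2 = (4 * S) ^+ 2 by ring.
    by rewrite natrX ler_pXn2r // ?nnegrE ?ler0n // mulr_ge0 // ltW.
  apply: ler_pM => //.
  - by rewrite mulr_ge0 // sumr_ge0 // => p _; rewrite sqr_ge0.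
  - by rewrite ler_wpM2r.
have k0 : (0 < k)%N by exact: ltnW k2.
pose s := [seq m <- prods k P | m%:R ^+ 2 <= N].
exists s; split.
- by rewrite filter_uniq // prods_uniq.
- move=> m; rewrite mem_filter => /andP[mN mP]; split => //.
  + exact: prods_gt0 mP.
  + exact: prods_numdiv mP.
  + move=> p pp pm; have := prods_prime Pp mP pp pm => /PY /andP[_ pY].
    apply: le_trans (_ : y ^+ 2 <= _).
      rewrite ler_pXn2r // ?nnegrE ?ler0n ?(ltW y0) //.
      by case/andP: Yy => h _; apply: le_trans h; rewrite ler_nat.
    rewrite -[leRHS]lnK ?posrE // /y -expRM_natl ler_expR -mulr_natl; clear -L0; lra.
have wE : \sum_(m <- prods k P) m%:R^-1 = esym w k P.
  by rewrite -(@esymE _ w) // /w ?invr1 // => p m; rewrite natrM invfM.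
have w'E : \sum_(m <- prods k P) w' m = esym w' k P.
  rewrite -(@esymE _ w') // /w'; last by rewrite invr1 mul1r powR1.
  move=> p m; rewrite natrM invfM powRM ?ler0n //; ring.
(* A product m above sqrt N has m^kap >= e^62, whereas the weights with p^kap have sum at most S +
   15, and (S + 15)^k <= e^60 S^k because k <= 4 S. The remaining e^(-2) is below 1/4. *)
have bad : \sum_(m <- prods k P | ~~ (m%:R ^+ 2 <= N)) m%:R^-1 <=
    expR (- 62) * esym w' k P.
  rewrite -w'E mulr_sumr [leRHS](bigID (fun m => m%:R ^+ 2 <= N)) /=.
  rewrite -[leLHS]add0r; apply: lerD.
    by apply: sumr_ge0 => m _; rewrite mulr_ge0 ?expR_ge0.
  rewrite big_seq_cond [leRHS]big_seq_cond; apply: ler_sum => m /andP[mP].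
  rewrite -ltNge => Nm; have m0 : 0 < m%:R :> R by rewrite ltr0n (prods_gt0 Pp mP).
  rewrite /w' mulrCA -[leLHS]mulr1 ler_wpM2l ?invr_ge0 ?ler0n //.
  rewrite /powR (gt_eqF m0) -expRD -[leLHS]expR0 ler_expR.
  have : ln N <= 2 * ln m%:R.
    by rewrite mulr_natl -lnXn // ler_ln ?posrE ?exprn_gt0 // ltW.
  move=> h; have : kap * ln N = 124 by rewrite /kap; field; rewrite lt0r_neq0.
  by clear -kap0 h; nra.
have bad2 : k`!%:R * (expR (- 62) * esym w' k P) <= S ^+ k / 4.
  rewrite mulrCA; apply: le_trans (_ : expR (- 62) * (S + 15) ^+ k <= _).
    rewrite ler_wpM2l ?expR_ge0 //; apply: le_trans (esym_le w'0 k P) _.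
    rewrite ler_pXn2r // ?nnegrE ?sumr_ge0 //.
    by apply: le_trans (_ : S <= _); [exact: ltW | clear; lra].
  have -> : S + 15 = S * (1 + 15 / S) by field; rewrite lt0r_neq0.
  rewrite exprMn mulrCA ler_wpM2l ?exprn_ge0 ?(ltW S0) //.
  apply: le_trans (_ : expR (- 62) * expR 60 <= _).
    rewrite ler_wpM2l ?expR_ge0 //; apply: le_trans (_ : expR (15 / S) ^+ k <= _).
      by rewrite ler_pXn2r ?nnegrE ?expR_ge0 ?expR_ge1Dx // addr_ge0 // divr_ge0 // ltW.
    by rewrite -expRM_natl ler_expR mulrA ler_pdivrMr //; clear -kS; lra.
  rewrite -expRD; have -> : - 62 + 60 = - (1 + 1) :> R by ring.
  rewrite expRN expRD lef_pV2 ?posrE ?mulr_gt0 ?expR_gt0 //.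
  by have := expR_ge1Dx (1 : R); clear; nra.
have good : S ^+ k / 4 <= k`!%:R * \sum_(m <- s) m%:R^-1.
  rewrite /s big_filter; move: main; rewrite -wE.
  rewrite (bigID (fun m => m%:R ^+ 2 <= N)) /= mulrDr => main.
  by have := ler_wpM2l (ltW f0) bad; clear -main bad2; lra.
rewrite mulrA ler_pdivrMr // [leRHS]mulrC; apply: le_trans good.
rewrite mulrAC ler_pM2r ?invr_gt0 //.
apply: le_trans (_ : (l - D) ^+ k <= _); last first.
  by rewrite ler_pXn2r // ?nnegrE ?(ltW S0) //; clear -hE l0 D0; lra.
(* As k / l is bounded by 13/5, replacing l - D by l in the k-th power costs the constant factor
   exp(-26/5 D). *)
have -> : l - D = l * (1 - D / l) by field; rewrite lt0r_neq0.
rewrite exprMn mulrC ler_wpM2l ?exprn_ge0 ?(ltW l0) //.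
have Dl : 0 <= D / l <= 2^-1.
  by rewrite divr_ge0 ?(ltW l0) //= ler_pdivrMr //; clear -hE l0; lra.
apply: le_trans (_ : expR (- (2 * (D / l))) ^+ k <= _); last first.
  rewrite ler_pXn2r ?nnegrE ?expR_ge0 // ?expR_ge_1Bx //.
  by case/andP: Dl => _ h; clear -h; lra.
rewrite -expRM_natl ler_expR -mulr_natl mulrN lerN2.
have -> : k%:R * (2 * (D / l)) = k%:R * 2 * D / l by rewrite !mulrA.
by rewrite ler_pdivrMr //; have := ler_wpM2r D0 hk; clear; lra.
Qed.

End GoodProducts.

(** * Stirling's upper bound and numerical facts on 2^(4/3) *)

Section DerivIneq.
Variable R : realType.

Lemma le_of_is_derive (f df : R -> R) (a b : R) : a <= b ->
  (forall x, a <= x <= b -> is_derive x 1 f (df x)) ->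
  (forall x, a <= x <= b -> 0 <= df x) -> f a <= f b.
Proof.
move=> ab fd d0.
have h x : x \in `]a, b[ -> is_derive x 1 f (df x).
  by rewrite in_itv /= => /andP[/ltW h1 /ltW h2]; apply: fd; rewrite h1.
have cf : {within `[a, b], continuous f}.
  apply: derivable_within_continuous => x; rewrite in_itv /= => hx.
  by have := fd _ hx.
have [c cab E] := MVT_segment ab h cf.
rewrite -subr_ge0 E mulr_ge0 ?subr_ge0 // d0 //.
Qed.

(** A Padé approximant of the logarithm at 1; the difference has derivative (t - 1)^2 / (t (t +
    1)^2). At y = (n+1)/n it gives (n + 1/2)(ln(n+1) - ln n) >= 1, the second-order precision that
    Stirling's bound requires. *)
Lemma ln_ge_pade (y : R) : 1 <= y -> 2 * (y - 1) / (y + 1) <= ln y.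
Proof.
move=> y1; pose f := fun t : R => ln t + 4 * (t + 1)^-1.
suff : f 1 <= f y.
  rewrite /f ln1 add0r => h; rewrite -subr_ge0.
  have -> : ln y - 2 * (y - 1) / (y + 1) = ln y + 4 * (y + 1)^-1 - 4 * (1 + 1)^-1.
    field; apply/eqP; lra.
  by rewrite subr_ge0.
apply: (@le_of_is_derive f (fun t => t^-1 - 4 * (t + 1) ^- 2)) => // t /andP[t1 _].
  have t0 : 0 < t by lra.
  have tn : t + 1 != 0 by apply/eqP; lra.
  have h1 := is_derive1_ln t0.
  have h2 : is_derive t 1 (fun t => (t + 1)^-1 : R) (- (t + 1) ^- 2 *: 1).
    apply: (@is_deriveV R (fun t => t + 1 : R) t 1 1) => //.
    have := @is_deriveD R R R id (cst 1) t 1 1 0 (is_derive_id _ _) (is_derive_cst _ _ _).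
    by rewrite addr0.
  have h3 := @is_deriveZ R R R (fun t => (t + 1)^-1 : R) 4 t 1 _ h2.
  have := is_deriveD h1 h3; rewrite /f.
  by rewrite (_ : _ + _ = t^-1 - 4 * (t + 1) ^- 2) // /GRing.scale /= mulr1 mulrN.
have t0 : 0 < t by lra.
have -> : t^-1 - 4 * (t + 1) ^- 2 = (t - 1) ^+ 2 / (t * (t + 1) ^+ 2).
  field; apply/andP; split; apply/eqP; lra.
by rewrite divr_ge0 ?sqr_ge0 // mulr_ge0 ?sqr_ge0 // ltW.
Qed.

(** The coefficient 1/2 of ln n matters: it becomes the exponent -1/2 of ln ln N in [many_divisors],
    and eventually the -3/8 of the theorem. *)
Lemma ln_fact_upper n : (0 < n)%N ->
  ln n`!%:R <= n%:R * ln n%:R - n%:R + ln n%:R / 2 + 1 :> R.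
Proof.
elim: n => // -[|n] IH _; first by rewrite (_ : 1`! = 1)%N // ln1; lra.
have {}IH := IH isT; rewrite (factS n.+1) natrM lnM ?posrE ?ltr0n ?fact_gt0 //.
have n0 : 0 < n.+1%:R :> R by rewrite ltr0n.
have h : 2 / (2 * n.+1%:R + 1) <= ln n.+2%:R - ln n.+1%:R :> R.
  rewrite -ln_div ?posrE ?ltr0n //.
  have y1 : 1 <= n.+2%:R / n.+1%:R :> R by rewrite ler_pdivlMr // mul1r ler_nat.
  apply: le_trans (ln_ge_pade y1); rewrite -[n.+2%:R]natr1.
  rewrite le_eqVlt; apply/orP; left; apply/eqP; move: n0; set x : R := n.+1%:R => x0.
  clearbody x; field; do ?(apply/andP; split); apply/eqP; lra.
move: IH h; set b := ln n.+2%:R; rewrite -[n.+2%:R]natr1.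
set x : R := n.+1%:R in n0 *; set a := ln x.
move=> IH; rewrite ler_pdivrMr; last by lra.
lra.
Qed.

Lemma ln2_le34 : ln 2 <= 3 / 4 :> R.
Proof.
have h : 2 <= expR (3 / 4) :> R.
  have -> : 3 / 4 = 1 / 8 *+ 6 :> R by lra.
  rewrite -[X in expR X]mulr_natl expRM_natl.
  have h1 : 9 / 8 <= expR (1 / 8) :> R by have := expR_ge1Dx (1 / 8 : R); lra.
  apply: le_trans (_ : (9 / 8) ^+ 6 <= _); first by rewrite !exprS expr0; lra.
  by rewrite ler_pXn2r // nnegrE ?expR_ge0 //; lra.
by rewrite -[leRHS]expRK ler_ln ?posrE ?expR_gt0.
Qed.

(** The bounds on [lam] come from its cube, which is 16; ln lam <= 1 amounts to ln 2 <= 3/4. *)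
Lemma lam_facts : let lam : R := 2 `^ (4 / 3) in
  [/\ 1 <= lam, lam <= 13 / 5, ln lam = 4 / 3 * ln 2, 0 <= ln lam & ln lam <= 1].
Proof.
move=> lam; have l2 : 0 <= ln 2 :> R by rewrite ln_ge0 // ler1n.
have E : ln lam = 4 / 3 * ln 2 by rewrite ln_powR.
have h : lam ^+ 3 = 16.
  rewrite /lam -powR_mulrn ?powR_ge0 // -powRrM.
  have -> : 4 / 3 * 3%:R = 4%:R :> R by field.
  by rewrite powR_mulrn //; ring.
have lam0 : 0 <= lam by apply: powR_ge0.
split => //.
- by rewrite -(@ler_pXn2r _ 3) ?nnegrE // h expr1n; lra.
- rewrite -(@ler_pXn2r _ 3) ?nnegrE // ?h ?divr_ge0 // !exprS expr0; lra.
- by rewrite E mulr_ge0 // divr_ge0.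
- by rewrite E; have := ln2_le34; lra.
Qed.

End DerivIneq.

Section ManyDivisors.
Variable R : realType.

Lemma powR_expR (a x : R) : 0 < a -> a `^ x = expR (x * ln a).
Proof. by move=> a0; rewrite /powR gt_eqF. Qed.

(* The integers are [n = m p] with [m] from [prod_sum_lower], where [k] is the integer part of
   [lam * ln (ln N)], and [p] a prime in the interval from [N / m] to [C0 N / m]. *)
Lemma many_divisors : let lam : R := 2 `^ (4 / 3) in
  exists C0 c1 E : R, [/\ 1 < C0, 0 < c1 & forall N : R, 0 < N -> E <= ln (ln N) ->
  exists s : seq nat,
    [/\ uniq s,
      forall n : nat, n \in s -> N < n%:R <= C0 * N /\
        c1 * ln N `^ (lam * ln 2) <= (numdiv n)%:R &
      c1 * (N * ln N `^ (- (1 - lam + lam * ln lam)) * ln (ln N) `^ (- 2^-1)) <=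
        (size s)%:R]].
Proof.
move=> lam; have [lam1 lam135 lamE lnlam0 lnlam1] := lam_facts R; rewrite -/lam in lam1 lam135 lamE lnlam0 lnlam1.
have [c1 [E [c10 H1]]] := prod_sum_lower R.
have [C0 [C01 H2]] := prime_count_lower R.
have l20 : 0 <= ln 2 :> R by rewrite ln_ge0 // ler1n.
exists C0, (Num.min (1 / 2) (c1 * expR (- (5 / 2)) / 2)), (`|E| + C0 + 3); split => //.
  by rewrite lt_min divr_gt0 //= divr_gt0 // mulr_gt0 // expR_gt0.
set cc := Num.min _ _.
have cc1 : cc <= 1 / 2 by rewrite /cc ge_min lexx.
have cc2 : cc <= c1 * expR (- (5 / 2)) / 2 by rewrite /cc ge_min lexx orbT.
move=> N N0 hE; set l := ln (ln N) in hE *.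
have E0 : 0 <= `|E| by [].
have hE' : E <= l by have := ler_norm E; lra.
have l3 : 3 <= l by lra.
have l0 : 0 < l by lra.
have L0 : 0 < ln N by rewrite ltNge; apply/negP => /ln0; rewrite -/l; lra.
have Lexp : ln N = expR l by rewrite /l lnK // posrE.
have LC : C0 + 1 <= ln N by rewrite Lexp; have := expR_ge1Dx l; lra.
have NC : C0 + 2 <= N.
  by rewrite -[leRHS]lnK ?posrE //; have := expR_ge1Dx (ln N); lra.
have N4 : 4 <= N.
  by rewrite -[leRHS]lnK ?posrE //; have := expR_ge1Dx (ln N); have := expR_ge1Dx l; lra.
have [k /andP[hk1 hk2]] : exists k : nat, k%:R <= lam * l < k.+1%:R.
  by exists (Num.truncn (lam * l)); apply: truncn_itv; rewrite mulr_ge0 ?(ltW l0) // (le_trans _ lam1).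
have k2 : (2 <= k)%N by rewrite -ltnS -(ltr_nat R); apply: le_lt_trans hk2; clear -lam1 l3; nra.
have k0 : 0 < k%:R :> R by rewrite ltr0n ltnW.
have [|s0 [us0 hs0 sum0]] := H1 N k N0 hE' k2.
  by apply: le_trans hk1 _; rewrite -/l ler_wpM2r // ltW.
have [L LE] : exists L : nat -> seq nat, forall m, L m =
    [seq p <- index_iota 0 (Num.truncn (C0 * (N / m%:R))).+1 | prime p & N / m%:R < p%:R].
  by eexists.
have mm (m : nat) : m \in s0 -> [/\ 0 < m%:R :> R, m%:R <= N / m%:R & 2 <= N / m%:R].
  move=> /hs0[m0 mN _ _]; have mR : 0 < m%:R :> R by rewrite ltr0n.
  have h : m%:R <= N / m%:R by rewrite ler_pdivlMr // -expr2.
  suff h2 : 2 <= N / m%:R by split.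
  have [m2|m1] := leqP 2 m; first by apply: le_trans h; rewrite ler_nat.
  have -> : m = 1%N by apply/eqP; rewrite eqn_leq m0 andbT -ltnS.
  by rewrite divr1; apply: le_trans N4; rewrite ler_nat.
have pL (m p : nat) : m \in s0 -> p \in L m ->
    [/\ prime p, N < (m * p)%:R, (m * p)%:R <= C0 * N & N < p%:R ^+ 2].
  move=> ms; have [m0 h1 h2] := mm _ ms.
  rewrite LE mem_filter mem_index_iota ltnS => /andP[/andP[pp Nmp] pC].
  split => //.
  - by rewrite natrM mulrC -ltr_pdivrMr.
  - rewrite natrM mulrC -ler_pdivlMr // -mulrA; apply: le_trans (_ : (Num.truncn (C0 * (N / m%:R)))%:R <= _).
      by rewrite ler_nat.
    have hq : 0 <= C0 * (N / m%:R) by apply: mulr_ge0; [clear -C01; lra | clear -h2; lra].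
      have : (Num.truncn (C0 * (N / m%:R)))%:R <= C0 * (N / m%:R) < (Num.truncn (C0 * (N / m%:R))).+1%:R.
        exact: truncn_itv.
      by case/andP.
  - apply: le_lt_trans (_ : m%:R * (N / m%:R) < _).
      by rewrite mulrCA divff ?lt0r_neq0 // mulr1.
    by rewrite expr2; apply: ltr_pM; clear -m0 h1 h2 Nmp; lra.
exists [seq (m * p)%N | m <- s0, p <- L m]; split.
- apply: allpairs_uniq_dep => //.
    by move=> m _; rewrite LE filter_uniq // iota_uniq.
  move=> _ _ /allpairsPdep[/= m [p [ms pm ->]]] /allpairsPdep[/= m' [p' [ms' pm' ->]]] /= e.
  have [pp _ _ pN] := pL _ _ ms pm; have [pp' _ _ _] := pL _ _ ms' pm'.
  (* The prime p exceeds sqrt N while the primes dividing m' do not, so p is determined by the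
     product. *)
  have ep : p = p'.
    have : (p %| m' * p')%N by rewrite -e dvdn_mull.
    rewrite Euclid_dvdM // => /orP[pm0|]; last by rewrite dvdn_prime2 // => /eqP.
    by have [_ _ _ /(_ _ pp pm0) hq] := hs0 _ ms'; move: pN; rewrite ltNge hq.
  subst p'; move/eqP: e; rewrite eqn_pmul2r ?prime_gt0 // => /eqP e; subst m'.
  by [].
- move=> n /allpairsPdep[m [p [ms pm ->]]].
  have [pp h1 h2 _] := pL _ _ ms pm; split; first by rewrite h1.
  have [m0 _ h3 _] := hs0 _ ms.
  apply: le_trans (_ : (numdiv m)%:R <= _); last first.
    by rewrite ler_nat mulnC numdiv_mul_le // muln_gt0 prime_gt0.
  apply: le_trans (_ : (2 ^ k)%:R <= _); last by rewrite ler_nat.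
  rewrite natrX -[X in X ^+ k]lnK ?posrE // -expRM_natl powR_expR // -/l.
  apply: le_trans (_ : expR (- ln 2) * expR (lam * ln 2 * l) <= _).
    by rewrite ler_wpM2r ?expR_ge0 // expRN lnK ?posrE //; clear -cc1; lra.
  rewrite -expRD ler_expR; move: hk2; rewrite -natr1 => hk2; clear -hk2 l20; nra.
rewrite size_allpairs_dep sumnE big_map natr_sum.
have key : N / (2 * ln N) * \sum_(m <- s0) m%:R^-1 <= \sum_(m <- s0) (size (L m))%:R.
  rewrite mulr_sumr big_seq [leRHS]big_seq; apply: ler_sum => /= m; move: m => m ms.
  have [m0 h1 h2] := mm _ ms.
  rewrite LE; apply: le_trans (H2 _ h2).
  have p1 : 1 < C0 * (N / m%:R) by clear -C01 h2; nra.
  have p2 : 0 < ln (C0 * (N / m%:R)) by rewrite ln_gt0.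
  have h3 : ln (C0 * (N / m%:R)) <= 2 * ln N.
    rewrite mulr_natl -lnXn // ler_ln ?posrE ?exprn_gt0 // ?(lt_trans ltr01 p1) //.
    have N_ge0 := ltW N0; rewrite expr2; apply: ler_pM.
    - by clear -C01; lra.
    - by clear -h2; lra.
    - by clear -NC; lra.
    rewrite ler_pdivrMr // ler_peMr //.
    by rewrite ler1n; have [] := hs0 _ ms.
  rewrite mulrAC ler_wpM2l //; first by clear -h2; lra.
  by rewrite lef_pV2 ?posrE // mulr_gt0.
apply: le_trans key.
have a0 : 0 <= N / (2 * ln N) by rewrite divr_ge0 ?mulr_ge0 // ltW.
apply: le_trans (_ : N / (2 * ln N) * (c1 * (l ^+ k / k`!%:R)) <= _); last first.
  by rewrite ler_wpM2l.
have f0 : 0 < k`!%:R :> R by rewrite ltr0n fact_gt0.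
(* Stirling's bound at k. Passing from k to lam l costs only constants: ln k <= ln lam + ln l, and k
   (1 - ln lam) can be bounded from below through k > lam l - 1 because ln lam <= 1. *)
have lk : expR (- (5 / 2)) * (expR (lam * (1 - ln lam) * l) * expR (- (ln l / 2))) <= l ^+ k / k`!%:R.
  have -> : l ^+ k / k`!%:R = expR (k%:R * ln l - ln k`!%:R).
    by rewrite expRB expRM_natl !lnK ?posrE.
  rewrite -!expRD ler_expR.
  have hf := @ln_fact_upper R k (ltnW k2).
  have hlk : ln k%:R <= ln lam + ln l.
    have lam0 : 0 < lam by exact: lt_le_trans lam1.
    by rewrite -lnM ?posrE // ler_ln ?posrE ?mulr_gt0.
  have h1 : k%:R * (ln k%:R) <= k%:R * (ln lam + ln l) by rewrite ler_wpM2l // ltW.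
  have h2 : (lam * l - 1) * (1 - ln lam) <= k%:R * (1 - ln lam).
    by rewrite ler_wpM2r ?subr_ge0 //; move: hk2; rewrite -natr1; clear; lra.
  by clear -hf hlk h1 h2 lnlam0; lra.
apply: le_trans (_ : N / (2 * ln N) * (c1 * (expR (- (5 / 2)) * (expR (lam * (1 - ln lam) * l) * expR (- (ln l / 2))))) <= _); last first.
  by rewrite ler_wpM2l // ler_wpM2l // ltW.
rewrite !powR_expR //.
have -> : N / (2 * ln N) = N * expR (- l) / 2 by rewrite Lexp expRN invfM -mulrA [2^-1 * _]mulrC.
have e1 : expR (- (1 - lam + lam * ln lam) * ln (ln N)) = expR (lam * (1 - ln lam) * l) * expR (- l).
  by rewrite -expRD -/l; congr expR; ring.
have e2 : - 2^-1 * ln (ln (ln N)) = - (ln l / 2) by rewrite /l; field.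
rewrite e1 e2.
set x := expR (lam * _ * _); set y := expR (- l); set z := expR (- (ln l / 2)).
set u := expR (- (5 / 2)) in cc2 *.
have -> : N * y / 2 * (c1 * (u * (x * z))) = c1 * u / 2 * (N * (x * y) * z) by field.
by rewrite ler_wpM2r // mulr_ge0 ?expR_ge0 // mulr_ge0 ?mulr_ge0 ?expR_ge0 // ltW.
Qed.

End ManyDivisors.

(** * Complex modulus and exponential *)

Section ComplexNorm.
Variable R : realType.
Implicit Types z w : R[i].
Local Notation nc := (@Normc.normc R).
Local Notation re := (@complex.Re R).
Local Notation im := (@complex.Im R).
Local Open Scope complex_scope.

Lemma nc_ge0 z : 0 <= nc z. Proof. by case: z => a b; rewrite sqrtr_ge0. Qed.

Lemma nc0 : nc 0 = 0. Proof. exact: Normc.normc0. Qed.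

Lemma nc_eq0 z : (nc z == 0) = (z == 0).
Proof.
by apply/eqP/eqP => [/Normc.eq0_normc //|->]; rewrite nc0.
Qed.

Lemma nc_gt0 z : (0 < nc z) = (z != 0).
Proof. by rewrite lt_def nc_eq0 nc_ge0 andbT. Qed.

Lemma ncM z w : nc (z * w) = nc z * nc w. Proof. exact: Normc.normcM. Qed.

Lemma ncV z : nc z^-1 = (nc z)^-1. Proof. exact: Normc.normcV. Qed.

Lemma ncX z n : nc (z ^+ n) = nc z ^+ n.
Proof. by elim: n => [|n IH]; rewrite ?expr0 ?Normc.normc1 // !exprS ncM IH. Qed.

Lemma ncXV z n : nc (z ^- n) = (nc z) ^- n. Proof. by rewrite ncV ncX. Qed.

Lemma ncN z : nc (- z) = nc z. Proof. exact: (@normcN R z). Qed.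

Lemma ncD_le z w : nc (z + w) <= nc z + nc w. Proof. exact: (@le_normcD R z w). Qed.

Lemma ncB_le z w : nc (z - w) <= nc z + nc w.
Proof. by apply: le_trans (ncD_le _ _) _; rewrite ncN. Qed.

Lemma ncBC z w : nc (z - w) = nc (w - z). Proof. by rewrite -ncN opprB. Qed.

Lemma nc_leB z w : nc z - nc w <= nc (z - w).
Proof. by rewrite lerBlDr; apply: le_trans (ncD_le _ _); rewrite subrK. Qed.

Lemma nc_real (x : R) : nc x%:C = `|x|.
Proof. by rewrite /real_complex_def /= expr0n /= addr0 sqrtr_sqr. Qed.

Lemma nc_nat n : nc n%:R = n%:R.
Proof.
have -> : n%:R = (n%:R : R)%:C :> R[i] by rewrite rmorph_nat.
by rewrite nc_real ger0_norm ?ler0n.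
Qed.

Lemma nc_sqr z : nc z ^+ 2 = re z ^+ 2 + im z ^+ 2.
Proof. by case: z => a b /=; rewrite sqr_sqrtr // addr_ge0 ?sqr_ge0. Qed.

Lemma Re_le_nc z : `|re z| <= nc z.
Proof.
rewrite -(@ler_pXn2r _ 2) ?nnegrE ?nc_ge0 // nc_sqr real_normK ?num_real //.
by rewrite lerDl sqr_ge0.
Qed.

Lemma Im_le_nc z : `|im z| <= nc z.
Proof.
rewrite -(@ler_pXn2r _ 2) ?nnegrE ?nc_ge0 // nc_sqr real_normK ?num_real //.
by rewrite lerDr sqr_ge0.
Qed.

Lemma nc_le_ReIm z : nc z <= `|re z| + `|im z|.
Proof.
rewrite -(@ler_pXn2r _ 2) ?nnegrE ?nc_ge0 ?addr_ge0 // nc_sqr.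
rewrite -[re z ^+ 2]real_normK ?num_real // -[im z ^+ 2]real_normK ?num_real //.
have := normr_ge0 (re z); have := normr_ge0 (im z); nra.
Qed.

Lemma nc_sum (I : Type) (r : seq I) (P : pred I) (F : I -> R[i]) :
  nc (\sum_(i <- r | P i) F i) <= \sum_(i <- r | P i) nc (F i).
Proof.
elim: r => [|a r IH]; first by rewrite !big_nil nc0.
rewrite !big_cons; case: ifP => // _.
by apply: le_trans (ncD_le _ _) _; rewrite lerD2l.
Qed.

Lemma ncD_ub z w a b : nc z <= a -> nc w <= b -> nc (z + w) <= a + b.
Proof. by move=> h1 h2; apply: le_trans (ncD_le _ _) _; apply: lerD. Qed.

Lemma ncB_ub z w a b : nc z <= a -> nc w <= b -> nc (z - w) <= a + b.
Proof. by move=> h1 h2; apply: le_trans (ncB_le _ _) _; apply: lerD. Qed.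

Lemma ncM_ub z w a b : nc z <= a -> nc w <= b -> nc (z * w) <= a * b.
Proof. by move=> h1 h2; rewrite ncM ler_pM ?nc_ge0. Qed.

Lemma ncX_ub z a n : nc z <= a -> nc (z ^+ n) <= a ^+ n.
Proof.
move=> h; rewrite ncX; case: n => [|n]; first by rewrite !expr0.
by rewrite ler_pXn2r // nnegrE ?nc_ge0 // (le_trans _ h) // nc_ge0.
Qed.

Lemma cReD z w : re (z + w) = re z + re w. Proof. by case: z; case: w. Qed.
Lemma cImD z w : im (z + w) = im z + im w. Proof. by case: z; case: w. Qed.
Lemma cReN z : re (- z) = - re z. Proof. by case: z. Qed.
Lemma cImN z : im (- z) = - im z. Proof. by case: z. Qed.
Lemma cRe_nat n : re (n%:R : R[i]) = n%:R.
Proof. by have -> : n%:R = (n%:R : R)%:C :> R[i] by rewrite rmorph_nat. Qed.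
Lemma cIm_nat n : im (n%:R : R[i]) = 0.
Proof. by have -> : n%:R = (n%:R : R)%:C :> R[i] by rewrite rmorph_nat. Qed.
Lemma cReZ (x : R) z : re (x%:C * z) = x * re z.
Proof. by case: z => a b /=; rewrite mul0r subr0. Qed.
Lemma cImZ (x : R) z : im (x%:C * z) = x * im z.
Proof. by case: z => a b /=; rewrite mul0r addr0. Qed.
Lemma cRe_sum (I : Type) (r : seq I) (P : pred I) (F : I -> R[i]) :
  re (\sum_(i <- r | P i) F i) = \sum_(i <- r | P i) re (F i).
Proof. by elim/big_rec2: _ => // i y z _; rewrite cReD => ->. Qed.

End ComplexNorm.

(** * Taylor bounds for the real exponential, sine and cosine *)

Section Taylor.
Variable R : realType.
Implicit Types x p y : R.

Lemma subcos_le x : 0 <= x -> 1 - cos x <= x.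
Proof.
move=> x0; have := @le_of_is_derive R (fun t => t - (1 - cos t)) (fun t => 1 - sin t) 0 x x0.
rewrite cos0 subrr subr0 subr_ge0; apply => [t _|t _].
  by apply: is_derive_eq; ring.
by rewrite subr_ge0 sin_le1.
Qed.

Lemma subsin_le x : 0 <= x -> x - sin x <= x ^+ 2 / 2.
Proof.
move=> x0; have := @le_of_is_derive R (fun t => t ^+ 2 / 2 - (t - sin t)) (fun t => t - (1 - cos t)) 0 x x0.
rewrite sin0 expr0n /= mul0r !subr0 subr_ge0; apply => [t _|t /andP[t0 _]].
  by apply: is_derive_eq; rewrite /GRing.scale /=; field.
by rewrite subr_ge0 subcos_le.
Qed.

Lemma cos_ub3 x : 0 <= x -> cos x - 1 + x ^+ 2 / 2 <= x ^+ 3 / 6.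
Proof.
move=> x0; have := @le_of_is_derive R (fun t => t ^+ 3 / 6 - (cos t - 1 + t ^+ 2 / 2))
  (fun t => t ^+ 2 / 2 - (t - sin t)) 0 x x0.
rewrite cos0 !expr0n /= !mul0r subrr addr0 subr0 subr_ge0; apply => [t _|t /andP[t0 _]].
  by apply: is_derive_eq; rewrite /GRing.scale /=; field.
by rewrite subr_ge0 subsin_le.
Qed.

Lemma sin_le_id x : 0 <= x -> sin x <= x.
Proof.
move=> x0; have := @le_of_is_derive R (fun t => t - sin t) (fun t => 1 - cos t) 0 x x0.
rewrite sin0 subrr => h; rewrite -subr_ge0; apply: h => t _.
by rewrite subr_ge0 cos_le1.
Qed.

Lemma cos_lb2 x : 0 <= x -> 0 <= cos x - 1 + x ^+ 2 / 2.
Proof.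
move=> x0; have := @le_of_is_derive R (fun t => cos t - 1 + t ^+ 2 / 2)
  (fun t => t - sin t) 0 x x0.
rewrite cos0 !expr0n /= !mul0r subrr addr0; apply => [t _|t /andP[t0 _]].
  by apply: is_derive_eq; rewrite /GRing.scale /=; field.
by rewrite subr_ge0 sin_le_id.
Qed.

Lemma sin_lb3 x : 0 <= x -> x - sin x <= x ^+ 3 / 6.
Proof.
move=> x0; have := @le_of_is_derive R (fun t => t ^+ 3 / 6 - (t - sin t))
  (fun t => cos t - 1 + t ^+ 2 / 2) 0 x x0.
rewrite sin0 expr0n /= mul0r !subr0 subr_ge0; apply => [t _|t /andP[t0 _]].
  by apply: is_derive_eq; rewrite /GRing.scale /=; field.
exact: cos_lb2.
Qed.

Lemma cos_taylor x : `|cos x - 1 + x ^+ 2 / 2| <= `|x| ^+ 3 / 6.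
Proof.
have -> : cos x - 1 + x ^+ 2 / 2 = cos `|x| - 1 + `|x| ^+ 2 / 2.
  by case: (ger0P x) => _; rewrite ?cosN ?sqrrN.
by rewrite ger0_norm ?cos_lb2 ?cos_ub3.
Qed.

Lemma sin_taylor x : `|sin x - x| <= `|x| ^+ 3 / 6.
Proof.
have -> : `|sin x - x| = `|sin `|x| - `|x| |.
  case: (ger0P x) => _ //; rewrite sinN -normrN; congr `|_|; ring.
by rewrite distrC ger0_norm ?subr_ge0 ?sin_le_id // sin_lb3.
Qed.

Lemma sin_norm_le x : `|sin x| <= `|x|.
Proof.
have -> : `|sin x| = `|sin `|x| |.
  by case: (ger0P x) => _ //; rewrite sinN normrN.
have [x1|x1] := leP `|x| 1; last by rewrite (le_trans (sin_max _)) // ltW.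
rewrite ger0_norm ?sin_le_id // sin_ge0_pi // normr_ge0 /=.
by apply: le_trans x1 _; have := pi_ge2 R; lra.
Qed.

Lemma expR_taylor1 p : p <= 0 -> 0 <= expR p - 1 - p <= p ^+ 2 / 2.
Proof.
move=> p0; apply/andP; split; first by have := expR_ge1Dx p; lra.
have := @le_of_is_derive R (fun t => expR t - 1 - t - t ^+ 2 / 2)
  (fun t => expR t - 1 - t) p 0 p0.
rewrite expR0 expr0n /= mul0r subr0 !subrr => h; rewrite -subr_le0; apply: h => [t _|t _].
  by apply: is_derive_eq; rewrite /GRing.scale /=; field.
by have := expR_ge1Dx t; lra.
Qed.

Lemma expR_taylor2 p : p <= 0 -> `|expR p - 1 - p - p ^+ 2 / 2| <= `|p| ^+ 3 / 6.
Proof.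
move=> p0; have /andP[_ h1] := expR_taylor1 p0.
rewrite ler0_norm ?subr_le0 // (ler0_norm p0).
have := @le_of_is_derive R (fun t => t ^+ 3 / 6 - (expR t - 1 - t - t ^+ 2 / 2))
  (fun t => t ^+ 2 / 2 - (expR t - 1 - t)) p 0 p0.
rewrite expR0 !expr0n /= !mul0r !subr0 !subrr => h.
suff : p ^+ 3 / 6 - (expR p - 1 - p - p ^+ 2 / 2) <= 0.
  have -> : (- p) ^+ 3 = - p ^+ 3 by rewrite !exprS expr0; ring.
  lra.
apply: h => [t _|t /andP[_ t0]].
  by apply: is_derive_eq; rewrite /GRing.scale /=; field.
by rewrite subr_ge0; case/andP: (expR_taylor1 t0).
Qed.

Lemma pi_le4 : pi <= 4 :> R.
Proof. by have [/andP[_ h] _] := pihalf_02_cos_pihalf R; lra. Qed.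

(** Taylor's bound serves up to 2; between 2 and pi the cosine is at most 0, and y^2 <= 16. *)
Lemma cos_quad_lb y : `|y| <= pi -> y ^+ 2 / 16 <= 1 - cos y.
Proof.
move=> hy.
have -> : cos y = cos `|y| by case: (ger0P y) => _; rewrite ?cosN.
rewrite -[y ^+ 2]real_normK ?num_real //; set a := `|y| in hy *.
have a0 : 0 <= a := normr_ge0 y.
have [a2|a2] := leP a 2.
  have := cos_ub3 a0; have : a ^+ 3 <= 2 * a ^+ 2 by rewrite exprS ler_wpM2r // sqr_ge0.
  have := sqr_ge0 a; lra.
have p4 := pi_le4.
have : cos a <= 0.
  have -> : a = (a - pi / 2) + pi / 2 by rewrite subrK.
  rewrite cosDpihalf oppr_le0 sin_ge0_pi //; lra.
have : a ^+ 2 <= 16 by nra.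
lra.
Qed.

End Taylor.

(** * The complex exponential near the origin and in a strip *)

Section ComplexExp.
Variable R : realType.
Implicit Types t u z : R[i].
Local Notation nc := (@Normc.normc R).
Local Notation re := (@complex.Re R).
Local Notation im := (@complex.Im R).
Local Open Scope complex_scope.

Definition cexp u : R[i] :=
  (expR (re u) * cos (im u)) +i* (expR (re u) * sin (im u)).

(** The function e(t) of the overview, with 2 pi i t split into real and imaginary parts. *)
Definition ce t : R[i] := cexp ((- (2 * pi * im t)) +i* (2 * pi * re t)).

Lemma cexpD u z : cexp (u + z) = cexp u * cexp z.
Proof.
case: u => a b; case: z => c d; rewrite /cexp /= expRD cosD sinD.
by apply/eqP; rewrite eq_complex /=; apply/andP; split; apply/eqP; ring.
Qed.

Lemma ceD t z : ce (t + z) = ce t * ce z.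
Proof.
rewrite /ce -cexpD; congr cexp; case: t => a b; case: z => c d /=.
by apply/eqP; rewrite eq_complex /=; apply/andP; split; apply/eqP; ring.
Qed.

Lemma ce0 : ce 0 = 1.
Proof.
rewrite /ce /cexp /= !mulr0 oppr0 expR0 cos0 sin0.
by apply/eqP; rewrite eq_complex /= mulr1 mulr0 !eqxx.
Qed.

Lemma ce_natM n t : ce (n%:R * t) = ce t ^+ n.
Proof.
elim: n => [|n IH]; first by rewrite mul0r ce0 expr0.
by rewrite -natr1 mulrDl mul1r ceD IH exprSr.
Qed.

Lemma ce_half : ce (2^-1) = -1.
Proof.
have -> : 2^-1 = (2^-1 : R)%:C :> R[i] by rewrite rmorphV ?unitfE // rmorph_nat.
rewrite /ce /cexp /= mulr0 oppr0 expR0 (_ : 2 * pi / 2 = pi) ?cospi ?sinpi; last by field.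
by apply/eqP; rewrite eq_complex /= !mul1r oppr0 !eqxx.
Qed.

Lemma ce1 : ce 1 = 1.
Proof.
have E : 2^-1 + 2^-1 = 1 :> R[i] by field.
by rewrite -[X in ce X]E ceD ce_half mulrNN mulr1.
Qed.

Lemma nc_cexp u : nc (cexp u) = expR (re u).
Proof.
apply/eqP; rewrite -(@eqrXn2 _ 2) ?nc_ge0 ?expR_ge0 // nc_sqr /=.
by rewrite !exprMn -mulrDr cos2Dsin2 mulr1.
Qed.

Lemma nc_ce t : nc (ce t) = expR (- (2 * pi * im t)).
Proof. by rewrite nc_cexp. Qed.

Lemma cexp_taylor u : re u <= 0 -> nc (cexp u - 1 - u - u ^+ 2 / 2) <= 2 * nc u ^+ 3.
Proof.
move=> hp; have hr := Re_le_nc u; have hi := Im_le_nc u.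
case: u hp hr hi => p y; set r := nc (p +i* y); rewrite [re _]/= [im _]/= => hp hr hi.
have r0 : 0 <= r := nc_ge0 _.
have i2 : 2^-1 = (2^-1 : R)%:C :> R[i] by rewrite rmorphV ?unitfE // rmorph_nat.
apply: le_trans (nc_le_ReIm _) _; rewrite expr2 i2 /=.
have e1 := expR_taylor2 hp; have /andP[e2 e3] := expR_taylor1 hp.
have c1 := cos_taylor y; have s1 := sin_taylor y.
have ep : expR p <= 1 by rewrite expR_le1.
have ep0 := expR_ge0 p.
have p3 : `|p| ^+ 3 <= r ^+ 3 by rewrite ler_pXn2r // nnegrE.
have y3 : `|y| ^+ 3 <= r ^+ 3 by rewrite ler_pXn2r // nnegrE.
have py : `|p| * `|y| ^+ 2 <= r ^+ 3.
  by rewrite [r ^+ 3]exprS ler_pM // ?sqr_ge0 // ler_pXn2r // nnegrE.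
have yp : `|y| * `|p| ^+ 2 <= r ^+ 3.
  by rewrite [r ^+ 3]exprS ler_pM // ?sqr_ge0 // ler_pXn2r // nnegrE.
have A1 : `|expR p * cos y - 1 - p - ((p * p - y * y) * 2^-1 - (p * y + y * p) * 0)| <= r ^+ 3 * (5 / 6).
  have -> : expR p * cos y - 1 - p - ((p * p - y * y) * 2^-1 - (p * y + y * p) * 0) =
    (expR p - 1 - p - p ^+ 2 / 2) + expR p * (cos y - 1 + y ^+ 2 / 2) - (expR p - 1) * (y ^+ 2 / 2) by field.
  apply: le_trans (ler_normB _ _) _; apply: le_trans (lerD (ler_normD _ _) (lexx _)) _.
  have h1 : `|expR p * (cos y - 1 + y ^+ 2 / 2)| <= r ^+ 3 / 6.
    rewrite normrM (ger0_norm ep0); apply: le_trans (_ : 1 * (`|y| ^+ 3 / 6) <= _).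
      by rewrite ler_pM.
    lra.
  have h2 : `|(expR p - 1) * (y ^+ 2 / 2)| <= r ^+ 3 / 2.
    rewrite normrM normrM normrX (ger0_norm (_ : 0 <= 2^-1 :> R)) //.
    apply: le_trans (_ : `|p| * (`|y| ^+ 2 / 2) <= _); last by lra.
    rewrite ler_wpM2r ?mulr_ge0 ?sqr_ge0 // ler0_norm ?ler0_norm //; lra.
  lra.
have A2 : `|expR p * sin y - 0 - y - ((p * p - y * y) * 0 + (p * y + y * p) * 2^-1)| <= r ^+ 3 * (4 / 6).
  have -> : expR p * sin y - 0 - y - ((p * p - y * y) * 0 + (p * y + y * p) * 2^-1) =
    expR p * (sin y - y) + y * (expR p - 1 - p) by field.
  apply: le_trans (ler_normD _ _) _.
  have h1 : `|expR p * (sin y - y)| <= r ^+ 3 / 6.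
    rewrite normrM (ger0_norm ep0); apply: le_trans (_ : 1 * (`|y| ^+ 3 / 6) <= _).
      by rewrite ler_pM.
    lra.
  have h2 : `|y * (expR p - 1 - p)| <= r ^+ 3 / 2.
    rewrite normrM (ger0_norm e2).
    apply: le_trans (_ : `|y| * (`|p| ^+ 2 / 2) <= _); last by lra.
    by rewrite ler_wpM2l // real_normK ?num_real.
  lra.
have r3 : 0 <= r ^+ 3 by rewrite exprn_ge0.
by apply: le_trans (lerD A1 A2) _; lra.
Qed.

(** For u = p + iy the identity |1 - e^u|^2 = (1 - e^p)^2 + 2 e^p (1 - cos y) separates the two
    variables. The first part is at least a multiple of p^2, the second of y^2 by [cos_quad_lb]. *)
Lemma cexp_sub1_lb (P : R) u : - P <= re u <= 0 -> `|im u| <= pi ->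
  expR (- P) / 3 * nc u <= nc (1 - cexp u).
Proof.
case: u => p y; set r := nc (p +i* y); rewrite [re _]/= [im _]/= => /andP[hP hp] hy.
have r0 : 0 <= r := nc_ge0 _.
have r2 : r ^+ 2 = p ^+ 2 + y ^+ 2 by rewrite /r nc_sqr.
have E0 := expR_ge0 (- P).
rewrite -(@ler_pXn2r _ 2) ?nnegrE ?nc_ge0 //; last first.
  by rewrite mulr_ge0 // divr_ge0.
rewrite exprMn [nc (1 - _) ^+ 2]nc_sqr r2 /=.
have cq := cos_quad_lb hy.
have -> : (1 - expR p * cos y) ^+ 2 + (0 - expR p * sin y) ^+ 2 =
   (1 - expR p) ^+ 2 + 2 * expR p * (1 - cos y).
  have -> : (0 - expR p * sin y) ^+ 2 = expR p ^+ 2 * (1 - cos y ^+ 2) by rewrite -sin2cos2; ring.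
  ring.
have Ep : expR (- P) <= expR p by rewrite ler_expR.
have E1 : expR (- P) <= 1 by apply: le_trans Ep _; rewrite expR_le1.
have d : - p * expR (- P) <= 1 - expR p.
  have h : 1 - p <= expR (- p) by have := expR_ge1Dx (- p).
  have : (1 - p) * expR p <= 1.
    apply: le_trans (_ : expR (- p) * expR p <= _); first by rewrite ler_wpM2r // expR_ge0.
    by rewrite -expRD addNr expR0.
  nra.
have d0 : 0 <= - p * expR (- P) by rewrite mulr_ge0 // oppr_ge0.
have d2 : (- p * expR (- P)) ^+ 2 <= (1 - expR p) ^+ 2.
  by rewrite ler_pXn2r // nnegrE // (le_trans d0).
have y2 := sqr_ge0 y.
have k1 : 2 * expR (- P) * (y ^+ 2 / 16) <= 2 * expR p * (1 - cos y).
  have : expR (- P) * (y ^+ 2 / 16) <= expR p * (1 - cos y).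
    by apply: ler_pM => //; rewrite divr_ge0.
  lra.
have k2 : expR (- P) ^+ 2 <= expR (- P) by rewrite expr2 ler_piMl.
have k3 : expR (- P) ^+ 2 * y ^+ 2 <= expR (- P) * y ^+ 2 by rewrite ler_wpM2r.
have h0 : 0 <= expR (- P) ^+ 2 * p ^+ 2 by rewrite mulr_ge0 ?sqr_ge0.
have d2' : expR (- P) ^+ 2 * p ^+ 2 <= (1 - expR p) ^+ 2.
  by move: d2; rewrite exprMn sqrrN mulrC.
have -> : (expR (- P) / 3) ^+ 2 * (p ^+ 2 + y ^+ 2) = expR (- P) ^+ 2 * p ^+ 2 / 9 + expR (- P) ^+ 2 * y ^+ 2 / 9 by field.
apply: lerD.
  by apply: le_trans d2'; rewrite ler_pdivrMr // ler_peMr // ler1n.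
move: k1 k3; set A := expR (- P) ^+ 2 * _; set B := 2 * expR p * _; clearbody A B => *.
have : 0 <= expR (- P) * y ^+ 2 by rewrite mulr_ge0.
lra.
Qed.

End ComplexExp.

(** * Lipschitz's formula *)

Section TailSums.
Variable R : realType.
Implicit Types D t : R.

Lemma sum_inv_sqr_shift (n : nat) D : 0 < D ->
  \sum_(i < n) (D + i%:R) ^- 2 <= D ^- 2 + D^-1.
Proof.
move=> D0; have Dn k : 0 < D + k%:R by rewrite ltr_wpDr // ler0n.
case: n => [|n].
  by rewrite big_ord0 addr_ge0 ?invr_ge0 ?sqr_ge0 // ltW.
rewrite big_ord_recl /= addr0 lerD2l.
suff h : \sum_(i < n) (D + (lift ord0 i)%:R) ^- 2 <= D^-1 - (D + n%:R)^-1.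
  by apply: le_trans h _; rewrite gerBl invr_ge0 ltW.
elim: n => [|n IH]; first by rewrite big_ord0 addr0 subrr.
rewrite big_ord_recr /=; apply: le_trans (lerD IH (lexx _)) _.
rewrite /bump /= add1n -natr1; set x := D + n%:R.
have x0 : 0 < x by apply: Dn.
have -> : D + (n%:R + 1) = x + 1 by rewrite addrA.
rewrite -subr_ge0.
have -> : D^-1 - (x + 1)^-1 - (D^-1 - x^-1 + (x + 1) ^- 2) = (x * (x + 1) ^+ 2)^-1.
  clearbody x; field; do ?(apply/andP; split); apply/eqP; lra.
by rewrite invr_ge0 mulr_ge0 ?sqr_ge0 // ltW.
Qed.

(** The points t + i are cut where they change sign; each side is a shifted sum of inverse squares,
    the left one being read backwards. *)
Lemma sum_inv_sqr_dist (n : nat) D t : 0 < D ->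
  \sum_(i < n) (D + `|t + i%:R|) ^- 2 <= 2 * (D ^- 2 + D^-1).
Proof.
move=> D0.
have pos t' i : 0 < D + `|t' + i%:R| by rewrite ltr_wpDr.
have up m t' : 0 <= t' -> \sum_(i < m) (D + `|t' + i%:R|) ^- 2 <= D ^- 2 + D^-1.
  move=> t0; apply: le_trans (sum_inv_sqr_shift m D0); apply: ler_sum => i _.
  have h : D + i%:R <= D + `|t' + i%:R|.
    by rewrite lerD2l ger0_norm ?addr_ge0 ?ler0n // lerDr.
  have p0 : 0 < D + i%:R by rewrite ltr_wpDr // ler0n.
  by rewrite lef_pV2 ?posrE ?exprn_gt0 // ler_pXn2r // nnegrE ltW.
have s0 : 0 <= D ^- 2 + D^-1 by rewrite addr_ge0 // invr_ge0 ?sqr_ge0 // ltW.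
have [t0|t0] := leP 0 t; first by apply: le_trans (up n t t0) _; lra.
have down m t' : t' + m%:R <= 1 -> \sum_(i < m) (D + `|t' + i%:R|) ^- 2 <= D ^- 2 + D^-1.
  move=> tm; apply: le_trans (sum_inv_sqr_shift m D0).
  rewrite (reindex_inj rev_ord_inj) /=; apply: ler_sum => i _.
  have im : (i < m)%N by [].
  have E : (m - i.+1)%:R = m%:R - i%:R - 1 :> R.
    by rewrite natrB // -natr1; ring.
  have h : D + i%:R <= D + `|t' + (m - i.+1)%:R|.
    rewrite lerD2l; apply: le_trans (_ : - (t' + (m - i.+1)%:R) <= _).
      by rewrite E; lra.
    by rewrite -normrN ler_norm.
  have p0 : 0 < D + i%:R by rewrite ltr_wpDr // ler0n.
  by rewrite lef_pV2 ?posrE ?exprn_gt0 // ler_pXn2r // nnegrE ltW.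
have [m hm] : exists m : nat, m%:R <= - t < m.+1%:R.
  by exists (Num.truncn (- t)); apply: truncn_itv; rewrite oppr_ge0 ltW.
case/andP: hm => hm1 hm2.
have [nm|mn] := leqP n m.+1.
  apply: le_trans (down n t _) _; last by lra.
  by have : n%:R <= m.+1%:R :> R; [rewrite ler_nat|rewrite -natr1; lra].
rewrite -(subnKC (ltnW mn)) big_split_ord /=.
have h1 : \sum_(i < m.+1) (D + `|t + i%:R|) ^- 2 <= D ^- 2 + D^-1.
  by apply: down; rewrite -natr1; lra.
have h2 : \sum_(i < n - m.+1) (D + `|t + (m.+1 + i)%:R|) ^- 2 <= D ^- 2 + D^-1.
  have e : t + m.+1%:R >= 0 by move: hm2; lra.
  apply: le_trans (up (n - m.+1)%N _ e); rewrite le_eqVlt; apply/orP; left; apply/eqP.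
  by apply: eq_bigr => i _; rewrite natrD addrA.
by rewrite mulrDl mul1r; apply: lerD.
Qed.

Lemma sum_inv_pow_dist (n k : nat) D t : 0 < D ->
  \sum_(i < n) (D + `|t + i%:R|) ^- k.+2 <= 2 * (D ^- k.+2 + D ^- k.+1).
Proof.
move=> D0.
have pos i : 0 < D + `|t + i%:R| by rewrite ltr_wpDr.
apply: le_trans (_ : D ^- k * (2 * (D ^- 2 + D^-1)) <= _); last first.
  rewrite le_eqVlt; apply/orP; left; apply/eqP.
  by rewrite !exprS expr0; field; rewrite !lt0r_neq0 ?exprn_gt0.
apply: le_trans (ler_wpM2l _ (@sum_inv_sqr_dist n D t D0)); last by rewrite invr_ge0 exprn_ge0 // ltW.
rewrite mulr_sumr; apply: ler_sum => i _.
rewrite -addn2 exprD invfM ler_wpM2r ?invr_ge0 ?sqr_ge0 //.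
rewrite lef_pV2 ?posrE ?exprn_gt0 //.
case: k => [|k]; first by rewrite !expr0.
by rewrite ler_pXn2r // ?nnegrE ?(ltW D0) ?(ltW (pos i)) // lerDl.
Qed.

End TailSums.

Section Lipschitz.
Variable R : realType.
Implicit Types t u z : R[i].
Local Notation nc := (@Normc.normc R).
Local Notation re := (@complex.Re R).
Local Notation im := (@complex.Im R).
Local Open Scope complex_scope.

(* Closed form of the sum of [h ^ 3 * q ^ h]. *)
Definition Sq (q : R[i]) : R[i] :=
  6 / (1 - q) ^+ 4 - 12 / (1 - q) ^+ 3 + 7 / (1 - q) ^+ 2 - 1 / (1 - q).

(** The constant (-2 pi i)^4 / 3! of Lipschitz's formula. *)
Definition c3 : R := (2 * pi) ^+ 4 / 6.

(** Closed form of the sum of (t - a)^(-4) over all integers a. The series itself appears only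
    through the finite sums [Zs] and explicit error bounds. *)
Definition Lip t : R[i] := c3%:C * Sq (ce t).

(** In the power series the odd terms cancel, and the even ones give 2 (2h)^3 r^(2h) = 16 h^3
    (r^2)^h. *)
Lemma Sq_dup (r : R[i]) : 1 - r != 0 -> 1 + r != 0 -> Sq r + Sq (- r) = 16 * Sq (r ^+ 2).
Proof.
move=> h1 h2; have h3 : 1 - r ^+ 2 != 0.
  have -> : 1 - r ^+ 2 = (1 - r) * (1 + r) by ring.
  exact: mulf_neq0.
rewrite /Sq opprK; field; rewrite h1 h2 /=.
by move: h3; rewrite expr2 => h3; rewrite ?h3 //.
Qed.

Lemma nc_ce_lt1 t : 0 < im t -> nc (ce t) < 1.
Proof.
by move=> t0; rewrite nc_ce expR_lt1 oppr_lt0 !mulr_gt0 // pi_gt0.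
Qed.

Lemma sub1_neq0 z : nc z < 1 -> 1 - z != 0.
Proof.
move=> h; rewrite -nc_gt0; apply: lt_le_trans (nc_leB _ _).
by rewrite Normc.normc1 subr_gt0.
Qed.

Lemma half_c : 2^-1 = (2^-1 : R)%:C :> R[i].
Proof. by rewrite rmorphV ?unitfE // rmorph_nat. Qed.

Lemma im_half t : im (t / 2) = im t / 2.
Proof. by rewrite mulrC half_c cImZ mulrC. Qed.

Lemma re_half t : re (t / 2) = re t / 2.
Proof. by rewrite mulrC half_c cReZ mulrC. Qed.

Lemma Lip_dup t : 0 < im t -> Lip (t / 2) + Lip ((t + 1) / 2) = 16 * Lip t.
Proof.
move=> t0; rewrite /Lip -mulrDr [16 * _]mulrCA; congr (_ * _).
have -> : ce ((t + 1) / 2) = - ce (t / 2).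
  by rewrite mulrDl mul1r ceD ce_half mulrN1.
have -> : ce t = ce (t / 2) ^+ 2 by rewrite -ce_natM; congr ce; field.
have h : nc (ce (t / 2)) < 1 by rewrite nc_ce_lt1 // im_half divr_gt0.
apply: Sq_dup; first exact: sub1_neq0.
by rewrite -[ce _]opprK sub1_neq0 // ncN.
Qed.

Lemma Lip_addn t (n : nat) : Lip (t + n%:R) = Lip t.
Proof. by rewrite /Lip ceD -[n%:R]mulr1 ce_natM ce1 expr1n mulr1. Qed.

Definition Zs (A : nat) t : R[i] := \sum_(i < A.*2.+1) (t + A%:R - i%:R) ^- 4.

Lemma sum_even_odd (V : nmodType) (n : nat) (h : nat -> V) :
  \sum_(j < n.*2) h j = \sum_(i < n) h i.*2 + \sum_(i < n) h i.*2.+1.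
Proof.
elim: n => [|n IH]; first by rewrite !big_ord0 addr0.
by rewrite doubleS !big_ord_recr /= IH -!addrA; congr (_ + _); rewrite !addrA; congr (_ + _); rewrite addrC.
Qed.

Lemma Zs_dup (A : nat) t :
  Zs A (t / 2) + Zs A ((t + 1) / 2) = 16 * (Zs A.*2 t + (t + A.*2.+1%:R) ^- 4).
Proof.
have half (z : R[i]) : (z / 2) ^- 4 = 16 * z ^- 4.
  by rewrite expr_div_n invf_div; congr (_ * _); rewrite ?exprS ?expr0; ring.
pose h j := (t + A.*2.+1%:R - j%:R) ^- 4.
have -> : Zs A.*2 t + (t + A.*2.+1%:R) ^- 4 = \sum_(j < A.*2.+1.*2) h j.
  rewrite doubleS big_ord_recl addrC; congr (_ + _); first by rewrite /h subr0.
  apply: eq_bigr => i _; rewrite /h /= /bump /= add1n -!natr1; congr (_ ^- 4); ring.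
rewrite sum_even_odd mulrDr addrC /Zs !mulr_sumr; congr (_ + _).
  apply: eq_bigr => i _; rewrite -half /h; congr (_ ^- 4); move: (nat_of_ord i) => {}i.
  by rewrite -natr1 -!mul2n !natrM; field.
apply: eq_bigr => i _; rewrite -half /h; congr (_ ^- 4); move: (nat_of_ord i) => {}i.
by rewrite -!natr1 -!mul2n !natrM; field.
Qed.

Lemma c3_gt0 : 0 < c3.
Proof. by rewrite /c3 divr_gt0 // exprn_gt0 // mulr_gt0 // pi_gt0. Qed.

Lemma frac_bound (k T M c w t u : R) : 0 <= k -> 0 <= T -> T <= M -> 0 < c -> c <= w ->
  0 < t -> t <= u -> k * (T / (u ^+ 2 * w ^+ 4)) <= k * M / c ^+ 4 * t ^- 2.
Proof.
move=> k0 T0 TM c0 cw t0 tu.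
have u0 : 0 < u by exact: lt_le_trans tu.
have w0 : 0 < w by exact: lt_le_trans cw.
have -> : k * M / c ^+ 4 * t ^- 2 = k * (M * (c ^+ 4 * t ^+ 2)^-1).
  by field; rewrite !lt0r_neq0.
apply: ler_wpM2l => //; apply: ler_pM => //.
  by rewrite invr_ge0 mulr_ge0 ?exprn_ge0 // ltW.
rewrite lef_pV2 ?posrE ?mulr_gt0 ?exprn_gt0 // mulrC.
by apply: ler_pM; rewrite ?exprn_ge0 ?ler_pXn2r ?nnegrE // ltW.
Qed.

(** With u = 2 pi i t, write 1 - e^u = - u w, w = 1 + u s, s = 1/2 + u rho, where u^3 rho is the
    third-order Taylor remainder. In Lip t - t^(-4) the terms of order u^(-4) and u^(-3) cancel
    identically, which leaves c3 T / (u^2 w^4) with T bounded; [cexp_sub1_lb] keeps w away from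
    0. *)
Lemma Lip_core (H : R) : 0 <= H -> exists K : R, 0 <= K /\
  forall t, 0 < im t <= H -> `|re t| <= 1 / 2 -> nc (t ^- 4 - Lip t) <= K * nc t ^- 2.
Proof.
move=> H0; have p0 : 0 < pi :> R := pi_gt0 R.
have p4 := pi_le4 R; have p2 := pi_ge2 R.
pose P := 2 * pi * H; pose c := expR (- P) / 3; pose U := P + 4.
have P0 : 0 <= P by rewrite /P !mulr_ge0 // ltW.
have c0 : 0 < c by rewrite /c divr_gt0 // expR_gt0.
have U0 : 0 <= U by rewrite /U addr_ge0.
pose s1 := 1 / 2 + U * 2; pose w1 := 1 + U * s1.
have s10 : 0 <= s1 by rewrite /s1 addr_ge0 ?mulr_ge0 // divr_ge0.
have w10 : 0 <= w1 by rewrite /w1 addr_ge0 ?mulr_ge0.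
pose M := 12 * s1 + 24 * 2 + 36 * s1 ^+ 2 + 24 * (U * s1 ^+ 3) + 6 * (U ^+ 2 * s1 ^+ 4) + 7 * w1 ^+ 2 + U * w1 ^+ 3.
have M0 : 0 <= M by rewrite /M !addr_ge0 // ?mulr_ge0 // ?exprn_ge0.
exists (c3 * M / c ^+ 4); split.
  by rewrite divr_ge0 ?exprn_ge0 ?(ltW c0) // mulr_ge0 // ltW // c3_gt0.
move=> t /andP[t0 tH] rt.
pose u : R[i] := (- (2 * pi * im t)) +i* (2 * pi * re t).
have uE : u = (2 * pi)%:C * 'i * t.
  case: (t) @u => a b /=; apply/eqP; rewrite eq_complex /=; apply/andP; split; apply/eqP; ring.
have pp : 0 <= 2 * pi :> R by rewrite mulr_ge0 // ltW.
have nu : nc u = 2 * pi * nc t.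
  rewrite uE !ncM nc_real ger0_norm //.
  by rewrite [X in _ * X * _](_ : nc _ = 1) ?mulr1 //= expr0n add0r expr1n sqrtr1.
have nt : 0 < nc t.
  by apply: lt_le_trans (Im_le_nc t); rewrite gtr0_norm.
have u0 : u != 0 by rewrite -nc_gt0 nu mulr_gt0 // mulr_gt0.
have un : 0 < nc u by rewrite nc_gt0.
have hre : re u <= 0 by rewrite /u /= oppr_le0 !mulr_ge0 // ltW.
have hP : - P <= re u by rewrite /u /= lerN2 /P ler_wpM2l.
have him : `|im u| <= pi.
  by rewrite /u /= normrM (ger0_norm pp); nra.
have uU : nc u <= U.
  apply: le_trans (nc_le_ReIm u) _; rewrite (ler0_norm hre) /U.
  by apply: lerD; [lra | apply: le_trans him _].
have hsub : c * nc u <= nc (1 - cexp u) by apply: cexp_sub1_lb => //; rewrite hP.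
have htay := cexp_taylor hre.
pose rho := (cexp u - 1 - u - u ^+ 2 / 2) / u ^+ 3.
have hrho : nc rho <= 2.
  by rewrite /rho ncM ncV ncX ler_pdivrMr ?exprn_gt0.
pose s := 1 / 2 + u * rho; pose w := 1 + u * s.
have vE : 1 - cexp u = - (u * w).
  by rewrite /w /s /rho; field; rewrite u0.
have hw : c <= nc w.
  by move: hsub; rewrite vE ncN ncM [nc u * _]mulrC ler_pM2r.
have w0 : w != 0 by rewrite -nc_gt0 (lt_le_trans c0).
pose T := 12 * s - 24 * rho - 36 * s ^+ 2 - 24 * (u * s ^+ 3) - 6 * (u ^+ 2 * s ^+ 4) + 7 * w ^+ 2 + u * w ^+ 3.
have hs : nc s <= s1.
  apply: ncD_ub; last by apply: ncM_ub.
  by rewrite ncM ncV Normc.normc1 nc_nat.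
have hw1 : nc w <= w1.
  by apply: ncD_ub; [rewrite Normc.normc1 | apply: ncM_ub].
have hT : nc T <= M.
  have nn (n : nat) : nc n%:R <= n%:R by rewrite nc_nat.
  rewrite /T /M; apply: ncD_ub; last by apply: ncM_ub => //; apply: ncX_ub.
  apply: ncD_ub; last by apply: ncM_ub => //; apply: ncX_ub.
  apply: ncB_ub; last by apply: ncM_ub => //; apply: ncM_ub; apply: ncX_ub.
  apply: ncB_ub; last by apply: ncM_ub => //; apply: ncM_ub => //; apply: ncX_ub.
  apply: ncB_ub; last by apply: ncM_ub => //; apply: ncX_ub.
  by apply: ncB_ub; apply: ncM_ub.
have tne : t != 0 by rewrite -nc_gt0.
have e4 : t ^- 4 = c3%:C * (6 / u ^+ 4).
  have -> : u ^+ 4 = ((2 * pi) ^+ 4)%:C * t ^+ 4.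
    have -> : ((2 * pi) ^+ 4)%:C = (2 * pi)%:C ^+ 4 :> R[i] by rewrite rmorphXn.
    have i4 : 'i ^+ 4 = 1 :> R[i] by rewrite (exprM _ 2 2) sqr_i sqrrN expr1n.
    by rewrite uE; set a := _%:C; rewrite !exprMn i4 mulr1.
  rewrite /c3 rmorphM /= rmorphV ?unitfE // rmorph_nat.
  have : ((2 * pi) ^+ 4)%:C != 0 :> R[i].
    by rewrite -nc_gt0 nc_real normr_gt0 expf_neq0 // lt0r_neq0 // mulr_gt0.
  set b := _%:C => b0; clearbody b; field; rewrite tne b0 //.
have -> : t ^- 4 - Lip t = - (c3%:C * (T / (u ^+ 2 * w ^+ 4))).
  rewrite e4 /Lip -mulrBr -mulrN; congr (_ * _).
  have -> : ce t = cexp u by [].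
  rewrite /Sq vE /T.
  have : w = 1 + u * (1 / 2 + u * rho) by [].
  move: w0; rewrite /s; move: (w) => W W0 WE.
  have e : 24 * rho * u ^+ 2 = 24 * (W - 1 - u / 2) by rewrite WE; field.
  rewrite (_ : 1 / 2 + u * rho = (W - 1) / u); last by rewrite WE; field; rewrite u0.
  rewrite (_ : rho = (W - 1 - u / 2) / u ^+ 2); last by rewrite WE; field; rewrite u0.
  by field; rewrite u0 W0.
rewrite ncN !ncM nc_real gtr0_norm ?c3_gt0 // ncV ncM !ncX.
have hnu : nc t <= nc u by rewrite nu ler_peMl ?nc_ge0 //; move: p2; clear; lra.
exact: (frac_bound (ltW c3_gt0) (nc_ge0 T) hT c0 hw nt hnu).
Qed.

(** The error that [Lip_core] leaves at the two poles 0 and 1 of the closed unit strip. *)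
Definition wt t : R := nc t ^- 2 + nc (t - 1) ^- 2.

Lemma wt_ge0 t : 0 <= wt t.
Proof. by rewrite addr_ge0 // invr_ge0 sqr_ge0. Qed.

(** Halving multiplies the inverse squares by 4 and introduces the points -1 and 2, which are no
    closer to t than 0 and 1. Against the 16 of the duplication formula, the 8 is a contraction by
    one half. *)
Lemma wt_dup t : 0 < im t -> 0 <= re t <= 1 -> wt (t / 2) + wt ((t + 1) / 2) <= 8 * wt t.
Proof.
move=> t0 /andP[r0 r1]; rewrite /wt.
have n0 z : 0 < im z -> 0 < nc z by move=> h; apply: lt_le_trans (Im_le_nc z); rewrite gtr0_norm.
have i1 (n : nat) : im (t - n%:R) = im t by rewrite cImD cImN cIm_nat oppr0 addr0.
have i1' (n : nat) : im (t + n%:R) = im t by rewrite cImD cIm_nat addr0.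
have inv2 (z : R[i]) : nc (z / 2) ^- 2 = 4 * nc z ^- 2.
  rewrite ncM ncV nc_nat exprMn invfM exprVn invrK -natrX mulrC; ring.
have -> : t / 2 - 1 = (t - 2%:R) / 2 by field.
have -> : (t + 1) / 2 - 1 = (t - 1%:R) / 2 by field.
rewrite !inv2.
have a1 : nc (t - 2%:R) ^- 2 <= nc (t - 1) ^- 2.
  rewrite lef_pV2 ?posrE ?exprn_gt0 ?n0 ?i1 ?(i1 1%N) // !nc_sqr (i1 1%N) i1.
  rewrite lerD2r !cReD !cReN cRe_nat (cRe_nat R 1%N); nra.
have a2 : nc (t + 1) ^- 2 <= nc t ^- 2.
  rewrite lef_pV2 ?posrE ?exprn_gt0 ?n0 ?(i1' 1%N) // !nc_sqr (i1' 1%N).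
  rewrite lerD2r !cReD (cRe_nat R 1%N); nra.
lra.
Qed.

(** [sum_inv_pow_dist] at D = 1/2 gives 48; the 16 is the price of replacing a distance r >= 1/2 by
    half of 1/2 + r in a fourth power. *)
Definition Zfar : R := 16 * 48.

Lemma Zfar_ge0 : 0 <= Zfar. Proof. by rewrite /Zfar mulr_ge0. Qed.

Lemma Zs_far (A : nat) t (j : nat) : (j < A.*2.+1)%N ->
  (forall i : nat, i != j -> 1 / 2 <= nc (t + A%:R - i%:R)) ->
  nc (Zs A t - (t + A%:R - j%:R) ^- 4) <= Zfar.
Proof.
move=> jA hfar; rewrite /Zs (bigD1 (Ordinal jA)) //= [X in X - _]addrC addrK.
apply: le_trans (nc_sum _ _ _) _.
apply: le_trans (_ : \sum_(i < A.*2.+1) 16 * (1 / 2 + `|- (re t + A%:R) + i%:R|) ^- 4 <= _); last first.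
  rewrite /Zfar -mulr_sumr ler_wpM2l //.
  have := @sum_inv_pow_dist R A.*2.+1 2 (1 / 2) (- (re t + A%:R)).
  have h : 0 < 1 / 2 :> R by rewrite divr_gt0.
  move=> /(_ h) /le_trans; apply.
  have -> : 2 * ((1 / 2) ^- 4 + (1 / 2) ^- 3) = 48 :> R by field.
  by [].
rewrite [leRHS](bigID (fun i => i != Ordinal jA)) /= -[leLHS]addr0.
apply: lerD; last first.
  by apply: sumr_ge0 => i _; rewrite mulr_ge0 // invr_ge0 exprn_ge0 // addr_ge0 // divr_ge0.
apply: ler_sum => i ij; rewrite ncXV.
have h1 : 1 / 2 <= nc (t + A%:R - i%:R) by apply: hfar.
have h2 : `|- (re t + A%:R) + i%:R| <= nc (t + A%:R - i%:R).
  apply: le_trans (Re_le_nc _); rewrite cReD cReN cReD !cRe_nat -[leLHS]normrN.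
  by rewrite le_eqVlt; apply/orP; left; apply/eqP; congr (`|_|); ring.
have h3 : (1 / 2 + `|- (re t + A%:R) + i%:R|) / 2 <= nc (t + A%:R - i%:R) by lra.
have h0 : 0 < 1 / 2 + `|- (re t + A%:R) + i%:R| by rewrite ltr_pwDl.
rewrite [leRHS](_ : _ = ((1 / 2 + `|- (re t + A%:R) + i%:R|) / 2) ^- 4); last first.
  rewrite expr_div_n invf_div; congr (_ * _); by rewrite !exprS expr0; ring.
rewrite lef_pV2 ?posrE ?exprn_gt0 ?divr_gt0 //; last by apply: lt_le_trans h1; rewrite divr_gt0.
by rewrite ler_pXn2r // nnegrE ?nc_ge0 // divr_ge0 // ltW.
Qed.

Lemma Zs_base (H : R) : 0 <= H -> exists K : R, 0 <= K /\
  forall (A : nat) t, (0 < A)%N -> 0 < im t <= H -> 0 <= re t <= 1 ->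
    nc (Zs A t - Lip t) <= K * wt t.
Proof.
move=> H0; have [K [K0 hK]] := Lip_core H0.
exists (K + Zfar * (1 + H ^+ 2)); split.
  by rewrite addr_ge0 // mulr_ge0 ?Zfar_ge0 // addr_ge0 // sqr_ge0.
move=> A t A0 /andP[t0 tH] /andP[r0 r1].
have iN (n : nat) : im (t - n%:R) = im t by rewrite cImD cImN cIm_nat oppr0 addr0.
have rN (n : nat) : re (t - n%:R) = re t - n%:R by rewrite cReD cReN cRe_nat.
have nt : 0 < nc t by apply: lt_le_trans (Im_le_nc t); rewrite gtr0_norm.
have nt1 : 0 < nc (t - 1%:R) by apply: lt_le_trans (Im_le_nc _); rewrite iN gtr0_norm.
have w1 : 1 <= (1 + H ^+ 2) * wt t.
  rewrite /wt mulrDr -[leLHS]addr0; apply: lerD; last first.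
    by rewrite mulr_ge0 ?invr_ge0 ?sqr_ge0 // addr_ge0 // sqr_ge0.
  rewrite ler_pdivlMr ?exprn_gt0 // mul1r nc_sqr; apply: lerD.
    by rewrite expr2; nra.
  by rewrite ler_pXn2r // nnegrE // ltW.
have main (a : nat) : (a <= 1)%N -> `|re t - a%:R| <= 1 / 2 ->
    nc (t - a%:R) ^- 2 <= wt t -> nc (Zs A t - Lip t) <= (K + Zfar * (1 + H ^+ 2)) * wt t.
  move=> a1 ha hw.
  have jA : (A + a < A.*2.+1)%N by rewrite -addnn ltnS leq_add2l (leq_trans a1).
  have E : t + A%:R - (A + a)%:R = t - a%:R by rewrite natrD; ring.
  have -> : Zs A t - Lip t = (Zs A t - (t + A%:R - (A + a)%:R) ^- 4) + ((t - a%:R) ^- 4 - Lip (t - a%:R)).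
    by rewrite E -[in RHS](@Lip_addn (t - a%:R) a) subrK; ring.
  rewrite addrC mulrDl; apply: ncD_ub.
    apply: le_trans (hK _ _ _) _; first by rewrite iN t0.
      by rewrite rN.
    by rewrite ler_wpM2l.
  apply: le_trans (Zs_far jA _) _; last first.
    by rewrite -mulrA -[leLHS]mulr1 ler_wpM2l ?Zfar_ge0.
  move=> i ij; apply: le_trans (Re_le_nc _); rewrite cReD cReN cReD !cRe_nat.
  have [ia|ia] := ltnP i (A + a).
    have : i%:R + 1 <= A%:R + a%:R :> R by rewrite natr1 -natrD ler_nat.
    move=> h; rewrite ler_normr; apply/orP; left.
    by move: ha; rewrite ler_norml => /andP[h1 h2]; lra.
  have : A%:R + a%:R + 1 <= i%:R :> R.
    by rewrite -natrD natr1 ler_nat ltn_neqAle eq_sym ij ia.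
  move=> h; rewrite ler_normr; apply/orP; right.
  by move: ha; rewrite ler_norml => /andP[h1 h2]; lra.
have [h|h] := leP (re t) (1 / 2).
  apply: (main 0%N) => //; rewrite subr0.
    by rewrite ger0_norm.
  by rewrite /wt lerDl invr_ge0 sqr_ge0.
apply: (main 1%N) => //.
  by rewrite ler_norml; apply/andP; split; lra.
by rewrite /wt lerDr invr_ge0 sqr_ge0.
Qed.

(* Herglotz's trick: [Zs] and [Lip] satisfy the same duplication formula (up to one boundary
   term), which halves the error measured by the weight [wt]. *)
Lemma Zs_cvg_strip (H : R) : 0 <= H -> exists K : R, 0 <= K /\
  forall (m : nat) t, 0 < im t <= H -> 0 <= re t <= 1 ->
    nc (Zs (2 ^ m) t - Lip t) <= K * (3 / 4) ^+ m * wt t.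
Proof.
move=> H0; have [K [K0 hK]] := Zs_base H0.
exists (K + 4 * (1 + H ^+ 2)); split.
  by rewrite addr_ge0 // mulr_ge0 // addr_ge0 // sqr_ge0.
elim=> [|m IH] t /andP[t0 tH] /andP[r0 r1].
  rewrite expn0 expr0 mulr1; apply: le_trans (hK 1%N t _ _ _) _; rewrite ?t0 ?r0 //.
  by rewrite ler_wpM2r ?wt_ge0 // lerDl mulr_ge0 // addr_ge0 // sqr_ge0.
set K1 := K + _ in IH *.
have K10 : 0 <= K1 by rewrite /K1 addr_ge0 // mulr_ge0 // addr_ge0 // sqr_ge0.
have b1 : nc (Zs (2 ^ m) (t / 2) - Lip (t / 2)) <= K1 * (3 / 4) ^+ m * wt (t / 2).
  apply: IH; rewrite ?im_half ?re_half; apply/andP; split; lra.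
have b2 : nc (Zs (2 ^ m) ((t + 1) / 2) - Lip ((t + 1) / 2)) <= K1 * (3 / 4) ^+ m * wt ((t + 1) / 2).
  apply: IH; rewrite ?im_half ?re_half ?cImD ?cReD (cRe_nat R 1%N, cIm_nat R 1%N); apply/andP; split; lra.
have w1 : 1 <= (1 + H ^+ 2) * wt t.
  have nt : 0 < nc t by apply: lt_le_trans (Im_le_nc t); rewrite gtr0_norm.
  rewrite /wt mulrDr -[leLHS]addr0; apply: lerD; last first.
    by rewrite mulr_ge0 ?invr_ge0 ?sqr_ge0 // addr_ge0 // sqr_ge0.
  rewrite ler_pdivlMr ?exprn_gt0 // mul1r nc_sqr; apply: lerD.
    by rewrite expr2; nra.
  by rewrite ler_pXn2r // nnegrE // ltW.
have E : Zs (2 ^ m.+1) t - Lip t =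
  ((Zs (2 ^ m) (t / 2) - Lip (t / 2)) + (Zs (2 ^ m) ((t + 1) / 2) - Lip ((t + 1) / 2))) / 16
    - (t + (2 ^ m).*2.+1%:R) ^- 4.
  have h1 := Zs_dup (2 ^ m) t; have h2 := Lip_dup t0.
  have n16 : 16 != 0 :> R[i] by rewrite pnatr_eq0.
  rewrite expnS mul2n; apply: (mulfI n16).
  rewrite mulrBr -h2 mulrBr [16 * (_ / 16)]mulrC divfK //.
  have -> : 16 * Zs (2 ^ m).*2 t = 16 * (Zs (2 ^ m).*2 t + (t + (2 ^ m).*2.+1%:R) ^- 4) - 16 * (t + (2 ^ m).*2.+1%:R) ^- 4 by ring.
  rewrite -h1; ring.
have c : nc ((t + (2 ^ m).*2.+1%:R) ^- 4) <= (1 / 2) ^+ m.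
  rewrite ncXV; have h : (2 ^+ m : R) <= nc (t + (2 ^ m).*2.+1%:R).
    apply: le_trans (Re_le_nc _); rewrite cReD cRe_nat ger0_norm ?addr_ge0 ?ler0n //.
    apply: le_trans (_ : (2 ^ m).*2.+1%:R <= _); last by rewrite lerDr.
    by rewrite -natrX ler_nat -addnn -addnS leq_addr.
  have p2 : 1 <= 2 ^+ m :> R by rewrite exprn_ege1 // ler1n.
  have h1 := le_trans p2 h.
  rewrite expr_div_n expr1n mul1r lef_pV2 ?posrE ?exprn_gt0 //; last exact: lt_le_trans h1.
  by apply: le_trans h _; rewrite ler_eXnr.
rewrite E; apply: le_trans (ncB_le _ _) _.
apply: le_trans (lerD _ c) (_ : (K1 * (3 / 4) ^+ m * (8 * wt t)) / 16 + (1 / 2) ^+ m <= _).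
  rewrite ncM ncV nc_nat ler_pM2r ?invr_gt0 //.
  apply: le_trans (ncD_ub b1 b2) _; rewrite -mulrDr ler_wpM2l ?mulr_ge0 ?exprn_ge0 //.
  by apply: wt_dup => //; rewrite r0.
(* The contraction alone would give the rate 1/2. The rate 3/4 leaves a quarter of the bound for the
   boundary term, of size at most (1/2)^m. *)
have c2 : (1 / 2) ^+ m <= (3 / 4) ^+ m * ((K1 / 4) * wt t).
  rewrite -[leLHS]mulr1; apply: ler_pM => //.
    by apply: lerXn2r; rewrite ?nnegrE ?divr_ge0 //; lra.
  apply: le_trans w1 _; rewrite ler_wpM2r ?wt_ge0 // /K1; lra.
rewrite exprS; set a := (3 / 4) ^+ m in c2 *; set b := wt t in c2 *; lra.
Qed.

Lemma le_of_geom (x B K : R) (m0 : nat) : 0 <= K ->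
  (forall m, (m0 <= m)%N -> x <= B + K * (3 / 4) ^+ m) -> x <= B.
Proof.
move=> K0 h; rewrite leNgt; apply/negP => Bx.
have d0 : 0 < x - B by rewrite subr_gt0.
have g (m : nat) : (3 / 4) ^+ m * (m%:R + 3) <= 3 :> R.
  elim: m => [|m IH]; first by rewrite expr0; lra.
  have p : 0 <= (3 / 4) ^+ m :> R by rewrite exprn_ge0 // divr_ge0.
  rewrite exprS -[m.+1%:R]natr1; have : 0 <= m%:R :> R by rewrite ler0n.
  move: IH; set q := (3 / 4) ^+ m in p *; set y : R := m%:R; nra.
have [k hk] : exists k : nat, 3 * K / (x - B) < k%:R.
  exists (Num.truncn (3 * K / (x - B))).+1.
  have : (Num.truncn (3 * K / (x - B)))%:R <= 3 * K / (x - B) < (Num.truncn (3 * K / (x - B))).+1%:R.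
    by apply: truncn_itv; rewrite divr_ge0 ?mulr_ge0 // ltW.
  by case/andP.
have := h (m0 + k)%N (leq_addr _ _); have := g (m0 + k)%N.
rewrite natrD; have : 0 <= m0%:R :> R by rewrite ler0n.
have k0 : 0 <= k%:R :> R by rewrite ler0n.
have q0 : 0 <= (3 / 4) ^+ (m0 + k) :> R by rewrite exprn_ge0 // divr_ge0.
move: hk; rewrite ltr_pdivrMr //; set q := (3 / 4) ^+ _ in q0 *.
move=> hk m00 hq hx.
have : (x - B) * (m0%:R + k%:R + 3) <= 3 * K.
  apply: le_trans (_ : (K * q) * (m0%:R + k%:R + 3) <= _).
    rewrite ler_wpM2r //; lra.
  have := ler_wpM2l K0 hq; lra.
nra.
Qed.

(** The truncated form in which Lipschitz's formula is applied: the kept set P is arbitrary as long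
    as the other nonnegative integers are at distance D0 from t; the negative ones are, since Re t
    >= 0 and D0 <= |t|. The proof translates t into the unit strip and lets m grow in [Zs (2 ^ m)],
    the limit being taken by [le_of_geom]. *)
Lemma Lip_tail t (P : pred nat) (n : nat) (D0 : R) :
  0 < im t -> 0 <= re t -> 0 < D0 -> D0 <= nc t ->
  (forall a : nat, P a -> (a < n)%N) ->
  (forall a : nat, ~~ P a -> D0 <= nc (t - a%:R)) ->
  nc (Lip t - \sum_(a < n | P a) (t - a%:R) ^- 4) <= 32 * (D0 ^- 4 + D0 ^- 3).
Proof.
move=> t0 r0 D00 Dt Pn Pfar.
have [n0 /andP[hn1 hn2]] : exists n0 : nat, n0%:R <= re t < n0.+1%:R.
  by exists (Num.truncn (re t)); apply: truncn_itv.
pose t' := t - n0%:R.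
have im' : im t' = im t by rewrite /t' cImD cImN cIm_nat oppr0 addr0.
have re' : re t' = re t - n0%:R by rewrite /t' cReD cReN cRe_nat.
have [K [K0 hK]] := Zs_cvg_strip (ltW t0).
have LipE : Lip t = Lip t' by rewrite -(@Lip_addn t' n0) subrK.
apply: (@le_of_geom _ _ (K * wt t') (n0 + n)%N); first by rewrite mulr_ge0 ?wt_ge0.
move=> m hm; pose A := (2 ^ m)%N.
have Am : (m < A)%N by apply: ltn_expl.
have hA : (n0 + n <= A)%N by apply: leq_trans hm (ltnW Am).
have nA : (n0 <= A)%N by apply: leq_trans hA; rewrite leq_addr.
have [B [BE BA nB]] : exists B : nat, [/\ B%:R = A%:R - n0%:R :> R[i],
    (B <= A.*2.+1)%N & (n <= A.*2.+1 - B)%N].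
  by exists (A - n0)%N; rewrite natrB //; split => //; rewrite -addnn; lia.
have ZE : Zs A t' = \sum_(0 <= i < A.*2.+1) (t + B%:R - i%:R) ^- 4.
  by rewrite big_mkord; apply: eq_bigr => i _; rewrite BE /t'; congr (_ ^- 4); ring.
pose Q i := (B <= i)%N && P (i - B)%N.
have QE : \sum_(0 <= i < A.*2.+1 | Q i) (t + B%:R - i%:R) ^- 4 = \sum_(a < n | P a) (t - a%:R) ^- 4.
  rewrite (big_cat_nat _ (n := B)) //= big1_seq ?add0r; last first.
    by move=> i; rewrite /Q mem_index_iota => /andP[/andP[h _] /andP[_ h']]; lia.
  rewrite -{1}[B]add0n big_addn (big_cat_nat _ (n := n)) //= [X in _ + X]big1_seq ?addr0; last first.
    by move=> i; rewrite /Q addnK mem_index_iota => /andP[/andP[_ /Pn h] /andP[h' _]]; lia.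
  rewrite big_mkord; apply: eq_big => [a|a _]; first by rewrite /Q leq_addl addnK.
  by rewrite natrD; congr (_ ^- 4); ring.
have split : Zs A t' = \sum_(a < n | P a) (t - a%:R) ^- 4 +
    \sum_(0 <= i < A.*2.+1 | ~~ Q i) (t + B%:R - i%:R) ^- 4.
  by rewrite ZE (bigID Q) /= QE.
have -> : Lip t - \sum_(a < n | P a) (t - a%:R) ^- 4 =
  \sum_(0 <= i < A.*2.+1 | ~~ Q i) (t + B%:R - i%:R) ^- 4 - (Zs A t' - Lip t').
  by rewrite split LipE; ring.
apply: le_trans (ncB_le _ _) _; apply: lerD; last first.
  rewrite mulrAC; apply: hK; first by rewrite im' t0 lexx.
  by rewrite re' subr_ge0 hn1 /=; move: hn2; rewrite -natr1; lra.
apply: le_trans (nc_sum _ _ _) _.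
apply: le_trans (_ : \sum_(0 <= i < A.*2.+1) 16 * (D0 + `|- (re t + B%:R) + i%:R|) ^- 4 <= _); last first.
  rewrite -mulr_sumr big_mkord; have := @sum_inv_pow_dist R A.*2.+1 2 D0 (- (re t + B%:R)) D00.
  lra.
rewrite [leRHS](bigID Q) /= addrC -[leLHS]addr0; apply: lerD; last first.
  by apply: sumr_ge0 => i _; rewrite mulr_ge0 // invr_ge0 exprn_ge0 // addr_ge0 // ltW.
apply: ler_sum => i iQ; rewrite ncXV.
have h1 : D0 <= nc (t + B%:R - i%:R).
  have [Bi|iB] := leqP B i.
    have -> : t + B%:R - i%:R = t - (i - B)%:R by rewrite natrB //; ring.
    by apply: Pfar; move: iQ; rewrite /Q Bi.
  apply: le_trans Dt _.
  have -> : t + B%:R - i%:R = t + (B - i)%:R by rewrite natrB 1?ltnW //; ring.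
  rewrite -(@ler_pXn2r _ 2) ?nnegrE ?nc_ge0 // !nc_sqr cReD cImD cRe_nat cIm_nat addr0 lerD2r.
  have : 0 <= (B - i)%:R :> R by rewrite ler0n.
  nra.
have h2 : `|- (re t + B%:R) + i%:R| <= nc (t + B%:R - i%:R).
  apply: le_trans (Re_le_nc _); rewrite cReD cReN cReD !cRe_nat -[leLHS]normrN.
  by rewrite le_eqVlt; apply/orP; left; apply/eqP; congr (`|_|); ring.
have h3 : (D0 + `|- (re t + B%:R) + i%:R|) / 2 <= nc (t + B%:R - i%:R) by lra.
have h0 : 0 < D0 + `|- (re t + B%:R) + i%:R| by rewrite ltr_pwDl.
rewrite [leRHS](_ : _ = ((D0 + `|- (re t + B%:R) + i%:R|) / 2) ^- 4); last first.
  rewrite expr_div_n invf_div; congr (_ * _); by rewrite !exprS expr0; ring.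
rewrite lef_pV2 ?posrE ?exprn_gt0 ?divr_gt0 //; last exact: lt_le_trans h1.
by rewrite ler_pXn2r // nnegrE ?nc_ge0 // divr_ge0 // ltW.
Qed.

Lemma Lip_ub t : 0 < im t -> 0 <= re t ->
  nc (Lip t) <= 32 * ((im t) ^- 4 + (im t) ^- 3).
Proof.
move=> t0 r0; have := @Lip_tail t pred0 0 (im t) t0 r0 t0.
rewrite big_ord0 subr0; apply => // [|a _].
  by apply: le_trans (Im_le_nc t); rewrite ler_norm.
by apply: le_trans (Im_le_nc _); rewrite cImD cImN cIm_nat oppr0 addr0 ler_norm.
Qed.

End Lipschitz.

(** * Divisor sums against the kernel (W - n)^-4 *)

Section InnerSum.
Variable R : realType.
Local Notation nc := (@Normc.normc R).
Local Notation re := (@complex.Re R).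
Local Notation im := (@complex.Im R).
Local Open Scope complex_scope.

Lemma abel_sum (a : nat -> R) (f : nat -> R[i]) (N : nat) : (0 < N)%N ->
  \sum_(1 <= n < N.+1) (a n - a n.-1)%:C * f n =
  (a N)%:C * f N - (a 0)%:C * f 1 - \sum_(1 <= n < N) (a n)%:C * (f n.+1 - f n).
Proof.
case: N => // N _; elim: N => [|N IH].
  by rewrite big_nat1 big_geq // subr0 rmorphB mulrBl.
rewrite big_nat_recr //= IH [in RHS]big_nat_recr //= rmorphB; ring.
Qed.

Definition main_term (n : nat) : R := n%:R * ln n%:R + (2 * euler_gamma R - 1) * n%:R.

Lemma Delta_nat (n : nat) :
  Delta (n%:R : R) = \sum_(1 <= m < n.+1) (numdiv m)%:R - main_term n.
Proof. by rewrite /Delta /main_term natrK. Qed.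

Lemma numdiv_Delta (n : nat) : (0 < n)%N ->
  (numdiv n)%:R = (Delta (n%:R : R) - Delta (n.-1%:R : R)) + (main_term n - main_term n.-1) :> R.
Proof. by case: n => // n _; rewrite !Delta_nat big_nat_recr //=; ring. Qed.

Definition gam : R := `|2 * euler_gamma R - 1|.

Lemma numdiv_le n : (0 < n)%N -> (numdiv n <= n)%N.
Proof.
move=> n0; rewrite /numdiv -[X in (_ <= X)%N](size_iota 1 n).
apply: uniq_leq_size; first exact: divisors_uniq.
move=> d; rewrite -dvdn_divisors // mem_iota => dn.
by rewrite (dvdn_gt0 n0 dn) add1n ltnS dvdn_leq.
Qed.

(** For n well below x^2 nothing is assumed on Delta, and the kernel is small enough there for this
    trivial bound. *)
Lemma Delta_crude (n : nat) : `|Delta (n%:R : R)| <= (2 + gam) * n%:R ^+ 2.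
Proof.
have [->|n0] := posnP n.
  by rewrite Delta_nat /main_term big_geq // !mul0r !mulr0 addr0 subr0 normr0 expr0n mulr0.
have n1 : 1 <= n%:R :> R by rewrite ler1n.
rewrite Delta_nat; apply: le_trans (ler_normB _ _) _.
have h1 : `|\sum_(1 <= m < n.+1) (numdiv m)%:R| <= n%:R ^+ 2 :> R.
  rewrite ger0_norm ?sumr_ge0 //.
  apply: le_trans (_ : \sum_(1 <= m < n.+1) n%:R <= _).
    rewrite big_nat [leRHS]big_nat; apply: ler_sum => m /andP[m0 mn].
    by rewrite ler_nat (leq_trans (numdiv_le m0)).
  by rewrite sumr_const_nat subn1 /= -[n%:R *+ n]mulr_natr expr2.
have h2 : `|main_term n| <= (1 + gam) * n%:R ^+ 2.
  rewrite /main_term; apply: le_trans (ler_normD _ _) _; rewrite [leRHS]mulrDl mul1r; apply: lerD.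
    rewrite ger0_norm ?mulr_ge0 ?ln_ge0 // expr2 ler_wpM2l //.
    by rewrite ltW // ln_sublinear // ltr0n.
  rewrite normrM -/gam ger0_norm // ler_wpM2l // ?normr_ge0 //.
  by rewrite expr2 ler_peMl.
lra.
Qed.

Definition mdiff (n : nat) : R := main_term n - main_term n.-1.

Lemma mdiff_bound (n : nat) : (0 < n)%N -> `|mdiff n| <= gam + 1 + ln n%:R.
Proof.
case: n => // n _; rewrite /mdiff /main_term /=.
have -> : n.+1%:R * ln n.+1%:R + (2 * euler_gamma R - 1) * n.+1%:R -
   (n%:R * ln n%:R + (2 * euler_gamma R - 1) * n%:R) =
   (2 * euler_gamma R - 1) + (n%:R * (ln n.+1%:R - ln n%:R) + ln n.+1%:R) :> R.
  by set b := ln n.+1%:R; rewrite -[n.+1%:R]natr1; ring.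
apply: le_trans (ler_normD _ _) _; rewrite -/gam -addrA lerD2l.
have l0 : 0 <= ln n.+1%:R :> R by rewrite ln_ge0 // ler1n.
have d0 : 0 <= (n%:R : R) * (ln n.+1%:R - ln n%:R) <= 1.
  have [->|n0] := posnP n; first by rewrite mul0r lexx ler01.
  have nR : 0 < n%:R :> R by rewrite ltr0n.
  rewrite mulr_ge0 ?subr_ge0 ?ler_ln ?posrE ?ltr0n ?ler_nat //=.
  rewrite -ln_div ?posrE ?ltr0n // -natr1 mulrDl divff ?lt0r_neq0 // mul1r.
  rewrite -[leRHS](divff (lt0r_neq0 nR)) ler_pM2l //.
  by apply: le_ln1Dx; rewrite (lt_le_trans (ltrN10 _)) // invr_ge0 ltW.
case/andP: d0 => d0 d1; rewrite ger0_norm ?addr_ge0 //; lra.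
Qed.

Lemma mdiff_diff (n : nat) : (0 < n)%N -> `|mdiff n.+1 - mdiff n| <= 2 / n%:R.
Proof.
case: n => // n _; rewrite /mdiff /main_term /=.
set c := 2 * euler_gamma R - 1.
have nR : 0 < n.+1%:R :> R by rewrite ltr0n.
have l1 : ln n.+2%:R - ln n.+1%:R <= n.+1%:R^-1 :> R.
  rewrite -ln_div ?posrE ?ltr0n // -[n.+2%:R]natr1 mulrDl divff ?lt0r_neq0 // mul1r.
  by apply: le_ln1Dx; rewrite (lt_le_trans (ltrN10 _)) // invr_ge0 ltW.
have l1' : (n.+2%:R)^-1 <= ln n.+2%:R - ln n.+1%:R :> R.
  rewrite -opprB -lerN2 opprK -ln_div ?posrE ?ltr0n //.
  have -> : n.+1%:R / n.+2%:R = 1 + (- n.+2%:R^-1) :> R.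
    by rewrite -[n.+2%:R]natr1; set y : R := n.+1%:R in nR *; clearbody y; field; apply/eqP; lra.
  by apply: le_ln1Dx; rewrite ltrN2 invf_lt1 ?ltr0n // ltr1n.
have [->|n0] := posnP n.
  have -> : 2 * ln 2 + c * 2 - (1 * ln 1 + c * 1) - (1 * ln 1 + c * 1 - (0 * ln 0 + c * 0)) = 2 * ln 2 :> R.
    by rewrite ln1; ring.
  rewrite divr1.
  have := ln2_le1 R; have : 0 <= ln 2 :> R by rewrite ln_ge0 // ler1n.
  move=> h1 h2; rewrite ger0_norm; lra.
have nR0 : 0 < n%:R :> R by rewrite ltr0n.
have l2 : ln n.+1%:R - ln n%:R <= n%:R^-1 :> R.
  rewrite -ln_div ?posrE ?ltr0n // -[n.+1%:R]natr1 mulrDl divff ?lt0r_neq0 // mul1r.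
  by apply: le_ln1Dx; rewrite (lt_le_trans (ltrN10 _)) // invr_ge0 ltW.
have l2' : (n.+1%:R)^-1 <= ln n.+1%:R - ln n%:R :> R.
  rewrite -opprB -lerN2 opprK -ln_div ?posrE ?ltr0n //.
  have -> : n%:R / n.+1%:R = 1 + (- n.+1%:R^-1) :> R.
    by rewrite -natr1; field; rewrite natr1 lt0r_neq0.
  by apply: le_ln1Dx; rewrite ltrN2 invf_lt1 // ltr1n.
move: l1 l1' l2 l2'; rewrite -[n.+2%:R]natr1.
have e1 : n.+1%:R = n%:R + 1 :> R by rewrite natr1.
set a := ln n%:R; set b := ln n.+1%:R; set d := ln (n.+1%:R + 1).
rewrite e1 in nR *; set y : R := n%:R in nR nR0 *.
move=> l1 l1' l2 l2'.
have -> : (y + 1 + 1) * d + c * (y + 1 + 1) - ((y + 1) * b + c * (y + 1)) -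
   ((y + 1) * b + c * (y + 1) - (y * a + c * y)) =
   (y + 1) * (d - b) + d - b - (y * (b - a)) by ring.
have m1 : (y + 1) * (d - b) <= 1.
  by rewrite -[leRHS](divff (lt0r_neq0 nR)) ler_pM2l.
have m2 : y * (b - a) <= 1.
  by rewrite -[leRHS](divff (lt0r_neq0 nR0)) ler_pM2l.
have m3 : 1 - (y + 1)^-1 <= y * (b - a).
  apply: le_trans (_ : y * (y + 1)^-1 <= _); last by rewrite ler_pM2l.
  by rewrite le_eqVlt; apply/orP; left; apply/eqP; field; rewrite lt0r_neq0.
have m4 : 1 - (y + 1 + 1)^-1 <= (y + 1) * (d - b).
  apply: le_trans (_ : (y + 1) * (y + 1 + 1)^-1 <= _); last by rewrite ler_pM2l.
  by rewrite le_eqVlt; apply/orP; left; apply/eqP; field; apply/eqP; lra.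
have i0 : 0 <= (y + 1)^-1 by rewrite invr_ge0 ltW.
have m5 : (y + 1 + 1)^-1 <= (y + 1)^-1 by rewrite lef_pV2 ?posrE //; lra.
have m6 : 0 <= (y + 1 + 1)^-1 by rewrite invr_ge0; lra.
rewrite -[2 / _]/(2 * (y + 1)^-1) ler_norml; apply/andP; split; lra.
Qed.

Lemma sub1_half (u : R[i]) : 2 <= nc u -> nc u / 2 <= nc (u - 1).
Proof.
move=> h; apply: le_trans (nc_leB _ _); rewrite Normc.normc1; lra.
Qed.

Lemma kernel_diff (u : R[i]) : 2 <= nc u ->
  nc ((u - 1) ^- 4 - u ^- 4) <= 144 * nc u ^- 5.
Proof.
move=> h; have h2 := sub1_half h.
have n0 : 0 < nc u by lra.
have n1 : 0 < nc (u - 1) by lra.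
have u0 : u != 0 by rewrite -nc_gt0.
have u1 : u - 1 != 0 by rewrite -nc_gt0.
have -> : (u - 1) ^- 4 - u ^- 4 = (4 * u ^+ 3 - 6 * u ^+ 2 + 4 * u - 1) / (u ^+ 4 * (u - 1) ^+ 4).
  by field; rewrite u1 u0.
set r := nc u in h h2 n0 *.
have num : nc (4 * u ^+ 3 - 6 * u ^+ 2 + 4 * u - 1) <= 9 * r ^+ 3.
  have nn (n : nat) : nc n%:R <= n%:R by rewrite nc_nat.
  apply: le_trans (_ : 4 * r ^+ 3 + 6 * r ^+ 2 + 4 * r + 1 <= _); last first.
    by rewrite !exprS expr0; nra.
  apply: ncB_ub; last by rewrite Normc.normc1.
  apply: ncD_ub; last by apply: ncM_ub.
  by apply: ncB_ub; apply: ncM_ub => //; rewrite ncX.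
rewrite ncM ncV ncM !ncX -/r.
apply: le_trans (_ : 9 * r ^+ 3 * (r ^+ 4 * (r / 2) ^+ 4)^-1 <= _); last first.
  by rewrite le_eqVlt; apply/orP; left; apply/eqP; field; rewrite lt0r_neq0.
apply: ler_pM => //; rewrite ?nc_ge0 ?invr_ge0 ?mulr_ge0 ?exprn_ge0 ?nc_ge0 ?(ltW n0) //.
rewrite lef_pV2 ?posrE; last 2 first.
- by rewrite mulr_gt0 ?exprn_gt0.
- by rewrite mulr_gt0 ?exprn_gt0 // divr_gt0.
rewrite ler_pM2l ?exprn_gt0 //; apply: lerXn2r => //; rewrite nnegrE; lra.
Qed.

Lemma kernel_antideriv (u : R[i]) : 2 <= nc u ->
  nc (((u - 1) ^- 3 - u ^- 3) / 3 - u ^- 4) <= 32 * nc u ^- 5.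
Proof.
move=> h; have h2 := sub1_half h.
have n0 : 0 < nc u by lra.
have n1 : 0 < nc (u - 1) by lra.
have u0 : u != 0 by rewrite -nc_gt0.
have u1 : u - 1 != 0 by rewrite -nc_gt0.
have -> : ((u - 1) ^- 3 - u ^- 3) / 3 - u ^- 4 = (6 * u ^+ 2 - 8 * u + 3) / (3 * (u ^+ 4 * (u - 1) ^+ 3)).
  by field; rewrite u1 u0.
set r := nc u in h h2 n0 *.
have nn (n : nat) : nc n%:R <= n%:R by rewrite nc_nat.
have num : nc (6 * u ^+ 2 - 8 * u + 3) <= 12 * r ^+ 2.
  apply: le_trans (_ : 6 * r ^+ 2 + 8 * r + 3 <= _).
    apply: ncD_ub => //; apply: ncB_ub; apply: ncM_ub => //; rewrite ncX //.
  by rewrite expr2; nra.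
rewrite ncM ncV ncM nc_nat ncM !ncX -/r.
apply: le_trans (_ : 12 * r ^+ 2 * (3 * (r ^+ 4 * (r / 2) ^+ 3))^-1 <= _); last first.
  by rewrite le_eqVlt; apply/orP; left; apply/eqP; field; rewrite lt0r_neq0.
apply: ler_pM => //; rewrite ?nc_ge0 ?invr_ge0 ?mulr_ge0 ?exprn_ge0 ?nc_ge0 ?(ltW n0) //.
rewrite lef_pV2 ?posrE; last 2 first.
- by rewrite !mulr_gt0 ?exprn_gt0.
- by rewrite !mulr_gt0 ?exprn_gt0 // divr_gt0.
rewrite ler_pM2l // ler_pM2l ?exprn_gt0 //; apply: lerXn2r => //; rewrite nnegrE; lra.
Qed.

Lemma sum_kernel_pow (W : R[i]) (N k : nat) : 0 < im W ->
  \sum_(1 <= n < N) nc (W - n%:R) ^- k.+2 <= 2 ^+ k.+3 * ((im W) ^- k.+2 + (im W) ^- k.+1).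
Proof.
move=> Y0; set Y := im W in Y0 *.
apply: le_trans (_ : \sum_(0 <= n < N) 2 ^+ k.+2 * (Y + `|- re W + n%:R|) ^- k.+2 <= _); last first.
  rewrite -mulr_sumr big_mkord [2 ^+ k.+3]exprSr -mulrA ler_wpM2l ?exprn_ge0 //.
  exact: sum_inv_pow_dist.
have pos (n : nat) : 0 < Y + `|- re W + n%:R| by rewrite ltr_pwDl.
case: N => [|N]; first by rewrite !big_geq.
rewrite [leRHS]big_ltn // -[leLHS]add0r; apply: lerD.
  by rewrite mulr_ge0 ?exprn_ge0 // invr_ge0 exprn_ge0 // ltW.
apply: ler_sum => n _.
have h1 : Y <= nc (W - n%:R).
  by apply: le_trans (Im_le_nc _); rewrite cImD cImN cIm_nat oppr0 addr0 ler_norm.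
have h2 : `|- re W + n%:R| <= nc (W - n%:R).
  apply: le_trans (Re_le_nc _); rewrite cReD cReN cRe_nat -[leLHS]normrN.
  by rewrite le_eqVlt; apply/orP; left; apply/eqP; congr (`|_|); ring.
have h3 : (Y + `|- re W + n%:R|) / 2 <= nc (W - n%:R) by lra.
rewrite [leRHS](_ : _ = ((Y + `|- re W + n%:R|) / 2) ^- k.+2); last first.
  by rewrite expr_div_n invf_div.
rewrite lef_pV2 ?posrE ?exprn_gt0 ?divr_gt0 //; last exact: lt_le_trans h1.
by apply: lerXn2r => //; rewrite nnegrE ?nc_ge0 // divr_ge0 // ltW.
Qed.

Lemma abel_sum_shift (a : nat -> R) (f : nat -> R[i]) (N : nat) :
  \sum_(1 <= n < N.+1) (a n)%:C * (f n.+1 - f n) =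
  (a N.+1)%:C * f N.+1 - (a 1)%:C * f 1 - \sum_(1 <= n < N.+1) (a n.+1 - a n)%:C * f n.+1.
Proof.
elim: N => [|N IH]; first by rewrite !big_geq // subr0 subrr.
rewrite big_nat_recr //= IH [in RHS]big_nat_recr //= rmorphB; ring.
Qed.

(** Used with one bound near W and another one far from it: each term is majorised by the sum of the
    two, so the range need not be split. *)
Lemma sum_mix (F G : nat -> R) (a b : R) (N : nat) : 0 <= b ->
  (forall n, (0 < n < N)%N -> F n <= a * G n + b) ->
  \sum_(1 <= n < N) F n <= a * \sum_(1 <= n < N) G n + b * N%:R.
Proof.
move=> b0 h; apply: le_trans (_ : \sum_(1 <= n < N) (a * G n + b) <= _).
  by rewrite big_nat [leRHS]big_nat; apply: ler_sum => n hn; apply: h.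
rewrite big_split /= -mulr_sumr lerD2l sumr_const_nat -[b *+ _]mulr_natr ler_wpM2l //.
by rewrite ler_nat leq_subr.
Qed.

Definition Cdelta : R := 1 + 144 * 128 + 576 * 128 * 1024.
Definition Csmooth : R := 32 * 128 + (8 * 1024 + 512) * 1024.

Lemma Cdelta_gt0 : 0 < Cdelta. Proof. by rewrite /Cdelta; lra. Qed.
Lemma Csmooth_gt0 : 0 < Csmooth. Proof. by rewrite /Csmooth; lra. Qed.

(** * Partial summation against the kernel at scale q *)

Section Kernel.
Variables (q : R) (N : nat) (W : R[i]).
Hypothesis q1 : 2 <= q.
Hypothesis Nq : N%:R = 128 * q :> R.
Hypothesis reW : 4 * q <= re W <= 16 * q.
Hypothesis Y2 : 2 <= im W.
Hypothesis Yq : im W ^+ 2 <= 32 * q.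
Local Notation Y := (im W).

Lemma ker_ge_im n : Y <= nc (W - n%:R).
Proof. by apply: le_trans (Im_le_nc _); rewrite cImD cImN cIm_nat oppr0 addr0 ler_norm. Qed.

Lemma ker_ge_near n : n%:R <= 3 * q -> q <= nc (W - n%:R).
Proof.
move=> h; apply: le_trans (Re_le_nc _); rewrite cReD cReN cRe_nat.
apply: le_trans (ler_norm _); case/andP: reW => ? _; lra.
Qed.

Let q0 : 0 < q. Proof. exact: lt_le_trans q1. Qed.
Let Y0 : 0 < Y. Proof. exact: lt_le_trans Y2. Qed.
Let Z := Y ^- 4.
Let Z0 : 0 < Z. Proof. by rewrite /Z invr_gt0 exprn_gt0. Qed.

Lemma ker_q2 : q ^- 2 <= 1024 * Z.
Proof.
have [k hk] : exists k : R, k = 1024 by exists 1024.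
rewrite /Z -hk; have k0 : 0 < k by lra.
rewrite -ler_pdivrMl // -invfM lef_pV2 ?posrE ?mulr_gt0 ?exprn_gt0 // hk.
have -> : Y ^+ 4 = Y ^+ 2 * Y ^+ 2 by rewrite -exprD.
have : Y ^+ 2 * Y ^+ 2 <= (32 * q) * (32 * q) by apply: ler_pM; rewrite ?exprn_ge0 // ltW.
by rewrite expr2 => h; lra.
Qed.

Lemma ker_qY : q^-1 * Y ^- 2 <= 32 * Z.
Proof.
have -> : Z = Y ^- 2 * Y ^- 2 by rewrite /Z -invfM -exprD.
rewrite mulrA ler_wpM2r ?invr_ge0 ?exprn_ge0 ?(ltW Y0) //.
rewrite -ler_pdivrMl // -invfM lef_pV2 ?posrE ?mulr_gt0 ?exprn_gt0 //.
Qed.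

Lemma ker_sum (k : nat) : \sum_(1 <= n < N.+2) nc (W - n%:R) ^- k.+2 <= 2 ^+ k.+4 * Y ^- k.+1.
Proof.
apply: le_trans (sum_kernel_pow _ _ Y0) _.
rewrite [2 ^+ k.+4]exprSr -mulrA ler_wpM2l ?exprn_ge0 // mulr2n mulrDl mul1r lerD2r.
have Y1 : 1 < Y by rewrite (lt_le_trans _ Y2) // ltr1n.
by rewrite lef_pV2 ?posrE ?exprn_gt0 // ler_eXn2l.
Qed.

Lemma pow_anti (a b : R) k : 0 < a -> a <= b -> b ^- k <= a ^- k.
Proof.
move=> a0 ab; have b0 : 0 < b by exact: lt_le_trans ab.
by rewrite lef_pV2 ?posrE ?exprn_gt0 // lerXn2r // nnegrE ltW.
Qed.

Lemma ker_sub_le (F : nat -> R) m : (forall n, 0 <= F n) -> (m <= N.+2)%N ->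
  \sum_(1 <= n < m) F n <= \sum_(1 <= n < N.+2) F n.
Proof.
move=> F0 mN; case: m mN => [|m] mN; first by rewrite big_geq // sumr_ge0.
by rewrite [leRHS](big_cat_nat (n := m.+1)) //= lerDl sumr_ge0.
Qed.

(** Abel summation moves the difference onto the kernel, which decays like |W - n|^(-5). For n >= 2q
    the bound B applies and the kernel sums to a multiple of Y^(-4); for n < 2q the distance to W is
    at least q, and N terms of size g q^2 q^(-5) give g q^(-2), which is O(g Y^(-4)) because Y^2 <=
    32 q. *)
Lemma inner_Delta (D : nat -> R) (B g : R) : 0 <= B -> 0 <= g -> D 0%N = 0 ->
  (forall n, `|D n| <= g * n%:R ^+ 2) ->
  (forall n, 2 * q <= n%:R -> (n <= N)%N -> `|D n| <= B) ->
  nc (\sum_(1 <= n < N.+1) (D n - D n.-1)%:C * (W - n%:R) ^- 4) <= Cdelta * ((B + g) * Z).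
Proof.
move=> B0 g0 D0 Dg DB; rewrite /Cdelta.
have [k hk] : exists k : R, k = 576 by exists 576.
have k_ge0 : 0 <= k by lra.
have N0 : (0 < N)%N by rewrite -(ltr0n R) Nq mulr_gt0.
have hq1 := q1; have hq0 := q0; have hZ0 := Z0.
rewrite abel_sum // D0 mul0r subr0.
set S := \sum_(_ <= _ < _) _.
have bS : nc S <= (144 * B) * (2 ^+ 7 * Z) + (k * g * q ^- 3) * N%:R.
  apply: le_trans (nc_sum _ _ _) _.
  apply: le_trans (_ : (144 * B) * \sum_(1 <= n < N) nc (W - n%:R) ^- 5 + (k * g * q ^- 3) * N%:R <= _); last first.
    rewrite lerD2r ler_wpM2l ?mulr_ge0 //; apply: le_trans (ker_sum 3).
    by apply: ker_sub_le => [n|]; rewrite ?invr_ge0 ?exprn_ge0 ?nc_ge0 // ltnW // ltnW.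
  apply: sum_mix => [|n /andP[n0 nN]]; first by rewrite mulr_ge0 ?invr_ge0 ?exprn_ge0 ?mulr_ge0 // ltW.
  have hk' : nc ((W - n.+1%:R) ^- 4 - (W - n%:R) ^- 4) <= 144 * nc (W - n%:R) ^- 5.
    have -> : W - n.+1%:R = W - n%:R - 1 by rewrite -natr1; ring.
    by apply: kernel_diff; apply: le_trans Y2 (ker_ge_im _).
  rewrite ncM nc_real.
  have k0 : 0 <= nc (W - n%:R) ^- 5 by rewrite invr_ge0 exprn_ge0 // nc_ge0.
  have [h|h] := leP (2 * q) n%:R.
    apply: le_trans (_ : B * (144 * nc (W - n%:R) ^- 5) <= _).
      by apply: ler_pM; rewrite ?nc_ge0 ?normr_ge0 // DB // ltnW.
    rewrite mulrCA mulrA lerDl mulr_ge0 ?invr_ge0 ?exprn_ge0 ?mulr_ge0 //; exact: ltW.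
  apply: le_trans (_ : (g * (2 * q) ^+ 2) * (144 * q ^- 5) <= _).
    apply: ler_pM; rewrite ?nc_ge0 ?normr_ge0 //.
      apply: le_trans (Dg _) _; apply: ler_wpM2l => //; apply: lerXn2r; rewrite ?nnegrE ?(ltW h) //; lra.
    apply: le_trans hk' _; rewrite ler_wpM2l // pow_anti // ker_ge_near //; clear -h hq0 q1 Nq reW Y2 Yq q0 Y0 Z0; lra.
  rewrite [leLHS](_ : _ = k * g * q ^- 3); last by rewrite hk; field; rewrite lt0r_neq0.
  by rewrite lerDr mulr_ge0 // mulr_ge0.
have bN : nc ((D N)%:C * (W - N%:R) ^- 4) <= B * Z.
  rewrite ncM nc_real ncXV; apply: ler_pM; rewrite ?normr_ge0 ?invr_ge0 ?exprn_ge0 ?nc_ge0 //.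
    by apply: DB => //; rewrite Nq; lra.
  by apply: pow_anti => //; exact: ker_ge_im.
apply: le_trans (ncB_ub bN bS) _.
have -> : k * g * q ^- 3 * N%:R = (k * 128 * g) * q ^- 2.
  by rewrite Nq; field; rewrite lt0r_neq0.
apply: le_trans (_ : B * Z + (144 * B * (2 ^+ 7 * Z) + k * 128 * g * (1024 * Z)) <= _).
  by rewrite !lerD2l ler_wpM2l ?mulr_ge0 // ker_q2.
have BZ : 0 <= B * Z by rewrite mulr_ge0 // ltW.
have gZ : 0 <= g * Z by rewrite mulr_ge0 // ltW.
have -> : 2 ^+ 7 = 128 :> R by ring.
set u := B * Z in BZ *; set w := g * Z in gZ *.
have -> : B * Z + (144 * B * (128 * Z) + k * 128 * g * (1024 * Z)) = u + (144 * 128) * u + k * 128 * 1024 * w.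
  by rewrite /u /w; ring.
rewrite [(B + g) * Z]mulrDl -/u -/w hk; clearbody u w; lra.
Qed.

(** Absolute values would give L Y^(-3), too large by a factor Y. As the kernel is, up to O(|W -
    n|^(-5)), the difference of (W - n)^(-3) / 3, a summation by parts moves the difference onto the
    slowly varying m, and the saving 2/n is of order 1/q near W. *)
Lemma inner_smooth (m : nat -> R) (L : R) : 1 <= L ->
  (forall n, (0 < n <= N)%N -> `|m n| <= L) ->
  (forall n, (0 < n)%N -> `|m n.+1 - m n| <= 2 / n%:R) ->
  nc (\sum_(1 <= n < N.+1) (m n)%:C * (W - n%:R) ^- 4) <= Csmooth * (L * Z).
Proof.
move=> L1 mL md; rewrite /Csmooth.
have N0 : (0 < N)%N by rewrite -(ltr0n R) Nq mulr_gt0.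
have hq1 := q1; have hq0 := q0; have hZ0 := Z0.
pose H (n : nat) : R[i] := (W - n%:R) ^- 3 / 3.
pose e (n : nat) : R[i] := H n.+1 - H n - (W - n%:R) ^- 4.
have he (n : nat) : nc (e n) <= 32 * nc (W - n%:R) ^- 5.
  rewrite /e /H -mulrBl.
  have -> : W - n.+1%:R = W - n%:R - 1 by rewrite -natr1; ring.
  by apply: kernel_antideriv; apply: le_trans Y2 (ker_ge_im _).
have -> : \sum_(1 <= n < N.+1) (m n)%:C * (W - n%:R) ^- 4 =
  \sum_(1 <= n < N.+1) (m n)%:C * (H n.+1 - H n) - \sum_(1 <= n < N.+1) (m n)%:C * e n.
  by rewrite -sumrB; apply: eq_bigr => n _; rewrite /e; ring.
have b1 : nc (\sum_(1 <= n < N.+1) (m n)%:C * e n) <= 32 * 128 * (L * Z).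
  apply: le_trans (nc_sum _ _ _) _.
  apply: le_trans (_ : (32 * L) * \sum_(1 <= n < N.+1) nc (W - n%:R) ^- 5 <= _).
    rewrite mulr_sumr big_nat [leRHS]big_nat; apply: ler_sum => n /andP[n0 nN].
    rewrite ncM nc_real [32 * L]mulrC -mulrA; apply: ler_pM; rewrite ?nc_ge0 ?normr_ge0 //.
    by apply: mL; rewrite n0 -ltnS.
  apply: le_trans (_ : (32 * L) * (2 ^+ 7 * Z) <= _); last first.
    by rewrite le_eqVlt; apply/orP; left; apply/eqP; ring.
  rewrite ler_wpM2l //; first lra.
  apply: le_trans (ker_sum 3).
  by apply: ker_sub_le => [n|]; rewrite ?invr_ge0 ?exprn_ge0 ?nc_ge0 // ltnW.
rewrite abel_sum_shift.
have q3 : q ^- 3 <= 1024 * Z.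
  apply: le_trans ker_q2; rewrite lef_pV2 ?posrE ?exprn_gt0 // ler_eXn2l //; lra.
have nH (n : nat) : nc (H n) <= nc (W - n%:R) ^- 3.
  have n3 : nc (3 : R[i]) = 3 by rewrite (nc_nat R 3).
  rewrite /H ncM ncXV ncV n3 ler_piMr ?invr_ge0 ?exprn_ge0 ?nc_ge0 //; lra.
have b2 : nc ((m N.+1)%:C * H N.+1) <= 3 * L * (1024 * Z).
  rewrite ncM nc_real; apply: ler_pM; rewrite ?nc_ge0 ?normr_ge0 //.
    have := mL N; rewrite N0 leqnn => /(_ isT) h1.
    have h2 := md N N0.
    have h3 : 2 / N%:R <= 2 :> R by rewrite ler_pdivrMr ?ltr0n // ler_peMr // ler1n.
    have -> : m N.+1 = (m N.+1 - m N) + m N by ring.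
    apply: le_trans (ler_normD _ _) _; lra.
  apply: le_trans (nH _) _; apply: le_trans q3; apply: pow_anti => //.
  apply: le_trans (Re_le_nc _); rewrite cReD cReN cRe_nat -normrN.
  apply: le_trans (ler_norm _); rewrite -natr1 Nq; case/andP: reW => _ ?; lra.
have b3 : nc ((m 1)%:C * H 1) <= L * (1024 * Z).
  rewrite ncM nc_real; apply: ler_pM; rewrite ?nc_ge0 ?normr_ge0 //; first exact: mL.
  apply: le_trans (nH _) _; apply: le_trans q3; apply: pow_anti => //.
  apply: (@ker_ge_near 1); lra.
have b4 : nc (\sum_(1 <= n < N.+1) (m n.+1 - m n)%:C * H n.+1) <= q^-1 * (2 ^+ 5 * Y ^- 2) + 2 * q ^- 3 * (N.+1)%:R.
  apply: le_trans (nc_sum _ _ _) _.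
  apply: le_trans (_ : q^-1 * \sum_(1 <= n < N.+1) nc (W - n.+1%:R) ^- 3 + 2 * q ^- 3 * N.+1%:R <= _); last first.
    rewrite lerD2r ler_wpM2l ?invr_ge0 ?(ltW q0) //; apply: le_trans (ker_sum 1).
    rewrite [leRHS]big_ltn // [X in _ <= _ + X]big_add1 /= lerDr invr_ge0 exprn_ge0 // nc_ge0 //.
  apply: sum_mix => [|n /andP[n0 nN]]; first by rewrite mulr_ge0 ?invr_ge0 ?exprn_ge0 // ltW.
  rewrite ncM nc_real.
  have k0 : 0 <= nc (W - n.+1%:R) ^- 3 by rewrite invr_ge0 exprn_ge0 // nc_ge0.
  have [h|h] := leP (2 * q) n%:R.
    apply: le_trans (_ : q^-1 * nc (W - n.+1%:R) ^- 3 <= _); last first.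
      by rewrite lerDl mulr_ge0 ?invr_ge0 ?exprn_ge0 // ltW.
    apply: ler_pM; rewrite ?nc_ge0 ?normr_ge0 //.
    apply: le_trans (md _ n0) _; rewrite -invf_div lef_pV2 ?posrE ?divr_gt0 ?ltr0n //; clear -h q1 Nq reW Y2 Yq q0 Y0 Z0; lra.
  apply: le_trans (_ : 2 * q ^- 3 <= _); last first.
    by rewrite lerDr mulr_ge0 // invr_ge0 ltW.
  apply: ler_pM; rewrite ?nc_ge0 ?normr_ge0 //.
    by apply: le_trans (md _ n0) _; rewrite ler_pdivrMr ?ltr0n // ler_peMr // ler1n.
  apply: le_trans (nH _) _; apply: pow_anti => //; apply: ker_ge_near.
  rewrite -natr1; clear -h hq1 q1 Nq reW Y2 Yq q0 Y0 Z0; lra.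
apply: le_trans (ncB_ub (ncB_ub (ncB_ub b2 b3) b4) b1) _.
have b5 : q^-1 * (2 ^+ 5 * Y ^- 2) + 2 * q ^- 3 * N.+1%:R <= 1024 * (L * Z) + 512 * (1024 * (L * Z)).
  have e1 : q^-1 * (2 ^+ 5 * Y ^- 2) = 32 * (q^-1 * Y ^- 2).
    have -> : 2 ^+ 5 = 32 :> R by ring.
    by rewrite mulrCA.
  have e2 : 2 * q ^- 3 * N.+1%:R <= 512 * q ^- 2.
    apply: le_trans (_ : 2 * q ^- 3 * (256 * q) <= _).
      rewrite ler_wpM2l ?mulr_ge0 ?invr_ge0 ?exprn_ge0 ?(ltW q0) //.
      by rewrite -natr1 Nq; clear -hq1 q1 Nq reW Y2 Yq q0 Y0 Z0; lra.
    by rewrite le_eqVlt; apply/orP; left; apply/eqP; field; rewrite lt0r_neq0.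
  have ZL : Z <= L * Z by rewrite ler_peMl // ltW.
  have := ker_qY; have := ker_q2.
  rewrite e1; move: ZL e2; set u := q ^- 2; set w := q^-1 * _; set v := 2 * _ * _; clear -q1 Nq reW Y2 Yq q0 Y0 Z0; lra.
have LZ : 0 <= L * Z by apply: mulr_ge0; [clear -L1 q1 Nq reW Y2 Yq q0 Y0 Z0; lra | exact: ltW].
set v : R := L * Z in LZ b5 *.
have -> : 3 * L * (1024 * Z) = 3 * (1024 * v) by rewrite /v; ring.
have -> : L * (1024 * Z) = 1024 * v by rewrite /v; ring.
move: b5; set w := _ + 2 * _ * _; clear -LZ q1 Nq reW Y2 Yq q0 Y0 Z0; lra.
Qed.

End Kernel.

Lemma inner_sum : exists2 C : R, 0 < C & forall (x : nat) (W : R[i]) (B : R),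
  (16 <= x)%N -> x%:R ^+ 2 / 2 <= re W <= 2 * x%:R ^+ 2 -> 2 <= im W <= 2 * x%:R -> 0 <= B ->
  (forall n : nat, (x ^ 2 <= 4 * n)%N -> (n <= 16 * x ^ 2)%N ->
    `|Delta (n%:R : R)| <= B * Num.sqrt (Num.sqrt n%:R)) ->
  nc (\sum_(1 <= n < (16 * x ^ 2).+1) (numdiv n)%:R * (W - n%:R) ^- 4) <=
    C * ((B * Num.sqrt x%:R + ln x%:R) * (im W) ^- 4).
Proof.
have [C1 eC1] : exists C, C = Cdelta by eexists.
have [C2 eC2] : exists C, C = Csmooth by eexists.
have C10 : 0 < C1 by rewrite eC1 Cdelta_gt0.
have C20 : 0 < C2 by rewrite eC2 Csmooth_gt0.
have g0 : 0 <= gam by exact: normr_ge0.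
exists ((C1 + C2) * (2 + (7 + 2 * gam))) => [|x W B x16 reW imW B0 hB].
  by rewrite mulr_gt0 //; lra.
have xR : 16 <= x%:R :> R by rewrite (ler_nat R 16).
(* With this q the cut-off 16 x^2 is 128 q, Re W lies between 4q and 16q, and the assumed bounds on
   Delta start at n = 2q. *)
pose q : R := x%:R ^+ 2 / 8.
have q2 : 2 <= q by rewrite /q expr2; nra.
have Nq : (16 * x ^ 2)%:R = 128 * q :> R by rewrite natrM natrX /q; field.
have rW : 4 * q <= re W <= 16 * q by rewrite /q; lra.
case/andP: imW => Y2 Yx.
have Yq : im W ^+ 2 <= 32 * q.
  rewrite /q; apply: le_trans (_ : (2 * x%:R) ^+ 2 <= _).
    by apply: lerXn2r => //; rewrite nnegrE // (le_trans _ Y2).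
  by rewrite le_eqVlt; apply/orP; left; apply/eqP; field.
have lx1 : 1 <= ln (x%:R : R).
  have h2 : 2^-1 <= ln (2 : R).
    rewrite -lerN2 -lnV ?posrE // [X in ln X](_ : _ = 1 + (- 2^-1)); last by field.
    by apply: le_ln1Dx; lra.
  apply: le_trans (_ : ln (2 ^+ 4) <= _); first by rewrite lnXn // -[ln 2 *+ 4]mulr_natl; lra.
  by apply: le_trans (_ : ln (16 : R) <= _); rewrite ler_ln ?posrE ?exprn_gt0 //; lra.
have lxN : ln ((16 * x ^ 2)%:R : R) <= 4 * ln (x%:R : R).
  rewrite natrM natrX -[16]/(4 ^ 2)%:R.
  have -> : 4 * ln (x%:R : R) = ln (x%:R ^+ 4) by rewrite lnXn ?ltr0n ?(leq_trans _ x16) // mulr_natl.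
  rewrite ler_ln ?posrE ?mulr_gt0 ?exprn_gt0 ?ltr0n ?(leq_trans _ x16) //.
  have -> : x%:R ^+ 4 = x%:R ^+ 2 * x%:R ^+ 2 :> R by rewrite -exprD.
  by rewrite ler_wpM2r ?exprn_ge0 // expr2; nra.
have -> : \sum_(1 <= n < (16 * x ^ 2).+1) (numdiv n)%:R * (W - n%:R) ^- 4 =
  \sum_(1 <= n < (16 * x ^ 2).+1) (Delta (n%:R : R) - Delta (n.-1%:R : R))%:C * (W - n%:R) ^- 4 +
  \sum_(1 <= n < (16 * x ^ 2).+1) (mdiff n)%:C * (W - n%:R) ^- 4.
  rewrite -big_split; apply: eq_big_nat => n /andP[n0 _] /=.
  rewrite -mulrDl; congr (_ * _).
  by rewrite -rmorphD /= -numdiv_Delta // rmorph_nat.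
have B20 : 0 <= 2 * (B * Num.sqrt x%:R) by rewrite !mulr_ge0 ?sqrtr_ge0.
have h1 : nc (\sum_(1 <= n < (16 * x ^ 2).+1) (Delta (n%:R : R) - Delta (n.-1%:R : R))%:C * (W - n%:R) ^- 4)
    <= C1 * ((2 * (B * Num.sqrt x%:R) + (2 + gam)) * im W ^- 4).
  rewrite eC1; apply: (@inner_Delta q _ W q2 Nq rW Y2 Yq (fun n => Delta (n%:R : R)) _ _ B20).
  - by rewrite addr_ge0.
  - have := Delta_crude 0; rewrite expr0n mulr0 => h; apply/eqP; rewrite -normr_le0 //.
  - exact: Delta_crude.
  - move=> n hn nN; apply: le_trans (hB _ _ nN) _.
      by rewrite -(ler_nat R) natrX natrM; move: hn; rewrite /q; lra.
    rewrite mulrCA ler_wpM2l //.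
    apply: le_trans (_ : Num.sqrt (Num.sqrt ((16 * x ^ 2)%:R)) <= _).
      by rewrite !ler_wsqrtr // ler_nat.
    rewrite natrM natrX.
    have -> : 16 * x%:R ^+ 2 = (4 * x%:R) ^+ 2 :> R by ring.
    rewrite sqrtr_sqr ger0_norm ?mulr_ge0 // sqrtrM //.
    have -> : Num.sqrt 4 = 2 :> R by rewrite (_ : 4 = 2 ^+ 2) ?sqrtr_sqr ?ger0_norm //; ring.
    by [].
have h2 : nc (\sum_(1 <= n < (16 * x ^ 2).+1) (mdiff n)%:C * (W - n%:R) ^- 4)
    <= C2 * ((gam + 1 + 4 * ln x%:R) * im W ^- 4).
  rewrite eC2; apply: (@inner_smooth q _ W q2 Nq rW Y2 Yq mdiff).
  - by lra.
  - move=> n /andP[n0 nN]; apply: le_trans (mdiff_bound n0) _; rewrite lerD2l; apply: le_trans lxN.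
    by rewrite ler_ln ?posrE ?ltr0n ?ler_nat ?muln_gt0 ?expn_gt0 ?(leq_trans _ x16).
  - exact: mdiff_diff.
apply: le_trans (ncD_ub h1 h2) _.
clear eC1 eC2; set Z := im W ^- 4; set b := B * _ in B20 *; set l := ln _ in lx1 *.
have Z0 : 0 <= Z by rewrite invr_ge0 exprn_ge0; lra.
have -> : C1 * ((2 * b + (2 + gam)) * Z) + C2 * ((gam + 1 + 4 * l) * Z) =
  (C1 * (2 * b + (2 + gam)) + C2 * (gam + 1 + 4 * l)) * Z by ring.
rewrite [leRHS]mulrA ler_wpM2r //.
have gl : gam <= gam * l by rewrite ler_peMr.
have gb : 0 <= gam * b by rewrite mulr_ge0 //; lra.
have b1 : 2 * b + (2 + gam) <= (2 + (7 + 2 * gam)) * (b + l).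
  by clear -gl gb lx1 B20 g0; lra.
have b2 : gam + 1 + 4 * l <= (2 + (7 + 2 * gam)) * (b + l).
  by clear -gl gb lx1 B20 g0; lra.
rewrite -[leRHS]mulrA [leRHS]mulrDl; apply: lerD; apply: ler_wpM2l; rewrite ?(ltW C10) ?(ltW C20) //.
Qed.

End InnerSum.

(** * The spatial side *)

Section GridUpper.
Variable R : realType.
Local Notation nc := (@Normc.normc R).
Local Notation re := (@complex.Re R).
Local Notation im := (@complex.Im R).
Local Open Scope complex_scope.

Lemma numdiv_sum (n : nat) : (0 < n)%N -> numdiv n = (\sum_(1 <= a < n.+1) (a %| n))%N.
Proof.
move=> n0; rewrite /numdiv.
have -> : size (divisors n) = size [seq a <- index_iota 1 n.+1 | (a %| n)%N].
  apply: perm_size; apply: uniq_perm; rewrite ?divisors_uniq ?filter_uniq ?iota_uniq // => d.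
  rewrite -dvdn_divisors // mem_filter mem_index_iota; case: (boolP (d %| n)%N) => //= dn.
  by rewrite (dvdn_gt0 n0 dn) ltnS dvdn_leq.
by rewrite size_filter -sum1_count big_mkcond /=; apply: eq_bigr => a _; case: ifP.
Qed.

(** Counts the points (a, b) under the hyperbola ab <= N according to their product. *)
Lemma divisor_regroup (V : pzRingType) (f : nat -> V) (N : nat) :
  \sum_(1 <= a < N.+1) \sum_(1 <= b < (N %/ a).+1) f (a * b)%N =
  \sum_(1 <= n < N.+1) (numdiv n)%:R * f n.
Proof.
elim: N => [|N IH]; first by rewrite !big_geq.
rewrite [RHS]big_nat_recr //= -IH numdiv_sum // natr_sum mulr_suml.
rewrite (big_nat_recr N.+1) //= [X in _ = _ + X](big_nat_recr N.+1) //= addrA divnn /= big_nat1 muln1 dvdnn mul1r.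
congr (_ + _); rewrite -big_split /= big_nat [RHS]big_nat; apply: eq_bigr => a /andP[a0 aN].
rewrite divnS //; case: (boolP (a %| N.+1)%N) => [/dvdnP[c hc]|_]; last by rewrite add0n mul0r addr0.
have -> : (N %/ a = c.-1)%N.
  have := divnS N a0; rewrite {2}hc dvdn_mull // hc mulnK // add1n => ->.
  by rewrite -pred_Sn.
case: c hc => [|c] hc; first by [].
by rewrite /= add1n big_nat_recr //= mul1r hc mulnC.
Qed.

Lemma kernel_lip (w1 w2 : R[i]) (e : R) : 0 < e -> e <= nc w1 -> e <= nc w2 ->
  nc (w1 ^- 4 - w2 ^- 4) <= 4 * e ^- 5 * nc (w1 - w2).
Proof.
move=> e0 h1 h2.
have u1 : w1 != 0 by rewrite -nc_gt0 (lt_le_trans e0).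
have u2 : w2 != 0 by rewrite -nc_gt0 (lt_le_trans e0).
have i1 : nc w1^-1 <= e^-1 by rewrite ncV lef_pV2 ?posrE // (lt_le_trans e0).
have i2 : nc w2^-1 <= e^-1 by rewrite ncV lef_pV2 ?posrE // (lt_le_trans e0).
set a := w1^-1 in i1; set b := w2^-1 in i2.
have -> : w1 ^- 4 - w2 ^- 4 = - (w1 - w2) * (a * b * (a ^+ 3 + a ^+ 2 * b + a * b ^+ 2 + b ^+ 3)).
  by rewrite /a /b; field; rewrite u1 u2.
rewrite ncM ncN mulrC ler_wpM2r ?nc_ge0 //.
have -> : 4 * e ^- 5 = e^-1 * e^-1 * (e^-1 ^+ 3 + e^-1 ^+ 2 * e^-1 + e^-1 * e^-1 ^+ 2 + e^-1 ^+ 3).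
  by field; rewrite lt0r_neq0.
apply: ncM_ub; first exact: ncM_ub.
by do !apply: ncD_ub; rewrite ?ncX_ub //; apply: ncM_ub => //; exact: ncX_ub.
Qed.

Lemma sigma_poly (s : R) : 0 < s -> (s ^+ 4 + s ^+ 3) * (s ^- 4 + s ^- 3) = 2 + s + s^-1.
Proof. by move=> s0; field; rewrite lt0r_neq0. Qed.

Lemma pow34_le (k t s : R) : 0 < k <= 1 -> t = k * s -> 0 < s ->
  t ^+ 4 + t ^+ 3 <= k ^+ 3 * (s ^+ 4 + s ^+ 3).
Proof.
move=> /andP[k0 k1] -> s0; rewrite !exprMn mulrDr lerD2r ler_wpM2r ?exprn_ge0 ?(ltW s0) //.
by rewrite exprS ler_piMl ?exprn_ge0 // ltW.
Qed.

Lemma invX (t : R) n : t ^- n = t^-1 ^+ n. Proof. by rewrite exprVn. Qed.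

(** With s = e^theta the factors s^4 and s^(-4) cancel, so the product of the two series is the
    double sum of (z - a s)^(-4) (z - b/s)^(-4). The discarded a have a s at distance at least x/4
    from x; for the kept ones a s <= 3x, so ab > 16 x^2 forces b/s >= 2x. Rescaling produces [E] and
    [F], whose product is 2 + s + 1/s. *)
Lemma Lip_pair_near (x : nat) (eta s : R) (A : pred nat) (n : nat) (z : R[i]) :
  z = x%:R +i* eta -> (0 < x)%N -> 0 < eta <= 1 -> 0 < s ->
  (forall a, A a -> (0 < a < n)%N /\ x%:R / 2 <= a%:R * s <= 3 * x%:R) ->
  (forall a, ~~ A a -> a%:R * s <= 3 / 4 * x%:R \/ 2 * x%:R <= a%:R * s) ->
  nc (Lip (s^-1%:C * z) * Lip (s%:C * z) -
      \sum_(a < n | A a) \sum_(1 <= b < ((16 * x ^ 2) %/ a).+1)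
        (z - (a%:R * s)%:C) ^- 4 * (z - (b%:R / s)%:C) ^- 4)
  <= 2 ^+ 19 * eta ^- 4 * x%:R ^- 3 * (2 + s + s^-1).
Proof.
move=> ez x0 /andP[e0 e1] s0 hA hnA.
have rez : re z = x%:R by rewrite ez.
have imz : im z = eta by rewrite ez.
clear ez.
have xR : 1 <= x%:R :> R by rewrite ler1n.
have xR0 : 0 < x%:R :> R by rewrite ltr0n.
set N := (16 * x ^ 2)%N.
set u := s^-1%:C * z; set v := s%:C * z.
have si : 0 < s^-1 by rewrite invr_gt0.
have reu : re u = s^-1 * x%:R by rewrite cReZ rez.
have rev : re v = s * x%:R by rewrite cReZ rez.
have imu : im u = s^-1 * eta by rewrite cImZ imz.
have imv : im v = s * eta by rewrite cImZ imz.
have u0 : 0 < im u by rewrite imu mulr_gt0.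
have v0 : 0 < im v by rewrite imv mulr_gt0.
have ru0 : 0 <= re u by rewrite reu mulr_ge0 ?ltW.
have rv0 : 0 <= re v by rewrite rev mulr_ge0 ?ltW.
have su : s != 0 by rewrite lt0r_neq0.
have sC : s%:C * s^-1%:C = 1 by rewrite -rmorphM divff.
pose Pb (a : nat) : pred nat := fun b => (0 < b <= N %/ a)%N.
have eq1 (a b : nat) : (z - (a%:R * s)%:C) ^- 4 * (z - (b%:R / s)%:C) ^- 4 = (u - a%:R) ^- 4 * (v - b%:R) ^- 4.
  rewrite -!invfM -!exprMn; congr ((_ ^+ _)^-1).
  have -> : u - a%:R = s^-1%:C * (z - (a%:R * s)%:C).
    by rewrite /u mulrBr -[in RHS]rmorphM mulrCA mulVf // mulr1 rmorph_nat.
  have -> : v - b%:R = s%:C * (z - (b%:R / s)%:C).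
    by rewrite /v mulrBr -[in RHS]rmorphM mulrCA mulfV // mulr1 rmorph_nat.
  by rewrite mulrACA [s^-1%:C * _]mulrC sC mul1r.
have -> : \sum_(a < n | A a) \sum_(1 <= b < (N %/ a).+1) (z - (a%:R * s)%:C) ^- 4 * (z - (b%:R / s)%:C) ^- 4 =
  \sum_(a < n | A a) (u - a%:R) ^- 4 * \sum_(b < N.+1 | Pb a b) (v - b%:R) ^- 4.
  apply: eq_bigr => a Aa; rewrite mulr_sumr.
  rewrite -(big_mkord (fun b => Pb a b) (fun b => (u - a%:R) ^- 4 * (v - b%:R) ^- 4)).
  rewrite [RHS](big_cat_nat (n := 1)) //= [X in _ = X + _]big_mkcond big_nat1 /= add0r.
  rewrite [RHS](big_cat_nat (n := (N %/ a).+1)) //=; last by rewrite ltnS leq_div.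
  rewrite [X in _ = _ + X]big_nat_cond [X in _ = _ + X]big_pred0 ?addr0; last first.
    by move=> b; apply/negP => /andP[/andP[h _]]; rewrite /Pb => /andP[_]; rewrite leqNgt h.
  rewrite [RHS]big_mkcond /= big_nat [RHS]big_nat; apply: eq_bigr => b /andP[b0 bN].
  by rewrite /Pb b0 -ltnS bN eq1.
have -> : Lip u * Lip v - \sum_(a < n | A a) (u - a%:R) ^- 4 * \sum_(b < N.+1 | Pb a b) (v - b%:R) ^- 4 =
  (Lip u - \sum_(a < n | A a) (u - a%:R) ^- 4) * Lip v +
  \sum_(a < n | A a) (u - a%:R) ^- 4 * (Lip v - \sum_(b < N.+1 | Pb a b) (v - b%:R) ^- 4).
  rewrite [X in _ = _ + X](eq_bigr (fun a : 'I_n => (u - a%:R) ^- 4 * Lip v -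
    (u - a%:R) ^- 4 * \sum_(b < N.+1 | Pb a b) (v - b%:R) ^- 4)); last by move=> a _; rewrite mulrBr.
    by rewrite sumrB -mulr_suml; ring.
pose E : R := s ^+ 4 + s ^+ 3; pose F : R := s ^- 4 + s ^- 3.
have E0 : 0 <= E by rewrite addr_ge0 ?exprn_ge0 // ltW.
have F0 : 0 <= F by rewrite addr_ge0 ?invr_ge0 ?exprn_ge0 // ltW.
have xi : 0 < (x%:R^-1 : R) <= 1 by rewrite invr_gt0 xR0 invf_le1.
have ei0 : 1 <= eta ^-1 by rewrite -invr1 lef_pV2 ?posrE.
have bU : nc (Lip u - \sum_(a < n | A a) (u - a%:R) ^- 4) <= 2 ^+ 13 * (x%:R ^- 3 * E).
  have := @Lip_tail R u A n (x%:R / (4 * s)) u0 ru0.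
  have D0 : 0 < x%:R / (4 * s) by rewrite divr_gt0 ?mulr_gt0.
  move=> /(_ D0).
  have h1 : x%:R / (4 * s) <= nc u.
    apply: le_trans (Re_le_nc _); apply: le_trans (ler_norm _); rewrite reu invfM mulrCA mulrA.
    by rewrite [s^-1 * _]mulrC -mulrA mulrC ler_piMl ?mulr_ge0 ?(ltW xR0) ?(ltW si) //; lra.
  move=> /(_ h1); have h2 a : A a -> (a < n)%N by move=> /hA[/andP[_]].
  move=> /(_ h2); have h3 a : ~~ A a -> x%:R / (4 * s) <= nc (u - a%:R).
    move=> /hnA h; apply: le_trans (Re_le_nc _); rewrite cReD cReN cRe_nat reu.
    have -> : s^-1 * x%:R - a%:R = s^-1 * (x%:R - a%:R * s) by field.
    have -> : x%:R / (4 * s) = s^-1 * (x%:R / 4) by field.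
    rewrite normrM (gtr0_norm si) ler_pM2l //.
    move: h; set y : R := x%:R in xR xR0 *; set w := a%:R * s => h.
    have [h'|h'] := leP 0 (y - w); first by rewrite ger0_norm //; case: h => h; clear -h h' xR0; lra.
    by rewrite ltr0_norm //; case: h => h; clear -h h' xR0; lra.
  move=> /(_ h3) h; apply: le_trans h _.
  have -> : 2 ^+ 13 = 32 * (4 ^+ 4) :> R by ring.
  rewrite -[32 * _ * _]mulrA ler_wpM2l //.
  have -> : (x%:R / (4 * s)) ^- 4 + (x%:R / (4 * s)) ^- 3 = (x%:R^-1 * (4 * s)) ^+ 4 + (x%:R^-1 * (4 * s)) ^+ 3.
    by rewrite !invX invf_div mulrC.
  apply: le_trans (pow34_le xi erefl _) _; first by rewrite mulr_gt0.
  rewrite exprVn mulrCA ler_wpM2l ?invr_ge0 ?exprn_ge0 //.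
  rewrite /E !exprMn mulrDr lerD2l ler_wpM2r ?exprn_ge0 ?(ltW s0) //.
  by rewrite ler_eXn2l // ltr1n.
have eta34 (t : R) : 0 < t -> (t * eta) ^- 4 + (t * eta) ^- 3 <= eta ^- 4 * (t ^- 4 + t ^- 3).
  move=> t0; have ti : 0 <= t^-1 by rewrite invr_ge0 ltW.
  rewrite !invX invfM !exprMn mulrDr [t^-1 ^+ 4 * _]mulrC [t^-1 ^+ 3 * _]mulrC lerD2l.
  by rewrite ler_wpM2r ?exprn_ge0 // ler_weXn2l.
have bV : nc (Lip v) <= 2 ^+ 5 * (eta ^- 4 * F).
  apply: le_trans (Lip_ub v0 rv0) _; rewrite imv.
  have -> : 2 ^+ 5 = 32 :> R by ring.
  by rewrite ler_wpM2l // eta34.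
have bA : \sum_(a < n | A a) nc (u - a%:R) ^- 4 <= 2 ^+ 5 * (eta ^- 4 * E).
  apply: le_trans (_ : \sum_(1 <= a < n) nc (u - a%:R) ^- 4 <= _); last first.
    apply: le_trans (sum_kernel_pow _ 2 u0) _; rewrite imu ler_wpM2l ?exprn_ge0 //.
    by apply: le_trans (eta34 _ si) _; rewrite !invX !invrK.
  rewrite -(big_mkord (fun a => A a) (fun a => nc (u - a%:R) ^- 4)).
  case: n hA {bU} => [|n] hA; first by rewrite !big_geq.
  rewrite big_ltn_cond //; case: ifP => [/hA[/andP[]]//|_].
  rewrite big_mkcond /=; apply: ler_sum => a _; case: ifP => // _.
  by rewrite invr_ge0 exprn_ge0 // nc_ge0.
have bB (a : nat) : A a -> nc (Lip v - \sum_(b < N.+1 | Pb a b) (v - b%:R) ^- 4) <= 2 ^+ 5 * (x%:R ^- 3 * F).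
  move=> Aa; have [/andP[a0 aN] /andP[al au]] := hA a Aa.
  have := @Lip_tail R v (Pb a) N.+1 (s * x%:R) v0 rv0.
  have D0 : 0 < s * x%:R by rewrite mulr_gt0.
  move=> /(_ D0).
  have h1 : s * x%:R <= nc v.
    by apply: le_trans (Re_le_nc _); apply: le_trans (ler_norm _); rewrite rev.
  move=> /(_ h1); have h2 b : Pb a b -> (b < N.+1)%N.
    by move=> /andP[_ bN]; rewrite ltnS (leq_trans bN) // leq_div.
  move=> /(_ h2); have h3 b : ~~ Pb a b -> s * x%:R <= nc (v - b%:R).
    rewrite negb_and -leqNgt -ltnNge leqn0 => /orP[/eqP->|hb]; first by rewrite subr0.
    apply: le_trans (Re_le_nc _); rewrite cReD cReN cRe_nat rev -normrN.
    apply: le_trans (ler_norm _).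
    suff : 2 * (s * x%:R) <= b%:R by clear; lra.
    have : (N < a * b)%N by rewrite mulnC -ltn_divLR.
    rewrite -(ltr_nat R) natrM /N natrM natrX => hN.
    have aR : 0 < a%:R :> R by rewrite ltr0n.
    rewrite -(ler_pM2l aR); apply: le_trans (ltW hN).
    have -> : a%:R * (2 * (s * x%:R)) = 2 * (x%:R * (a%:R * s)) by ring.
    move: au; set w := a%:R * s; set y : R := x%:R in xR xR0 * => au; rewrite expr2; clear -au xR0; nra.
  move=> /(_ h3) h; apply: le_trans h _.
  have -> : 2 ^+ 5 = 32 :> R by ring.
  rewrite ler_wpM2l // !invX invfM [_ / _]mulrC; apply: le_trans (pow34_le xi erefl si) _.
  by rewrite /F !invX.
apply: le_trans (ncD_le _ _) _.
apply: le_trans (_ : 2 ^+ 13 * (x%:R ^- 3 * E) * (2 ^+ 5 * (eta ^- 4 * F)) +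
   2 ^+ 5 * (eta ^- 4 * E) * (2 ^+ 5 * (x%:R ^- 3 * F)) <= _).
  apply: lerD; first by apply: ncM_ub.
  apply: le_trans (nc_sum _ _ _) _.
  apply: le_trans (_ : (\sum_(a < n | A a) nc (u - a%:R) ^- 4) * (2 ^+ 5 * (x%:R ^- 3 * F)) <= _).
    rewrite mulr_suml; apply: ler_sum => a Aa; rewrite ncM ncXV ler_wpM2l ?bB //.
    by rewrite invr_ge0 exprn_ge0 // nc_ge0.
  by rewrite ler_wpM2r // !mulr_ge0 ?exprn_ge0 ?invr_ge0 ?exprn_ge0.
rewrite -sigma_poly // -/E -/F.
have -> : 2 ^+ 13 * (x%:R ^- 3 * E) * (2 ^+ 5 * (eta ^- 4 * F)) +
   2 ^+ 5 * (eta ^- 4 * E) * (2 ^+ 5 * (x%:R ^- 3 * F)) =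
   (2 ^+ 18 + 2 ^+ 10) * (eta ^- 4 * x%:R ^- 3 * (E * F)) by ring.
rewrite -[2 ^+ 19 * _ * _]mulrA -[leRHS]mulrA ler_wpM2r //.
  by rewrite !mulr_ge0 ?invr_ge0 ?exprn_ge0 // ltW.
have -> : 2 ^+ 19 = 2 ^+ 18 + 2 ^+ 18 :> R by rewrite exprS mulr2n mulrDl mul1r.
by rewrite lerD2l ler_eXn2l // ltr1n.
Qed.

Lemma ln_ge1_16 (x : nat) : (16 <= x)%N -> 1 <= ln (x%:R : R).
Proof.
move=> x16; have xR : 16 <= x%:R :> R by rewrite (ler_nat R 16).
have h2 : 2^-1 <= ln (2 : R).
  rewrite -lerN2 -lnV ?posrE // [X in ln X](_ : _ = 1 + (- 2^-1)); last by field.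
  by apply: le_ln1Dx; lra.
apply: le_trans (_ : ln (2 ^+ 4) <= _); first by rewrite lnXn // -[ln 2 *+ 4]mulr_natl; lra.
by apply: le_trans (_ : ln (16 : R) <= _); rewrite ler_ln ?posrE ?exprn_gt0 //; lra.
Qed.

Lemma exp_dist (x t : R) : 0 < x -> x / 2 <= expR t -> x / 2 * `|t - ln x| <= `|x - expR t|.
Proof.
move=> x0 h; have lx : expR (ln x) = x by rewrite lnK.
have [h1|h1] := leP (ln x) t.
  rewrite ger0_norm ?subr_ge0 // ler0_norm ?subr_le0; last by rewrite -{1}lx ler_expR.
  have := expR_ge1Dx (t - ln x); rewrite expRD expRN lx => h2.
  have : x * (1 + (t - ln x)) <= x * (expR t / x) by rewrite ler_pM2l.
  have -> : x * (expR t / x) = expR t by field; rewrite lt0r_neq0.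
  have : 0 <= x * (t - ln x) by rewrite mulr_ge0 ?subr_ge0 // ltW.
  lra.
rewrite ltr0_norm ?subr_lt0 // gtr0_norm ?subr_gt0; last by rewrite -[X in _ < X]lx ltr_expR.
have := expR_ge1Dx (ln x - t); rewrite expRD expRN lx => h2.
have e0 := expR_gt0 t.
have : expR t * (1 + (ln x - t)) <= expR t * (x / expR t) by rewrite ler_pM2l.
have -> : expR t * (x / expR t) = x by field; rewrite lt0r_neq0.
have : 0 <= (expR t - x / 2) * (ln x - t) by rewrite mulr_ge0 ?subr_ge0 // ltW.
lra.
Qed.

(** * The change of variable alpha = a e^theta on the geometric grid *)

Section Grid.
Variables (x I : nat) (eta delta : R).
Hypothesis x16 : (16 <= x)%N.
Hypothesis eta01 : 0 < eta <= 1.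
Hypothesis delta0 : 0 < delta <= 4^-1.
Local Notation E := (expR (I%:R * delta)).
Hypothesis Ex : 32 * x%:R <= E.
Hypothesis small : 2 ^+ 16 * x%:R ^+ 8 * delta <= eta ^+ 9.
Let z : R[i] := x%:R +i* eta.
(** The value of e^theta at a grid point. The index may run past the grid, because after the shift
    by [pa a] it stands for alpha. *)
Let al (p : nat) : R := expR (delta * (p%:R - I%:R)).
Let m := I.*2.+1.
Let N := (16 * x ^ 2)%N.
Let Q (p : nat) := x%:R / 2 <= al p <= 2 * x%:R.
Let pa (a : nat) := Num.truncn (ln (a%:R : R) / delta).

Let xR : 16 <= x%:R :> R. Proof. by rewrite (ler_nat R 16). Qed.
Let xR0 : 0 < x%:R :> R. Proof. by apply: lt_le_trans xR. Qed.
Let d0 : 0 < delta. Proof. by case/andP: delta0. Qed.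
Let e0 : 0 < eta. Proof. by case/andP: eta01. Qed.

(* Rounding [ln a] to the grid makes [a * al i] almost equal to [al (pa a + i)], and imposing
   the cutoff [Q] on the rounded value makes the change of variable [Q_reindex] exact. *)
Lemma al_shift (a i : nat) : (0 < a)%N -> exists2 r : R, 0 <= r < delta &
  a%:R * al i = al (pa a + i) * expR r.
Proof.
move=> a0; have aR : 0 < a%:R :> R by rewrite ltr0n.
have l0 : 0 <= ln (a%:R : R) / delta by rewrite divr_ge0 ?ln_ge0 ?ler1n // ltW.
exists (ln a%:R - (pa a)%:R * delta).
  rewrite subr_ge0 -ler_pdivlMr // ltrBlDl -[X in _ + X]mul1r -mulrDl natr1 -ltr_pdivrMr //.
  exact: truncn_itv.
rewrite /al -expRD -[in LHS](lnK (x := a%:R)) ?posrE // -expRD natrD; congr expR; ring.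
Qed.

Lemma Q_small (a p : nat) : (0 < a <= N)%N -> (p < pa a)%N -> ~~ Q p.
Proof.
move=> /andP[a0 aN] hp; have aR : 0 < a%:R :> R by rewrite ltr0n.
have l0 : 0 <= ln (a%:R : R) / delta by rewrite divr_ge0 ?ln_ge0 ?ler1n // ltW.
rewrite negb_and -ltNge; apply/orP; left.
have h1 : delta * p%:R < ln a%:R.
  rewrite mulrC -ltr_pdivlMr //.
  have /andP[h _] := truncn_itv l0; apply: lt_le_trans h.
  by rewrite ltr_nat.
have h2 : al p < a%:R / E.
  by rewrite /al -expRN -[a%:R](lnK (x := a%:R)) ?posrE // -expRD ltr_expR; lra.
apply: lt_le_trans h2 _; rewrite ler_pdivrMr ?expR_gt0 //.
apply: le_trans (_ : x%:R / 2 * (32 * x%:R) <= _); last by rewrite ler_wpM2l // divr_ge0 // ltW.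
apply: le_trans (_ : N%:R <= _); first by rewrite ler_nat.
by rewrite /N natrM natrX le_eqVlt; apply/orP; left; apply/eqP; field.
Qed.

Lemma Q_large (p : nat) : (m <= p)%N -> ~~ Q p.
Proof.
move=> hp; rewrite negb_and -!ltNge; apply/orP; right.
apply: lt_le_trans (_ : E <= _); first by have hx := xR0; have hE := Ex; lra.
rewrite ler_expR mulrC ler_wpM2l ?(ltW d0) //.
have : (I + I <= p)%N by rewrite addnn ltnW.
by rewrite -(ler_nat R) natrD; lra.
Qed.

(** As E >= 32 x, for every a <= 16 x^2 the shifted grid covers the whole window [x/2, 2x]:
    [Q_small] and [Q_large] exclude what lies before and after. Hence the cut-off sum does not
    depend on a. *)
Lemma Q_reindex (a : nat) (f : nat -> R[i]) : (0 < a <= N)%N ->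
  \sum_(i < m | Q (pa a + i)) f (pa a + i)%N = \sum_(p < m | Q p) f p.
Proof.
move=> ha.
have e1 : \sum_(0 <= p < pa a + m | Q p) f p = \sum_(i < m | Q (pa a + i)) f (pa a + i)%N.
  rewrite (big_cat_nat (n := pa a)) ?leq_addr //=.
  rewrite [X in X + _]big_nat_cond [X in X + _]big_pred0 ?add0r; last first.
    by move=> p; apply/negP => /andP[/andP[_ h]]; apply/negP/(Q_small ha).
  rewrite -{1}[pa a]add0n big_addn addKn big_mkord.
  by apply: eq_big => [i|i _]; rewrite addnC.
rewrite -e1 (big_cat_nat (n := m)) ?leq_addl //=.
rewrite [X in _ + X]big_nat_cond [X in _ + X]big_pred0 ?addr0; last first.
  by move=> p; apply/negP => /andP[/andP[h _]]; apply/negP/Q_large.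
by rewrite big_mkord.
Qed.

Lemma z_ker (y : R) : eta <= nc (z - y%:C) /\ `|x%:R - y| <= nc (z - y%:C).
Proof.
split; last by apply: le_trans (Re_le_nc _); rewrite cReD cReN.
by apply: le_trans (Im_le_nc _); rewrite cImD cImN /= oppr0 addr0 ler_norm.
Qed.

Lemma small_D : 1 <= 2 * eta / (x%:R * delta).
Proof.
have /andP[_ e1] := eta01; have hx := xR.
rewrite ler_pdivlMr ?mulr_gt0 // mul1r.
apply: le_trans (_ : eta ^+ 9 <= _); last first.
  apply: le_trans (_ : eta <= _); last by rewrite mulr_natl mulr2n lerDl ltW.
  by rewrite exprS ler_piMr ?(ltW e0) // exprn_ile1 // ltW.
apply: le_trans small; rewrite ler_wpM2r ?(ltW d0) //.
have h7 : 1 <= x%:R ^+ 7 :> R by rewrite exprn_ege1 //; lra.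
have h16 : 1 <= 2 ^+ 16 :> R by rewrite exprn_ege1 // ler1n.
have -> : x%:R ^+ 8 = x%:R * x%:R ^+ 7 :> R by rewrite -exprS.
by rewrite mulrCA ler_peMr ?(ltW xR0) // mulr_ege1.
Qed.

(** A Riemann sum for the integral of |z - alpha|^(-4) d(alpha)/alpha over alpha of order x, which
    has size eta^(-3) / x. [D] measures the width eta in grid steps, and D >= 1 says that the grid
    resolves the kernel. *)
Lemma grid_kernel_sum : delta * \sum_(p < m | Q p) nc (z - (al p)%:C) ^- 4 <= 2 ^+ 7 * eta ^- 3 / x%:R.
Proof.
pose D := 2 * eta / (x%:R * delta).
have D1 : 1 <= D := small_D.
have D0 : 0 < D by apply: lt_le_trans D1.
pose t := - (I%:R + ln x%:R / delta).
have c0 : 0 < x%:R * delta / 4 by rewrite divr_gt0 // mulr_gt0.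
have h1 (p : nat) : Q p -> nc (z - (al p)%:C) ^- 4 <= (x%:R * delta / 4) ^- 4 * (D + `|t + p%:R|) ^- 4.
  move=> /andP[hp _]; rewrite -invfM -exprMn.
  have [k1 k2] := z_ker (al p).
  have k3 := le_trans (exp_dist xR0 hp) k2.
  have D2 : 0 < D + `|t + p%:R| by rewrite ltr_pwDl.
  apply: pow_anti; first by rewrite mulr_gt0.
  have e1 : delta * (p%:R - I%:R) - ln x%:R = delta * (t + p%:R).
    by rewrite /t; field; rewrite lt0r_neq0.
  rewrite e1 normrM (gtr0_norm d0) in k3.
  have -> : x%:R * delta / 4 * (D + `|t + p%:R|) = (eta + x%:R / 2 * (delta * `|t + p%:R|)) / 2.
    by rewrite /D; field; rewrite !lt0r_neq0.
  by lra.
apply: le_trans (_ : delta * ((x%:R * delta / 4) ^- 4 * (2 * (D ^- 4 + D ^- 3))) <= _).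
  rewrite ler_wpM2l ?(ltW d0) //.
  apply: le_trans (_ : (x%:R * delta / 4) ^- 4 * \sum_(p < m) (D + `|t + p%:R|) ^- 4 <= _); last first.
    by rewrite ler_wpM2l ?invr_ge0 ?exprn_ge0 ?(ltW c0) // sum_inv_pow_dist.
  rewrite mulr_sumr big_mkcond; apply: ler_sum => p _; case: ifP => [|_]; first exact: h1.
  by rewrite mulr_ge0 ?invr_ge0 ?exprn_ge0 ?addr_ge0 ?(ltW c0) ?(ltW D0).
apply: le_trans (_ : delta * ((x%:R * delta / 4) ^- 4 * (4 * D ^- 3)) <= _).
  rewrite ler_wpM2l ?(ltW d0) // ler_wpM2l ?invr_ge0 ?exprn_ge0 ?(ltW c0) //.
  have : D ^- 4 <= D ^- 3 by rewrite lef_pV2 ?posrE ?exprn_gt0 // ler_weXn2l.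
  lra.
rewrite le_eqVlt; apply/orP; left; apply/eqP.
by rewrite /D; field; rewrite !lt0r_neq0.
Qed.

(** Rounding multiplies the two nodes by e^r and e^(-r) with 0 <= r < delta, and the kernel is
    Lipschitz with constant 4 eta^(-5). After rounding, a and b occur only through [pa a + i] and
    the product ab. *)
Lemma grid_shift_error (a b i : nat) : (0 < a)%N -> (a * b <= N)%N -> Q (pa a + i) ->
  nc ((z - (a%:R * al i)%:C) ^- 4 * (z - (b%:R / al i)%:C) ^- 4 -
      (z - (al (pa a + i))%:C) ^- 4 * (z - ((a * b)%:R / al (pa a + i))%:C) ^- 4)
  <= 144 * x%:R * delta * eta ^- 9.
Proof.
move=> a0 abN /andP[Q1 Q2]; have [r /andP[r0 r1] er] := al_shift i a0.
have /andP[_ dl] := delta0.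
have p0 : 0 < al (pa a + i) by exact: expR_gt0.
have i0 : 0 < al i by exact: expR_gt0.
have aR : 0 < a%:R :> R by rewrite ltr0n.
have eb : b%:R / al i = (a * b)%:R / al (pa a + i) * expR (- r).
  rewrite expRN -mulrA -invfM -er natrM.
  by field; rewrite !lt0r_neq0.
rewrite er eb; set P := al (pa a + i) in Q1 Q2 p0 *; set q := (a * b)%:R / P.
have [k1 _] := z_ker (P * expR r); have [k2 _] := z_ker P.
have [k3 _] := z_ker (q * expR (- r)); have [k4 _] := z_ker q.
have q0 : 0 <= q by rewrite divr_ge0 // ltW.
have q1 : q <= 32 * x%:R.
  rewrite ler_pdivrMr //; apply: le_trans (_ : N%:R <= _); first by rewrite ler_nat.
  rewrite /N natrM natrX; apply: le_trans (_ : 32 * x%:R * (x%:R / 2) <= _).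
    by rewrite le_eqVlt; apply/orP; left; apply/eqP; field.
  by rewrite ler_wpM2l // mulr_ge0 // ltW.
have l1 := kernel_lip e0 k1 k2; have l2 := kernel_lip e0 k3 k4.
have er1 : 0 <= expR r - 1 <= 2 * delta.
  rewrite subr_ge0 -{1}expR0 ler_expR r0 /=.
  have := expR_ge1Dx (- r); rewrite expRN => h.
  have h' : expR r * (1 - r) <= 1.
    by rewrite -[leRHS](divff (lt0r_neq0 (expR_gt0 r))) ler_pM2l ?expR_gt0.
  have : 1 <= expR r by rewrite -{1}expR0 ler_expR.
  by nra.
have er2 : 0 <= 1 - expR (- r) <= delta.
  have := expR_ge1Dx (- r); have : expR (- r) <= 1 by rewrite -[X in _ <= X]expR0 ler_expR; lra.
  by lra.
have n1 : nc (z - (P * expR r)%:C - (z - P%:C)) <= 4 * x%:R * delta.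
  have -> : z - (P * expR r)%:C - (z - P%:C) = (- (P * (expR r - 1)))%:C by rewrite mulrBr mulr1 rmorphN rmorphB; ring.
  case/andP: er1 => er1 er1'.
  rewrite nc_real normrN ger0_norm ?mulr_ge0 ?(ltW p0) //.
  have -> : 4 * x%:R * delta = 2 * x%:R * (2 * delta) by ring.
  by apply: ler_pM => //; exact: ltW.
have n2 : nc (z - (q * expR (- r))%:C - (z - q%:C)) <= 32 * x%:R * delta.
  have -> : z - (q * expR (- r))%:C - (z - q%:C) = (q * (1 - expR (- r)))%:C by rewrite mulrBr mulr1 rmorphB; ring.
  case/andP: er2 => er2 er2'.
  rewrite nc_real ger0_norm; last exact: mulr_ge0.
  by apply: ler_pM.
have ei : 0 <= eta ^- 4 by rewrite invr_ge0 exprn_ge0 // ltW.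
have ei5 : 0 <= 4 * eta ^- 5 by rewrite mulr_ge0 ?invr_ge0 ?exprn_ge0 // ltW.
set A1 := (z - (P * expR r)%:C) ^- 4 in l1 *; set A2 := (z - P%:C) ^- 4 in l1 *.
set B1 := (z - (q * expR (- r))%:C) ^- 4 in l2 *; set B2 := (z - q%:C) ^- 4 in l2 *.
have -> : A1 * B1 - A2 * B2 = (A1 - A2) * B1 + A2 * (B1 - B2) by ring.
apply: le_trans (_ : 4 * eta ^- 5 * (4 * x%:R * delta) * eta ^- 4 + eta ^- 4 * (4 * eta ^- 5 * (32 * x%:R * delta)) <= _); last first.
  by rewrite le_eqVlt; apply/orP; left; apply/eqP; field; rewrite lt0r_neq0.
apply: ncD_ub; apply: ncM_ub.
- by apply: le_trans l1 _; rewrite ler_wpM2l.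
- by rewrite ncXV; exact: pow_anti.
- by rewrite ncXV; exact: pow_anti.
- by apply: le_trans l2 _; rewrite ler_wpM2l.
Qed.

Lemma grid_pointwise (i : nat) : (i < m)%N ->
  nc (Lip ((al i)^-1%:C * z) * Lip ((al i)%:C * z) -
      \sum_(1 <= a < N.+1 | Q (pa a + i)) \sum_(1 <= b < (N %/ a).+1)
         (z - (a%:R * al i)%:C) ^- 4 * (z - (b%:R / al i)%:C) ^- 4)
  <= 2 ^+ 21 * eta ^- 4 * x%:R ^- 3 * E.
Proof.
move=> im; have i0 : 0 < al i by exact: expR_gt0.
have /andP[_ dl] := delta0; have hx := xR.
pose n := (N + (Num.truncn (3 * x%:R / al i)).+1)%N.
have nT : 3 * x%:R / al i < n%:R.
  apply: lt_le_trans (_ : (Num.truncn (3 * x%:R / al i)).+1%:R <= _).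
    have h0 : 0 <= 3 * x%:R / al i by rewrite divr_ge0 ?mulr_ge0 // ltW.
    by have /andP[] := truncn_itv h0.
  by rewrite ler_nat leq_addl.
pose A : pred nat := fun a => (0 < a)%N && Q (pa a + i).
have er1 r : 0 <= r < delta -> 1 <= expR r <= 3 / 2.
  move=> /andP[r0 r1]; rewrite -{1}expR0 ler_expR r0 /=.
  have := expR_ge1Dx (- r); rewrite expRN => h.
  have h' : expR r * (1 - r) <= 1.
    by rewrite -[leRHS](divff (lt0r_neq0 (expR_gt0 r))) ler_pM2l ?expR_gt0.
  have : 1 <= expR r by rewrite -{1}expR0 ler_expR.
  by nra.
have hA a : A a -> (0 < a < n)%N /\ x%:R / 2 <= a%:R * al i <= 3 * x%:R.
  move=> /andP[a0 /andP[Q1 Q2]]; have [r hr er] := al_shift i a0.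
  have /andP[r1 r2] := er1 r hr.
  have h : x%:R / 2 <= a%:R * al i <= 3 * x%:R.
    rewrite er; apply/andP; split.
      by apply: le_trans Q1 _; rewrite ler_peMr // ltW // expR_gt0.
    have -> : 3 * x%:R = 2 * x%:R * (3 / 2) :> R by field.
    by apply: ler_pM => //; rewrite ltW // expR_gt0.
  split=> //; rewrite a0 /= -(ltr_nat R); apply: le_lt_trans nT.
  by rewrite ler_pdivlMr //; case/andP: h.
have hnA a : ~~ A a -> a%:R * al i <= 3 / 4 * x%:R \/ 2 * x%:R <= a%:R * al i.
  rewrite negb_and -leqNgt leqn0 => /orP[/eqP->|]; first by left; rewrite mul0r mulr_ge0 // ltW.
  have [->|a0] := posnP a; first by left; rewrite mul0r mulr_ge0 // ltW.
  have [r hr er] := al_shift i a0; have /andP[r1 r2] := er1 r hr.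
  rewrite negb_and -!ltNge => /orP[h|h]; rewrite er; [left|right].
    have -> : 3 / 4 * x%:R = x%:R / 2 * (3 / 2) :> R by field.
    by apply: ler_pM => //; rewrite ltW // expR_gt0.
  by apply: le_trans (ltW h) _; rewrite ler_peMr // ltW // expR_gt0.
have x0 : (0 < x)%N by apply: leq_trans x16.
have h := Lip_pair_near erefl x0 eta01 i0 hA hnA.
have e1 : \sum_(a < n | A a) \sum_(1 <= b < ((16 * x ^ 2) %/ a).+1)
        (z - (a%:R * al i)%:C) ^- 4 * (z - (b%:R / al i)%:C) ^- 4 =
  \sum_(1 <= a < N.+1 | Q (pa a + i)) \sum_(1 <= b < (N %/ a).+1)
         (z - (a%:R * al i)%:C) ^- 4 * (z - (b%:R / al i)%:C) ^- 4.
  rewrite -(big_mkord A (fun a => \sum_(1 <= b < ((16 * x ^ 2) %/ a).+1)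
        (z - (a%:R * al i)%:C) ^- 4 * (z - (b%:R / al i)%:C) ^- 4)).
  rewrite (big_cat_nat (n := N.+1)) //=; last by rewrite /n addnS ltnS leq_addr.
  rewrite [X in _ + X]big_nat_cond [X in _ + X]big1 ?addr0; last first.
    by move=> a /andP[/andP[aN _] _]; rewrite divn_small // big_geq.
  rewrite big_ltn_cond // /A ltnn /= big_nat_cond [RHS]big_nat_cond.
  by apply: eq_bigl => a; case: a.
rewrite e1 in h; apply: le_trans h _.
have E1 : 1 <= E by have := Ex; lra.
have aE : al i <= E.
  rewrite ler_expR mulrC ler_wpM2r ?(ltW d0) // lerBlDr -natrD ler_nat addnn.
  by move: im; rewrite /m ltnS.
have aiE : (al i)^-1 <= E.
  rewrite -expRN ler_expR -mulrN mulrC ler_wpM2r ?(ltW d0) // opprB lerBlDr lerDl //.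
have -> : 2 ^+ 21 * eta ^- 4 * x%:R ^- 3 * E = 2 ^+ 19 * eta ^- 4 * x%:R ^- 3 * (4 * E).
  by rewrite [2 ^+ 21](_ : _ = 4 * 2 ^+ 19); [ring | rewrite -[4](_ : 2 ^+ 2 = 4) -?exprD //; ring].
rewrite ler_wpM2l //; last by lra.
by rewrite !mulr_ge0 ?exprn_ge0 ?invr_ge0 ?exprn_ge0 // ltW.
Qed.

(** Once the nodes are rounded and the sum reindexed, the pairs (a, b) regroup into the divisor sum
    bounded by [G0]. The hypothesis on m delta E makes the total truncation error O(eta^(-4) / x),
    and [small] makes the rounding error at most 1/x. *)
Lemma grid_upper (G0 : R) : m%:R * delta * E <= x%:R ^+ 2 -> 0 <= G0 ->
  (forall y, x%:R / 2 <= y <= 2 * x%:R ->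
     nc (\sum_(1 <= n < N.+1) (numdiv n)%:R * (z - (n%:R / y)%:C) ^- 4) <= G0) ->
  delta * nc (\sum_(i < m) Lip ((al i)^-1%:C * z) * Lip ((al i)%:C * z)) <=
    (2 ^+ 21 * eta ^- 4 + 1 + G0 * (2 ^+ 7 * eta ^- 3)) / x%:R.
Proof.
move=> mE G00 hG.
pose K (a b i : nat) := (z - (a%:R * al i)%:C) ^- 4 * (z - (b%:R / al i)%:C) ^- 4.
pose K' (c p : nat) := (z - (al p)%:C) ^- 4 * (z - (c%:R / al p)%:C) ^- 4.
pose S (i : nat) := Lip ((al i)^-1%:C * z) * Lip ((al i)%:C * z).
pose T (i : nat) := \sum_(1 <= a < N.+1 | Q (pa a + i)) \sum_(1 <= b < (N %/ a).+1) K a b i.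
pose U := \sum_(p < m | Q p) \sum_(1 <= a < N.+1) \sum_(1 <= b < (N %/ a).+1) K' (a * b)%N p.
have E1 : 1 <= E by have := Ex; have := xR; lra.
have md0 : 0 <= m%:R * delta by rewrite mulr_ge0 // ltW.
have h1 : delta * nc (\sum_(i < m) S i - \sum_(i < m) T i) <= 2 ^+ 21 * eta ^- 4 / x%:R.
  apply: le_trans (_ : delta * (m%:R * (2 ^+ 21 * eta ^- 4 * x%:R ^- 3 * E)) <= _).
    rewrite ler_wpM2l ?(ltW d0) // -sumrB; apply: le_trans (nc_sum _ _ _) _.
    apply: le_trans (_ : \sum_(i < m) (2 ^+ 21 * eta ^- 4 * x%:R ^- 3 * E) <= _).
      by apply: ler_sum => i _; exact: grid_pointwise.
    by rewrite sumr_const card_ord [leRHS]mulr_natl.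
  have -> : delta * (m%:R * (2 ^+ 21 * eta ^- 4 * x%:R ^- 3 * E)) = 2 ^+ 21 * eta ^- 4 * (x%:R ^- 3 * (m%:R * delta * E)) by ring.
  rewrite ler_wpM2l ?mulr_ge0 ?exprn_ge0 ?invr_ge0 ?exprn_ge0 ?(ltW e0) //.
  apply: le_trans (_ : x%:R ^- 3 * x%:R ^+ 2 <= _); first by rewrite ler_wpM2l // invr_ge0 exprn_ge0 // ltW.
  by rewrite le_eqVlt; apply/orP; left; apply/eqP; field; rewrite lt0r_neq0 // xR0.
have eT : \sum_(i < m) T i = \sum_(1 <= a < N.+1) \sum_(i < m | Q (pa a + i)) \sum_(1 <= b < (N %/ a).+1) K a b i.
  under eq_bigr => i _ do rewrite /T big_mkcond.
  by rewrite exchange_big /=; apply: eq_bigr => a _; rewrite -big_mkcond.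
have eU : U = \sum_(1 <= a < N.+1) \sum_(i < m | Q (pa a + i)) \sum_(1 <= b < (N %/ a).+1) K' (a * b)%N (pa a + i)%N.
  rewrite /U exchange_big /= big_nat [RHS]big_nat; apply: eq_bigr => a ha.
  by rewrite -(Q_reindex (fun p => \sum_(1 <= b < (N %/ a).+1) K' (a * b)%N p) ha).
pose e := 144 * x%:R * delta * eta ^- 9.
have ee0 : 0 <= e by rewrite !mulr_ge0 ?invr_ge0 ?exprn_ge0 // ltW.
have h2 : nc (\sum_(i < m) T i - U) <= N%:R * (m%:R * (N%:R * e)).
  rewrite eT eU -sumrB; apply: le_trans (nc_sum _ _ _) _.
  apply: le_trans (_ : \sum_(1 <= a < N.+1) (m%:R * (N%:R * e)) <= _); last first.
    by rewrite sumr_const_nat subn1 [leRHS]mulr_natl.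
  rewrite big_nat [leRHS]big_nat; apply: ler_sum => a /andP[a0 aN].
  rewrite -sumrB; apply: le_trans (nc_sum _ _ _) _.
  apply: le_trans (_ : \sum_(i < m) (N%:R * e) <= _); last first.
    by rewrite sumr_const card_ord [leRHS]mulr_natl.
  rewrite big_mkcond; apply: ler_sum => i _; case: ifP => [Qi|_]; last by rewrite mulr_ge0.
  rewrite -sumrB; apply: le_trans (nc_sum _ _ _) _.
  apply: le_trans (_ : \sum_(1 <= b < (N %/ a).+1) e <= _); last first.
    by rewrite sumr_const_nat subn1 -[_ *+ _]mulr_natl ler_wpM2r // ler_nat leq_div.
  rewrite big_nat [leRHS]big_nat; apply: ler_sum => b /andP[b0 bN].
  apply: grid_shift_error => //.
  by rewrite mulnC (leq_trans _ (leq_divM N a)) // leq_mul2r -ltnS bN orbT.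
have h3 : delta * nc (\sum_(i < m) T i - U) <= x%:R^-1.
  apply: le_trans (_ : delta * (N%:R * (m%:R * (N%:R * e))) <= _); first by rewrite ler_wpM2l // ltW.
  have eN : N%:R = 16 * x%:R ^+ 2 :> R by rewrite /N natrM natrX.
  apply: le_trans (_ : (m%:R * delta) * (2 ^+ 16 * x%:R ^+ 5 * delta * eta ^- 9) <= _).
    have -> : delta * (N%:R * (m%:R * (N%:R * e))) = (m%:R * delta) * ((16 * 16 * 144) * (x%:R ^+ 5 * delta * eta ^- 9)).
      by rewrite eN /e; ring.
    have -> : 2 ^+ 16 * x%:R ^+ 5 * delta * eta ^- 9 = 2 ^+ 16 * (x%:R ^+ 5 * delta * eta ^- 9) by rewrite !mulrA.
    have w0 : 0 <= x%:R ^+ 5 * delta * eta ^- 9 by rewrite !mulr_ge0 ?invr_ge0 ?exprn_ge0 // ltW.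
    apply: ler_wpM2l => //; apply: ler_wpM2r => //.
    have -> : 2 ^+ 16 = 16 * 16 * 256 :> R by ring.
    by rewrite ler_wpM2l // ler_nat.
  apply: le_trans (_ : x%:R ^+ 2 * (x%:R ^- 3) <= _); last first.
    by rewrite le_eqVlt; apply/orP; left; apply/eqP; field; rewrite lt0r_neq0 // xR0.
  apply: ler_pM => //.
  - by rewrite !mulr_ge0 ?exprn_ge0 ?invr_ge0 ?exprn_ge0 // ltW.
  - by apply: le_trans mE; rewrite ler_peMr.
  rewrite ler_pdivrMr ?exprn_gt0 // [leRHS]mulrC ler_pdivlMr ?exprn_gt0 //.
  by apply: le_trans small; rewrite le_eqVlt; apply/orP; left; apply/eqP; ring.
have h4 : delta * nc U <= G0 * (2 ^+ 7 * eta ^- 3 / x%:R).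
  have -> : U = \sum_(p < m | Q p) (z - (al p)%:C) ^- 4 * \sum_(1 <= n < N.+1) (numdiv n)%:R * (z - (n%:R / al p)%:C) ^- 4.
    apply: eq_bigr => p _; rewrite mulr_sumr.
    rewrite (divisor_regroup (fun c => K' c p) N); apply: eq_bigr => n _.
    by rewrite /K'; ring.
  apply: le_trans (_ : delta * ((\sum_(p < m | Q p) nc (z - (al p)%:C) ^- 4) * G0) <= _).
    rewrite ler_wpM2l ?(ltW d0) // mulr_suml; apply: le_trans (nc_sum _ _ _) _.
    apply: ler_sum => p Qp; rewrite ncM ncXV ler_wpM2l ?hG //.
    by rewrite invr_ge0 exprn_ge0 // nc_ge0.
  by rewrite mulrA [leRHS]mulrC ler_wpM2r // grid_kernel_sum.
have -> : \sum_(i < m) S i = (\sum_(i < m) S i - \sum_(i < m) T i) + (\sum_(i < m) T i - U) + U by ring.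
apply: le_trans (_ : delta * (nc (\sum_(i < m) S i - \sum_(i < m) T i) + nc (\sum_(i < m) T i - U) + nc U) <= _).
  by rewrite ler_wpM2l ?(ltW d0) // !ncD_ub.
rewrite !mulrDr !mulrDl mul1r -[G0 * _ / _]mulrA; exact: lerD (lerD h1 h3) h4.
Qed.

End Grid.

Lemma grid_bound : exists2 C : R, 0 < C & forall (x I : nat) (eta delta B : R),
  (16 <= x)%N -> 0 < eta <= 1 -> 4 <= x%:R * eta -> 0 < delta <= 4^-1 ->
  32 * x%:R <= expR (I%:R * delta) -> (I.*2.+1)%:R * delta * expR (I%:R * delta) <= x%:R ^+ 2 ->
  2 ^+ 16 * x%:R ^+ 8 * delta <= eta ^+ 9 -> 0 <= B ->
  (forall n : nat, (x ^ 2 <= 4 * n)%N -> (n <= 16 * x ^ 2)%N ->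
    `|Delta (n%:R : R)| <= B * Num.sqrt (Num.sqrt n%:R)) ->
  delta * nc (\sum_(i < I.*2.+1) Lip ((expR (delta * (i%:R - I%:R)))^-1%:C * (x%:R +i* eta)) *
        Lip ((expR (delta * (i%:R - I%:R)))%:C * (x%:R +i* eta)))
  <= C * (eta ^- 7 * ((B * Num.sqrt x%:R + ln x%:R) / x%:R)).
Proof.
have [C0 C00 hin] := inner_sum R.
exists (2 ^+ 21 + 1 + C0 * 2 ^+ 7); first by rewrite !addr_gt0 ?mulr_gt0 ?exprn_gt0.
move=> x I eta delta B x16 eta01 xe delta01 Ex mE small B0 hB.
have xR : 16 <= x%:R :> R by rewrite (ler_nat R 16).
have /andP[e0 e1] := eta01.
have lx1 := ln_ge1_16 x16.
set V := B * Num.sqrt x%:R + ln x%:R.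
have V1 : 1 <= V by rewrite /V; have : 0 <= B * Num.sqrt x%:R by [rewrite mulr_ge0 ?sqrtr_ge0]; lra.
have hG y : x%:R / 2 <= y <= 2 * x%:R ->
     nc (\sum_(1 <= n < (16 * x ^ 2).+1) (numdiv n)%:R * ((x%:R +i* eta) - (n%:R / y)%:C) ^- 4) <= C0 * V * eta ^- 4.
  move=> /andP[y1 y2]; have y0 : 0 < y by lra.
  (* Rescaling by y: (z - n/y)^(-4) = y^4 (W - n)^(-4), and y^4 (Im W)^(-4) is eta^(-4). *)
  pose W : R[i] := y%:C * (x%:R +i* eta).
  have rW : re W = y * x%:R by rewrite cReZ.
  have iW : im W = y * eta by rewrite cImZ.
  have := hin x W B x16; rewrite rW iW => h.
  have h1 : x%:R ^+ 2 / 2 <= y * x%:R <= 2 * x%:R ^+ 2 by rewrite expr2; apply/andP; split; nra.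
  have h2 : 2 <= y * eta <= 2 * x%:R.
    apply/andP; split; first by nra.
    by apply: le_trans y2; rewrite ler_piMr // ltW.
  have -> : \sum_(1 <= n < (16 * x ^ 2).+1) (numdiv n)%:R * ((x%:R +i* eta) - (n%:R / y)%:C) ^- 4 =
    (y ^+ 4)%:C * \sum_(1 <= n < (16 * x ^ 2).+1) (numdiv n)%:R * (W - n%:R) ^- 4.
    rewrite mulr_sumr; apply: eq_bigr => n _; rewrite mulrCA; congr (_ * _).
    have -> : W - n%:R = y%:C * ((x%:R +i* eta) - (n%:R / y)%:C).
      by rewrite /W mulrBr -[in RHS]rmorphM mulrCA mulfV ?lt0r_neq0 // mulr1 rmorph_nat.
    have yC : y%:C != 0 :> R[i] by rewrite -nc_gt0 nc_real normr_gt0 lt0r_neq0.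
    set w := _ - _; have -> : (y ^+ 4)%:C = y%:C ^+ 4 by rewrite rmorphXn.
    by rewrite exprMn [(_ * w ^+ 4)^-1]invfM [RHS]mulrA mulfV ?mul1r // expf_neq0.
  rewrite ncM nc_real ger0_norm ?exprn_ge0 ?(ltW y0) //.
  apply: le_trans (_ : y ^+ 4 * (C0 * (V * (y * eta) ^- 4)) <= _).
    by rewrite ler_wpM2l ?exprn_ge0 ?(ltW y0) //; apply: h.
  by rewrite le_eqVlt; apply/orP; left; apply/eqP; field; rewrite !lt0r_neq0.
have G0 : 0 <= C0 * V * eta ^- 4.
  by rewrite !mulr_ge0 ?invr_ge0 ?exprn_ge0 ?(ltW e0) ?(ltW C00) //; lra.
have := grid_upper x16 eta01 delta01 Ex small mE G0 hG.
move=> h; apply: le_trans h _.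
have -> : eta ^- 7 * (V / x%:R) = (eta ^- 7 * V) / x%:R by rewrite mulrA.
rewrite [leRHS]mulrA ler_wpM2r ?invr_ge0 //.
have ei : 1 <= eta^-1 by rewrite -invr1 lef_pV2 ?posrE.
have e74 : eta ^- 4 <= eta ^- 7 by rewrite !invX ler_weXn2l.
have e70 : 1 <= eta ^- 7 by rewrite invX exprn_ege1.
set u := eta ^- 7 in e74 e70 *.
have uV : u <= u * V by rewrite ler_peMr //; lra.
have -> : C0 * V * eta ^- 4 * (2 ^+ 7 * eta ^- 3) = C0 * 2 ^+ 7 * (u * V).
  by rewrite /u; field; rewrite lt0r_neq0.
rewrite !mulrDl mul1r lerD2r; apply: lerD; last by lra.
by rewrite ler_wpM2l ?exprn_ge0 //; lra.
Qed.

End GridUpper.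

(** * Exponential sums over the grid *)

Section Fresnel.
Variable R : realType.
Local Notation nc := (@Normc.normc R).
Local Notation re := (@complex.Re R).
Local Notation im := (@complex.Im R).
Local Open Scope complex_scope.

Lemma expR_ge_pow (n : nat) (y : R) : 0 <= y -> (y / n%:R) ^+ n <= expR y.
Proof.
case: n => [|n] y0; first by rewrite expr0 -[leLHS]expR0 ler_expR.
have -> : expR y = expR (y / n.+1%:R) ^+ n.+1.
  by rewrite -expRM_natl; congr expR; field; rewrite lt0r_neq0 // ltr0n.
have h := expR_ge1Dx (y / n.+1%:R).
have p : 0 <= y / n.+1%:R by rewrite divr_ge0.
set t := y / n.+1%:R in h p *; clearbody t.
by apply: lerXn2r; rewrite ?nnegrE ?expR_ge0 //; lra.
Qed.

Definition SK (K : nat) (q : R[i]) : R[i] := \sum_(h < K) (h%:R) ^+ 3 * q ^+ h.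

(** The tail of the series, expanded by h = K + j into the closed forms of the sums of j^i q^j. At K
    = 0 it is the Eulerian form of [Sq]. *)
Lemma SK_tail (K : nat) (q : R[i]) : 1 - q != 0 ->
  SK K q + q ^+ K * (K%:R ^+ 3 / (1 - q) + 3 * K%:R ^+ 2 * q / (1 - q) ^+ 2 +
    3 * K%:R * (q + q ^+ 2) / (1 - q) ^+ 3 + (q + 4 * q ^+ 2 + q ^+ 3) / (1 - q) ^+ 4) = Sq q.
Proof.
move=> q1; elim: K => [|K <-].
  by rewrite /SK big_ord0 /Sq expr0; field; rewrite q1.
rewrite /SK big_ord_recr /= -/(SK K q) -addrA; congr (_ + _).
by rewrite [q ^+ K.+1]exprSr -[K.+1%:R]natr1; set N : R[i] := K%:R; set Q := q ^+ K; field; rewrite q1.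
Qed.

Lemma SK_approx (kap eps : R) : 0 < kap -> 0 < eps -> exists K0 : nat,
  forall K t, (K0 <= K)%N -> kap <= im t -> nc (SK K (ce t) - Sq (ce t)) <= eps.
Proof.
move=> k0 e0.
pose w := 1 - expR (- (2 * pi * kap)).
have p0 : 0 < pi :> R := pi_gt0 R.
have pk : 0 < 2 * pi * kap by rewrite !mulr_gt0.
have w0 : 0 < w by rewrite subr_gt0 expR_lt1 oppr_lt0.
have w1 : w <= 1 by rewrite /w; have := expR_gt0 (- (2 * pi * kap)); lra.
pose A := 16 / (w ^+ 4 * kap ^+ 4).
have A0 : 0 < A by rewrite divr_gt0 ?mulr_gt0 ?exprn_gt0.
exists (Num.truncn (A / eps)).+1 => n t hn ht.
have nA : A / eps < n%:R.
  have h0 : 0 <= A / eps by rewrite divr_ge0 // ltW.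
  by have /andP[_ h1] := truncn_itv h0; apply: lt_le_trans h1 _; rewrite ler_nat.
have [N eN] : exists N : R, N = n%:R by eexists.
have N1 : 1 <= N by rewrite eN ler1n (leq_trans _ hn).
have N0 : 0 < N by apply: lt_le_trans N1.
set q := ce t.
have nq : nc q <= 1 - w by rewrite nc_ce /w subKr ler_expR lerN2 ler_pM2l // mulr_gt0.
have nv : w <= nc (1 - q).
  by apply: le_trans (nc_leB _ _); rewrite Normc.normc1; lra.
have v0 : 1 - q != 0 by rewrite -nc_gt0 (lt_le_trans w0).
rewrite -(SK_tail n v0) opprD addrA subrr add0r ncN ncM ncX.
have q1 : nc q <= 1 by lra.
have qX k : nc (q ^+ k) <= 1 by rewrite ncX exprn_ile1 // nc_ge0.
have vX k : nc ((1 - q) ^- k) <= w ^- k by rewrite ncXV; exact: pow_anti.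
have nN k : nc ((n%:R : R[i]) ^+ k) <= N ^+ k by rewrite ncX nc_nat eN.
have nn (j : nat) : nc (j%:R : R[i]) <= j%:R by rewrite nc_nat.
have wi : 1 <= w^-1 by rewrite -invr1 lef_pV2 ?posrE.
have hr : nc (n%:R ^+ 3 / (1 - q) + 3 * n%:R ^+ 2 * q / (1 - q) ^+ 2 +
    3 * n%:R * (q + q ^+ 2) / (1 - q) ^+ 3 + (q + 4 * q ^+ 2 + q ^+ 3) / (1 - q) ^+ 4) <= 16 * N ^+ 3 * w ^- 4.
  apply: le_trans (_ : N ^+ 3 * w ^- 1 + 3 * N ^+ 2 * 1 * w ^- 2 + 3 * N ^+ 1 * (1 + 1) * w ^- 3 + (1 + 4 * 1 + 1) * w ^- 4 <= _).
    apply: ncD_ub; [apply: ncD_ub; [apply: ncD_ub|]|].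
    - by apply: ncM_ub => //; exact: (vX 1%N).
    - by do !apply: ncM_ub => //.
    - do !apply: ncM_ub => //; first exact: (nN 1%N).
      by apply: ncD_ub.
    - apply: ncM_ub => //; apply: ncD_ub => //; apply: ncD_ub => //; exact: ncM_ub.
  have iw k : (k <= 4)%N -> w ^- k <= w ^- 4 by move=> hk; rewrite !invX ler_weXn2l.
  have iN k : (k <= 3)%N -> N ^+ k <= N ^+ 3 by move=> hk; rewrite ler_weXn2l.
  have w40 : 0 <= w ^- 4 by rewrite invr_ge0 exprn_ge0 // ltW.
  have T1 k l : (k <= 3)%N -> (l <= 4)%N -> N ^+ k * w ^- l <= N ^+ 3 * w ^- 4.
    by move=> hk hl; apply: ler_pM; rewrite ?iw ?iN ?invr_ge0 ?exprn_ge0 // ltW.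
  have := T1 3%N 1%N isT isT; have := T1 2%N 2%N isT isT; have := T1 1%N 3%N isT isT; have := T1 0%N 4%N isT isT.
  rewrite expr0; set P := N ^+ 3 * w ^- 4; set P1 := N ^+ 3 * _; set P2 := N ^+ 2 * _; set P3 := N ^+ 1 * _.
  have -> : 16 * N ^+ 3 * w ^- 4 = 16 * P by rewrite -mulrA.
  have -> : 3 * N ^+ 2 * 1 * w ^- 2 = 3 * P2 by rewrite mulr1 -mulrA.
  have -> : 3 * N ^+ 1 * (1 + 1) * w ^- 3 = 6 * P3 by rewrite /P3; ring.
  lra.
have hq : nc q ^+ n <= (kap * N) ^- 4.
  apply: le_trans (_ : expR (- (2 * pi * kap)) ^+ n <= _).
    by rewrite lerXn2r ?nnegrE ?nc_ge0 ?expR_ge0 //; move: nq; rewrite /w; lra.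
  rewrite -expRM_natl -eN mulrN expRN lef_pV2 ?posrE ?exprn_gt0 ?mulr_gt0 ?expR_gt0 //.
  have y0 : 0 <= N * (2 * pi * kap) by rewrite mulr_ge0 // ltW.
  apply: le_trans (expR_ge_pow 4 y0); rewrite lerXn2r ?nnegrE ?mulr_ge0 ?(ltW k0) ?(ltW N0) ?(ltW p0) //.
  have p2 : 2 <= pi :> R := pi_ge2 R.
  have -> : N * (2 * pi * kap) / 4 = kap * N * (pi / 2) by field.
  rewrite ler_peMr ?mulr_ge0 ?(ltW k0) ?(ltW N0) //; lra.
apply: le_trans (_ : (kap * N) ^- 4 * (16 * N ^+ 3 * w ^- 4) <= _).
  by apply: ler_pM; rewrite ?exprn_ge0 ?nc_ge0.
have -> : (kap * N) ^- 4 * (16 * N ^+ 3 * w ^- 4) = A / N.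
  by rewrite /A; field; rewrite !lt0r_neq0.
rewrite ler_pdivrMr // mulrC -ler_pdivrMr //; rewrite -eN in nA; exact: ltW.
Qed.

Lemma ce_arg (z : R[i]) (d : R) : exists u : R[i],
  [/\ ce (d%:C * z) = cexp u, re u = - (2 * pi * (d * im z)) & nc u = 2 * pi * nc z * `|d|].
Proof.
have p0 : 0 < pi :> R := pi_gt0 R.
exists ((2 * pi)%:C * (d%:C * z) * 'i); split.
- rewrite /ce; congr cexp; case: z => a b /=.
  by apply/eqP; rewrite eq_complex /=; apply/andP; split; apply/eqP; ring.
- by case: z => a b /=; ring.
- rewrite !ncM !nc_real ger0_norm ?mulr_ge0 ?(ltW p0) //.
  have -> : nc 'i = 1 by rewrite /Normc.normc /= expr0n expr1n add0r sqrtr1.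
  by rewrite mulr1 mulrA mulrAC.
Qed.

Lemma cexp_sub1_ub (u : R[i]) : re u <= 0 -> nc u <= 2^-1 -> nc (cexp u - 1) <= 2 * nc u.
Proof.
move=> h1 h2; have := cexp_taylor h1; set r := nc u in h2 *.
have r0 : 0 <= r := nc_ge0 _.
move=> h; have -> : cexp u - 1 = (cexp u - 1 - u - u ^+ 2 / 2) + (u + u ^+ 2 * 2^-1) by ring.
apply: le_trans (ncD_le _ _) _.
have : nc (u + u ^+ 2 * 2^-1) <= r + r ^+ 2 * 2^-1.
  by apply: ncD_ub => //; apply: ncM_ub; rewrite ?ncX // ncV (nc_nat R 2).
have : r ^+ 2 <= 2^-1 * r by rewrite expr2 ler_wpM2r.
have : r ^+ 3 <= 4^-1 * r.
  have -> : r ^+ 3 = r * r * r by rewrite !exprS expr0 mulr1 mulrA.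
  by rewrite ler_wpM2r //; nra.
by rewrite -/r; lra.
Qed.

Lemma cexp_sub1_lb' (u : R[i]) : nc u <= 2^-1 -> nc u / 4 <= nc (cexp u - 1).
Proof.
have core v : re v <= 0 -> nc v <= 2^-1 -> nc v / 4 <= nc (cexp v - 1).
  move=> h1 h2; have := cexp_taylor h1; set r := nc v in h2 *.
  have r0 : 0 <= r := nc_ge0 _.
  move=> h; have -> : cexp v - 1 = v - - ((cexp v - 1 - v - v ^+ 2 / 2) + v ^+ 2 * 2^-1) by ring.
  apply: le_trans (nc_leB _ _); rewrite ncN -/r.
  have : nc (cexp v - 1 - v - v ^+ 2 / 2 + v ^+ 2 * 2^-1) <= 2 * r ^+ 3 + r ^+ 2 * 2^-1.
    by apply: ncD_ub => //; apply: ncM_ub; rewrite ?ncX // ncV (nc_nat R 2).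
  have : r ^+ 2 <= 2^-1 * r by rewrite expr2 ler_wpM2r.
  have : r ^+ 3 <= 4^-1 * r.
    have -> : r ^+ 3 = r * r * r by rewrite !exprS expr0 mulr1 mulrA.
    by rewrite ler_wpM2r //; nra.
  lra.
move=> hu; have [h|h] := leP (re u) 0; first exact: core.
have hN : re (- u) <= 0 by rewrite cReN; lra.
have := core (- u) hN; rewrite ncN => /(_ hu) h1.
have e1 : cexp u * cexp (- u) = 1.
  rewrite -cexpD subrr /cexp /= expR0 cos0 sin0 mulr1 mulr0 //.
have -> : cexp u - 1 = - (cexp u * (cexp (- u) - 1)) by rewrite mulrBr e1 mulr1 opprB.
rewrite ncN ncM nc_cexp; apply: le_trans h1 _.
by rewrite ler_peMl ?nc_ge0 // -expR0 ler_expR ltW.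
Qed.

(** * The Kusmin-Landau inequality at a complex point *)

Section KL.
Variables (z : R[i]) (x : R).
Hypothesis x1 : 1 <= x.
Hypothesis rez : re z = x.
Hypothesis imz : 0 <= im z <= 1.
Let phi (d : R) := ce (d%:C * z) - 1.
Let Z := 2 * pi * nc z.

Lemma Z_lb : 4 * x <= Z.
Proof.
have p2 : 2 <= pi :> R := pi_ge2 R.
have : x <= nc z by apply: le_trans (Re_le_nc _); rewrite rez ler_norm.
move=> h; rewrite /Z; have hx := x1.
apply: le_trans (_ : 2 * 2 * x <= _); first by lra.
by apply: ler_pM => //; lra.
Qed.

Lemma Z_ub : Z <= 16 * x.
Proof.
have p4 := @pi_le4 R; have p0 := pi_gt0 R; have hx := x1.
have : nc z <= 2 * x.
  apply: le_trans (nc_le_ReIm _) _; rewrite rez ger0_norm; last lra.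
  by case/andP: imz => h1 h2; rewrite ger0_norm //; lra.
move=> h; rewrite /Z.
apply: le_trans (_ : 2 * 4 * (2 * x) <= _); last by lra.
by apply: ler_pM => //; rewrite ?nc_ge0 //; lra.
Qed.

Let Z0 : 0 < Z. Proof. by apply: lt_le_trans Z_lb; rewrite mulr_gt0 // (lt_le_trans _ x1). Qed.

Lemma phi_lb d : 64 * x * `|d| <= 1 -> Z * `|d| / 4 <= nc (phi d).
Proof.
move=> h; have [u [e1 e2 e3]] := ce_arg z d; rewrite /phi e1 -e3.
apply: cexp_sub1_lb'; rewrite e3 -/Z.
apply: le_trans (_ : 16 * x * `|d| <= _); first by rewrite ler_wpM2r // Z_ub.
lra.
Qed.

Lemma phi_neq0 d : d != 0 -> 64 * x * `|d| <= 1 -> phi d != 0.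
Proof.
move=> d0 h; rewrite -nc_gt0; apply: lt_le_trans (phi_lb h).
by rewrite divr_gt0 // mulr_gt0 // normr_gt0.
Qed.

Lemma phi_inc d e : d <= e -> 64 * x * `|d| <= 1 -> 64 * x * `|e| <= 1 ->
  nc (phi e - phi d) <= 6 * (Z * (e - d)).
Proof.
move=> de hd he; have hx := x1.
have -> : phi e - phi d = ce (d%:C * z) * phi (e - d).
  rewrite /phi mulrBr mulr1 -ceD -mulrDl -rmorphD /= [d + _]addrC subrK; ring.
have b1 : nc (ce (d%:C * z)) <= 3.
  rewrite nc_ce cImZ.
  have p4 := @pi_le4 R; have p0 := pi_gt0 R.
  have hd1 : `|d| <= 32^-1.
    have : 1 * `|d| <= x * `|d| by rewrite ler_wpM2r.
    have -> : x * `|d| = (64 * x * `|d|) / 64 by field.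
    lra.
  have h : - (2 * pi * (d * im z)) <= 2^-1.
    apply: le_trans (ler_norm _) _; rewrite normrN !normrM (ger0_norm (ltW p0)) normr_nat.
    case/andP: imz => i0 i1; rewrite (ger0_norm i0).
    apply: le_trans (_ : 2 * 4 * (32^-1 * 1) <= _); last by lra.
    by apply: ler_pM; rewrite ?mulr_ge0 ?normr_ge0 // ?(ltW p0) //; [lra | apply: ler_pM; rewrite ?normr_ge0].
  apply: le_trans (_ : expR (2^-1) <= _); first by rewrite ler_expR.
  have := expR_ge1Dx (- 2^-1 : R); rewrite expRN => h'.
  have e0 := expR_gt0 (2^-1 : R).
  have : expR (2^-1) * (1 + - 2^-1) <= expR (2^-1) * (expR (2^-1))^-1 :> R by rewrite ler_pM2l.
  rewrite divff ?lt0r_neq0 //; lra.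
have b2 : nc (phi (e - d)) <= 2 * (Z * (e - d)).
  have [u [e1 e2 e3]] := ce_arg z (e - d); rewrite /phi e1.
  have en : `|e - d| = e - d by rewrite ger0_norm // subr_ge0.
  rewrite -[X in Z * X]en -e3; apply: cexp_sub1_ub.
    rewrite e2 oppr_le0 !mulr_ge0 ?subr_ge0 // ?pi_ge0 //; by case/andP: imz.
  rewrite e3 -/Z; apply: le_trans (_ : 16 * x * `|e - d| <= _); first by rewrite ler_wpM2r // Z_ub.
  have : 64 * x * `|e - d| <= 64 * x * (`|e| + `|d|) by rewrite ler_wpM2l ?ler_normB // mulr_ge0 //; lra.
  lra.
apply: le_trans (_ : 3 * (2 * (Z * (e - d))) <= _); last by lra.
exact: ncM_ub.
Qed.

Let A := 96 / Z.
Let A_ub : A <= 24 / x.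
Proof.
have hx := x1; have -> : 24 / x = 96 / (4 * x) by field; apply/eqP; lra.
by rewrite /A ler_wpM2l // lef_pV2 ?posrE ?Z_lb // mulr_gt0 //; lra.
Qed.

Lemma inv_phi_lb d : d != 0 -> 64 * x * `|d| <= 1 -> nc (phi d)^-1 <= A / `|d|.
Proof.
move=> d0 h; have n0 : 0 < `|d| by rewrite normr_gt0.
rewrite ncV; apply: le_trans (_ : (Z * `|d| / 4)^-1 <= _).
  by rewrite lef_pV2 ?posrE ?phi_lb ?nc_gt0 ?phi_neq0 // divr_gt0 // mulr_gt0.
have -> : (Z * `|d| / 4)^-1 = 4 / Z / `|d| by field; rewrite !lt0r_neq0.
rewrite ler_wpM2r ?invr_ge0 // /A ler_wpM2r ?invr_ge0 ?(ltW Z0) //; lra.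
Qed.

(** The bound is A (1/d - 1/e), so it telescopes along a nondecreasing sequence of differences of
    constant sign. *)
Lemma inv_phi_inc d e : d <= e -> 0 < d * e -> 64 * x * `|d| <= 1 -> 64 * x * `|e| <= 1 ->
  nc ((phi e)^-1 - (phi d)^-1) <= A * ((e - d) / (d * e)).
Proof.
move=> de p hd he.
have d0 : d != 0 by apply: contraTneq p => ->; rewrite mul0r ltxx.
have e0 : e != 0 by apply: contraTneq p => ->; rewrite mulr0 ltxx.
have f1 := phi_neq0 d0 hd; have f2 := phi_neq0 e0 he.
have -> : (phi e)^-1 - (phi d)^-1 = - (phi e - phi d) / (phi d * phi e) by field; rewrite f1 f2.
rewrite ncM ncN ncV ncM.
have nde : d * e = `|d| * `|e| by rewrite -normrM gtr0_norm.
have nd : 0 < `|d| by rewrite normr_gt0.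
have ne : 0 < `|e| by rewrite normr_gt0.
apply: le_trans (_ : 6 * (Z * (e - d)) * ((Z * `|d| / 4) * (Z * `|e| / 4))^-1 <= _).
  apply: ler_pM; rewrite ?nc_ge0 ?invr_ge0 ?mulr_ge0 ?nc_ge0 ?phi_inc //.
  rewrite lef_pV2 ?posrE; last 2 first.
  - by rewrite mulr_gt0 ?nc_gt0.
  - by rewrite mulr_gt0 // divr_gt0 // mulr_gt0.
  by apply: ler_pM; rewrite ?phi_lb // divr_ge0 // mulr_ge0 // ltW.
rewrite nde le_eqVlt; apply/orP; left; apply/eqP.
by rewrite /A; field; rewrite !lt0r_neq0.
Qed.

(* The Kusmin-Landau argument: partial summation against [1 / phi] of the differences of [F]. *)
Lemma KL_segment (F : nat -> R) (W D s : R) (p r : nat) : 0 < D -> (p <= r)%N -> `|s| = 1 ->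
  (forall i, (p <= i <= r)%N -> nc (ce ((F i)%:C * z)) <= W) ->
  (forall i, (p <= i < r)%N -> D <= s * (F i.+1 - F i)) ->
  (forall i, (p <= i < r)%N -> 64 * x * `|F i.+1 - F i| <= 1) ->
  (forall i, (p <= i)%N -> (i.+1 < r)%N -> F i.+1 - F i <= F i.+2 - F i.+1) ->
  nc (\sum_(p <= i < r) ce ((F i)%:C * z)) <= 3 * W * (24 / x / D).
Proof.
move=> D0 pr s1 hW hD hs hmono; have hx := x1.
pose d i := F i.+1 - F i.
have W0 : 0 <= W by apply: le_trans (hW p _); rewrite ?nc_ge0 // leqnn.
have xD : 0 < 24 / x / D by rewrite !divr_gt0 //; lra.
have ss : s * s = 1 by rewrite -expr2 -real_normK ?num_real // s1 expr1n.
have Dd i : (p <= i < r)%N -> D <= `|d i|.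
  move=> hi; apply: le_trans (hD i hi) _; apply: le_trans (ler_norm _) _.
  by rewrite normrM s1 mul1r.
have dn0 i : (p <= i < r)%N -> d i != 0.
  by move=> hi; rewrite -normr_gt0 (lt_le_trans D0) ?Dd.
pose c i := (phi (d i))^-1.
pose u i := ce ((F i)%:C * z).
pose g i := A * (s / d i).
have sd i : (p <= i < r)%N -> s / d i = `|d i|^-1.
  move=> hi; have e : `|d i| = s * d i.
    by rewrite -[LHS]mul1r -s1 -normrM gtr0_norm // (lt_le_trans D0) // hD.
  have sn : s != 0 by rewrite -normr_gt0 s1.
  have -> : s = s^-1 by rewrite -[RHS]mul1r -ss mulfK.
  by rewrite e invfM.
have A0 : 0 < A by rewrite divr_gt0.
have gub i : (p <= i < r)%N -> 0 <= g i <= 24 / x / D.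
  move=> hi; rewrite /g sd // mulr_ge0 ?invr_ge0 ?(ltW A0) //=.
  apply: ler_pM; rewrite ?invr_ge0 ?(ltW A0) ?A_ub // lef_pV2 ?posrE ?Dd //.
  by rewrite (lt_le_trans D0) // Dd.
have uc i : (p <= i < r)%N -> u i = c i * (u i.+1 - u i).
  move=> hi; have -> : u i.+1 - u i = phi (d i) * u i.
    have -> : u i.+1 = ce ((d i)%:C * z) * u i.
      by rewrite /u -ceD -mulrDl -rmorphD /= /d subrK.
    by rewrite /phi mulrBl mul1r.
  by rewrite mulrA /c mulVf ?mul1r // phi_neq0 ?dn0 ?hs.
have ncc i : (p <= i < r)%N -> nc (c i) <= 24 / x / D.
  move=> hi; apply: le_trans (inv_phi_lb (dn0 _ hi) (hs _ hi)) _.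
  by rewrite -sd // -/(g i); case/andP: (gub i hi).
have ncd i : (p <= i)%N -> (i.+1 < r)%N -> nc (c i.+1 - c i) <= s * (g i - g i.+1).
  move=> h1 h2.
  have hi : (p <= i < r)%N by rewrite h1 ltnW.
  have hi1 : (p <= i.+1 < r)%N by rewrite leqW.
  have pos : 0 < d i * d i.+1.
    have -> : d i * d i.+1 = (s * d i) * (s * d i.+1) by rewrite mulrACA ss mul1r.
    by rewrite mulr_gt0 // (lt_le_trans D0) // hD.
  apply: le_trans (inv_phi_inc (hmono _ h1 h2) pos (hs _ hi) (hs _ hi1)) _.
  have -> : g i - g i.+1 = s * (A * ((d i.+1 - d i) / (d i * d i.+1))).
    by rewrite /g; field; rewrite !dn0.
  by rewrite mulrA ss mul1r.
move: pr; rewrite leq_eqVlt => /orP[/eqP->|pr].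
  by rewrite big_geq // Normc.normc0 mulr_ge0 ?(ltW xD) // mulr_ge0.
have e1 : forall k, (p < k)%N -> (k <= r)%N -> \sum_(p <= i < k) u i =
   c k.-1 * u k - c p * u p - \sum_(p <= i < k.-1) (c i.+1 - c i) * u i.+1.
  elim=> // k IH; rewrite ltnS leq_eqVlt => /orP[/eqP<-|pk] kr.
    by rewrite big_nat1 /= big_geq // subr0 {1}uc ?leqnn // mulrBr.
  rewrite big_nat_recr ?(ltnW pk) //= IH //; last by rewrite ltnW.
  have uk : u k = c k * (u k.+1 - u k) by rewrite -uc // ltnW.
  rewrite [X in _ + X = _]uk.
  case: k pk {IH} kr uk => // k pk kr uk.
  rewrite [in RHS]big_nat_recr //=; ring.
rewrite e1 //.
have e2 : nc (\sum_(p <= i < r.-1) (c i.+1 - c i) * u i.+1) <= W * (24 / x / D).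
  apply: le_trans (nc_sum _ _ _) _.
  apply: le_trans (_ : \sum_(p <= i < r.-1) W * (s * (g i - g i.+1)) <= _).
    rewrite big_nat [leRHS]big_nat; apply: ler_sum => i /andP[i1 i2].
    have i3 : (i.+1 < r)%N by case: (r) i2 pr.
    rewrite ncM mulrC; apply: ler_pM; rewrite ?nc_ge0 ?ncd // hW //.
    by rewrite leqW //= ltnW.
  have hr : (p <= r.-1)%N by case: (r) pr.
  have rr : (r.-1 < r)%N by case: (r) pr.
  rewrite -!mulr_sumr ler_wpM2l //.
  have -> : \sum_(p <= i < r.-1) (g i - g i.+1) = g p - g r.-1.
    rewrite -[RHS]opprB -(telescope_sumr g hr) -sumrN.
    by apply: eq_bigr => i _; rewrite opprB.
  have /andP[g1 g2] : 0 <= g p <= 24 / x / D by rewrite gub // leqnn.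
  have /andP[g3 g4] : 0 <= g r.-1 <= 24 / x / D by rewrite gub // hr.
  apply: le_trans (ler_norm _) _; rewrite normrM s1 mul1r ler_norml; apply/andP; split; lra.
have hr : (p <= r.-1 < r)%N by case: (r) pr => // k; rewrite ltnS leqnn andbT.
have e3 : nc (c r.-1 * u r) <= W * (24 / x / D).
  by rewrite mulrC; apply: ncM_ub; [apply: hW; rewrite leqnn ltnW | exact: ncc].
have e4 : nc (c p * u p) <= W * (24 / x / D).
  by rewrite mulrC; apply: ncM_ub; [apply: hW; rewrite leqnn ltnW | apply: ncc; rewrite leqnn].
apply: le_trans (ncB_ub (ncB_ub e3 e4) e2) _.
by rewrite le_eqVlt; apply/orP; left; apply/eqP; ring.
Qed.

End KL.

Lemma mono_split (d : nat -> R) (t : R) (m : nat) :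
  (forall i, (i.+1 < m)%N -> d i <= d i.+1) ->
  exists p, [/\ (p <= m)%N, forall i, (i < p)%N -> d i < t & forall i, (p <= i < m)%N -> t <= d i].
Proof.
elim: m => [|m IH] hd; first by exists 0%N; split=> // i; rewrite ltn0 andbF.
have [|p [pm h1 h2]] := IH; first by move=> i im; apply: hd; rewrite ltnW.
have [h|h] := leP t (d m).
  exists p; split=> //; first exact: leqW.
  by move=> i /andP[i1]; rewrite ltnS leq_eqVlt => /orP[/eqP->//|im]; rewrite h2 // i1.
exists m.+1; split=> // [i|i]; last by rewrite leqNgt; case: leqP.
have mono j : (j <= m)%N -> d (m - j)%N <= d m.
  elim: j => [|j IHj] jm; first by rewrite subn0.
  apply: le_trans (IHj (ltnW jm)).
  have -> : (m - j = (m - j.+1).+1)%N by rewrite subnSK.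
  by apply: hd; rewrite -subSn // ltnS leq_subLR addSn ltnS leq_addl.
rewrite ltnS => im; apply: le_lt_trans h.
by rewrite -(subKn im); apply: mono; rewrite leq_subr.
Qed.

Lemma amgm2 (a b t : R) : 0 <= a -> 0 <= b -> 0 < t -> 2 * Num.sqrt (a * b) <= a / t + b * t.
Proof.
move=> a0 b0 t0.
have sa : a = Num.sqrt a ^+ 2 by rewrite sqr_sqrtr.
have sb : b = Num.sqrt b ^+ 2 by rewrite sqr_sqrtr.
have st : t = Num.sqrt t ^+ 2 by rewrite sqr_sqrtr // ltW.
have r0 : 0 < Num.sqrt t by rewrite sqrtr_gt0.
rewrite sqrtrM // [in leRHS]sa [in leRHS]sb st.
set u := Num.sqrt a; set v := Num.sqrt b; set r := Num.sqrt t in r0 *.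
rewrite -subr_ge0.
have -> : u ^+ 2 / r ^+ 2 + v ^+ 2 * r ^+ 2 - 2 * (u * v) = (u / r - v * r) ^+ 2 by field; rewrite lt0r_neq0.
exact: sqr_ge0.
Qed.

(** A discrete stationary phase bound. The phase is convex in theta: its differences grow by at
    least delta^2 per step, so those below D = delta / sqrt x in absolute value number at most 2 /
    (delta sqrt x) + 1 and are summed trivially. On each outer part [KL_segment] gives 3 * 24 /
    (delta sqrt x). After multiplication by delta the constant is 2 * 72 + 3 = 147. The exponential
    decay comes from the minimum 2 sqrt(ab) of the phase. *)
Lemma fresnel (x I : nat) (eta delta a b : R) : (0 < x)%N -> 0 < eta <= 1 -> 0 < delta <= 2^-1 ->
  1 <= a -> 1 <= b -> delta ^+ 2 * x%:R <= 1 ->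
  128 * delta * (a + b) * expR (I%:R * delta) * x%:R <= 1 ->
  delta * nc (\sum_(i < I.*2.+1)
     ce ((a / expR (delta * (i%:R - I%:R)) + b * expR (delta * (i%:R - I%:R)))%:C * (x%:R +i* eta)))
  <= 147 * (Num.sqrt x%:R)^-1 * expR (- (4 * pi * eta * Num.sqrt (a * b))).
Proof.
move=> x0 /andP[e0 e1] /andP[d0 d1] a1 b1 dx small.
have xR : 1 <= x%:R :> R by rewrite ler1n.
set z := x%:R +i* eta; set m := I.*2.+1; set E := expR _ in small.
set W := expR _.
pose q := expR delta.
have q1 : 1 + delta <= q by exact: expR_ge1Dx.
have q0 : 0 < q by exact: expR_gt0.
have q2 : q <= 1 + 2 * delta.
  have := expR_ge1Dx (- delta); rewrite expRN -/q => h.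
  have : q * (1 + - delta) <= 1 by rewrite -[leRHS](divff (lt0r_neq0 q0)) ler_pM2l.
  by nra.
pose al i := expR (delta * (i%:R - I%:R)).
pose F i := a / al i + b * al i.
have al0 i : 0 < al i by exact: expR_gt0.
have alS i : al i.+1 = q * al i.
  by rewrite /al /q -expRD; congr expR; rewrite -[i.+1%:R]natr1; ring.
have [r er] : exists r : R, r = Num.sqrt x%:R by eexists.
rewrite -er.
have s0 : 0 < r by rewrite er sqrtr_gt0; lra.
have sx : r ^+ 2 = x%:R by rewrite er sqr_sqrtr.
have ab1 : 1 <= Num.sqrt (a * b).
  by rewrite -sqrtr1 ler_wsqrtr // mulr_ege1.
have F_lb i : 2 * Num.sqrt (a * b) <= F i by apply: amgm2 => //; lra.
have Wb i : nc (ce ((F i)%:C * z)) <= W.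
  rewrite nc_ce cImZ ler_expR lerN2 /=.
  have -> : 4 * pi * eta * Num.sqrt (a * b) = 2 * pi * eta * (2 * Num.sqrt (a * b)) :> R by ring.
  have -> : 2 * pi * (F i * eta) = 2 * pi * eta * F i by ring.
  by rewrite ler_wpM2l // !mulr_ge0 ?pi_ge0 // ltW.
pose d i := F i.+1 - F i.
have dgap i : d i + delta ^+ 2 <= d i.+1.
  have -> : d i.+1 = d i + F i.+1 / q * (q - 1) ^+ 2.
    by rewrite /d /F !alS; field; rewrite !lt0r_neq0.
  rewrite lerD2l; apply: le_trans (_ : 1 * (q - 1) ^+ 2 <= _).
    by rewrite mul1r; apply: lerXn2r; rewrite ?nnegrE; lra.
  rewrite ler_wpM2r ?sqr_ge0 // ler_pdivlMr // mul1r.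
  by have h := F_lb i.+1; lra.
have dmono i : d i <= d i.+1.
  by apply: le_trans (dgap i); rewrite lerDl sqr_ge0.
have E0 : 0 < E by exact: expR_gt0.
have d_ub i : (i < m)%N -> 64 * x%:R * `|d i| <= 1.
  move=> im.
  have aE : al i <= E.
    rewrite ler_expR mulrC ler_wpM2r ?(ltW d0) // lerBlDr -natrD ler_nat addnn.
    by move: im; rewrite /m ltnS.
  have aiE : (al i)^-1 <= E.
    by rewrite -expRN ler_expR -mulrN mulrC ler_wpM2r ?(ltW d0) // opprB lerBlDr lerDl.
  have h1 : `|d i| <= (a + b) * E * (2 * delta).
    have -> : d i = b * al i * (q - 1) - a / al i * (1 - q^-1).
      by rewrite /d /F alS; field; rewrite !lt0r_neq0.
    have qi : 0 <= 1 - q^-1 <= 2 * delta.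
      have : 1 * q^-1 <= q * q^-1 by rewrite ler_wpM2r ?invr_ge0 ?(ltW q0) //; lra.
      have : (2 - q) * q <= 1 by have := sqr_ge0 (q - 1); rewrite expr2; lra.
      rewrite -ler_pdivlMr // mul1r divff ?lt0r_neq0 //; move: q2; lra.
    apply: le_trans (ler_normB _ _) _.
    rewrite !normrM (gtr0_norm (al0 i)) (ger0_norm (_ : 0 <= b)) ?(ger0_norm (_ : 0 <= a)) //; try lra.
    rewrite normfV (gtr0_norm (al0 i)) (ger0_norm (_ : 0 <= q - 1)); last by lra.
    case/andP: qi => qi1 qi2; rewrite (ger0_norm qi1).
    have -> : (a + b) * E * (2 * delta) = b * E * (2 * delta) + a * E * (2 * delta) by ring.
    have ai0 : 0 <= (al i)^-1 by rewrite invr_ge0 ltW.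
    have al_ge0 := ltW (al0 i); have a_ge0 : 0 <= a by lra.
    have b_ge0 : 0 <= b by lra.
    have q_ge0 : 0 <= q - 1 by lra.
    have q_le : q - 1 <= 2 * delta by lra.
    by apply: lerD; apply: ler_pM; rewrite ?mulr_ge0 // ler_wpM2l.
  apply: le_trans (_ : 64 * x%:R * ((a + b) * E * (2 * delta)) <= _).
    by rewrite ler_wpM2l // mulr_ge0 //; lra.
  by apply: le_trans small; rewrite le_eqVlt; apply/orP; left; apply/eqP; ring.
pose D := delta / r.
have D0 : 0 < D by rewrite divr_gt0.
have eD : 24 / x%:R / D = 24 / (delta * r).
  by rewrite /D -sx; field; rewrite !lt0r_neq0.
have [p1 [p1m lo1 hi1]] := @mono_split d (- D) m (fun i _ => dmono i).
have [p2 [p2m lo2 hi2]] := @mono_split d D m (fun i _ => dmono i).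
have p12 : (p1 <= p2)%N.
  rewrite leqNgt; apply/negP => h; have := lo1 _ h.
  by have := hi2 p2; rewrite leqnn (leq_trans h p1m) => /(_ isT); clear -D0; lra.
have iz : 0 <= im z <= 1 by rewrite /= e1 ltW.
have W0 : 0 <= W by exact: expR_ge0.
have seg1 : nc (\sum_(0 <= i < p1) ce ((F i)%:C * z)) <= 3 * W * (24 / x%:R / D).
  apply: (@KL_segment z x%:R xR erefl iz F W D (-1)) => //; rewrite ?normrN1 //.
  - by move=> i /andP[_ hi]; have := lo1 i hi; rewrite /d; clear; lra.
  - by move=> i /andP[_ hi]; apply: d_ub; exact: leq_trans p1m.
  - by move=> i _ _; exact: dmono.
have seg2 : nc (\sum_(p2 <= i < m) ce ((F i)%:C * z)) <= 3 * W * (24 / x%:R / D).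
  apply: (@KL_segment z x%:R xR erefl iz F W D 1) => //; rewrite ?normr1 //.
  - by move=> i hi; rewrite mul1r; exact: hi2.
  - by move=> i /andP[_ hi]; exact: d_ub.
  - by move=> i _ _; exact: dmono.
have grow k i : d i + k%:R * delta ^+ 2 <= d (i + k)%N.
  elim: k => [|k IH]; first by rewrite mul0r addr0 addn0.
  by rewrite addnS; apply: le_trans (dgap _); rewrite -natr1; clear -IH; lra.
have cnt : (p2 - p1)%:R * delta ^+ 2 <= 2 * D + delta ^+ 2.
  have [h|h] := leqP p2 p1.
    by rewrite (eqP h) mul0r addr_ge0 ?sqr_ge0 // mulr_ge0 // ltW.
  have h3 : (p2 = (p1 + (p2 - p1).-1).+1)%N by rewrite -addnS prednK ?subn_gt0 // subnKC // ltnW.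
  have := grow (p2 - p1).-1 p1.
  have := hi1 p1; rewrite leqnn (leq_trans h p2m) => /(_ isT).
  have := lo2 (p1 + (p2 - p1).-1)%N; rewrite {2}h3 ltnS leqnn => /(_ isT).
  have -> : (p2 - p1)%:R = (p2 - p1).-1%:R + 1 :> R by rewrite natr1 prednK // subn_gt0.
  by clear; lra.
have mid : nc (\sum_(p1 <= i < p2) ce ((F i)%:C * z)) <= (p2 - p1)%:R * W.
  apply: le_trans (nc_sum _ _ _) _.
  apply: le_trans (_ : \sum_(p1 <= i < p2) W <= _); first by apply: ler_sum.
  by rewrite sumr_const_nat [leRHS]mulr_natl.
have -> : \sum_(i < m) ce ((a / expR (delta * (i%:R - I%:R)) + b * expR (delta * (i%:R - I%:R)))%:C * z) =
  \sum_(0 <= i < p1) ce ((F i)%:C * z) + \sum_(p1 <= i < p2) ce ((F i)%:C * z) + \sum_(p2 <= i < m) ce ((F i)%:C * z).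
  by rewrite -big_cat_nat //= -big_cat_nat //= big_mkord.
apply: le_trans (_ : delta * (3 * W * (24 / x%:R / D) + (p2 - p1)%:R * W + 3 * W * (24 / x%:R / D)) <= _).
  by rewrite ler_wpM2l ?(ltW d0) // !ncD_ub.
rewrite eD.
have dr : delta <= r^-1.
  rewrite -[leRHS]mul1r ler_pdivlMr // -(@ler_pXn2r _ 2) ?nnegrE ?mulr_ge0 ?(ltW d0) ?(ltW s0) //.
  by rewrite exprMn sx expr1n.
have c2 : delta * (p2 - p1)%:R <= 3 * r^-1.
  rewrite -(@ler_pM2l _ delta) //.
  apply: le_trans (_ : 2 * D + delta ^+ 2 <= _).
    by apply: le_trans cnt; rewrite le_eqVlt; apply/orP; left; apply/eqP; ring.
  have : delta * delta <= delta * r^-1 by rewrite ler_wpM2l // ltW.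
  by rewrite /D expr2; clear; lra.
have -> : delta * (3 * W * (24 / (delta * r)) + (p2 - p1)%:R * W + 3 * W * (24 / (delta * r))) =
  (144 * r^-1 + delta * (p2 - p1)%:R) * W.
  by field; rewrite !lt0r_neq0.
by rewrite ler_wpM2r //; clear -c2; lra.
Qed.

End Fresnel.

(** * Resonance *)

Section Resonance.
Variable R : realType.
Implicit Types (phi psi : nat -> R) (s : seq R).

(** The unnormalised Fejer mean: the sum over |j| < J of (J - |j|) phi(|j|). *)
Definition fej (J : nat) phi : R := J%:R * phi 0%N + 2 * \sum_(1 <= j < J) (J%:R - j%:R) * phi j.

Lemma fejS J phi : fej J.+1 phi = fej J phi + phi 0%N + 2 * \sum_(1 <= j < J.+1) phi j.
Proof.
rewrite /fej -[J.+1%:R]natr1; case: J => [|J].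
  by rewrite !big_geq //; ring.
have -> : \sum_(1 <= j < J.+2) (J.+1%:R + 1 - j%:R) * phi j =
   \sum_(1 <= j < J.+1) (J.+1%:R - j%:R) * phi j + \sum_(1 <= j < J.+2) phi j.
  rewrite (big_nat_recr J.+1) //= [X in _ = _ + X](big_nat_recr J.+1) //= addrA -big_split /=.
  congr (_ + _); last by ring.
  by apply: eq_bigr => j _; ring.
ring.
Qed.

Lemma fej_le J phi psi : (forall j, (j < J)%N -> phi j <= psi j) -> fej J phi <= fej J psi.
Proof.
case: J => [|J] h; first by rewrite /fej !big_geq // !mul0r.
rewrite /fej; apply: lerD; first by rewrite ler_wpM2l // h.
rewrite ler_wpM2l // big_nat [leRHS]big_nat; apply: ler_sum => j /andP[j0 jJ].
by rewrite ler_wpM2l ?h // subr_ge0 ler_nat ltnW.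
Qed.

Lemma eq_fej J phi psi : phi =1 psi -> fej J phi = fej J psi.
Proof. by move=> h; rewrite /fej h; under eq_bigr do rewrite h. Qed.

Lemma fejD J phi psi : fej J (fun j => phi j + psi j) = fej J phi + fej J psi.
Proof. by rewrite /fej; under eq_bigr do rewrite mulrDr; rewrite big_split /=; ring. Qed.

Lemma fejZ J a phi : fej J (fun j => a * phi j) = a * fej J phi.
Proof. by rewrite /fej; under eq_bigr do rewrite mulrCA; rewrite -mulr_sumr; ring. Qed.

Lemma fej_sum J (I : Type) (r : seq I) (P : pred I) (F : I -> nat -> R) :
  fej J (fun j => \sum_(i <- r | P i) F i j) = \sum_(i <- r | P i) fej J (F i).
Proof.
elim: r => [|i r IH].
  rewrite big_nil /fej big_nil; under eq_bigr do rewrite big_nil mulr0.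
  by rewrite big1 // !mulr0 addr0.
rewrite big_cons (@eq_fej _ _ (fun j => if P i then F i j + \sum_(i <- r | P i) F i j else \sum_(i <- r | P i) F i j)).
  by case: ifP => _; rewrite -?IH -?fejD.
by move=> j; rewrite big_cons.
Qed.

(** The Fejer kernel as the squared modulus of the sum of e^(itj) over j < J. The positivity of all
    the coefficients [Psi] rests on it. *)
Lemma fej_cos J (t : R) : fej J (fun j => cos (t * j%:R)) =
  (\sum_(0 <= j < J) cos (t * j%:R)) ^+ 2 + (\sum_(0 <= j < J) sin (t * j%:R)) ^+ 2.
Proof.
elim: J => [|J IH]; first by rewrite /fej !big_geq // expr0n /=; ring.
rewrite fejS IH [X in _ = X ^+ 2 + _](big_nat_recr J) //= [X in _ = _ + X ^+ 2](big_nat_recr J) //= mulr0 cos0.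
set C := \sum_(0 <= j < J) cos _; set S := \sum_(0 <= j < J) sin _.
have -> : \sum_(1 <= j < J.+1) cos (t * j%:R) = cos (t * J%:R) * C + sin (t * J%:R) * S.
  rewrite big_nat_rev /= add1n big_add1 /= /C /S !mulr_sumr -big_split /= big_nat [RHS]big_nat.
  apply: eq_bigr => j /andP[_ jJ].
  by rewrite subSS subSS natrB ?(ltnW jJ) // mulrBr cosB.
have := cos2Dsin2 (t * J%:R); lra.
Qed.

Definition Rs s (j : nat) : R := \prod_(l <- s) (1 + cos (2 * pi * l * j%:R)).

(** The Fourier coefficient at frequency [mu] of the Fejer-weighted resonator. [Psi s J 0] is its
    total mass, the unit in which everything is measured. *)
Definition Psi s J (mu : R) : R := fej J (fun j => Rs s j * cos (2 * pi * mu * j%:R)).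

Lemma Rs_ge0 s j : 0 <= Rs s j.
Proof.
by apply: prodr_ge0 => l _; rewrite -lerBlDl sub0r cos_geN1.
Qed.

Lemma Rs_le s j : Rs s j <= 2 ^+ size s.
Proof.
rewrite /Rs; elim: s => [|l s IH] /=; first by rewrite big_nil expr0.
rewrite big_cons exprS; apply: ler_pM => //.
- by have := Rs_ge0 s j.
- by have := cos_le1 (2 * pi * l * j%:R); rewrite -(lerD2l 1).
Qed.

Lemma Psi_cons l s J mu : Psi (l :: s) J mu =
  Psi s J mu + 2^-1 * Psi s J (mu + l) + 2^-1 * Psi s J (mu - l).
Proof.
rewrite /Psi -!fejZ -!fejD; apply: eq_fej => j; rewrite /Rs big_cons -/(Rs s j).
have -> : 2 * pi * (mu + l) * j%:R = 2 * pi * mu * j%:R + 2 * pi * l * j%:R by ring.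
have -> : 2 * pi * (mu - l) * j%:R = 2 * pi * mu * j%:R - 2 * pi * l * j%:R by ring.
by rewrite cosD cosB; field.
Qed.

Lemma PsiN s J mu : Psi s J (- mu) = Psi s J mu.
Proof. by apply: eq_fej => j; rewrite mulrN mulNr cosN. Qed.

Lemma Psi_ge0 s J mu : 0 <= Psi s J mu.
Proof.
elim: s mu => [|l s IH] mu; last first.
  rewrite Psi_cons; have := IH mu; have := IH (mu + l); have := IH (mu - l); lra.
rewrite /Psi (@eq_fej _ _ (fun j => cos (2 * pi * mu * j%:R))).
  by rewrite fej_cos addr_ge0 ?sqr_ge0.
by move=> j; rewrite /Rs big_nil mul1r.
Qed.

Lemma Psi0_ge s J : J%:R ^+ 2 <= Psi s J 0.
Proof.
elim: s => [|l s IH]; last first.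
  rewrite Psi_cons; apply: le_trans IH _; rewrite -addrA lerDl.
  by rewrite !addr_ge0 ?mulr_ge0 ?Psi_ge0.
rewrite /Psi (@eq_fej _ _ (fun j => cos (0 * j%:R))).
  rewrite fej_cos; under eq_bigr do rewrite mul0r cos0.
  by rewrite sumr_const_nat subn0 lerDl sqr_ge0.
by move=> j; rewrite /Rs big_nil mul1r mulr0.
Qed.

Lemma Psi_perm s s' J mu : perm_eq s s' -> Psi s J mu = Psi s' J mu.
Proof. by move=> h; apply: eq_fej => j; rewrite /Rs (perm_big _ h). Qed.

(** Take the factor of frequency l out of the resonator and let Psi' belong to the rest. Then Psi(0)
    = Psi'(0) + Psi'(l) and Psi(l) = Psi'(l) + Psi'(2l)/2 + Psi'(0)/2, all terms being
    nonnegative. *)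
Lemma Psi_mem s J l : l \in s -> 2^-1 * Psi s J 0 <= Psi s J l.
Proof.
move=> ls; have h := perm_to_rem ls.
rewrite !(Psi_perm _ _ h) !Psi_cons add0r sub0r PsiN subrr.
have := Psi_ge0 (rem l s) J l; have := Psi_ge0 (rem l s) J 0; have := Psi_ge0 (rem l s) J (l + l).
lra.
Qed.

Lemma Psi0E s J : Psi s J 0 = fej J (Rs s).
Proof. by apply: eq_fej => j; rewrite mulr0 mul0r cos0 mulr1. Qed.

Lemma cos_lip (a b : R) : `|cos a - cos b| <= `|a - b|.
Proof.
have [m [d [-> ->]]] : exists m d, a = m + d /\ b = m - d.
  by exists ((a + b) / 2), ((a - b) / 2); split; field.
have -> : cos (m + d) - cos (m - d) = - (2 * (sin m * sin d)) by rewrite cosD cosB; ring.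
have -> : m + d - (m - d) = 2 * d by ring.
rewrite normrN !normrM normr_nat ler_wpM2l //.
apply: le_trans (_ : 1 * `|d| <= _); last by rewrite mul1r.
by apply: ler_pM; rewrite ?normr_ge0 ?sin_norm_le // ler_norml sin_geN1 sin_le1.
Qed.

(** The resonator is nonnegative, so the Lipschitz constant of the cosine can be multiplied by its
    mass. *)
Lemma Psi_lip s J mu nu : Psi s J mu - Psi s J nu <= 2 * pi * `|mu - nu| * J%:R * Psi s J 0.
Proof.
rewrite lerBlDr Psi0E -fejZ /Psi -fejD; apply: fej_le => j jJ.
rewrite -lerBlDr -mulrBr [leRHS]mulrC ler_wpM2l ?Rs_ge0 //.
apply: le_trans (ler_norm _) _; apply: le_trans (cos_lip _ _) _.
have -> : 2 * pi * mu * j%:R - 2 * pi * nu * j%:R = 2 * pi * (mu - nu) * j%:R by ring.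
rewrite !normrM normr_nat (ger0_norm (pi_ge0 R)) normr_nat.
by rewrite ler_wpM2l ?mulr_ge0 ?pi_ge0 // ler_nat ltnW.
Qed.

Lemma fej_norm J phi : `|fej J phi| <= fej J (fun j => `|phi j|).
Proof.
rewrite ler_norml -[- fej _ _]mulN1r -fejZ; apply/andP; split; apply: fej_le => j _.
  by rewrite mulN1r lerNl -normrN ler_norm.
exact: ler_norm.
Qed.

Lemma sum_inv_sqrt (n : nat) : \sum_(1 <= j < n.+1) (Num.sqrt (j%:R : R))^-1 <= 2 * Num.sqrt n%:R.
Proof.
elim: n => [|n IH]; first by rewrite big_geq // sqrtr0 mulr0.
rewrite big_nat_recr //=; apply: le_trans (lerD IH (lexx _)) _.
set a := Num.sqrt n%:R; set b := Num.sqrt n.+1%:R.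
have a0 : 0 <= a by exact: sqrtr_ge0.
have b0 : 0 < b by rewrite sqrtr_gt0 ltr0n.
have ab : b ^+ 2 = a ^+ 2 + 1 by rewrite !sqr_sqrtr // natr1.
have : b^-1 * b ^+ 2 = b by field; rewrite lt0r_neq0.
have := sqr_ge0 (b - a) => h1 h2.
rewrite -(ler_pM2r b0) mulrDl mulVf ?lt0r_neq0 //.
by move: h1; rewrite !expr2 in ab *; lra.
Qed.

(* For a length [2 ^ l] maximising [V l / 3 ^ l] the shorter dyadic ranges contribute at most a
   constant times the last one, and [V l / 3 ^ l >= (4 / 3) ^ lmax] dominates the trivial bound
   for small [j]. *)
Section Dyadic.
Variables (s : seq R) (lmax l : nat).
Let V (i : nat) := Psi s (2 ^ i) 0.
Hypothesis lmaxP : forall i, (i <= lmax)%N -> V i / 3 ^+ i <= V l / 3 ^+ l.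

(** For j <= 2^i the Fejer weight of length 2^(i+1) is at least 2^i. *)
Lemma sum_Rs_le (i : nat) : (2 ^ i)%:R * \sum_(1 <= j < (2 ^ i).+1) Rs s j <= V i.+1.
Proof.
rewrite /V Psi0E /fej expnS.
set n := (2 ^ i)%N; have n1 : (0 < n)%N by rewrite expn_gt0.
apply: le_trans (_ : 2 * \sum_(1 <= j < 2 * n) ((2 * n)%:R - j%:R) * Rs s j <= _); last first.
  by rewrite lerDr mulr_ge0 ?Rs_ge0.
apply: le_trans (_ : \sum_(1 <= j < n.+1) ((2 * n)%:R - j%:R) * Rs s j <= _).
  rewrite mulr_sumr big_nat [leRHS]big_nat; apply: ler_sum => j /andP[j0 jn].
  rewrite ler_wpM2r ?Rs_ge0 // natrM.
  have : j%:R <= n%:R :> R by rewrite ler_nat -ltnS.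
  lra.
have p (j : nat) : (j < 2 * n)%N -> 0 <= ((2 * n)%:R - j%:R) * Rs s j.
  by move=> h; rewrite mulr_ge0 ?Rs_ge0 // subr_ge0 ler_nat ltnW.
apply: le_trans (_ : \sum_(1 <= j < 2 * n) ((2 * n)%:R - j%:R) * Rs s j <= _); last first.
  rewrite ler_peMl ?ler1n // big_nat sumr_ge0 // => j /andP[_ h]; exact: p.
case: (leqP n 1) => hn.
  have -> : n = 1%N by apply/eqP; rewrite eqn_leq hn n1.
  by rewrite muln1.
rewrite [leRHS](big_cat_nat (n := n.+1)) //=; last by rewrite mul2n -addnn -addn1 leq_add.
rewrite lerDl big_nat sumr_ge0 // => j /andP[_ h]; exact: p.
Qed.

Lemma V_geom (k : nat) : (k <= l)%N -> (l <= lmax)%N -> V k <= V l * 3 ^+ k / 3 ^+ l.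
Proof.
move=> kl ll; have := lmaxP (leq_trans kl ll).
by rewrite ler_pdivrMr ?exprn_gt0 // mulrAC.
Qed.

Hypothesis ll : (l <= lmax)%N.
Let rr : R := Num.sqrt 2.
Let J : nat := (2 ^ l)%N.

Let rr0 : 0 < rr. Proof. by rewrite sqrtr_gt0. Qed.
Let rr2 : rr ^+ 2 = 2. Proof. by rewrite sqr_sqrtr. Qed.
(** The base 3 lies between 2 sqrt 2 and 4. The first makes [rho] less than 1, so that the dyadic
    blocks decay geometrically; the second makes the maximum of V l / 3^l at least (4/3)^lmax, by
    [Psi0_ge]. *)
Let rho := 2 * rr / 3.
Let rho0 : 0 < rho. Proof. by rewrite divr_gt0 // mulr_gt0. Qed.

Lemma sqrt_pow2 (k : nat) : Num.sqrt ((2 ^ k)%:R : R) = rr ^+ k.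
Proof.
elim: k => [|k IH]; first by rewrite expn0 sqrtr1 expr0.
by rewrite expnS natrM sqrtrM // IH exprS.
Qed.

Lemma rho_le : rho <= 17 / 18.
Proof.
rewrite -(@ler_pXn2r _ 2) ?nnegrE ?(ltW rho0) ?divr_ge0 //.
by rewrite /rho !exprMn rr2 !expr2; lra.
Qed.

Lemma rho_sum k : \sum_(0 <= i < k) rho ^+ (k - i) <= 17.
Proof.
elim: k => [|k IH]; first by rewrite big_geq.
rewrite big_nat_recr //= subSnn expr1.
have -> : \sum_(0 <= i < k) rho ^+ (k.+1 - i) = rho * \sum_(0 <= i < k) rho ^+ (k - i).
  rewrite mulr_sumr big_nat [RHS]big_nat; apply: eq_bigr => i /andP[_ ik].
  by rewrite subSn ?exprS // ltnW.
have : rho * \sum_(0 <= i < k) rho ^+ (k - i) <= rho * 17 by rewrite ler_wpM2l // ltW.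
have h := rho_le; lra.
Qed.

Let Tm (j : nat) := (J%:R - j%:R) * Rs s j * (Num.sqrt j%:R)^-1.
Let Vr := V l * rr ^- l.

(** On the block the weight is at most 2^l 2^(-k/2), and the resonator sums to at most V(k+2) /
    2^(k+1), which the maximum property bounds by V(l) 3^(k+2-l) / 2^(k+1). The last block, k + 1 =
    l, is treated apart because k + 2 would exceed l there. *)
Lemma dyadic_block (k : nat) : (k < l)%N ->
  \sum_(2 ^ k <= j < 2 ^ k.+1) Tm j <= 9 / 2 * Vr * rho ^+ (l - k).
Proof.
move=> kl; have V0 : 0 <= V l by exact: Psi_ge0.
have rk0 : 0 < rr ^+ k by rewrite exprn_gt0.
have J2 : J%:R = 2 ^+ l :> R by rewrite /J natrX.
have kJ : (2 ^ k.+1 <= J)%N by rewrite leq_exp2l.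
have JR j : (2 ^ k <= j < 2 ^ k.+1)%N -> 0 <= (J%:R - j%:R : R) <= J%:R.
  move=> /andP[_ h]; rewrite subr_ge0 ler_nat (leq_trans (ltnW h)) //=.
  by rewrite lerBlDr lerDl.
have s1 j : (2 ^ k <= j)%N -> (Num.sqrt (j%:R : R))^-1 <= rr ^- k.
  move=> h; rewrite lef_pV2 ?posrE //; last by rewrite sqrtr_gt0 ltr0n (leq_trans _ h) // expn_gt0.
  by rewrite -sqrt_pow2 ler_wsqrtr // ler_nat.
have h1 : \sum_(2 ^ k <= j < 2 ^ k.+1) Tm j <= rr ^- k * \sum_(2 ^ k <= j < 2 ^ k.+1) (J%:R - j%:R) * Rs s j.
  rewrite mulr_sumr big_nat [leRHS]big_nat; apply: ler_sum => j hj.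
  rewrite [leRHS]mulrC; apply: ler_wpM2l; last by apply: s1; case/andP: hj.
  by rewrite mulr_ge0 ?Rs_ge0 //; case/andP: (JR j hj).
apply: le_trans h1 _.
have k1 : (0 < 2 ^ k)%N by rewrite expn_gt0.
have p j : (j < J)%N -> 0 <= (J%:R - j%:R) * Rs s j.
  by move=> h; rewrite mulr_ge0 ?Rs_ge0 // subr_ge0 ler_nat ltnW.
move: kl; rewrite leq_eqVlt => /orP[/eqP el|kl].
  have -> : (l - k = 1)%N by rewrite -el subSnn.
  have h2 : \sum_(2 ^ k <= j < 2 ^ k.+1) (J%:R - j%:R) * Rs s j <= V l / 2.
    rewrite ler_pdivlMr // mulrC /V Psi0E /fej -/J.
    apply: le_trans (_ : 2 * \sum_(1 <= j < J) (J%:R - j%:R) * Rs s j <= _); last first.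
      by rewrite lerDr mulr_ge0 ?Rs_ge0.
    rewrite ler_wpM2l // /J -el [leRHS](big_cat_nat (n := (2 ^ k)%N)) //=; last by rewrite leq_exp2l.
    rewrite lerDr big_nat sumr_ge0 // => j /andP[_ h]; rewrite el; apply: p.
    by rewrite /J -el (leq_trans h) // leq_exp2l.
  apply: le_trans (_ : rr ^- k * (V l / 2) <= _); first by rewrite ler_wpM2l // invr_ge0 ltW.
  have -> : 9 / 2 * Vr * rho ^+ 1 = 6 * (rr ^- k * (V l / 2)).
    by rewrite /Vr /rho -el exprS; field; rewrite !lt0r_neq0.
  by rewrite ler_peMl ?ler1n // mulr_ge0 ?invr_ge0 ?divr_ge0 // ltW.
have h2 : \sum_(2 ^ k <= j < 2 ^ k.+1) (J%:R - j%:R) * Rs s j <= J%:R * (V k.+2 / 2 ^+ k.+1).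
  apply: le_trans (_ : J%:R * \sum_(1 <= j < (2 ^ k.+1).+1) Rs s j <= _).
    apply: le_trans (_ : J%:R * \sum_(2 ^ k <= j < 2 ^ k.+1) Rs s j <= _).
      rewrite mulr_sumr big_nat [leRHS]big_nat; apply: ler_sum => j hj.
      by rewrite ler_wpM2r ?Rs_ge0 //; case/andP: (JR j hj).
    rewrite ler_wpM2l // big_nat_recr ?expn_gt0 //=.
    rewrite [in leRHS](big_cat_nat (n := (2 ^ k)%N)) //=; last by rewrite leq_exp2l.
    by rewrite addrAC lerDr addr_ge0 ?Rs_ge0 // sumr_ge0 // => j _; exact: Rs_ge0.
  rewrite ler_wpM2l // ler_pdivlMr ?exprn_gt0 // mulrC -natrX.
  exact: sum_Rs_le.
apply: le_trans (_ : rr ^- k * (J%:R * (V l * 3 ^+ k.+2 / 3 ^+ l / 2 ^+ k.+1)) <= _).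
  rewrite ler_wpM2l ?invr_ge0 ?(ltW rk0) //; apply: le_trans h2 _.
  by rewrite ler_wpM2l // ler_wpM2r ?invr_ge0 ?exprn_ge0 // V_geom.
have el : l = (k + (l - k))%N by rewrite subnKC // ltnW // ltnW.
set e := (l - k)%N in el *.
have el3 : 3 ^+ l = 3 ^+ k * 3 ^+ e :> R by rewrite -exprD -el.
have el2 : 2 ^+ l = 2 ^+ k * 2 ^+ e :> R by rewrite -exprD -el.
have elr : rr ^+ l = rr ^+ k * rr ^+ e by rewrite -exprD -el.
rewrite /Vr J2 el2 el3 elr le_eqVlt; apply/orP; left; apply/eqP.
rewrite /rho [(2 * rr / 3) ^+ e]exprMn exprVn exprMn [3 ^+ k.+2]exprS [3 ^+ k.+1]exprS [2 ^+ k.+1]exprS.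
set a := rr ^+ k in rk0 *; set b := rr ^+ e; set c := 2 ^+ k; set d := 2 ^+ e; set u := 3 ^+ k; set v := 3 ^+ e.
have b0 : 0 < b by rewrite exprn_gt0.
have c0 : 0 < c by rewrite exprn_gt0.
have u0 : 0 < u by rewrite exprn_gt0.
have v0 : 0 < v by rewrite exprn_gt0.
by field; rewrite !lt0r_neq0.
Qed.

Lemma dyadic_sum : \sum_(1 <= j < J) Tm j <= 77 * Vr.
Proof.
have V0 : 0 <= Vr by rewrite mulr_ge0 ?Psi_ge0 // invr_ge0 exprn_ge0 // ltW.
have h k : (k <= l)%N -> \sum_(1 <= j < 2 ^ k) Tm j <= \sum_(0 <= i < k) 9 / 2 * Vr * rho ^+ (l - i).
  elim: k => [|k IH] kl; first by rewrite expn0 !big_geq.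
  rewrite (big_cat_nat (n := (2 ^ k)%N)) ?expn_gt0 ?leq_exp2l //= [leRHS]big_nat_recr //=.
  by apply: lerD; [apply: IH; exact: ltnW | exact: dyadic_block].
apply: le_trans (h l (leqnn l)) _; rewrite -mulr_sumr.
apply: le_trans (_ : 9 / 2 * Vr * 17 <= _); last by lra.
by rewrite ler_wpM2l ?rho_sum // mulr_ge0.
Qed.

End Dyadic.

(** The right-hand sum in the hypothesis on L is the Fejer mean of [Rs s * g]. For j <= X0 the
    resonator is bounded by 2^(size s), and V l / sqrt(2^l) >= 2^l (4/3)^lmax absorbs this range
    into the 1. The larger j contribute 2 * 77 * A2 by [dyadic_sum]. The lower bound is asked for
    every l because the maximising one is not known. *)
Lemma resonance (T : finType) (w f : T -> R) (g : nat -> R) (s : seq R) (lmax X0 : nat) (A0 A1 A2 L : R) :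
  (forall t, 0 <= w t) -> 0 <= A0 -> 0 <= A1 -> 0 <= A2 ->
  (forall j, g j = \sum_t w t * cos (2 * pi * f t * j%:R)) ->
  [/\ `|g 0%N| <= A0, forall j, (0 < j <= X0)%N -> `|g j| <= A1 * (Num.sqrt j%:R)^-1 &
     forall j, (X0 < j < 2 ^ lmax)%N -> `|g j| <= A2 * (Num.sqrt j%:R)^-1] ->
  2 ^+ size s * (A0 + 4 * A1 * Num.sqrt X0%:R) <= (4 / 3) ^+ lmax ->
  (forall l, (l <= lmax)%N ->
     L * (Num.sqrt (2 ^ l)%:R)^-1 * Psi s (2 ^ l) 0 <= \sum_t w t * Psi s (2 ^ l) (f t)) ->
  L <= 1 + 154 * A2.
Proof.
move=> w0 A00 A10 A20 gE [g0 g1 g2] hs hL.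
pose V (i : nat) := Psi s (2 ^ i) 0.
pose q (i : 'I_lmax.+1) : R := V i / 3 ^+ i.
have [l hl] : exists l : 'I_lmax.+1, forall i, q i <= q l.
  exists [arg max_(i > ord0) q i]%O; case: arg_maxP => // i _ h j; exact: h.
have ll : (l <= lmax)%N by rewrite -ltnS.
have lP i : (i <= lmax)%N -> V i / 3 ^+ i <= V l / 3 ^+ l.
  by move=> hi; have := hl (Ordinal (hi : (i < lmax.+1)%N)).
have := hL l ll.
set J := (2 ^ l)%N; set rJ := Num.sqrt _.
have J0 : (0 < J)%N by rewrite expn_gt0.
have rJ0 : 0 < rJ by rewrite sqrtr_gt0 ltr0n.
have VJ : J%:R * (4 / 3) ^+ lmax <= V l * rJ^-1.
  have h1 : (4 / 3) ^+ lmax <= V l / 3 ^+ l.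
    apply: le_trans (lP _ (leqnn _)); rewrite expr_div_n ler_wpM2r ?invr_ge0 ?exprn_ge0 //.
    apply: le_trans (Psi0_ge _ _); rewrite natrX -exprM mulnC exprM.
    by have -> : 2 ^+ 2 = 4 :> R by ring.
  have h2 : J%:R * rJ <= 3 ^+ l.
    have r2 : 2 * Num.sqrt 2 <= 3 :> R.
      rewrite -(@ler_pXn2r _ 2) ?nnegrE ?mulr_ge0 ?sqrtr_ge0 // exprMn sqr_sqrtr // !expr2; lra.
    rewrite /rJ /J sqrt_pow2 natrX -exprMn lerXn2r ?nnegrE ?mulr_ge0 ?sqrtr_ge0 //.
  rewrite ler_pdivlMr // mulrAC.
  apply: le_trans (_ : 3 ^+ l * (4 / 3) ^+ lmax <= _).
    by rewrite ler_wpM2r // exprn_ge0 // divr_ge0.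
  by rewrite mulrC -ler_pdivlMr ?exprn_gt0.
have eg : \sum_t w t * Psi s J (f t) = fej J (fun j => Rs s j * g j).
  rewrite (@eq_fej _ _ (fun j => \sum_t w t * (Rs s j * cos (2 * pi * f t * j%:R)))); last first.
    by move=> j; rewrite gE mulr_sumr; apply: eq_bigr => t _; rewrite mulrCA.
  by rewrite fej_sum; apply: eq_bigr => t _; rewrite -fejZ.
rewrite eg => hLJ.
have V0 : 0 < V l * rJ^-1.
  by apply: lt_le_trans VJ; rewrite mulr_gt0 ?ltr0n // exprn_gt0 // divr_gt0.
have bnd : fej J (fun j => Rs s j * g j) <= J%:R * (2 ^+ size s * (A0 + 4 * A1 * Num.sqrt X0%:R)) +
   154 * A2 * (V l * rJ^-1).
  apply: le_trans (ler_norm _) _; apply: le_trans (fej_norm _ _) _.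
  rewrite /fej.
  have t0 : J%:R * `|Rs s 0 * g 0%N| <= J%:R * (2 ^+ size s * A0).
    by rewrite ler_wpM2l // normrM (ger0_norm (Rs_ge0 s 0)); apply: ler_pM; rewrite ?Rs_ge0 ?Rs_le.
  have t1 : \sum_(1 <= j < J) (J%:R - j%:R) * `|Rs s j * g j| <=
      \sum_(1 <= j < X0.+1) J%:R * 2 ^+ size s * A1 * (Num.sqrt j%:R)^-1 +
      A2 * \sum_(1 <= j < J) (J%:R - j%:R) * Rs s j * (Num.sqrt j%:R)^-1.
    apply: le_trans (_ : \sum_(1 <= j < J | (j <= X0)%N) J%:R * 2 ^+ size s * A1 * (Num.sqrt j%:R)^-1 +
       A2 * \sum_(1 <= j < J) (J%:R - j%:R) * Rs s j * (Num.sqrt j%:R)^-1 <= _).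
      rewrite mulr_sumr [X in _ <= X + _]big_mkcond -big_split /= big_nat [leRHS]big_nat.
      apply: ler_sum => j /andP[j0 jJ].
      have jR : 0 <= (J%:R - j%:R : R) <= J%:R by rewrite subr_ge0 ler_nat ltnW //= lerBlDr lerDl.
      case/andP: jR => jR1 jR2.
      have sj : 0 <= (Num.sqrt (j%:R : R))^-1 by rewrite invr_ge0 sqrtr_ge0.
      rewrite normrM (ger0_norm (Rs_ge0 s j)) mulrA.
      have a2 : 0 <= A2 * ((J%:R - j%:R) * Rs s j * (Num.sqrt j%:R)^-1) by rewrite !mulr_ge0 ?Rs_ge0.
      case: ifP => jX.
        apply: le_trans (_ : J%:R * 2 ^+ size s * A1 * (Num.sqrt j%:R)^-1 <= _); last by rewrite lerDl.
        rewrite -[leRHS]mulrA; apply: ler_pM; rewrite ?mulr_ge0 ?Rs_ge0 //; last by rewrite g1 // j0.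
        by apply: ler_pM; rewrite ?Rs_ge0 ?Rs_le.
      rewrite add0r [leRHS]mulrCA ler_wpM2l ?mulr_ge0 ?Rs_ge0 // g2 //.
      rewrite ltnNge jX /= (leq_trans jJ) // leq_exp2l //.
    rewrite lerD2r.
    have e1 : \sum_(1 <= j < J | (j <= X0)%N) J%:R * 2 ^+ size s * A1 * (Num.sqrt (j%:R : R))^-1 =
      \sum_(1 <= j < X0.+1 | (j < J)%N) J%:R * 2 ^+ size s * A1 * (Num.sqrt (j%:R : R))^-1.
      rewrite (big_nat_widen _ _ (J + X0.+1)) ?leq_addr // [RHS](big_nat_widen _ _ (J + X0.+1)) ?leq_addl //.
      by apply: eq_bigl => j; rewrite ltnS andbC.
    rewrite e1 big_mkcond; apply: ler_sum => j _; case: ifP => // _.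
    by rewrite !mulr_ge0 ?exprn_ge0 // invr_ge0 sqrtr_ge0.
  have t2 : \sum_(1 <= j < X0.+1) J%:R * 2 ^+ size s * A1 * (Num.sqrt (j%:R : R))^-1 <=
     J%:R * 2 ^+ size s * A1 * (2 * Num.sqrt X0%:R).
    by rewrite -mulr_sumr ler_wpM2l ?sum_inv_sqrt // !mulr_ge0 ?exprn_ge0.
  have t3 : A2 * \sum_(1 <= j < J) (J%:R - j%:R) * Rs s j * (Num.sqrt j%:R)^-1 <= A2 * (77 * (V l * rJ^-1)).
    by rewrite ler_wpM2l // /rJ sqrt_pow2; apply: dyadic_sum lP ll.
  apply: le_trans (_ : J%:R * (2 ^+ size s * A0) + 2 * (J%:R * 2 ^+ size s * A1 * (2 * Num.sqrt X0%:R) + A2 * (77 * (V l * rJ^-1))) <= _).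
    apply: lerD => //; rewrite ler_wpM2l //; apply: le_trans t1 _; exact: lerD.
  by rewrite le_eqVlt; apply/orP; left; apply/eqP; ring.
have b2 : J%:R * (2 ^+ size s * (A0 + 4 * A1 * Num.sqrt X0%:R)) <= V l * rJ^-1.
  by apply: le_trans VJ; rewrite ler_wpM2l.
rewrite -(ler_pM2r V0) [leRHS]mulrDl mul1r.
have -> : L * (V l * rJ^-1) = L * rJ^-1 * V l by rewrite mulrA mulrAC.
apply: le_trans hLJ _; apply: le_trans bnd _; exact: lerD.
Qed.

End Resonance.

(** * The frequency side *)

Section Kernel.
Variable R : realType.
Local Notation nc := (@Normc.normc R).
Local Notation re := (@complex.Re R).
Local Notation im := (@complex.Im R).
Local Open Scope complex_scope.

Definition agrid (delta : R) (I i : nat) : R := expR (delta * (i%:R - I%:R)).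

Definition freq (delta : R) (I h k i : nat) : R :=
  h%:R / agrid delta I i + k%:R * agrid delta I i.

(** The grid version of G with both factors S truncated at K, so that it is a finite combination of
    exponentials. *)
Definition GK (K I : nat) (eta delta : R) (j : nat) : R[i] :=
  \sum_(i < I.*2.+1) SK K (ce ((agrid delta I i)^-1%:C * (j%:R +i* eta))) *
                     SK K (ce ((agrid delta I i)%:C * (j%:R +i* eta))).

Definition gK K I eta delta j : R := delta * re (GK K I eta delta j).

Definition wt3 (eta delta : R) (I h k i : nat) : R :=
  delta * ((h%:R * k%:R) ^+ 3 * expR (- (2 * pi * (freq delta I h k i * eta)))).

Lemma GK_expand K I eta delta j : GK K I eta delta j =
  \sum_(h < K) \sum_(k < K) ((h%:R * k%:R) ^+ 3) *
     \sum_(i < I.*2.+1) ce ((freq delta I h k i)%:C * (j%:R +i* eta)).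
Proof.
rewrite /GK; under eq_bigr => i _.
  rewrite /SK big_distrlr /=.
  over.
rewrite exchange_big /=; apply: eq_bigr => h _; rewrite exchange_big /=; apply: eq_bigr => k _.
rewrite mulr_sumr; apply: eq_bigr => i _.
rewrite -!ce_natM exprMn mulrACA; congr (_ * _); rewrite -ceD; congr ce.
rewrite /freq rmorphD !rmorphM !rmorph_nat mulrDl; congr (_ + _); first by rewrite mulrA.
by rewrite mulrA.
Qed.

Lemma re_ce (F x eta : R) : re (ce (F%:C * (x +i* eta))) =
  expR (- (2 * pi * (F * eta))) * cos (2 * pi * F * x).
Proof.
by rewrite /ce /cexp /= !mul0r subr0 addr0; congr (expR _ * cos _); ring.
Qed.

Lemma gK_E K I eta delta j : gK K I eta delta j =
  \sum_(t : 'I_K * 'I_K * 'I_I.*2.+1) wt3 eta delta I t.1.1 t.1.2 t.2 *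
     cos (2 * pi * freq delta I t.1.1 t.1.2 t.2 * j%:R).
Proof.
rewrite /gK GK_expand.
rewrite -(pair_bigA _ (fun (p : 'I_K * 'I_K) (i : 'I_I.*2.+1) => wt3 eta delta I p.1 p.2 i *
     cos (2 * pi * freq delta I p.1 p.2 i * j%:R))) /=.
rewrite -(pair_bigA _ (fun (h k : 'I_K) => \sum_(i < I.*2.+1) wt3 eta delta I h k i *
     cos (2 * pi * freq delta I h k i * j%:R))) /=.
rewrite cRe_sum mulr_sumr; apply: eq_bigr => h _.
rewrite cRe_sum mulr_sumr; apply: eq_bigr => k _.
have -> : ((h%:R * k%:R) ^+ 3 : R[i]) = ((h%:R * k%:R) ^+ 3)%:C by rewrite rmorphXn rmorphM !rmorph_nat.
rewrite cReZ cRe_sum !mulr_sumr; apply: eq_bigr => i _.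
by rewrite re_ce /wt3; ring.
Qed.

Lemma sum_inv_sqr2 (K : nat) : \sum_(h < K) (h%:R ^- 2 : R) <= 2.
Proof.
case: K => [|K]; first by rewrite big_ord0.
rewrite -(big_mkord xpredT (fun h => h%:R ^- 2 : R)) big_ltn // expr0n invr0 add0r.
case: K => [|K]; first by rewrite big_geq.
rewrite big_ltn // expr1n invr1.
have := @sum_inv_sqr R 1 K.+1 isT; rewrite invr1; lra.
Qed.

(** From e^y >= (y/10)^10 with y = 4 pi eta sqrt n. The tenth power turns n^3 into n^(-2), summable
    over h and k separately, at the price eta^(-10). *)
Lemma weight_decay (eta n : R) : 0 < eta -> 0 < n ->
  n ^+ 3 * expR (- (4 * pi * eta * Num.sqrt n)) <= 16 * eta ^- 10 * n ^- 2.
Proof.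
move=> e0 n0; have s0 : 0 < Num.sqrt n by rewrite sqrtr_gt0.
have sn : Num.sqrt n ^+ 2 = n by rewrite sqr_sqrtr // ltW.
have p2 : 2 <= pi :> R := pi_ge2 R.
set s := Num.sqrt n in s0 sn *; rewrite -sn; clear sn.
have y0 : 0 <= 4 * pi * eta * s by rewrite !mulr_ge0 ?(ltW e0) ?(ltW s0) //; lra.
have es0 : 0 < eta * s by rewrite mulr_gt0.
have h1 : (4 / 5 * (eta * s)) ^+ 10 <= expR (4 * pi * eta * s).
  have a0 : 0 <= 4 / 5 * (eta * s) by rewrite mulr_ge0 ?divr_ge0 // ltW.
  apply: le_trans (expR_ge_pow 10 y0); apply: lerXn2r; rewrite ?nnegrE ?divr_ge0 //.
  have -> : 4 * pi * eta * s / 10 = 2 / 5 * pi * (eta * s) by field.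
  by rewrite ler_wpM2r ?(ltW es0) //; lra.
have h2 : 16^-1 * (eta * s) ^+ 10 <= expR (4 * pi * eta * s).
  apply: le_trans h1; rewrite [leRHS]exprMn ler_wpM2r ?exprn_ge0 ?(ltW es0) //.
  have -> : (4 / 5) ^+ 10 = ((4 / 5) ^+ 5) ^+ 2 :> R by rewrite -exprM.
  have -> : (4 / 5) ^+ 5 = 1024 / 3125 :> R by field.
  by rewrite expr2; lra.
have p : 0 < 16^-1 * (eta * s) ^+ 10 by rewrite mulr_gt0 ?exprn_gt0 // invr_gt0.
rewrite expRN; apply: le_trans (_ : (s ^+ 2) ^+ 3 * (16^-1 * (eta * s) ^+ 10)^-1 <= _).
  by rewrite ler_wpM2l ?exprn_ge0 ?(ltW s0) // lef_pV2 ?posrE ?expR_gt0.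
by rewrite le_eqVlt; apply/orP; left; apply/eqP; field; rewrite !lt0r_neq0.
Qed.

Lemma weight_sum (K : nat) (eta : R) : 0 < eta ->
  \sum_(h < K) \sum_(k < K) (h%:R * k%:R) ^+ 3 * expR (- (4 * pi * eta * Num.sqrt (h%:R * k%:R)))
   <= 64 * eta ^- 10.
Proof.
move=> e0; have ei : 0 <= 16 * eta ^- 10 by rewrite mulr_ge0 // invr_ge0 exprn_ge0 // ltW.
apply: le_trans (_ : \sum_(h < K) \sum_(k < K) 16 * eta ^- 10 * (h%:R ^- 2 * k%:R ^- 2) <= _).
  apply: ler_sum => h _; apply: ler_sum => k _.
  have [/eqP hk|hk] := boolP ((h%:R * k%:R : R) == 0).
    rewrite hk expr0n mul0r; by apply: mulr_ge0 => //; rewrite mulr_ge0 // invr_ge0 exprn_ge0.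
  have hk0 : 0 < (h%:R * k%:R : R) by rewrite lt_neqAle eq_sym hk mulr_ge0.
  have -> : h%:R ^- 2 * k%:R ^- 2 = (h%:R * k%:R) ^- 2 :> R by rewrite -invfM -exprMn.
  exact: weight_decay.
have s0 : 0 <= \sum_(h < K) (h%:R ^- 2 : R).
  by apply: sumr_ge0 => h _; rewrite invr_ge0 exprn_ge0.
have -> : \sum_(h < K) \sum_(k < K) 16 * eta ^- 10 * (h%:R ^- 2 * k%:R ^- 2) =
   16 * eta ^- 10 * ((\sum_(h < K) h%:R ^- 2) * (\sum_(k < K) k%:R ^- 2)).
  rewrite big_distrlr /= mulr_sumr; apply: eq_bigr => h _.
  by rewrite mulr_sumr.
have -> : 64 * eta ^- 10 = 16 * eta ^- 10 * (2 * 2) by ring.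
by rewrite ler_wpM2l //; apply: ler_pM; rewrite ?sum_inv_sqr2.
Qed.

Lemma nc_ReGK K I eta delta j : 0 < delta -> `|gK K I eta delta j| <=
  \sum_(h < K) \sum_(k < K) (h%:R * k%:R) ^+ 3 *
     (delta * nc (\sum_(i < I.*2.+1) ce ((freq delta I h k i)%:C * (j%:R +i* eta)))).
Proof.
move=> d0; rewrite /gK normrM gtr0_norm //.
apply: le_trans (_ : delta * nc (GK K I eta delta j) <= _).
  by rewrite ler_wpM2l ?(ltW d0) // Re_le_nc.
rewrite GK_expand; apply: le_trans (_ : delta * \sum_(h < K) \sum_(k < K) (h%:R * k%:R) ^+ 3 *
     nc (\sum_(i < I.*2.+1) ce ((freq delta I h k i)%:C * (j%:R +i* eta))) <= _).
  rewrite ler_wpM2l ?(ltW d0) //; apply: le_trans (nc_sum _ _ _) _; apply: ler_sum => h _.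
  apply: le_trans (nc_sum _ _ _) _; apply: ler_sum => k _.
  by rewrite ncM ncX ncM !nc_nat.
rewrite mulr_sumr; apply: ler_sum => h _; rewrite mulr_sumr; apply: ler_sum => k _.
by rewrite mulrCA.
Qed.

Lemma agrid_gt0 delta I i : 0 < agrid delta I i. Proof. exact: expR_gt0. Qed.

Lemma gK_0 K I (eta delta : R) : 0 < eta -> 0 < delta ->
  `|gK K I eta delta 0| <= I.*2.+1%:R * delta * (64 * eta ^- 10).
Proof.
move=> e0 d0; apply: le_trans (nc_ReGK _ _ _ _ d0) _.
have md : 0 <= I.*2.+1%:R * delta by rewrite mulr_ge0 // ltW.
apply: le_trans (_ : I.*2.+1%:R * delta * \sum_(h < K) \sum_(k < K) (h%:R * k%:R) ^+ 3 * expR (- (4 * pi * eta * Num.sqrt (h%:R * k%:R))) <= _); last first.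
  by rewrite ler_wpM2l // weight_sum.
rewrite mulr_sumr; apply: ler_sum => h _; rewrite mulr_sumr; apply: ler_sum => k _.
rewrite [leRHS]mulrCA ler_wpM2l ?exprn_ge0 ?mulr_ge0 //.
rewrite [leRHS]mulrAC [leRHS]mulrC ler_wpM2l ?(ltW d0) //.
apply: le_trans (nc_sum _ _ _) _.
apply: le_trans (_ : \sum_(i < I.*2.+1) expR (- (4 * pi * eta * Num.sqrt (h%:R * k%:R))) <= _); last first.
  by rewrite sumr_const card_ord [leRHS]mulr_natl.
apply: ler_sum => i _; rewrite nc_ce cImZ ler_expR lerN2 /=.
have h1 := amgm2 (ler0n R h) (ler0n R k) (agrid_gt0 delta I i).
have -> : 4 * pi * eta * Num.sqrt (h%:R * k%:R) = 2 * pi * eta * (2 * Num.sqrt (h%:R * k%:R)) by ring.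
have -> : 2 * pi * (freq delta I h k i * eta) = 2 * pi * eta * freq delta I h k i by ring.
by rewrite ler_wpM2l // !mulr_ge0 ?pi_ge0 // ltW.
Qed.

(** Serves the j up to X0, where nothing is assumed on Delta. The large power of eta is harmless: it
    is a power of log X, set against (4/3)^lmax in [resonance]. *)
Lemma gK_small K I (eta delta : R) j : (0 < j)%N -> 0 < eta <= 1 -> 0 < delta <= 2^-1 ->
  delta ^+ 2 * j%:R <= 1 -> 256 * delta * K%:R * expR (I%:R * delta) * j%:R <= 1 ->
  `|gK K I eta delta j| <= 147 * (64 * eta ^- 10) * (Num.sqrt j%:R)^-1.
Proof.
move=> j0 e01 d01 dj small; have /andP[e0 _] := e01; have /andP[d0 _] := d01.
apply: le_trans (nc_ReGK _ _ _ _ d0) _.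
have sj : 0 <= 147 * (Num.sqrt (j%:R : R))^-1 by rewrite mulr_ge0 // invr_ge0 sqrtr_ge0.
apply: le_trans (_ : 147 * (Num.sqrt j%:R)^-1 * \sum_(h < K) \sum_(k < K) (h%:R * k%:R) ^+ 3 * expR (- (4 * pi * eta * Num.sqrt (h%:R * k%:R))) <= _); last first.
  by rewrite [leRHS]mulrAC ler_wpM2l // weight_sum.
rewrite mulr_sumr; apply: ler_sum => h _; rewrite mulr_sumr; apply: ler_sum => k _.
rewrite [leRHS]mulrCA.
have [/eqP hk|] := boolP ((h * k)%N == 0%N).
  by rewrite -natrM hk expr0n !mul0r.
rewrite -lt0n muln_gt0 => /andP[h0 k0].
rewrite ler_wpM2l ?exprn_ge0 ?mulr_ge0 //.
apply: fresnel => //; rewrite ?ler1n //.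
apply: le_trans small.
have E0 : 0 <= expR (I%:R * delta) by exact: expR_ge0.
rewrite ler_wpM2r // ler_wpM2r //.
have hkK : h%:R + k%:R <= 2 * K%:R :> R.
  have hK : h%:R <= K%:R :> R by rewrite ler_nat ltnW.
  have kK : k%:R <= K%:R :> R by rewrite ler_nat ltnW.
  lra.
apply: le_trans (_ : 128 * delta * (2 * K%:R) <= _); last by rewrite le_eqVlt; apply/orP; left; apply/eqP; ring.
by rewrite ler_wpM2l // mulr_ge0 // ltW.
Qed.

Lemma Sq_ub (kap : R) (t : R[i]) : 0 < kap -> kap <= im t -> 0 <= re t ->
  nc (Sq (ce t)) <= 32 * (kap ^- 4 + kap ^- 3) / c3 R.
Proof.
move=> k0 ki r0; have c0 := c3_gt0 R.
have := Lip_ub (lt_le_trans k0 ki) r0.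
rewrite /Lip ncM nc_real (gtr0_norm c0) => h.
rewrite ler_pdivlMr // mulrC; apply: le_trans h _.
by rewrite ler_wpM2l // lerD ?pow_anti.
Qed.

Lemma SK_choice (kap D : R) : 0 < kap -> 0 < D -> exists K0 : nat, forall K I j (eta delta : R),
  (K0 <= K)%N -> 0 < delta -> I.*2.+1%:R * delta <= D -> kap <= eta / expR (I%:R * delta) ->
  delta * nc (\sum_(i < I.*2.+1) Sq (ce ((agrid delta I i)^-1%:C * (j%:R +i* eta))) *
                     Sq (ce ((agrid delta I i)%:C * (j%:R +i* eta))) - GK K I eta delta j) <= D^-1.
Proof.
move=> k0 D0; have c0 := c3_gt0 R.
pose M := 32 * (kap ^- 4 + kap ^- 3) / c3 R.
have M0 : 0 <= M by rewrite divr_ge0 ?(ltW c0) // mulr_ge0 // addr_ge0 // invr_ge0 exprn_ge0 // ltW.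
pose eps := Num.min 1 (D ^- 2 / (2 * M + 1)).
have den : 0 < 2 * M + 1 by lra.
have eps0 : 0 < eps by rewrite lt_min ltr01 divr_gt0 // invr_gt0 exprn_gt0.
have eps1 : eps <= 1 by rewrite ge_min lexx.
have epsM : eps * (2 * M + 1) <= D ^- 2.
  by rewrite -ler_pdivlMr // ge_min lexx orbT.
have [K0 hK0] := SK_approx k0 eps0.
exists K0 => K I j eta delta KK d0 mD hk.
set E := expR _ in hk; have E0 : 0 < E by exact: expR_gt0.
have eta0 : 0 < eta by move: hk; rewrite ler_pdivlMr //; apply: lt_le_trans; rewrite mulr_gt0.
apply: le_trans (_ : delta * (I.*2.+1%:R * D ^- 2) <= _); last first.
  rewrite mulrCA mulrA; apply: le_trans (_ : D * D ^- 2 <= _).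
    by rewrite ler_wpM2r ?invr_ge0 ?exprn_ge0 // ltW.
  by rewrite le_eqVlt; apply/orP; left; apply/eqP; field; rewrite lt0r_neq0.
rewrite ler_wpM2l ?(ltW d0) // /GK -sumrB.
apply: le_trans (nc_sum _ _ _) _.
apply: le_trans (_ : \sum_(i < I.*2.+1) D ^- 2 <= _); last first.
  by rewrite sumr_const card_ord [leRHS]mulr_natl.
apply: ler_sum => i _; apply: le_trans epsM.
have a0 := agrid_gt0 delta I i.
have aE : agrid delta I i <= E.
  rewrite ler_expR mulrC ler_wpM2r ?(ltW d0) // lerBlDr -natrD ler_nat addnn -ltnS.
  exact: ltn_ord.
have aiE : (agrid delta I i)^-1 <= E.
  by rewrite -expRN ler_expR -mulrN mulrC ler_wpM2r ?(ltW d0) // opprB lerBlDr lerDl.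
set u := (agrid delta I i)^-1%:C * _; set v := (agrid delta I i)%:C * _.
have iu : kap <= im u.
  rewrite cImZ /=; apply: le_trans hk _; rewrite mulrC ler_wpM2r ?(ltW eta0) // lef_pV2 ?posrE //.
have iv : kap <= im v.
  rewrite cImZ /=; apply: le_trans hk _; rewrite mulrC ler_wpM2r ?(ltW eta0) //.
  by rewrite -[leRHS]invrK lef_pV2 ?posrE ?invr_gt0.
have ru : 0 <= re u by rewrite cReZ mulr_ge0 // invr_ge0 ltW.
have rv : 0 <= re v by rewrite cReZ mulr_ge0 // ltW.
have du := hK0 K u KK iu; have dv := hK0 K v KK iv.
have Mu := Sq_ub k0 iu ru; have Mv := Sq_ub k0 iv rv.
rewrite -/M in Mu Mv.
set P := Sq (ce u) in du Mu *; set Q := Sq (ce v) in dv Mv *.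
set P' := SK K (ce u) in du *; set Q' := SK K (ce v) in dv *.
have -> : P * Q - P' * Q' = (P' - P) * (Q - Q') - P * (Q' - Q) - (P' - P) * Q by ring.
rewrite ncBC in dv; apply: le_trans (_ : eps * eps + M * eps + eps * M <= _).
  apply: ncB_ub; [apply: ncB_ub|]; apply: ncM_ub => //.
  by rewrite ncBC.
have : eps * eps <= eps * 1 by rewrite ler_wpM2l // ltW.
lra.
Qed.

(** Here ln x <= 2 sqrt x puts the logarithm of [grid_bound] into B + 2, and x <= D makes the
    truncation error 1/D at most 1 / sqrt x. *)
Lemma gK_large : exists2 C : R, 0 < C & forall (kap D : R), 0 < kap -> 1 <= D -> exists K0 : nat,
  forall (K I x : nat) (eta delta B : R), (K0 <= K)%N ->
  (16 <= x)%N -> 0 < eta <= 1 -> 4 <= x%:R * eta -> 0 < delta <= 4^-1 -> x%:R <= D ->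
  32 * x%:R <= expR (I%:R * delta) -> I.*2.+1%:R * delta * expR (I%:R * delta) <= x%:R ^+ 2 ->
  I.*2.+1%:R * delta <= D -> kap <= eta / expR (I%:R * delta) ->
  2 ^+ 16 * x%:R ^+ 8 * delta <= eta ^+ 9 -> 0 <= B ->
  (forall n : nat, (x ^ 2 <= 4 * n)%N -> (n <= 16 * x ^ 2)%N ->
    `|Delta (n%:R : R)| <= B * Num.sqrt (Num.sqrt n%:R)) ->
  `|gK K I eta delta x| <= C * eta ^- 7 * (B + 1) * (Num.sqrt x%:R)^-1.
Proof.
have [C0 C00 hC] := grid_bound R.
have c0 := c3_gt0 R.
exists (2 * C0 / c3 R ^+ 2 + 1); first by rewrite addr_gt0 // divr_gt0 ?exprn_gt0 // mulr_gt0.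
move=> kap D k0 D1; have D0 : 0 < D by apply: lt_le_trans D1.
have [K0 hK] := SK_choice k0 D0.
exists K0 => K I x eta delta B KK x16 e01 xe d01 xD Ex mE mD hk small B0 hB.
have /andP[d0 _] := d01; have /andP[e0 e1] := e01.
have := hC x I eta delta B x16 e01 xe d01 Ex mE small B0 hB.
set SL := \sum_(i < _) _ => hSL.
have := hK K I x eta delta KK d0 mD hk.
set SS := \sum_(i < _) _ => hSS.
have eSL : SL = (c3 R ^+ 2)%:C * SS.
  rewrite /SL /SS mulr_sumr; apply: eq_bigr => i _; rewrite /Lip /agrid rmorphXn expr2.
  by rewrite mulrACA.
have xR : 1 <= x%:R :> R by rewrite ler1n (leq_trans _ x16).
have s0 : 0 < Num.sqrt (x%:R : R) by rewrite sqrtr_gt0; lra.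
have sx : Num.sqrt x%:R ^+ 2 = x%:R :> R by rewrite sqr_sqrtr.
have lnx : ln (x%:R : R) <= 2 * Num.sqrt x%:R.
  rewrite -{1}sx lnXn // -[ln _ *+ 2]mulr_natl ler_wpM2l //.
  by rewrite ltW // ln_sublinear.
set r := Num.sqrt (x%:R : R) in s0 sx lnx *.
have h1 : delta * nc SS <= C0 / c3 R ^+ 2 * (eta ^- 7 * ((B + 2) * r^-1)).
  have : delta * nc SL <= C0 * (eta ^- 7 * ((B + 2) * r^-1)).
    apply: le_trans hSL _; rewrite ler_wpM2l ?(ltW C00) // ler_wpM2l ?invr_ge0 ?exprn_ge0 ?(ltW e0) //.
    rewrite ler_pdivrMr; last by lra.
    rewrite -/r; have -> : (B + 2) * r^-1 * x%:R = B * r + 2 * r by rewrite -sx; field; rewrite lt0r_neq0.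
    by rewrite lerD2l.
  rewrite eSL ncM nc_real ger0_norm ?exprn_ge0 ?(ltW c0) // => h.
  rewrite [C0 / _]mulrC -mulrA -(ler_pM2l (exprn_gt0 2 c0)).
  rewrite [leRHS]mulrA mulfV ?mul1r; last by rewrite expf_neq0 // lt0r_neq0.
  by rewrite mulrCA.
have h2 : `|gK K I eta delta x| <= delta * nc SS + D^-1.
  rewrite /gK normrM gtr0_norm //.
  apply: le_trans (_ : delta * (nc SS + nc (SS - GK K I eta delta x)) <= _); last by rewrite mulrDr lerD2l.
  rewrite ler_wpM2l ?(ltW d0) //; apply: le_trans (Re_le_nc _) _.
  rewrite -{1}[GK K I eta delta x](subKr SS); exact: ncB_le.
have h3 : D^-1 <= r^-1.
  rewrite lef_pV2 ?posrE // (le_trans _ xD) // -sx expr2 ler_peMr ?(ltW s0) //.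
  by rewrite -sqrtr1 ler_wsqrtr.
have e7 : 1 <= eta ^- 7.
  by rewrite invX exprn_ege1 // -invr1 lef_pV2 ?posrE.
have u0 : 0 <= r^-1 by rewrite invr_ge0 ltW.
apply: le_trans h2 _.
set a := C0 / c3 R ^+ 2 in h1 *.
have a0 : 0 < a by rewrite divr_gt0 // exprn_gt0.
have -> : 2 * C0 / c3 R ^+ 2 = 2 * a by rewrite /a mulrA.
apply: le_trans (_ : a * (eta ^- 7 * ((2 * (B + 1)) * r^-1)) + 1 * (eta ^- 7 * ((B + 1) * r^-1)) <= _); last first.
  by rewrite le_eqVlt; apply/orP; left; apply/eqP; ring.
apply: lerD.
  apply: le_trans h1 _; rewrite ler_wpM2l ?(ltW a0) // ler_wpM2l ?invr_ge0 ?exprn_ge0 ?(ltW e0) //.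
  by rewrite ler_wpM2r //; clear -B0; lra.
apply: le_trans h3 _; rewrite mul1r mulrA ler_peMl // mulr_ege1 //; clear -B0; lra.
Qed.

(** An interval of length 2u holds more than 2u/delta - 1 >= u/delta grid points. *)
Lemma near_count (delta u th : R) (I : nat) : 0 < delta -> delta <= u -> `|th| + u <= I%:R * delta ->
  u <= \sum_(i < I.*2.+1 | `|delta * (i%:R - I%:R) - th| <= u) delta.
Proof.
move=> d0 du hT.
pose y := (th - u) / delta + I%:R.
have /andP[ht1 ht2] : - `|th| <= th <= `|th| by rewrite -ler_norml.
have y0 : 0 <= y.
  have -> : y = (th - u + I%:R * delta) / delta by rewrite /y; field; rewrite lt0r_neq0.
  by rewrite divr_ge0 // ?(ltW d0) //; lra.
have u0 : 0 < u by apply: lt_le_trans du.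
have [i0 [i1 i2]] : exists i0 : nat, y < i0%:R /\ (i0%:R <= y + 1).
  have /andP[h1 h2] := truncn_itv y0.
  by exists (Num.truncn y).+1; split=> //; rewrite -natr1 lerD2r.
have [c [c1 c2]] : exists c : nat, c%:R <= 2 * u / delta /\ 2 * u / delta < c%:R + 1.
  have h0 : 0 <= 2 * u / delta by rewrite divr_ge0 ?mulr_ge0 // ltW.
  have /andP[h1 h2] := truncn_itv h0.
  by exists (Num.truncn (2 * u / delta)); split=> //; rewrite natr1.
have yd : delta * (y - I%:R) = th - u by rewrite /y; field; rewrite lt0r_neq0.
rewrite ler_pdivlMr // in c1; rewrite ltr_pdivrMr // in c2.
have c0 : (0 < c)%N.
  rewrite lt0n; apply/eqP => c0; rewrite c0 in c2; lra.
have near i : (i0 <= i < i0 + c)%N -> th - u < delta * (i%:R - I%:R) <= th + u.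
  move=> /andP[a1 a2]; rewrite -(ler_nat R) in a1.
  have a3 : i%:R + 1 <= i0%:R + c%:R :> R by rewrite natr1 -natrD ler_nat.
  have a4 : delta * (y - I%:R) < delta * (i%:R - I%:R) by rewrite ltr_pM2l // ltrD2r; lra.
  have a5 : delta * (i%:R - I%:R) <= delta * (y + c%:R - I%:R) by rewrite ler_pM2l //; lra.
  apply/andP; split; first by lra.
  have -> : th + u = delta * (y - I%:R) + 2 * u by rewrite yd; ring.
  lra.
have cm : (i0 + c <= I.*2.+1)%N.
  have hc : (i0 + c = (i0 + c.-1).+1)%N by rewrite -addnS prednK.
  have := near (i0 + c.-1)%N; rewrite leq_addr hc ltnS leqnn => /(_ isT) /andP[_ h].
  rewrite ltnS -addnn -(ler_nat R) [X in _ <= X]natrD -lerBlDr -(ler_pM2l d0).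
  by apply: le_trans h _; lra.
rewrite -(big_mkord (fun i : nat => `|delta * (i%:R - I%:R) - th| <= u) (fun=> delta)) big_mkcond.
rewrite (big_cat_nat (n := i0)) ?(leq_trans _ cm) ?leq_addr //= [X in _ <= _ + X](big_cat_nat (n := (i0 + c)%N)) ?leq_addr //=.
have pos (a b : nat) : 0 <= \sum_(a <= i < b) (if `|delta * (i%:R - I%:R) - th| <= u then delta else 0).
  by apply: sumr_ge0 => i _; case: ifP => // _; exact: ltW.
have -> : \sum_(i0 <= i < i0 + c) (if `|delta * (i%:R - I%:R) - th| <= u then delta else 0) = c%:R * delta.
  rewrite (eq_big_nat _ _ (F2 := fun=> delta)).
    by rewrite sumr_const_nat addKn mulr_natl.
  move=> i hi; have /andP[n1 n2] := near i hi.
  have -> // : `|delta * (i%:R - I%:R) - th| <= u.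
  by rewrite ler_norml; apply/andP; split; clear -n1 n2; lra.
have := pos 0%N i0; have := pos (i0 + c)%N I.*2.+1; lra.
Qed.

Lemma cosh_ub (u : R) : `|u| <= 1 -> expR u + expR (- u) <= 2 + 4 * u ^+ 2.
Proof.
have core (v : R) : 0 <= v -> v <= 1 -> expR v + expR (- v) <= 2 + 4 * v ^+ 2.
  move=> v0 v1; have E0 := expR_gt0 v.
  have E4 : expR v <= 4.
    have e : expR v = expR (v / 2) ^+ 2 by rewrite -expRM_natl; congr expR; field.
    have := expR_ge1Dx (- (v / 2)); rewrite expRN => h.
    have p := expR_gt0 (v / 2).
    have : expR (v / 2) * (1 + - (v / 2)) <= 1 by rewrite -[leRHS](divff (lt0r_neq0 p)) ler_pM2l.
    have q : expR (v / 2) * 2^-1 <= expR (v / 2) * (1 + - (v / 2)) by rewrite ler_wpM2l ?(ltW p) //; lra.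
    move=> h1; have h2 : expR (v / 2) <= 2 by lra.
    by rewrite e expr2; nra.
  have h1 : expR v - 1 <= v * expR v.
    have := expR_ge1Dx (- v); rewrite expRN => h.
    have : expR v * (1 + - v) <= 1 by rewrite -[leRHS](divff (lt0r_neq0 E0)) ler_pM2l.
    lra.
  have h0 : 0 <= expR v - 1 by have := expR_ge1Dx v; lra.
  have h2 : (expR v - 1) ^+ 2 <= v ^+ 2 * expR v ^+ 2 by rewrite -exprMn lerXn2r ?nnegrE ?mulr_ge0 ?expR_ge0.
  rewrite expRN -subr_ge0 -(pmulr_rge0 _ E0).
  have -> : expR v * (2 + 4 * v ^+ 2 - (expR v + (expR v)^-1)) = 4 * v ^+ 2 * expR v - (expR v - 1) ^+ 2.
    by field; rewrite lt0r_neq0.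
  have : v ^+ 2 * expR v ^+ 2 <= 4 * v ^+ 2 * expR v.
    have -> : v ^+ 2 * expR v ^+ 2 = v ^+ 2 * expR v * expR v by rewrite expr2 mulrA.
    have -> : 4 * v ^+ 2 * expR v = v ^+ 2 * expR v * 4 by ring.
    by rewrite ler_wpM2l // mulr_ge0 ?sqr_ge0 // ltW.
  lra.
move=> hu; have [h|h] := leP 0 u; first by rewrite ger0_norm in hu => //; exact: core.
have := core (- u); rewrite opprK sqrrN addrC; apply; first lra.
by rewrite ltr0_norm in hu.
Qed.

(** The frequency equals 2 sqrt(hk) cosh u, where u is the displacement from the minimising theta =
    (ln h - ln k)/2. *)
Lemma freq_near (delta : R) (I h k i : nat) : (0 < h)%N -> (0 < k)%N ->
  let u := delta * (i%:R - I%:R) - (ln h%:R - ln k%:R) / 2 in `|u| <= 1 ->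
  2 * Num.sqrt (h * k)%:R <= freq delta I h k i <= 2 * Num.sqrt (h * k)%:R + 4 * Num.sqrt (h * k)%:R * u ^+ 2.
Proof.
move=> h0 k0 u hu; rewrite natrM; apply/andP; split.
  by apply: amgm2; rewrite ?ler0n // agrid_gt0.
have hR : 0 < h%:R :> R by rewrite ltr0n.
have kR : 0 < k%:R :> R by rewrite ltr0n.
have := cosh_ub hu => hc.
have s0 : 0 <= Num.sqrt (h%:R * k%:R : R) by exact: sqrtr_ge0.
suff -> : freq delta I h k i = Num.sqrt (h%:R * k%:R) * (expR u + expR (- u)).
  by apply: le_trans (ler_wpM2l s0 hc) _; rewrite le_eqVlt; apply/orP; left; apply/eqP; ring.
pose a := expR (ln (h%:R : R) / 2); pose b := expR (ln (k%:R : R) / 2).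
have a0 : 0 < a by exact: expR_gt0.
have b0 : 0 < b by exact: expR_gt0.
have ea : h%:R = a ^+ 2 :> R.
  by rewrite /a -expRM_natl mulrC -mulrA mulVf ?mulr1 ?lnK // posrE.
have eb : k%:R = b ^+ 2 :> R.
  by rewrite /b -expRM_natl mulrC -mulrA mulVf ?mulr1 ?lnK // posrE.
have eal : agrid delta I i = expR u * a / b.
  by rewrite /agrid /a /b -expRN -!expRD; congr expR; rewrite /u; field.
have U0 := expR_gt0 u.
rewrite /freq eal ea eb -exprMn sqrtr_sqr ger0_norm ?mulr_ge0 ?(ltW a0) ?(ltW b0) // expRN.
by field; rewrite !lt0r_neq0.
Qed.

(** For |u| <= u0 the frequency exceeds 2 sqrt n by at most 4 sqrt n u0^2 = 1/(36 J). By [Psi_lip]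
    this costs at most 2/9 < 1/4 of the mass, out of the half that [Psi_mem] guarantees. It also
    stays below 6 sqrt n, which gives the exponent 12 pi eta sqrt n. *)
Lemma lower_pair (eta delta : R) (I J h k : nat) (s : seq R) : 0 < eta -> 0 < delta ->
  (0 < h)%N -> (0 < k)%N -> (0 < J)%N ->
  let n := (h * k)%N in let u0 := (12 * Num.sqrt J%:R * Num.sqrt (Num.sqrt n%:R))^-1 in
  2 * Num.sqrt n%:R \in s -> delta <= u0 -> `|(ln h%:R - ln k%:R) / 2| + u0 <= I%:R * delta ->
  n%:R ^+ 3 * expR (- (12 * pi * (eta * Num.sqrt n%:R))) * (4^-1 * Psi s J 0) * u0 <=
  \sum_(i < I.*2.+1) wt3 eta delta I h k i * Psi s J (freq delta I h k i).
Proof.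
move=> e0 d0 h0 k0 J0 n u0 ns du hT.
have n0 : (0 < n)%N by rewrite muln_gt0 h0.
have [r er] : exists r : R, r = Num.sqrt n%:R by eexists.
have [q eq] : exists q : R, q = Num.sqrt r by eexists.
have [rJ eJ] : exists rJ : R, rJ = Num.sqrt J%:R by eexists.
have r1 : 1 <= r by rewrite er -[X in X <= _]sqrtr1 ler_wsqrtr // ler1n.
have q1 : 1 <= q by rewrite eq -[X in X <= _]sqrtr1 ler_wsqrtr.
have J1 : 1 <= rJ by rewrite eJ -[X in X <= _]sqrtr1 ler_wsqrtr // ler1n.
have q2 : q ^+ 2 = r by rewrite eq sqr_sqrtr //; lra.
have J2 : rJ ^+ 2 = J%:R by rewrite eJ sqr_sqrtr.
have eu : u0 = (12 * rJ * q)^-1 by rewrite /u0 -er -eq -eJ.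
have den : 0 < 12 * rJ * q by rewrite !mulr_gt0 //; lra.
have u00 : 0 < u0 by rewrite eu invr_gt0.
have u01 : u0 <= 1.
  rewrite eu -[X in _ <= X]invr1 lef_pV2 ?posrE //.
  have : 1 <= rJ * q by rewrite mulr_ege1.
  lra.
have u02 : 144 * J%:R * r * u0 ^+ 2 = 1.
  by rewrite eu -J2 -q2; field; apply/andP; split; apply/eqP; lra.
set th := (ln h%:R - ln k%:R) / 2 in hT.
have nc0 := near_count d0 du hT.
have P0 := Psi_ge0 s J 0.
have p0 := pi_gt0 R.
have p4 := @pi_le4 R.
pose W := n%:R ^+ 3 * expR (- (12 * pi * (eta * Num.sqrt n%:R))).
have W0 : 0 <= W by rewrite mulr_ge0 ?exprn_ge0 ?expR_ge0.
rewrite -/W; apply: le_trans (_ : W * (4^-1 * Psi s J 0) * \sum_(i < I.*2.+1 | `|delta * (i%:R - I%:R) - th| <= u0) delta <= _).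
  by rewrite ler_wpM2l // mulr_ge0 // mulr_ge0.
rewrite mulr_sumr big_mkcond; apply: ler_sum => i _.
have w0 : 0 <= wt3 eta delta I h k i.
  by rewrite /wt3 mulr_ge0 ?(ltW d0) // mulr_ge0 ?expR_ge0 // exprn_ge0 // mulr_ge0.
case: ifP => [hi|_]; last by rewrite mulr_ge0 ?Psi_ge0.
have := freq_near h0 k0 (le_trans hi u01); rewrite -/th -/n -er.
set u := _ - th in hi *; set F := freq _ _ _ _ _ => /andP[F1 F2].
have uu : u ^+ 2 <= u0 ^+ 2 by rewrite -real_normK ?num_real // lerXn2r ?nnegrE // ltW.
have u1 : u ^+ 2 <= 1 by apply: le_trans uu _; rewrite expr_le1 // ltW.
have F3 : F <= 6 * r by apply: le_trans F2 _; clear -r1 u1; nra.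
have wl : W * delta <= wt3 eta delta I h k i.
  rewrite /wt3 -/F mulrC ler_wpM2l ?(ltW d0) // /W -natrM -/n ler_wpM2l ?exprn_ge0 // ler_expR lerN2 -er.
  have -> : 2 * pi * (F * eta) = 2 * (pi * eta) * F by ring.
  have -> : 12 * pi * (eta * r) = 2 * (pi * eta) * (6 * r) by ring.
  by rewrite ler_wpM2l // mulr_ge0 // mulr_ge0 // ltW.
have Pl : 4^-1 * Psi s J 0 <= Psi s J F.
  have h1 := Psi_mem J ns; rewrite -er in h1.
  have h2 := Psi_lip s J (2 * r) F.
  have h3 : 2 * pi * `|2 * r - F| * J%:R <= 4^-1.
    rewrite ler0_norm ?subr_le0 // opprB.
    apply: le_trans (_ : 2 * 4 * (4 * r * u0 ^+ 2) * J%:R <= _); last by clear -u02; lra.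
    rewrite ler_wpM2r //; apply: ler_pM; rewrite ?mulr_ge0 ?subr_ge0 ?(ltW p0) //.
      by rewrite ler_wpM2l.
    by rewrite lerBlDl; apply: le_trans F2 _; rewrite lerD2l ler_wpM2l //; clear -r1; lra.
  have h4 : 2 * pi * `|2 * r - F| * J%:R * Psi s J 0 <= 4^-1 * Psi s J 0 by rewrite ler_wpM2r.
  by clear -h1 h2 h4; lra.
apply: le_trans (_ : (W * delta) * (4^-1 * Psi s J 0) <= _); first by rewrite mulrAC.
by apply: ler_pM => //; rewrite mulr_ge0 // ltW.
Qed.

End Kernel.

(** * Comparison of the spatial and the frequency side *)

Section Key.
Variable R : realType.

Lemma numdiv_pairs (K n : nat) : (0 < n < K)%N ->
  (numdiv n <= \sum_(h < K) \sum_(k < K) (h * k == n))%N.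
Proof.
move=> /andP[n0 nK]; rewrite numdiv_sum //.
rewrite -(big_mkord xpredT (fun h => \sum_(k < K) (h * k == n))%N).
rewrite [X in (_ <= X)%N](big_cat_nat (n := n.+1)) //=.
rewrite [X in (_ <= X + _)%N](big_cat_nat (n := 1)) //=.
rewrite -addnA (leq_trans _ (leq_addl _ _)) // (leq_trans _ (leq_addr _ _)) //.
rewrite big_nat [X in (_ <= X)%N]big_nat; apply: leq_sum => h /andP[h0 hn].
case: (boolP (h %| n)%N) => // hdn.
have kK : (n %/ h < K)%N by rewrite (leq_ltn_trans _ nK) // leq_div.
by rewrite (bigD1 (Ordinal kK)) //= mulnC divnK // eqxx.
Qed.

(** By positivity only the pairs with product in [ms] are kept, and each n of [ms] has d(n) of
    them. *)
Lemma pair_count (K : nat) (ms : seq nat) (Phi : nat -> nat -> R) (P0 : R) :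
  uniq ms -> (forall n, n \in ms -> (0 < n < K)%N) -> 0 <= P0 ->
  (forall h k, 0 <= Phi h k) ->
  (forall h k, (0 < h)%N -> (0 < k)%N -> (h * k)%N \in ms -> P0 <= Phi h k) ->
  P0 * \sum_(n <- ms) (numdiv n)%:R <= \sum_(h < K) \sum_(k < K) Phi h k.
Proof.
move=> um mK P00 Phi0 hPhi.
apply: le_trans (_ : P0 * \sum_(h < K) \sum_(k < K) ((h * k)%N \in ms)%:R <= _); last first.
  rewrite mulr_sumr; apply: ler_sum => h _; rewrite mulr_sumr; apply: ler_sum => k _.
  case: (boolP ((h * k)%N \in ms)) => hk; last by rewrite mulr0.
  have /andP[] := mK _ hk; rewrite muln_gt0 => /andP[h0 k0] _.
  by rewrite mulr1 hPhi.
rewrite ler_wpM2l //.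
have -> : \sum_(h < K) \sum_(k < K) ((h * k)%N \in ms)%:R =
  \sum_(n <- ms) \sum_(h < K) \sum_(k < K) ((h * k)%N == n)%:R :> R.
  rewrite [RHS]exchange_big /=; apply: eq_bigr => h _; rewrite [RHS]exchange_big /=; apply: eq_bigr => k _.
  rewrite -count_uniq_mem // -sum1_count natr_sum big_mkcond /=.
  by apply: eq_bigr => n _; rewrite eq_sym; case: eqP.
rewrite big_seq [leRHS]big_seq; apply: ler_sum => n /mK hn.
apply: le_trans (_ : (\sum_(h < K) \sum_(k < K) (h * k == n))%N%:R <= _).
  by rewrite ler_nat numdiv_pairs.
by rewrite natr_sum; apply: ler_sum => h _; rewrite natr_sum.
Qed.

Lemma wt3_ge0 (eta delta : R) (I h k i : nat) : 0 <= delta -> 0 <= wt3 eta delta I h k i.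
Proof. by move=> d0; rewrite /wt3 mulr_ge0 // mulr_ge0 ?expR_ge0 // exprn_ge0 // mulr_ge0. Qed.

(** Taking delta = T / I with I large makes the grid end exactly at T, so that the largest e^theta
    does not depend on K or on the mesh; the other conclusions only ask for delta small. *)
Lemma grid_params (eta P K T : R) : 0 < eta -> 1 <= P -> 1 <= K -> 1 <= T ->
  exists (I : nat) (delta : R), [/\ 0 < delta, delta <= 4^-1, I%:R * delta = T,
    delta * (12 * P ^+ 2) <= 1 &
    forall x, 0 <= x -> x <= P -> [/\ 2 ^+ 16 * x ^+ 8 * delta <= eta ^+ 9,
      256 * delta * K * (64 * P) * x <= 1 & delta ^+ 2 * x <= 1]].
Proof.
move=> e0 P1 K1 T1.
have P0 : 0 < P by apply: lt_le_trans P1.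
have K0 : 0 < K by apply: lt_le_trans K1.
have T0 : 0 < T by apply: lt_le_trans T1.
pose q1 := 2 ^+ 16 * P ^+ 8; pose q2 := 256 * (64 * (K * P ^+ 2)).
have q10 : 0 < q1 by rewrite mulr_gt0 ?exprn_gt0.
have q20 : 0 < q2.
  have h : 0 < K * P ^+ 2 by rewrite mulr_gt0 ?exprn_gt0.
  rewrite /q2; set y := K * _ in h *; lra.
pose d0 := Num.min 4^-1 (Num.min (eta ^+ 9 / q1) q2^-1).
have d0_gt0 : 0 < d0.
  by rewrite !lt_min invr_gt0 ltr0n /= divr_gt0 ?exprn_gt0 //= invr_gt0.
have h0 : 0 <= T / d0 by rewrite divr_ge0 // ltW.
have [I [I0 hI]] : exists I : nat, (0 < I)%N /\ T / d0 <= I%:R.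
  exists (Num.truncn (T / d0)).+1; split=> //.
  by have /andP[_ h] := truncn_itv h0; exact: ltW.
have IR : 0 < I%:R :> R by rewrite ltr0n.
have [delta ed] : exists delta, delta = T / I%:R by eexists.
have dd : delta <= d0 by rewrite ed ler_pdivrMr // mulrC -ler_pdivrMr.
have delta0 : 0 < delta by rewrite ed divr_gt0.
have d4 : delta <= 4^-1 by apply: le_trans dd _; rewrite ge_min lexx.
have db : delta * q1 <= eta ^+ 9.
  by rewrite -ler_pdivlMr //; apply: le_trans dd _; rewrite !ge_min lexx orbT.
have dc : delta * q2 <= 1.
  by rewrite -ler_pdivlMr // mul1r; apply: le_trans dd _; rewrite !ge_min lexx !orbT.
have y0 : 0 <= delta * P ^+ 2 by rewrite mulr_ge0 ?exprn_ge0 // ltW.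
have yK : delta * P ^+ 2 <= delta * P ^+ 2 * K by rewrite ler_peMr.
have eq2 : delta * q2 = 256 * (64 * (delta * P ^+ 2 * K)) by rewrite /q2; ring.
rewrite eq2 in dc.
exists I, delta; split; [exact: delta0 | exact: d4 | | |].
- by rewrite ed mulrC divfK // lt0r_neq0.
- have -> : delta * (12 * P ^+ 2) = 12 * (delta * P ^+ 2) by ring.
  by set u := delta * P ^+ 2 in y0 yK dc *; set v := u * K in yK dc *; clear -y0 yK dc; lra.
move=> x x0 xP; split.
- apply: le_trans db; rewrite mulrC ler_wpM2l ?(ltW delta0) // /q1 ler_wpM2l ?exprn_ge0 //.
  by rewrite lerXn2r ?nnegrE // ltW.
- apply: le_trans dc.
  have -> : 256 * delta * K * (64 * P) * x = 256 * (64 * (delta * K * P * x)) by ring.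
  have h : delta * K * P * x <= delta * P ^+ 2 * K.
    have -> : delta * P ^+ 2 * K = delta * K * P * P by ring.
    by rewrite ler_wpM2l // !mulr_ge0 // ltW.
  by set u := delta * K * P * x in h *; set v := _ * K in h *; clear -h; lra.
- have Px : delta * x <= delta * P ^+ 2.
    rewrite ler_wpM2l ?(ltW delta0) //; apply: le_trans xP _.
    by rewrite expr2 ler_peMl // ltW.
  have dx : 0 <= delta * x by rewrite mulr_ge0 // ltW.
  rewrite expr2 -mulrA; apply: le_trans (_ : 1 * 1 <= _); last by rewrite mul1r.
  apply: ler_pM => //; first exact: ltW.
    by clear -d4; lra.
  by set u := delta * P ^+ 2 in y0 yK dc Px *; set v := u * K in yK dc *; clear -y0 yK dc Px; lra.
Qed.

(** For n between nu^4 and C0 nu^4 and eta = nu^(-2), the product eta sqrt n is at most sqrt C0, so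
    the damping is a constant. What remains is n^3 from the weights and n^(-1/4) from the width u0,
    that is nu^11. *)
Lemma lower_pair_uniform (C0 rC qC nu eta delta P : R) (I J h k : nat) (s : seq R) :
  1 <= rC -> 1 <= qC -> rC ^+ 2 = C0 -> qC ^+ 2 = rC -> 1 <= nu -> eta = nu ^- 2 ->
  0 < delta -> delta * (12 * P ^+ 2) <= 1 -> (0 < h)%N -> (0 < k)%N -> (0 < J)%N -> J%:R <= P ->
  let n := (h * k)%N in nu ^+ 4 < n%:R -> n%:R <= C0 * nu ^+ 4 -> n%:R <= P ->
  1 + ln P <= I%:R * delta -> 2 * Num.sqrt n%:R \in s ->
  nu ^+ 11 * (expR (- (12 * pi * rC)) / (48 * qC)) * (Num.sqrt J%:R)^-1 * Psi s J 0 <=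
    \sum_(i < I.*2.+1) wt3 eta delta I h k i * Psi s J (freq delta I h k i).
Proof.
move=> rC1 qC1 rC2 qC2 nu1 eE delta0 small_d h0 k0 J0 JP n n1 n2 nP hT ns.
have nu0 : 0 < nu by apply: lt_le_trans nu1.
have eta0 : 0 < eta by rewrite eE invr_gt0 exprn_gt0.
have rC0 : 0 <= rC by apply: le_trans rC1.
have qC0 : 0 < qC by apply: lt_le_trans qC1.
have n0 : (0 < n)%N by rewrite muln_gt0 h0.
have n1R : 1 <= n%:R :> R by rewrite ler1n.
have [r er] : exists r : R, r = Num.sqrt n%:R by eexists.
have [q eq] : exists q : R, q = Num.sqrt r by eexists.
have r1 : 1 <= r by rewrite er -[X in X <= _]sqrtr1 ler_wsqrtr.
have r0 : 0 <= r by apply: le_trans r1.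
have q1 : 1 <= q by rewrite eq -[X in X <= _]sqrtr1 ler_wsqrtr.
have q0 : 0 < q by apply: lt_le_trans q1.
have r2 : r ^+ 2 = n%:R by rewrite er sqr_sqrtr.
have q2 : q ^+ 2 = r by rewrite eq sqr_sqrtr.
have rub : r <= rC * nu ^+ 2.
  rewrite -(@ler_pXn2r _ 2) ?nnegrE // ?mulr_ge0 ?exprn_ge0 ?(ltW nu0) //.
  by rewrite r2 exprMn rC2 -exprM.
have qub : q <= qC * nu.
  rewrite -(@ler_pXn2r _ 2) ?nnegrE ?(ltW q0) ?mulr_ge0 ?(ltW nu0) ?(ltW qC0) //.
  by rewrite q2 exprMn qC2.
have qP : q <= P.
  apply: le_trans nP; rewrite -r2 -q2 -exprM.
  by rewrite -[X in X <= _]expr1 ler_weXn2l.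
have [sj esj] : exists sj : R, sj = Num.sqrt J%:R by eexists.
have sj1 : 1 <= sj by rewrite esj -[X in X <= _]sqrtr1 ler_wsqrtr // ler1n.
have sj0 : 0 < sj by apply: lt_le_trans sj1.
have JsP : sj <= P.
  have e : sj ^+ 2 = J%:R by rewrite esj sqr_sqrtr.
  by apply: le_trans JP; rewrite -e expr2 ler_peMr // ltW.
have sq1 : 1 <= sj * q by rewrite mulr_ege1.
have den : 0 < 12 * sj * q by rewrite mulr_gt0 // mulr_gt0.
have := @lower_pair R eta delta I J h k s eta0 delta0 h0 k0 J0.
rewrite /= -/n -er -eq -esj => hl; apply: le_trans (hl _ _ _) => //.
- have [Ps ePs] : exists Ps : R, Ps = Psi s J 0 by eexists.
  have Ps0 : 0 <= Ps by rewrite ePs Psi_ge0.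
  rewrite -ePs.
  have w1 : nu ^+ 12 <= n%:R ^+ 3.
    have -> : nu ^+ 12 = (nu ^+ 4) ^+ 3 by rewrite -exprM.
    by rewrite lerXn2r ?nnegrE ?exprn_ge0 ?(ltW nu0) // ltW.
  have w2 : expR (- (12 * pi * rC)) <= expR (- (12 * pi * (eta * r))).
    rewrite ler_expR lerN2 ler_wpM2l ?mulr_ge0 ?pi_ge0 //.
    by rewrite eE mulrC ler_pdivrMr ?exprn_gt0.
  have sj12 : 0 < 12 * sj by rewrite mulr_gt0.
  have w3 : (12 * sj * (qC * nu))^-1 <= (12 * sj * q)^-1.
    by rewrite lef_pV2 ?posrE // ?mulr_gt0 // ler_wpM2l // ltW.
  set e := expR (- (12 * pi * rC)) in w2 *.
  have e0 : 0 <= e by exact: expR_ge0.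
  apply: le_trans (_ : nu ^+ 12 * e * (4^-1 * Ps) * (12 * sj * (qC * nu))^-1 <= _).
    rewrite le_eqVlt; apply/orP; left; apply/eqP; field.
    by rewrite !lt0r_neq0.
  have nX : 0 <= nu ^+ 12 by rewrite exprn_ge0 // ltW.
  have P4 : 0 <= 4^-1 * Ps by rewrite mulr_ge0.
  apply: ler_pM => //.
  + by rewrite mulr_ge0 // mulr_ge0.
  + by rewrite invr_ge0 ltW // mulr_gt0 // mulr_gt0.
  + by apply: ler_wpM2r => //; apply: ler_pM.
- by rewrite er.
- rewrite -[leRHS]mul1r ler_pdivlMr //; apply: le_trans small_d.
  rewrite ler_wpM2l ?(ltW delta0) // -mulrA ler_wpM2l // expr2.
  by apply: ler_pM => //; exact: ltW.
- have u1 : (12 * sj * q)^-1 <= 1.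
    by rewrite invf_le1 //; clear -sq1; lra.
  have lh : 0 <= ln (h%:R : R) <= ln P.
    rewrite ln_ge0 ?ler1n //= ler_ln ?posrE ?ltr0n // ?(le_trans _ nP) ?ler_nat ?leq_pmulr //.
    by apply: lt_le_trans nP; rewrite ltr0n.
  have lk : 0 <= ln (k%:R : R) <= ln P.
    rewrite ln_ge0 ?ler1n //= ler_ln ?posrE ?ltr0n // ?(le_trans _ nP) ?ler_nat ?leq_pmull //.
    by apply: lt_le_trans nP; rewrite ltr0n.
  case/andP: lh => lh0 lh1; case/andP: lk => lk0 lk1.
  apply: le_trans hT; rewrite addrC; apply: lerD => //.
  by rewrite ler_norml; apply/andP; split; clear -lh0 lh1 lk0 lk1; lra.
Qed.

(** [resonance] with L = c1 nu^11 sum d(n) and A2 = C' eta^(-7) (B + 1) = C' nu^14 (B + 1); the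
    quotient of the powers is nu^(-3). In use X0 is about X, 2^lmax about X^(3/2) and nu^4 = N. *)
Lemma key_inequality (C0 : R) : 1 <= C0 -> exists2 C : R, 0 < C &
  forall (nu : R) (lmax X0 : nat) (ms : seq nat) (B : R),
  let P : R := (2 ^ lmax)%:R in
  1 <= nu -> uniq ms -> (forall n, n \in ms -> nu ^+ 4 < n%:R <= C0 * nu ^+ 4) ->
  (16 <= X0)%N -> (X0 <= 2 ^ lmax)%N -> 4 * nu ^+ 2 <= X0%:R -> C0 * nu ^+ 4 <= P ->
  (2 * ln (64 * P) + 1) * (64 * P) <= X0%:R ^+ 2 ->
  2 ^+ size ms * (2 ^+ 16 * nu ^+ 20 * (2 * ln (64 * P) + 1 + Num.sqrt X0%:R)) <= (4 / 3) ^+ lmax ->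
  0 <= B ->
  (forall x n : nat, (X0 < x < 2 ^ lmax)%N -> (x ^ 2 <= 4 * n)%N -> (n <= 16 * x ^ 2)%N ->
    `|Delta (n%:R : R)| <= B * Num.sqrt (Num.sqrt n%:R)) ->
  nu ^- 3 * \sum_(n <- ms) (numdiv n)%:R <= C * (B + 1).
Proof.
move=> C01; have [C' C'0 hlarge] := gK_large R.
have [rC erC] : exists r : R, r = Num.sqrt C0 by eexists.
have [qC eqC] : exists q : R, q = Num.sqrt rC by eexists.
have rC1 : 1 <= rC by rewrite erC -[X in X <= _]sqrtr1 ler_wsqrtr.
have qC1 : 1 <= qC by rewrite eqC -[X in X <= _]sqrtr1 ler_wsqrtr.
have rC2 : rC ^+ 2 = C0 by rewrite erC sqr_sqrtr //; lra.
have qC2 : qC ^+ 2 = rC by rewrite eqC sqr_sqrtr //; lra.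
have qC0 : 0 < qC by lra.
have [c1 c10 ec1] : exists2 c1 : R, 0 < c1 & c1 = expR (- (12 * pi * rC)) / (48 * qC).
  by eexists; last reflexivity; rewrite divr_gt0 ?expR_gt0 // mulr_gt0.
exists ((1 + 154 * C') / c1); first by apply: divr_gt0 => //; clear -C'0; lra.
move=> nu lmax X0 ms B P nu1 um hms X16 X0P nuX nuP hP hs B0 hB.
have P1 : 1 <= P by rewrite /P ler1n expn_gt0.
have PE : P = (2 ^ lmax)%:R by [].
clearbody P.
have P0 : 0 < P by exact: lt_le_trans P1.
have nu0 : 0 < nu by exact: lt_le_trans nu1.
have [eta eE] : exists eta : R, eta = nu ^- 2 by eexists.
have eta0 : 0 < eta by rewrite eE invr_gt0 exprn_gt0.
have eta1 : eta <= 1 by rewrite eE invf_le1 ?exprn_gt0 // exprn_ege1.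
have [T TE] : exists T : R, T = ln (64 * P) by eexists.
rewrite -TE in hP hs.
have lnP : 0 <= ln P by rewrite ln_ge0.
have ln64 : 1 <= ln (64 : R) by apply: (@ln_ge1_16 R 64).
have eT : T = ln 64 + ln P by rewrite TE lnM ?posrE.
have T1 : 1 <= T by clear -eT ln64 lnP; lra.
pose D := 2 * T + 1 + P.
have D1 : 1 <= D by rewrite /D; clear -T1 P1; lra.
pose kap := eta / (64 * P).
have kap0 : 0 < kap by rewrite divr_gt0 // mulr_gt0.
have [K0 hK] := hlarge kap D kap0 D1.
(* [K0] is known before the grid; the mesh is chosen afterwards, small in terms of K. The second
   summand places every n of [ms] below K, so that all its factorisations occur among the pairs (h,
   k). *)
pose K := (K0 + (2 ^ lmax).+1)%N.
have K1 : 1 <= K%:R :> R by rewrite ler1n /K addnS.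
have [I [delta [delta0 d4 Id small_d conds]]] := grid_params eta0 P1 K1 T1.
have E64 : expR (I%:R * delta) = 64 * P by rewrite Id TE lnK // posrE mulr_gt0.
have mdE : I.*2.+1%:R * delta <= 2 * T + 1.
  rewrite -[I.*2.+1%:R]natr1 -addnn natrD mulrDl mul1r mulrDl Id.
  have : delta <= 1 by apply: le_trans d4 _; rewrite invf_le1 // ler1n.
  by clear; lra.
have ed0 : 0 <= delta by exact: ltW.
have P_ge0 : 0 <= P by exact: ltW.
(* The existential hides the hypothesis from [lra], which is slow on such powers. *)
have hs' : exists v : unit, 2 ^+ size ms * (2 ^+ 16 * nu ^+ 20 * (2 * T + 1 + Num.sqrt X0%:R)) <= (4 / 3 : R) ^+ lmax.
  by exists tt.
clear hs.
have PP : P <= P ^+ 2 by rewrite expr2 ler_peMl // ltW.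
have d01 : 0 < delta <= 4^-1 by rewrite delta0.
have [w w0 ew] : exists2 w : R, 0 < w & w = nu ^+ 20 by exists (nu ^+ 20); rewrite ?exprn_gt0.
have w_ge0 := ltW w0.
have e10 : eta ^- 10 = w by rewrite eE ew -exprVn invrK -exprM.
have e7 : eta ^- 7 = nu ^+ 14 by rewrite eE -exprVn invrK -exprM.
rewrite -ew in hs'.
pose L := nu ^+ 11 * c1 * \sum_(n <- ms) (numdiv n)%:R.
pose lam := [seq 2 * Num.sqrt (n%:R : R) | n <- ms].
pose A2 := C' * nu ^+ 14 * (B + 1).
have xP (x : nat) : (x <= 2 ^ lmax)%N -> x%:R <= P by rewrite PE ler_nat.
have main : L <= 1 + 154 * A2.
  apply: (@resonance R _ (fun t : 'I_K * 'I_K * 'I_I.*2.+1 => wt3 eta delta I t.1.1 t.1.2 t.2)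
    (fun t => freq delta I t.1.1 t.1.2 t.2) (gK K I eta delta) lam lmax X0
    ((2 * T + 1) * (64 * w)) (147 * (64 * w)) A2).
  - by move=> t; exact: wt3_ge0.
  - by apply: mulr_ge0; [clear -T1; lra | rewrite mulr_ge0].
  - by rewrite mulr_ge0 // mulr_ge0.
  - by apply: mulr_ge0; [rewrite mulr_ge0 ?exprn_ge0 ?(ltW C'0) ?(ltW nu0) | clear -B0; lra].
  - by move=> j; exact: gK_E.
  - split.
    + apply: le_trans (gK_0 _ _ eta0 delta0) _; rewrite e10 ler_wpM2r ?mulr_ge0 //.
    + move=> j /andP[j0 jX]; rewrite -e10.
      have jP : j%:R <= P by apply: xP; exact: leq_trans X0P.
      have [_ c2 c3'] := conds _ (ler0n R j) jP.
      have d2 : 0 < delta <= 2^-1 by rewrite delta0 /=; clear -d4; lra.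
      have e01 : 0 < eta <= 1 by rewrite eta0.
      by apply: (gK_small j0 e01 d2 c3'); rewrite E64.
    + move=> j /andP[jX jl]; rewrite /A2 -e7.
      have jP : j%:R <= P by apply: xP; exact: ltnW.
      have jR : X0%:R <= j%:R :> R by rewrite ler_nat ltnW.
      apply: hK => //.
      * by rewrite leq_addr.
      * by rewrite (leq_trans X16) // ltnW.
      * by rewrite eta0.
      * rewrite eE ler_pdivlMr ?exprn_gt0 //; exact: le_trans jR.
      * by clear -jP T1; rewrite /D; lra.
      * by clear -jP E64 P0; rewrite E64; lra.
      * rewrite E64; apply: le_trans (_ : X0%:R ^+ 2 <= _); last by rewrite lerXn2r ?nnegrE.
        by apply: le_trans hP; rewrite ler_wpM2r // mulr_ge0 // ltW.
      * by clear -mdE P0; rewrite /D; lra.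
      * by rewrite E64 /kap.
      * by case: (conds _ (ler0n R j) jP).
      * by move=> n; apply: hB; rewrite jX.
  - case: hs' => _ hs.
    rewrite size_map; apply: le_trans hs; rewrite ler_wpM2l ?exprn_ge0 //.
    set r := Num.sqrt X0%:R; have r0 : 0 <= r by exact: sqrtr_ge0.
    have -> : (2 * T + 1) * (64 * w) + 4 * (147 * (64 * w)) * r =
      w * (64 * (2 * T + 1) + 588 * (64 * r)) by ring.
    rewrite [2 ^+ 16 * _]mulrC -[leRHS]mulrA ler_wpM2l //.
    have -> : 2 ^+ 16 = 1024 * 64 :> R by ring.
    by clear -T1 r0; lra.
  - move=> l ll; set J := (2 ^ l)%N.
    have J0 : (0 < J)%N by rewrite expn_gt0.
    have JP : J%:R <= P by apply: xP; rewrite leq_exp2l.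
    pose Pc := nu ^+ 11 * c1 * (Num.sqrt J%:R)^-1 * Psi lam J 0.
    have sJ : 1 <= Num.sqrt (J%:R : R) by rewrite -[X in X <= _]sqrtr1 ler_wsqrtr // ler1n.
    have Pc0 : 0 <= Pc.
      by rewrite !mulr_ge0 ?exprn_ge0 ?invr_ge0 ?sqrtr_ge0 ?Psi_ge0 ?(ltW c10) ?(ltW nu0).
    have hmK n : n \in ms -> (0 < n < K)%N.
      move=> hn; have /andP[n1 n2] := hms n hn.
      rewrite -(ltr0n R) (le_lt_trans _ n1) ?exprn_ge0 ?(ltW nu0) //=.
      have : n%:R <= P by apply: le_trans nuP.
      by rewrite PE ler_nat => h; rewrite /K addnS ltnS (leq_trans h) // leq_addl.
    have -> : L * (Num.sqrt J%:R)^-1 * Psi lam J 0 = Pc * \sum_(n <- ms) (numdiv n)%:R.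
      by rewrite /L /Pc; ring.
    have -> : \sum_(t : 'I_K * 'I_K * 'I_I.*2.+1) wt3 eta delta I t.1.1 t.1.2 t.2 * Psi lam J (freq delta I t.1.1 t.1.2 t.2) =
      \sum_(h < K) \sum_(k < K) \sum_(i < I.*2.+1) wt3 eta delta I h k i * Psi lam J (freq delta I h k i).
      rewrite -(pair_bigA _ (fun (p : 'I_K * 'I_K) (i : 'I_I.*2.+1) =>
         wt3 eta delta I p.1 p.2 i * Psi lam J (freq delta I p.1 p.2 i))) /=.
      by rewrite -(pair_bigA _ (fun (h k : 'I_K) => \sum_(i < I.*2.+1)
         wt3 eta delta I h k i * Psi lam J (freq delta I h k i))).
    apply: (@pair_count K ms (fun h k => \sum_(i < I.*2.+1) wt3 eta delta I h k i * Psi lam J (freq delta I h k i))) => //.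
      move=> h k; apply: sumr_ge0 => i _; by rewrite mulr_ge0 ?Psi_ge0 ?wt3_ge0.
    move=> h k h0 k0 hk; have /andP[n1 n2] := hms _ hk.
    rewrite /Pc ec1; apply: (lower_pair_uniform rC1 qC1 rC2 qC2 nu1 eE delta0 small_d) => //.
    - exact: le_trans nuP.
    - by rewrite Id eT lerD2r.
    - by apply: (map_f (fun n : nat => 2 * Num.sqrt (n%:R : R))).
rewrite mulrAC ler_pdivlMr //.
have n3 : 0 < nu ^+ 14 by rewrite exprn_gt0.
rewrite -(ler_pM2l n3).
have -> : nu ^+ 14 * (nu ^- 3 * (\sum_(n <- ms) (numdiv n)%:R) * c1) = L.
  by rewrite /L; field; rewrite lt0r_neq0.
apply: le_trans main _; rewrite /A2.
have [y ey] : exists y : R, y = nu ^+ 14 * (B + 1) by eexists.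
have y1 : 1 <= y by rewrite ey mulr_ege1 ?exprn_ege1 //; clear -B0; lra.
rewrite -[C' * _ * _]mulrA -ey [leRHS]mulrCA -ey; clear -y1 C'0; lra.
Qed.

End Key.

(** * Choice of parameters *)

Section Asymptotics.
Variable R : realType.

Lemma ln2_half : 2^-1 <= ln 2 :> R.
Proof.
rewrite -lerN2 -lnV ?posrE // [X in ln X](_ : _ = 1 + (- 2^-1)); last by field.
by apply: le_ln1Dx; lra.
Qed.

(** Since (4/3)^5 >= 2^2, (4/3)^lmax is at least (2^lmax)^(2/5), about X^(3/5). This has to exceed
    sqrt X, which comes from the sum of 1 / sqrt j over j <= X, and 3/5 = 1/2 + 1/20 + 1/20 leaves
    X^(1/20) for the resonator and X^(1/20) for powers of log X. *)
Lemma dyadic_scale (L : R) : 1 <= L -> exists lmax : nat,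
  [/\ expR (3 / 2 * L) <= 2 * (2 ^ lmax)%:R, (2 ^ lmax)%:R <= expR (3 / 2 * L) &
      expR (3 / 5 * L - 1) <= (4 / 3) ^+ lmax].
Proof.
move=> L1; have l2 := ln2_half; have l20 : 0 < ln 2 :> R by lra.
have h0 : 0 <= 3 / 2 * L / ln 2 by apply: divr_ge0; [lra | exact: ltW].
have [lmax [h1 h2]] : exists lmax : nat, lmax%:R * ln 2 <= 3 / 2 * L /\ 3 / 2 * L < lmax%:R * ln 2 + ln 2.
  have /andP[h1 h2] := truncn_itv h0; exists (Num.truncn (3 / 2 * L / ln 2)).
  split; first by rewrite -ler_pdivlMr.
  by rewrite -[X in _ + X]mul1r -mulrDl natr1 -ltr_pdivrMr.
have eP : (2 ^ lmax)%:R = expR (lmax%:R * ln 2) :> R.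
  by rewrite natrX expRM_natl lnK // posrE.
have b1 : expR (3 / 2 * L) <= 2 * (2 ^ lmax)%:R.
  have e2 : 2 = expR (ln 2) :> R by rewrite lnK // posrE.
  by rewrite eP [X in _ <= X * _]e2 -expRD ler_expR addrC ltW.
exists lmax; split=> //; first by rewrite eP ler_expR.
have q0 : 0 <= (4 / 3) ^+ lmax :> R by rewrite exprn_ge0 // divr_ge0.
rewrite -(@ler_pXn2r _ 5) ?nnegrE ?expR_ge0 // -exprM mulnC exprM.
have -> : expR (3 / 5 * L - 1) ^+ 5 = expR (3 / 2 * L) ^+ 2 * expR (- 5).
  by rewrite -!expRM_natl -expRD; congr expR; field.
apply: le_trans (_ : ((2 ^ lmax)%:R) ^+ 2 <= _); last first.
  rewrite natrX -exprM mulnC exprM; apply: lerXn2r; rewrite ?nnegrE ?exprn_ge0 ?divr_ge0 //.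
  have -> : (4 / 3) ^+ 5 = 1024 / 243 :> R by field.
  have -> : 2 ^+ 2 = 4 :> R by ring.
  lra.
have e5 : 4 * expR (- 5) <= 1 :> R.
  rewrite expRN ler_pdivrMr ?expR_gt0 // mul1r.
  by have := expR_ge1Dx (5 : R); lra.
have : expR (3 / 2 * L) ^+ 2 <= (2 * (2 ^ lmax)%:R) ^+ 2 by rewrite lerXn2r ?nnegrE ?expR_ge0 // mulr_ge0.
rewrite exprMn => h; apply: le_trans (_ : 2 ^+ 2 * (2 ^ lmax)%:R ^+ 2 * expR (- 5) <= _).
  by rewrite ler_wpM2r // expR_ge0.
have -> : 2 ^+ 2 * (2 ^ lmax)%:R ^+ 2 * expR (- 5) = (4 * expR (- 5)) * (2 ^ lmax)%:R ^+ 2 :> R by ring.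
by rewrite ler_piMl ?exprn_ge0.
Qed.

(* [220 = 11 * 20], as in [expR y >= (y / 11) ^ 11] at [y = L / 20]. *)
Definition Kpow : R := 2 ^+ 19 * 220 ^+ 11.

Lemma Kpow_ge1 : 1 <= Kpow.
Proof. by rewrite /Kpow mulr_ege1 // exprn_ege1 // ler1n. Qed.

Lemma exp_beats_pow (L : R) : Kpow <= L -> 2 ^+ 19 * L ^+ 10 <= expR (L / 20).
Proof.
have aux (a b : R) : 0 < b -> 0 <= L -> a * b ^+ 11 <= L -> a * L ^+ 10 <= (L / b) ^+ 11.
  move=> b0 L0 h; have p11 : 0 < b ^+ 11 by rewrite exprn_gt0.
  rewrite expr_div_n ler_pdivlMr // [L ^+ 11]exprS mulrAC.
  by rewrite ler_wpM2r // exprn_ge0.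
move=> h; have L0 : 0 <= L by apply: le_trans h; exact: le_trans Kpow_ge1.
have L20 : 0 <= L / 20 by rewrite divr_ge0.
apply: le_trans (aux _ 220 _ L0 h) _; first by rewrite ltr0n.
have -> : L / 220 = L / 20 / 11 by field.
by apply: le_trans (expR_ge_pow 11 L20); rewrite lexx.
Qed.

(** The size comparisons with every exponential replaced by a variable: [z] is e^(L/2), [y] is
    e^(L/20), [Lp] is L^10, [X] and [P] are about z^2 and z^3, [sM] is the bound 2^M of the
    resonator, [n20] is nu^20, [T] is ln(64 P) and [q] is (4/3)^lmax. *)
Lemma range_core (C0 N L Lp y z X P T sX sM n20 q : R) :
  0 <= C0 -> 0 <= N -> 1 <= L -> L <= Lp -> 1024 * (512 * Lp) <= y -> y <= z ->
  N <= L -> C0 <= L -> C0 * N ^+ 2 <= Lp -> n20 <= Lp -> 0 <= n20 -> 0 <= sM -> sM <= y ->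
  z * z <= X + 1 -> X <= z * z -> 0 <= sX -> sX <= z -> z * z * z <= 2 * P -> P <= z * z * z ->
  0 <= T -> T <= 6 + 3 / 2 * L -> z * (y * y) / 4 <= q ->
  [/\ 16 <= X, X <= P, 4 * N <= X, C0 * N ^+ 2 <= P &
   (2 * T + 1) * (64 * P) <= X ^+ 2 /\ sM * (1024 * 64 * n20 * (2 * T + 1 + sX)) <= q].
Proof.
move=> C00 N0 L1 LLp hy yz NL CL CN n20L n200 sM0 sMy X1 X2 sX0 sXz P1 P2 T0 T1 hq.
have z1 : 1024 * (512 * Lp) <= z by exact: le_trans yz.
have Lp0 : 0 <= Lp by clear -L1 LLp; lra.
have y0 : 0 <= y by clear -Lp0 hy; lra.
have z0 : 0 <= z by exact: le_trans yz.
have [Z eZ] : exists Z : R, Z = z * z by eexists.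
have [W eW] : exists W : R, W = Z * z by eexists.
rewrite -eZ -?eW in X1 X2 P1 P2.
have zL : 1024 * (512 * L) <= z by clear -z1 LLp; lra.
have zZ : 1024 * (512 * z) <= Z.
  have : 1024 * 512 * z <= z * z by rewrite ler_wpM2r //; clear -zL L1; lra.
  by rewrite -eZ; clear; lra.
have Z0 : 0 <= Z by clear -zZ z0; lra.
have ZW : 1024 * (512 * Z) <= W.
  have : 1024 * 512 * Z <= z * Z by rewrite ler_wpM2r //; clear -zL L1; lra.
  by rewrite eW [Z * z]mulrC; clear; lra.
have W0 : 0 <= W by clear -ZW Z0; lra.
have XZ : Z / 2 <= X by clear -zZ zL L1 X1; lra.
split.
- by clear -XZ zZ zL L1; lra.
- by clear -X2 P1 ZW Z0; lra.
- by clear -XZ zZ zL L1 NL; lra.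
- by apply: le_trans CN _; clear -P1 ZW zZ z1 Lp0 Z0; lra.
split.
  have hT : 2 * T + 1 <= 16 * L by clear -T1 L1; lra.
  apply: le_trans (_ : 16 * L * (64 * W) <= _).
    by apply: ler_pM => //; clear -T0 P1 W0 P2; lra.
  apply: le_trans (_ : (Z / 2) ^+ 2 <= _); last first.
    by apply: lerXn2r => //; rewrite nnegrE; clear -Z0 XZ; lra.
  have -> : (Z / 2) ^+ 2 = z * (W / 4) by rewrite eW eZ; field.
  have -> : 16 * L * (64 * W) = (4096 * L) * (W / 4) by field.
  by apply: ler_wpM2r; [clear -W0; lra | clear -zL L1; lra].
apply: le_trans hq.
have hT : 2 * T + 1 + sX <= 2 * z by clear -T1 L1 zL sXz; lra.
have hT0 : 0 <= 2 * T + 1 + sX by clear -T0 sX0; lra.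
have h64 : 0 <= 1024 * 64 * n20 by clear -n200; lra.
have h64' : 1024 * 64 * n20 <= 1024 * 64 * Lp by clear -n20L; lra.
apply: le_trans (_ : y * (1024 * 64 * Lp * (2 * z)) <= _).
  apply: ler_pM; [exact: sM0 | exact: mulr_ge0 | exact: sMy | exact: ler_pM].
have -> : y * (1024 * 64 * Lp * (2 * z)) = z * y * (1024 * 128 * Lp) by ring.
have -> : z * (y * y) / 4 = z * y * (y / 4) by field.
by apply: ler_wpM2l; [exact: mulr_ge0 | clear -hy; lra].
Qed.

Lemma range_conditions (C0 nu L : R) (lmax X0 M : nat) :
  1 <= C0 -> 1 <= nu -> nu ^+ 2 <= L -> Kpow <= L -> C0 <= L ->
  expR (3 / 2 * L) <= 2 * (2 ^ lmax)%:R -> (2 ^ lmax)%:R <= expR (3 / 2 * L) ->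
  expR (3 / 5 * L - 1) <= (4 / 3) ^+ lmax ->
  X0%:R <= expR L < X0%:R + 1 -> M%:R <= L / 20 ->
  let P : R := (2 ^ lmax)%:R in
  [/\ (16 <= X0)%N, (X0 <= 2 ^ lmax)%N, 4 * nu ^+ 2 <= X0%:R, C0 * nu ^+ 4 <= P &
    (2 * ln (64 * P) + 1) * (64 * P) <= X0%:R ^+ 2 /\
    2 ^+ M * (2 ^+ 16 * nu ^+ 20 * (2 * ln (64 * P) + 1 + Num.sqrt X0%:R)) <= (4 / 3) ^+ lmax].
Proof.
move=> C01 nu1 nuL KL CL P1 P2 hl /andP[X1 X2] ML P.
have L1 : 1 <= L by apply: le_trans KL; exact: Kpow_ge1.
have L0 : 0 <= L by exact: le_trans L1.
have nu0 : 0 <= nu by exact: le_trans nu1.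
have hexp : 1024 * (512 * L ^+ 10) <= expR (L / 20).
  apply: le_trans (exp_beats_pow KL).
  by rewrite mulrA ler_wpM2r ?exprn_ge0 // le_eqVlt; apply/orP; left; apply/eqP; ring.
have eL : expR L = expR (L / 2) * expR (L / 2) by rewrite -expRD; congr expR; field.
have e32 : expR (3 / 2 * L) = expR (L / 2) * expR (L / 2) * expR (L / 2).
  by rewrite -!expRD; congr expR; field.
have P1' : 1 <= P by rewrite /P ler1n expn_gt0.
have P0 : 0 < P by exact: lt_le_trans P1'.
have lnP : ln (64 * P) <= 6 + 3 / 2 * L.
  rewrite lnM ?posrE //; apply: lerD; last first.
    apply: le_trans (_ : ln (expR (3 / 2 * L)) <= _); last by rewrite expRK.
    by rewrite ler_ln ?posrE ?expR_gt0.
  have -> : 64 = 2 ^+ 6 :> R by ring.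
  by rewrite lnXn // -[ln 2 *+ 6]mulr_natl; have := ln2_le1 R; clear; lra.
have lnP0 : 0 <= ln (64 * P) by rewrite ln_ge0 // mulr_ege1 // ler1n.
have sX : Num.sqrt X0%:R <= expR (L / 2).
  rewrite -[leRHS]ger0_norm ?expR_ge0 // -sqrtr_sqr ler_wsqrtr // expr2 -eL //.
have sM : 2 ^+ M <= expR (L / 20).
  rewrite -[X in X ^+ M](lnK (x := 2)) ?posrE // -expRM_natl ler_expR.
  by apply: le_trans ML; rewrite ler_piMr //; exact: ln2_le1.
have hq : expR (L / 2) * (expR (L / 20) * expR (L / 20)) / 4 <= (4 / 3) ^+ lmax.
  apply: le_trans hl.
  have -> : expR (3 / 5 * L - 1) = expR (L / 2) * (expR (L / 20) * expR (L / 20)) * expR (- 1).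
    by rewrite -!expRD; congr expR; field.
  rewrite ler_wpM2l // ?mulr_ge0 ?expR_ge0 //.
  have := expR_ge1Dx (- 2^-1 : R) => h.
  have -> : expR (- 1) = expR (- 2^-1) ^+ 2 :> R by rewrite -expRM_natl; congr expR; field.
  have -> : 4^-1 = (2^-1) ^+ 2 :> R by field.
  by apply: lerXn2r; rewrite ?nnegrE ?expR_ge0 //; clear -h; lra.
have L10 : L <= L ^+ 10 by rewrite -[leLHS]expr1 ler_weXn2l.
have yz : expR (L / 20) <= expR (L / 2) by rewrite ler_expR; clear -L0; lra.
have CN : C0 * (nu ^+ 2) ^+ 2 <= L ^+ 10.
  apply: le_trans (_ : L * L ^+ 2 <= _); last by rewrite -exprS ler_weXn2l.
  apply: ler_pM => //; rewrite ?exprn_ge0 //; first exact: le_trans C01.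
  by rewrite lerXn2r ?nnegrE ?exprn_ge0.
have n20 : nu ^+ 20 <= L ^+ 10.
  rewrite (_ : nu ^+ 20 = (nu ^+ 2) ^+ 10); last by rewrite -exprM.
  by rewrite lerXn2r ?nnegrE ?exprn_ge0.
rewrite eL in X1 X2; rewrite e32 in P1 P2.
have [c1 c2 c3 c4 [c5 c6]] := @range_core C0 (nu ^+ 2) L (L ^+ 10) (expR (L / 20)) (expR (L / 2)) X0%:R P (ln (64 * P))
  (Num.sqrt X0%:R) (2 ^+ M) (nu ^+ 20) ((4 / 3) ^+ lmax) (le_trans ler01 C01) (exprn_ge0 2 nu0) L1 L10 hexp yz nuL CL CN n20
  (exprn_ge0 20 nu0) (exprn_ge0 M (ler0n R 2)) sM (ltW X2) X1 (sqrtr_ge0 _) sX P1 P2 lnP0 lnP hq.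
split=> //.
- by rewrite -(ler_nat R).
- by rewrite -(ler_nat R).
- by rewrite (_ : nu ^+ 4 = (nu ^+ 2) ^+ 2) // -exprM.
split=> //; apply: le_trans c6; rewrite ler_wpM2l ?exprn_ge0 // ler_wpM2r //.
  by rewrite addr_ge0 ?sqrtr_ge0 // addr_ge0 // mulr_ge0.
rewrite ler_wpM2r ?exprn_ge0 // le_eqVlt; apply/orP; left; apply/eqP; ring.
Qed.

Definition beta : R := 1 - 2 `^ (4 / 3) + 2 `^ (4 / 3) * ln (2 `^ (4 / 3)).

(** The identity uses ln lam = (4/3) ln 2, which says that lam is the critical point of lam ln 2 -
    (3/4) beta; the terms in lam ln 2 cancel. Nonnegativity of [beta] is ln lam >= 1 - 1/lam. *)
Lemma beta_facts : 0 <= beta <= 1 /\ 2 `^ (4 / 3) * ln 2 - 3 / 4 * beta = 3 / 4 * (2 `^ (4 / 3) - 1).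
Proof.
have [h1 h2 h3 h4 h5] := lam_facts R; rewrite /beta.
set lam := 2 `^ (4 / 3) in h1 h2 h3 h4 h5 *.
have l0 : 0 < lam by clear -h1; lra.
split; last by rewrite h3; field.
apply/andP; split.
  have : 1 - lam^-1 <= ln lam.
    rewrite -lerN2 -lnV ?posrE // opprB.
    have p : 0 < lam^-1 by rewrite invr_gt0.
    have e : lam^-1 = 1 + (lam^-1 - 1) by ring.
    by rewrite {1}e; apply: le_ln1Dx; clear -p; lra.
  move=> h; have : lam * (1 - lam^-1) <= lam * ln lam by rewrite ler_pM2l.
  by rewrite mulrBr mulr1 mulfV ?lt0r_neq0 //; clear; lra.
have : lam * ln lam <= lam * 1 by rewrite ler_pM2l.
by clear; lra.
Qed.

(** Here m, l, L stand for log_3 X, log_2 X, log X. The last inequality keeps ln N = l + beta m +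
    t/2 below 2 l. *)
Lemma scale_facts (m : R) : 27 <= m ->
  let l := expR m in let L := expR l in let t := ln m in
  [/\ m <= l, l <= L, 0 <= t, t <= m & beta * m + t / 2 <= l].
Proof.
move=> m27 l L t; have m0 : 0 < m by clear -m27; lra.
have ml : m <= l by have := expR_ge1Dx m; rewrite -/l; clear; lra.
have lL : l <= L by have := expR_ge1Dx l; rewrite -/L; clear; lra.
have t0 : 0 <= t by rewrite ln_ge0 //; clear -m27; lra.
have tm : t <= m by rewrite ltW // ln_sublinear.
split=> //; have [/andP[b0 b1] _] := beta_facts.
have : (m / 2%:R) ^+ 2 <= l by apply: expR_ge_pow; exact: ltW.
have : beta * m <= 1 * m by rewrite ler_wpM2r // ltW.
have : 0 <= (m - 27) * m by rewrite mulr_ge0 ?subr_ge0 // ltW.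
clear -m27 tm; rewrite expr2; lra.
Qed.

(* [nu ^ 4] is the number [N = L * l ^ beta * m ^ (1/2)], for which [many_divisors] provides a
   positive proportion of [L] integers. *)
Lemma divisor_rich_sets : exists C0 c1 E : R, [/\ 1 <= C0, 0 < c1 &
  forall m eps : R, 27 <= m -> E <= m -> 0 < eps -> eps <= c1 / 4 ->
  let l := expR m in let L := expR l in let nu := expR ((l + beta * m + ln m / 2) / 4) in
  2 <= eps * L -> exists ms : seq nat, [/\ uniq ms,
    forall n, n \in ms -> nu ^+ 4 < n%:R <= C0 * nu ^+ 4, (size ms)%:R <= eps * L &
    eps * c1 / 2 * (L `^ (1 / 4) * l `^ (3 / 4 * (2 `^ (4 / 3) - 1)) * m `^ (- (3 / 8))) <=
      nu ^- 3 * \sum_(n <- ms) (numdiv n)%:R]].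
Proof.
have [C0 [c1 [E [C01 c10 H]]]] := many_divisors R.
exists C0, c1, E; split=> //; first exact: ltW.
move=> m eps m27 Em e0 ec l L nu eL.
have [ml lL t0 tm nl] := scale_facts m27; rewrite -/l -/L in ml lL nl.
set t := ln m in t0 tm nl nu *.
have m0 : 0 < m by clear -m27; lra.
have l0 : 0 < l by exact: expR_gt0.
have L0 : 0 < L by exact: expR_gt0.
have [n_ en] : exists n_, n_ = l + beta * m + t / 2 by eexists.
have [/andP[b0 b1] bE] := beta_facts.
have bm : 0 <= beta * m by rewrite mulr_ge0 // ltW.
have nl1 : l <= n_ by rewrite en; clear -bm t0; lra.
have nl2 : n_ <= 2 * l by rewrite en; clear -nl; lra.
have n0 : 0 < n_ by exact: lt_le_trans nl1.
have nu4 : nu ^+ 4 = expR n_ by rewrite /nu -expRM_natl -en; congr expR; field.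
have lnl : ln l = m by rewrite expRK.
have lnn1 : m <= ln n_ by rewrite -lnl ler_ln ?posrE.
have l2 := ln2_half; have l20 : 0 <= ln 2 :> R by clear -l2; lra.
have l21 := ln2_le1 R.
have lnn2 : ln n_ <= ln 2 + m by rewrite -lnl -lnM ?posrE // ler_ln ?posrE // mulr_gt0.
have lln : ln (ln n_) <= ln 2 + t.
  have p : 0 < ln n_ by exact: lt_le_trans lnn1.
  rewrite -lnM ?posrE // ler_ln ?posrE ?mulr_gt0 //; clear -lnn2 l21 m27; lra.
have NE : E <= ln (ln (expR n_)) by rewrite expRK; exact: le_trans lnn1.
have [s [us hs ss]] := H (expR n_) (expR_gt0 _) NE.
rewrite expRK -/beta in hs ss.
have pos_ln : 0 < ln n_ by exact: lt_le_trans lnn1.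
(* As l <= ln N <= 2 l, replacing ln N and ln ln N by l and m costs at most a factor 4; hence the
   condition [eps <= c1 / 4]. *)
have size_s : eps * L <= (size s)%:R.
  apply: le_trans ss; apply: le_trans (_ : c1 / 4 * L <= _).
    by rewrite ler_wpM2r // ltW.
  rewrite -mulrA ler_wpM2l ?(ltW c10) // !powR_expR // -!expRD.
  have -> : 4^-1 = expR (- (2 * ln 2)) :> R.
    have -> : 2 * ln 2 = ln (2 ^+ 2) :> R by rewrite lnXn // [LHS]mulr_natl.
    by rewrite expRN lnK ?posrE ?exprn_gt0 //; field.
  rewrite /L -expRD ler_expR.
  have : beta * ln n_ <= beta * (ln 2 + m) by rewrite ler_wpM2l.
  have : beta * ln 2 <= 1 * ln 2 by rewrite ler_wpM2r.
  rewrite mulrDr mulNr; move: lln; set u := ln (ln n_); set v := beta * ln n_.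
  by rewrite {1}en; clear -l20; lra.
have eL0 : 0 <= eps * L by apply: mulr_ge0; exact: ltW.
have [M [M1 M2]] : exists M : nat, M%:R <= eps * L /\ eps * L < M%:R + 1.
  by have /andP[h1 h2] := truncn_itv eL0; exists (Num.truncn (eps * L)); split=> //; rewrite natr1.
have Ms : (M <= size s)%N by rewrite -(ler_nat R); exact: le_trans size_s.
exists (take M s); split.
- exact: take_uniq.
- by move=> n /mem_take /hs[]; rewrite nu4.
- by rewrite size_takel.
have dn n : n \in take M s -> c1 * expR (2 `^ (4 / 3) * ln 2 * m) <= (numdiv n)%:R.
  move=> /mem_take /hs[_]; apply: le_trans; rewrite ler_wpM2l ?(ltW c10) // (powR_expR _ n0) ler_expR.
  by rewrite ler_wpM2l // mulr_ge0 // powR_ge0.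
have hsum : M%:R * (c1 * expR (2 `^ (4 / 3) * ln 2 * m)) <= \sum_(n <- take M s) (numdiv n)%:R.
  apply: le_trans (_ : \sum_(n <- take M s) c1 * expR (2 `^ (4 / 3) * ln 2 * m) <= _).
    by rewrite big_const_seq count_predT size_takel // iter_addr_0 mulr_natl.
  by rewrite big_seq [leRHS]big_seq; apply: ler_sum => n hn; exact: dn.
have M3 : eps * L / 2 <= M%:R by clear -M2 eL; lra.
have nu3 : nu ^- 3 = expR (- (3 / 4 * n_)).
  by rewrite /nu -en -expRM_natl -expRN; congr expR; field.
rewrite nu3; apply: le_trans (_ : expR (- (3 / 4 * n_)) * (eps * L / 2 * (c1 * expR (2 `^ (4 / 3) * ln 2 * m))) <= _); last first.
  rewrite ler_wpM2l ?expR_ge0 //; apply: le_trans hsum.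
  by rewrite ler_wpM2r // mulr_ge0 ?expR_ge0 // ltW.
have -> : expR (- (3 / 4 * n_)) * (eps * L / 2 * (c1 * expR (2 `^ (4 / 3) * ln 2 * m))) =
  eps * c1 / 2 * (expR (- (3 / 4 * n_)) * L * expR (2 `^ (4 / 3) * ln 2 * m)) by ring.
apply: ler_wpM2l; first by rewrite divr_ge0 // mulr_ge0 // ltW.
rewrite (powR_expR _ L0) (powR_expR _ l0) (powR_expR _ m0) {1}/L expRK lnl {1}/L -!expRD ler_expR en -bE -/t.
by rewrite le_eqVlt; apply/orP; left; apply/eqP; field.
Qed.

(** Ensures that the target c V is at least 1, so that the B + 1 of [key_inequality] is at most 2 c
    V when B = c V. *)
Lemma growth_lb (c m l L : R) : l = expR m -> L = expR l -> 0 < c -> 27 <= m -> 64 / c <= m ->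
  1 <= c * (L `^ (1 / 4) * l `^ (3 / 4 * (2 `^ (4 / 3) - 1)) * m `^ (- (3 / 8))).
Proof.
move=> lE LE c0 m27 cm; have [ml lL t0 tm nl] := scale_facts m27; rewrite -lE -LE in ml lL nl.
have m0 : 0 < m by clear -m27; lra.
have l0 : 0 < l by rewrite lE expR_gt0.
have L0 : 0 < L by rewrite LE expR_gt0.
have [lam1 _ _ _ _] := lam_facts R.
have h1 : (l / 8) ^+ 2 <= L `^ (1 / 4).
  rewrite powR_expR // {1}LE expRK; have p : 0 <= 1 / 4 * l by apply: mulr_ge0; [lra | exact: ltW].
  apply: le_trans (expR_ge_pow 2 p).
  by rewrite le_eqVlt; apply/orP; left; apply/eqP; field.
have h2 : 1 <= l `^ (3 / 4 * (2 `^ (4 / 3) - 1)).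
  rewrite (powR_expR _ l0) lE expRK -[leLHS]expR0 ler_expR mulr_ge0 ?(ltW m0) //.
  by rewrite mulr_ge0 ?subr_ge0 // divr_ge0.
have h3 : m^-1 <= m `^ (- (3 / 8)).
  rewrite (powR_expR _ m0) -[X in X^-1](lnK (x := m)) ?posrE // -expRN ler_expR.
  by clear -t0; set t := ln m in t0 *; lra.
have sq : 0 <= (l / 8) ^+ 2 by exact: sqr_ge0.
apply: le_trans (_ : c * ((l / 8) ^+ 2 * 1 * l^-1) <= _); last first.
  rewrite ler_wpM2l ?(ltW c0) //; apply: ler_pM; rewrite ?mulr1 ?invr_ge0 ?(ltW l0) //.
    by rewrite -[X in X <= _]mulr1; apply: ler_pM.
  by apply: le_trans h3; rewrite lef_pV2 ?posrE.
have -> : c * ((l / 8) ^+ 2 * 1 * l^-1) = l / (64 / c) by field; rewrite !lt0r_neq0.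
by rewrite ler_pdivlMr ?divr_gt0 // mul1r; exact: le_trans ml.
Qed.

End Asymptotics.

Theorem theorem1 (R : realType) :
  exists c X0 : R, 0 < c /\
    forall X : R, X0 <= X ->
      ((c * ln X `^ (1 / 4)
          * ln (ln X) `^ (3 / 4 * (2 `^ (4 / 3) - 1))
          * ln (ln (ln X)) `^ (- (3 / 8)))%R%:E
       <= ereal_sup
            [set (`|Delta (x ^+ 2) / Num.sqrt x|)%R%:E
               | x in [set x : R |
                   X / 2 < x <= 5 * X `^ (3 / 2) * ln X ^+ 2]%R])%E.
Proof.
have [C0 [c1 [E [C01 c10 Hset]]]] := divisor_rich_sets R.
have [C C_gt0 Hkey] := key_inequality C01.
have [eps [e0 e20 ec]] : exists eps : R, [/\ 0 < eps, eps <= 20^-1 & eps <= c1 / 4].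
  exists (Num.min 20^-1 (c1 / 4)); split; first by rewrite lt_min invr_gt0 ltr0n divr_gt0.
    by rewrite ge_min lexx.
  by rewrite ge_min lexx orbT.
(* With this c, [key_inequality] at B = c V reads 4 c V <= c V + 1, which contradicts c V >= 1. *)
have [c c0 ecc] : exists2 c : R, 0 < c & 4 * c * C = eps * c1 / 2.
  exists (eps * c1 / 2 / (4 * C)); last by field; rewrite lt0r_neq0.
  by rewrite divr_gt0 ?divr_gt0 ?mulr_gt0.
pose m0 := 27 + `|E| + 64 / c + C0 + Kpow R + 2 / eps.
exists c, (expR (expR (expR m0))); split=> // X hX.
have X_gt0 : 0 < X by apply: lt_le_trans hX; exact: expR_gt0.
have [L eL] : exists L, L = ln X by eexists.
have hL : expR (expR m0) <= L by rewrite eL -[leLHS]expRK ler_ln ?posrE ?expR_gt0.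
have L0 : 0 < L by apply: lt_le_trans hL; exact: expR_gt0.
have [l el] : exists l, l = ln L by eexists.
have hl : expR m0 <= l by rewrite el -[leLHS]expRK ler_ln ?posrE ?expR_gt0.
have l0 : 0 < l by apply: lt_le_trans hl; exact: expR_gt0.
have [m em] : exists m, m = ln l by eexists.
have hm : m0 <= m by rewrite em -[leLHS]expRK ler_ln ?posrE ?expR_gt0.
rewrite -eL -el -em.
have lE : l = expR m by rewrite em lnK.
have LE : L = expR l by rewrite el lnK.
have XE : X = expR L by rewrite eL lnK.
have p64 : 0 < 64 / c by rewrite divr_gt0.
have p2 : 0 < 2 / eps by rewrite divr_gt0.
have K1 := Kpow_ge1 R.
have E1 := ler_norm E; have E2 := normr_ge0 E.
have [m27 mE m64 mC [mK me]] :
    [/\ 27 <= m, E <= m, 64 / c <= m, C0 <= m & Kpow R <= m /\ 2 / eps <= m].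
  move: hm p64 p2 K1 E1 E2 C01; rewrite /m0; move: (`|E|) (64 / c) (2 / eps) (Kpow R) => a1 a2 a3 a4 h1 h2 h3 h4 h5 h6 h7.
  by clear -h1 h2 h3 h4 h5 h6 h7; split; lra.
have [ml lL t0 tm nl] := scale_facts m27; rewrite -lE -LE in ml lL nl.
have mL : m <= L by exact: le_trans lL.
have V1 := growth_lb lE LE c0 m27 m64.
have epL : 2 <= eps * L by rewrite mulrC -ler_pdivrMr //; exact: le_trans mL.
have := Hset m eps m27 mE e0 ec; rewrite /= -lE -LE => /(_ epL).
set nu := expR _; move=> [ms [ums hms sms Vms]].
set V := L `^ (1 / 4) * _ * _ in V1 Vms.
have L1 : 1 <= L by have := le_trans m27 mL; clear; lra.
have nu1 : 1 <= nu.
  rewrite /nu -[leLHS]expR0 ler_expR divr_ge0 // !addr_ge0 ?(ltW l0) //; last by rewrite divr_ge0.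
  have [/andP[b0 _] _] := beta_facts R.
  by rewrite mulr_ge0 //; clear -m27; lra.
have nuL : nu ^+ 2 <= L.
  by rewrite /nu -expRM_natl LE ler_expR; clear -nl; lra.
have [lmax [d1 d2 d3]] := dyadic_scale L1.
have [X0 hX0] : exists X0 : nat, X0%:R <= expR L < X0%:R + 1.
  by exists (Num.truncn (expR L)); have := truncn_itv (expR_ge0 L); rewrite natr1.
have sM : (size ms)%:R <= L / 20.
  by apply: le_trans sms _; rewrite mulrC ler_wpM2l // ltW.
have [r1 r2 r3 r4 [r5 r6]] := range_conditions C01 nu1 nuL (le_trans mK mL) (le_trans mC mL) d1 d2 d3 hX0 sM.
(* If the supremum were below c V, every integer n = y^2 with y in the range would satisfy
   |Delta(n)| <= c V n^(1/4), the hypothesis of [key_inequality]. *)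
rewrite leNgt; apply/negP => hsup.
have cV : c * L `^ (1 / 4) * l `^ (3 / 4 * (2 `^ (4 / 3) - 1)) * m `^ (- (3 / 8)) = c * V.
  by rewrite /V !mulrA.
rewrite cV in hsup.
have cV0 : 0 <= c * V by exact: le_trans V1.
have hB x n : (X0 < x < 2 ^ lmax)%N -> (x ^ 2 <= 4 * n)%N -> (n <= 16 * x ^ 2)%N ->
    `|Delta (n%:R : R)| <= c * V * Num.sqrt (Num.sqrt n%:R).
  move=> /andP[x1 x2] n1 n2.
  have xX : X < x%:R.
    case/andP: hX0 => _ h; rewrite XE; apply: lt_le_trans h _.
    by rewrite natr1 ler_nat.
  have x0 : 0 < x%:R :> R by exact: lt_trans xX.
  have n1R : x%:R ^+ 2 <= 4 * n%:R :> R by rewrite -natrX -natrM ler_nat.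
  have n2R : n%:R <= 16 * x%:R ^+ 2 :> R by rewrite -natrX -natrM ler_nat.
  have nR0 : 0 < n%:R :> R.
    have : 0 < x%:R ^+ 2 :> R by rewrite exprn_gt0.
    clear -n1R; lra.
  have [y ey] : exists y : R, y = Num.sqrt n%:R by eexists.
  have y2 : y ^+ 2 = n%:R by rewrite ey sqr_sqrtr.
  have y0 : 0 < y by rewrite ey sqrtr_gt0.
  (* Since x exceeds the integer part of X, x > X, and n >= x^2 / 4 gives y >= x/2. In the other
     direction n <= 16 x^2 and x < 2^lmax give y <= 4 X^(3/2). *)
  have yl : X / 2 < y.
    apply: lt_le_trans (_ : x%:R / 2 <= _); first by clear -xX; lra.
    rewrite -(@ler_pXn2r _ 2) ?nnegrE ?divr_ge0 ?(ltW y0) //.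
    by rewrite y2 expr_div_n -[2 ^+ 2]/(2 * 2); clear -n1R; lra.
  have yu : y <= 5 * X `^ (3 / 2) * L ^+ 2.
    have h4 : y <= 4 * x%:R.
      rewrite -(@ler_pXn2r _ 2) ?nnegrE ?mulr_ge0 ?(ltW y0) //.
      by rewrite y2 exprMn -[4 ^+ 2]/(4 * 4); clear -n2R; lra.
    have hx : x%:R <= X `^ (3 / 2).
      rewrite powR_expR // XE expRK; apply: le_trans d2; rewrite ler_nat; exact: ltnW.
    have L2 : 1 <= L ^+ 2 by rewrite exprn_ege1.
    apply: le_trans (_ : 5 * X `^ (3 / 2) * 1 <= _); first by clear -h4 hx x0; lra.
    by rewrite ler_wpM2l // mulr_ge0 // powR_ge0.
  have : ((`|Delta (y ^+ 2) / Num.sqrt y|)%:E <= ereal_sup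
            [set (`|Delta (x ^+ 2) / Num.sqrt x|)%R%:E
               | x in [set x : R | X / 2 < x <= 5 * X `^ (3 / 2) * L ^+ 2]%R])%E.
    apply: ereal_sup_ubound; exists y => //=.
    by rewrite yl yu.
  move=> /le_lt_trans /(_ hsup); rewrite lte_fin y2 normrM normfV.
  have sy : 0 < Num.sqrt y by rewrite sqrtr_gt0.
  rewrite (gtr0_norm sy) ltr_pdivrMr // => h.
  by rewrite -ey; exact: ltW.
have := Hkey nu lmax X0 ms (c * V) nu1 ums hms r1 r2 r3 r4 r5 r6 cV0 hB.
move=> /(le_trans Vms); rewrite -ecc.
have -> : 4 * c * C * V = C * (4 * (c * V)) by ring.
rewrite ler_pM2l //; clear -V1; lra.
Qed.
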